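(* Assume GRH for $F$. Let $0<B_1<B_2\leq B_3<1/d_F$ and suppose that for some $c>0$, \[ V_F(X, \delta)=\frac{1}{2}\delta X^2\Big(d_F \log\frac{1}{\delta}+\log\mathfrak{q}_F+(1-\gamma_0-\log2\pi)d_F\Big)+O\big(\delta^{1+c} X^2\big) \] uniformly for $X^{-B_3}\ll\delta\ll X^{-B_1}$. Then for every $\varepsilon>0$, \begin{eqnarray*} \tilde{V}_F(X,h)&=&h X\Big(d_F \log\frac{X}{h}+\log\mathfrak{q}_F-(\gamma_0+\log 2\pi)d_F\Big)\\ &&+O_\varepsilon\big(hX^{1+\varepsilon}(h/X)^{c/3}\big)+O_\varepsilon\Big(hX^{1+\varepsilon}\big(hX^{-(1-B_1)}\big)^{1/(3(1-B_1))}\Big) \end{eqnarray*} uniformly for $X^{1-B_3}\ll h\ll X^{1-B_2}$.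
   Context: Let $F(s)=\sum_{n\ge1}a_F(n)n^{-s}$ be a primitive element of the Selberg class: the series converges absolutely for $\mathrm{Re}(s)>1$; $F$ extends meromorphically to $\mathbb C$ with at most a pole at $s=1$, whose order is denoted $m_F\ge0$, and $(s-1)^{m_F}F(s)$ is entire of finite order; $F$ satisfies $\Phi(s)=\varepsilon_F\overline{\Phi}(1-s)$ where $\Phi(s)=Q^s\prod_{j=1}^r\Gamma(\lambda_js+\mu_j)F(s)$ with $Q>0$, $\lambda_j>0$, $\mathrm{Re}(\mu_j)\ge0$, $|\varepsilon_F|=1$, and $\overline{\Phi}(s)=\overline{\Phi(\bar s)}$; $a_F(n)\ll_\varepsilon n^\varepsilon$; and $F(s)=\prod_p\exp\big(\sum_{l\ge1}b_F(p^l)p^{-ls}\big)$ with $b_F(p^l)\ll p^{l\theta}$ for some $\theta<1/2$. The degree is $d_F=2\sum_{j}\lambda_j$ and the conductor is $\mathfrak q_F=(2\pi)^{d_F}Q^2\prod_j\lambda_j^{2\lambda_j}$. Define $\Lambda_F(n)$ by $\frac{F'}{F}(s)=-\sum_{n\ge1}\Lambda_F(n)n^{-s}$ ($\mathrm{Re}(s)>1$) and $\psi_F(x)=\sum_{n\le x}\Lambda_F(n)$. GRH for $F$ means all nontrivial zeros of $F$ are $\rho_F=\tfrac12+i\gamma_F$ with $\gamma_F$ real. Define $V_F(X,\delta)=\int_1^X|\psi_F(x+\delta x)-\psi_F(x)-m_F\delta x|^2dx$, $\tilde V_F(X,h)=\int_1^X|\psi_F(x+h)-\psi_F(x)-m_Fh|^2dx$.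 $\gamma_0$ denotes the Euler–Mascheroni constant. ''Uniformly for $a\ll y\ll b$'' means: for any fixed positive constants $k_1,k_2$, the estimate holds for all $y$ with $k_1a\le y\le k_2b$ (as the main parameter tends to infinity), with implied constants independent of the variables. *)

(* Defs.v *)
From Stdlib Require Import Reals Lra ZArith Znumtheory ClassicalEpsilon.
Open Scope R_scope.

Record Cx := mkC { Re : R ; Im : R }.

Definition RtoC (x : R) : Cx := mkC x 0.
Definition C0 : Cx := RtoC 0.
Definition C1 : Cx := RtoC 1.
Definition Cadd (z w : Cx) : Cx := mkC (Re z + Re w) (Im z + Im w).
Definition Copp (z : Cx) : Cx := mkC (- Re z) (- Im z).
Definition Csub (z w : Cx) : Cx := Cadd z (Copp w).
Definition Cmul (z w : Cx) : Cx :=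
  mkC (Re z * Re w - Im z * Im w) (Re z * Im w + Im z * Re w).
Definition Cinv (z : Cx) : Cx :=
  mkC (Re z / (Re z ^ 2 + Im z ^ 2)) (- Im z / (Re z ^ 2 + Im z ^ 2)).
Definition Cdiv (z w : Cx) : Cx := Cmul z (Cinv w).
Definition Cconj (z : Cx) : Cx := mkC (Re z) (- Im z).
Definition Cnorm (z : Cx) : R := sqrt (Re z ^ 2 + Im z ^ 2).
Definition Cexp (z : Cx) : Cx := mkC (exp (Re z) * cos (Im z)) (exp (Re z) * sin (Im z)).
Fixpoint Cpow (z : Cx) (n : nat) : Cx :=
  match n with O => C1 | S k => Cmul z (Cpow z k) end.
Definition Cpow_pos (x : R) (s : Cx) : Cx := Cexp (Cmul s (RtoC (ln x))).

Fixpoint Csum (n : nat) (f : nat -> Cx) : Cx :=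
  match n with O => C0 | S k => Cadd (Csum k f) (f k) end.
Fixpoint Cprod (n : nat) (f : nat -> Cx) : Cx :=
  match n with O => C1 | S k => Cmul (Cprod k f) (f k) end.
Fixpoint Rsum (n : nat) (f : nat -> R) : R :=
  match n with O => 0 | S k => Rsum k f + f k end.
Fixpoint Rprod (n : nat) (f : nat -> R) : R :=
  match n with O => 1 | S k => Rprod k f * f k end.

Definition Ccv (u : nat -> Cx) (l : Cx) : Prop :=
  forall e, e > 0 -> exists N, forall n, (n >= N)%nat -> Cnorm (Csub (u n) l) < e.
Definition Cseries_sum (f : nat -> Cx) (l : Cx) : Prop :=
  Ccv (fun n => Csum (S n) f) l.

Definition Cderiv (f : Cx -> Cx) (z d : Cx) : Prop :=
  forall e, e > 0 -> exists del, del > 0 /\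
    forall h, h <> C0 -> Cnorm h < del ->
      Cnorm (Csub (Cdiv (Csub (f (Cadd z h)) (f z)) h) d) < e.
Definition entire (f : Cx -> Cx) : Prop := forall z, exists d, Cderiv f z d.
Definition finite_order (f : Cx -> Cx) : Prop :=
  exists A K, A > 0 /\ K > 0 /\ forall z, Cnorm (f z) <= A * exp (Rpower (Cnorm z) K).

(** Euler's Gamma function, via Gauss' limit formula
    Gamma(s) = lim n^s n! / (s (s+1) ... (s+n)), valid for s not in {0,-1,-2,...} *)
Definition Gauss_term (s : Cx) (n : nat) : Cx :=
  Cdiv (Cmul (Cpow_pos (INR n) s) (RtoC (INR (fact n))))
       (Cprod (S n) (fun k => Cadd s (RtoC (INR k)))).
Definition CGamma (s : Cx) : Cx :=
  epsilon (inhabits C0) (fun g => Ccv (Gauss_term s) g).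
Definition Gamma_pole (s : Cx) : Prop := exists k : nat, s = RtoC (- INR k).

Definition euler_gamma : R :=
  epsilon (inhabits 0)
    (fun g => Un_cv (fun n => sum_f_R0 (fun k => 1 / INR (S k)) n - ln (INR (S n))) g).

(** Riemann integral (the integrands used here are Riemann integrable) *)
Definition RInt (f : R -> R) (a b : R) : R :=
  epsilon (inhabits 0) (fun v => exists pr : Riemann_integrable f a b, RiemannInt pr = v).

Definition gamma_factor (r : nat) (Q : R) (lam : nat -> R) (mu : nat -> Cx) (s : Cx) : Cx :=
  Cmul (Cpow_pos Q s) (Cprod r (fun j => CGamma (Cadd (Cmul (RtoC (lam j)) s) (mu j)))).
Definition Phi (F : Cx -> Cx) r Q lam mu (s : Cx) : Cx := Cmul (gamma_factor r Q lam mu s) (F s).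
Definition gamma_pole_at (r : nat) (lam : nat -> R) (mu : nat -> Cx) (s : Cx) : Prop :=
  exists j, (j < r)%nat /\ Gamma_pole (Cadd (Cmul (RtoC (lam j)) s) (mu j)).

(** F : Cx -> Cx is the meromorphic function (its value at the pole s = 1 is irrelevant);
    a = coefficients a_F(n) (n >= 1); m = order of the pole at 1;
    (r, Q, lam, mu, epsF) = data of the functional equation. *)
Definition selberg_data (F : Cx -> Cx) (a : nat -> Cx) (m : nat)
    (r : nat) (Q : R) (lam : nat -> R) (mu : nat -> Cx) (epsF : Cx) : Prop :=
  (forall s, Re s > 1 ->
     (exists l, infinite_sum (fun n => Cnorm (a (S n)) * Rpower (INR (S n)) (- Re s)) l) /\
     Cseries_sum (fun n => Cmul (a (S n)) (Cpow_pos (INR (S n)) (Copp s))) (F s)) /\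
  (exists G, entire G /\ finite_order G /\
     (forall s, (m = 0%nat \/ s <> C1) -> G s = Cmul (Cpow (Csub s C1) m) (F s)) /\
     ((m > 0)%nat -> G C1 <> C0)) /\
  Q > 0 /\ (forall j, (j < r)%nat -> lam j > 0 /\ Re (mu j) >= 0) /\ Cnorm epsF = 1 /\
  (forall s, s <> C1 -> s <> C0 -> ~ gamma_pole_at r lam mu s ->
     ~ gamma_pole_at r lam mu (Csub C1 (Cconj s)) ->
     Phi F r Q lam mu s = Cmul epsF (Cconj (Phi F r Q lam mu (Csub C1 (Cconj s))))) /\
  (forall e, e > 0 -> exists K, forall n, (n >= 1)%nat -> Cnorm (a n) <= K * Rpower (INR n) e) /\
  (exists (b : nat -> nat -> Cx) (theta K : R), theta < 1/2 /\
     (forall p l, prime (Z.of_nat p) -> (l >= 1)%nat ->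
        Cnorm (b p l) <= K * Rpower (INR p) (INR l * theta)) /\
     forall s, Re s > 1 -> exists Sp : nat -> Cx,
       (forall p, prime (Z.of_nat p) ->
          Cseries_sum (fun l => Cmul (b p (S l)) (Cpow_pos (INR p) (Copp (Cmul (RtoC (INR (S l))) s)))) (Sp p)) /\
       Ccv (fun N => Cprod (S N) (fun p => if prime_dec (Z.of_nat p) then Cexp (Sp p) else C1)) (F s)).

Definition selberg (F : Cx -> Cx) : Prop :=
  exists a m r Q lam mu epsF, selberg_data F a m r Q lam mu epsF.

(** primitivity: F <> 1 and F = F1 F2 in S forces F1 = 1 or F2 = 1
    (equality of meromorphic functions is tested on Re s > 1) *)
Definition selberg_primitive (F : Cx -> Cx) : Prop :=
  selberg F /\ (exists s, Re s > 1 /\ F s <> C1) /\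
  forall F1 F2, selberg F1 -> selberg F2 ->
    (forall s, Re s > 1 -> F s = Cmul (F1 s) (F2 s)) ->
    (forall s, Re s > 1 -> F1 s = C1) \/ (forall s, Re s > 1 -> F2 s = C1).

Definition degree (r : nat) (lam : nat -> R) : R := 2 * Rsum r lam.
Definition conductor (r : nat) (Q : R) (lam : nat -> R) : R :=
  Rpower (2 * PI) (degree r lam) * Q ^ 2 * Rprod r (fun j => Rpower (lam j) (2 * lam j)).

Definition is_vonMangoldt (F : Cx -> Cx) (Lam : nat -> Cx) : Prop :=
  forall s, Re s > 1 -> exists d, Cderiv F s d /\
    Cseries_sum (fun n => Cmul (Lam (S n)) (Cpow_pos (INR (S n)) (Copp s)))
                (Copp (Cdiv d (F s))).

Definition psiF (Lam : nat -> Cx) (x : R) : Cx :=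
  Csum (Z.to_nat (Int_part x)) (fun k => Lam (S k)).

(** GRH: every nontrivial zero (zero of F that is not the pole s = 1 and not a pole
    of a Gamma factor, i.e. a zero of Phi) has real part 1/2 *)
Definition GRH (F : Cx -> Cx) (m r : nat) (lam : nat -> R) (mu : nat -> Cx) : Prop :=
  forall s, F s = C0 -> (m = 0%nat \/ s <> C1) -> ~ gamma_pole_at r lam mu s -> Re s = 1/2.

Definition V_F (Lam : nat -> Cx) (m : nat) (X delta : R) : R :=
  RInt (fun x => Cnorm (Csub (Csub (psiF Lam (x + delta * x)) (psiF Lam x))
                             (RtoC (INR m * delta * x))) ^ 2) 1 X.
Definition Vt_F (Lam : nat -> Cx) (m : nat) (X h : R) : R :=
  RInt (fun x => Cnorm (Csub (Csub (psiF Lam (x + h)) (psiF Lam x))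
                             (RtoC (INR m * h))) ^ 2) 1 X.

(* Main.v *)
(** Write E(x) = psi_F(x) - m_F x. Let G(s) = (s - 1)^m F(s), which has no zero in Re s > 1/2. Convexity
    bounds for G (functional equation, Stirling-type estimates, Phragmen-Lindelof) together with
    Borel-Caratheodory give G'/G << log |t| on every line right of 1/2. Shifting a Perron integral
    there and applying Plancherel bounds the mean squares of E(x), of E((1+D)x) - E(x), and of the
    difference between E(x) and its average over [x, (1+D)x]; up to epsilons the last two gain a factor D.
    Since the averages vary slowly, increments of E over variable lags of size at most D Z are small in mean
    square on [Z, 2Z].

    On [Z, 2Z] cut into n blocks, replace the translation by h on the block starting at x_j by the dilation
    by 1 + h/x_j, to which the hypothesis on V_F applies; the lag estimate controls the difference. With
    n ~ (Z/h)^(2c/3) every error is << hZ (h/Z)^(c/3) Z^epsilon. Summing dyadically over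
    Z >= X1 ~ h^(1/(1-B1)), where the hypothesis is available, and using the trivial mean square
    bound below X1 gives the theorem. This takes c <= 1, which is no loss because the second error term
    dominates (h/X)^(1/3), and it takes B3 <= 1: for B3 > 1 intervals of length delta x < 1 contain at most
    one integer, so V_F would be asymptotically additive in delta, contradicting the factor log (1/delta). *)

Require Import Defs.
From Stdlib Require Import Reals Lra Lia ZArith Znumtheory ClassicalEpsilon Classical Wf_nat.
From Coquelicot Require Import Coquelicot.
Open Scope R_scope.

(** Zeros are neither counted nor summed over: GRH is used only as the absence of zeros of G to the
    right of 1/2, and the resulting bound for G'/G may have a constant that blows up near that line.
    Since psi jumps, its own inversion integral converges only conditionally. Inversion is therefore
    done for the integral of E, whose kernel is smaller by a factor 1/|t|; bounds uniform in the
    length of averaging then pass back to E in mean square.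

    The exponent c/3 balances three relative errors. Put r = h/Z. Comparing a translation with a
    dilation at weight th costs th; n uses of the hypothesis cost n r^c; the lags, of relative
    length r/n, cost 1/(n th). With th = r^(c/3) and n ~ th^(-2) all three are of order th.

    The exponent 1/(3(1-B1)) comes from elsewhere. The range below X1 costs a proportion min(1,
    X1/X), which is at most (X1/X)^(1/3); this weak power is also the one that absorbs (h/X)^(1/3)
    when c > 1. *)

(** * Inequalities for the complex modulus *)

Lemma Cmod_sub_sym (a b : C) : Cmod (a - b)%C = Cmod (b - a)%C.
Proof. rewrite <- Cmod_opp. f_equal. ring. Qed.

Lemma Cmod_le_abs (z : C) : Cmod z <= Rabs (fst z) + Rabs (snd z).
Proof.
  replace z with (RtoC (fst z) + Ci * RtoC (snd z))%C.
  - eapply Rle_trans; [apply Cmod_triangle|].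
    rewrite Cmod_mult, Cmod_Ci, !Cmod_R. destruct z; simpl.
    replace (r + (0 * r0 - 1 * 0)) with r by ring.
    replace (0 + (0 * 0 + 1 * r0)) with r0 by ring. lra.
  - destruct z; unfold RtoC, Ci, Cplus, Cmult; simpl; f_equal; ring.
Qed.

Lemma fst_le_Cmod (z : C) : Rabs (fst z) <= Cmod z.
Proof. eapply Rle_trans; [|apply Rmax_Cmod]. apply Rmax_l. Qed.

Lemma snd_le_Cmod (z : C) : Rabs (snd z) <= Cmod z.
Proof. eapply Rle_trans; [|apply Rmax_Cmod]. apply Rmax_r. Qed.

Lemma Cmod_sub_le (a b : C) : Cmod a - Cmod b <= Cmod (a - b)%C.
Proof.
  assert (H := Cmod_triangle (a - b) b). replace (a - b + b)%C with a in H by ring. lra.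
Qed.

Lemma Cmod_le_sub (a b : C) : Cmod (a - b)%C <= Cmod a + Cmod b.
Proof.
  assert (H := Cmod_triangle a (- b)). rewrite Cmod_opp in H. exact H.
Qed.

(** * Continuity and complex derivatives *)

Definition contC (f : C -> C) (z : C) : Prop :=
  forall e, 0 < e -> exists d, 0 < d /\
    forall w, Cmod (w - z)%C < d -> Cmod (f w - f z)%C < e.

Lemma contC_ext_loc (f g : C -> C) (z : C) (r : R) :
  0 < r -> (forall w, Cmod (w - z)%C < r -> f w = g w) -> contC f z -> contC g z.
Proof.
  intros Hr He Hf e Hep. destruct (Hf e Hep) as [d [Hd H]].
  exists (Rmin d r). split; [now apply Rmin_glb_lt|]. intros w Hw.
  assert (Cmod (w - z)%C < d) by (eapply Rlt_le_trans; [apply Hw|apply Rmin_l]).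
  assert (Cmod (w - z)%C < r) by (eapply Rlt_le_trans; [apply Hw|apply Rmin_r]).
  rewrite <- (He w), <- (He z); auto.
  replace (z - z)%C with (RtoC 0) by ring. now rewrite Cmod_0.
Qed.

Lemma contC_const (c z : C) : contC (fun _ => c) z.
Proof.
  intros e He. exists 1. split; [lra|]. intros.
  replace (c - c)%C with (RtoC 0) by ring. now rewrite Cmod_0.
Qed.

Lemma contC_id (z : C) : contC (fun w => w) z.
Proof. intros e He. exists e. split; auto. Qed.

Lemma contC_plus (f g : C -> C) (z : C) :
  contC f z -> contC g z -> contC (fun w => f w + g w)%C z.
Proof.
  intros Hf Hg e He. destruct (Hf (e/2) ltac:(lra)) as [d1 [H1 H1']].
  destruct (Hg (e/2) ltac:(lra)) as [d2 [H2 H2']].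
  exists (Rmin d1 d2). split; [now apply Rmin_glb_lt|]. intros w Hw.
  replace (f w + g w - (f z + g z))%C with ((f w - f z) + (g w - g z))%C by ring.
  eapply Rle_lt_trans; [apply Cmod_triangle|].
  specialize (H1' w ltac:(eapply Rlt_le_trans; [apply Hw|apply Rmin_l])).
  specialize (H2' w ltac:(eapply Rlt_le_trans; [apply Hw|apply Rmin_r])). lra.
Qed.

Lemma contC_mult (f g : C -> C) (z : C) :
  contC f z -> contC g z -> contC (fun w => f w * g w)%C z.
Proof.
  intros Hf Hg e He.
  assert (Pf := Cmod_ge_0 (f z)). assert (Pg := Cmod_ge_0 (g z)).
  set (B := Cmod (f z) + Cmod (g z) + 1).
  assert (HB : 1 <= B) by (unfold B; lra).
  set (e' := Rmin 1 (e / (2 * B))).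
  assert (He1 : 0 < e') by (apply Rmin_glb_lt; [lra|apply Rdiv_lt_0_compat; lra]).
  assert (He2 : e' <= 1) by apply Rmin_l.
  assert (He3 : e' * B <= e / 2).
  { replace (e/2) with ((e / (2 * B)) * B) by (field; lra).
    apply Rmult_le_compat_r; [lra|apply Rmin_r]. }
  destruct (Hf e' He1) as [d1 [H1 H1']]. destruct (Hg e' He1) as [d2 [H2 H2']].
  exists (Rmin d1 d2). split; [now apply Rmin_glb_lt|]. intros w Hw.
  specialize (H1' w ltac:(eapply Rlt_le_trans; [apply Hw|apply Rmin_l])).
  specialize (H2' w ltac:(eapply Rlt_le_trans; [apply Hw|apply Rmin_r])).
  replace (f w * g w - f z * g z)%C
    with ((f w - f z) * (g w - g z) + (f w - f z) * g z + f z * (g w - g z))%C by ring.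
  eapply Rle_lt_trans; [apply Cmod_triangle|].
  eapply Rle_lt_trans; [apply Rplus_le_compat_r, Cmod_triangle|].
  rewrite !Cmod_mult. assert (P1 := Cmod_ge_0 (f w - f z)). assert (P2 := Cmod_ge_0 (g w - g z)).
  assert (Cmod (f w - f z) * Cmod (g w - g z) <= e' * 1) by (apply Rmult_le_compat; lra).
  assert (Cmod (f w - f z) * Cmod (g z) <= e' * Cmod (g z)) by (apply Rmult_le_compat; lra).
  assert (Cmod (f z) * Cmod (g w - g z) <= Cmod (f z) * e') by (apply Rmult_le_compat; lra).
  unfold B in He3. nra.
Qed.

Lemma contC_opp (f : C -> C) (z : C) : contC f z -> contC (fun w => - f w)%C z.
Proof.
  intros H. apply (contC_ext_loc (fun w => RtoC (-1) * f w)%C _ z 1); [lra| |].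
  - intros. ring.
  - apply contC_mult; auto. apply contC_const.
Qed.

Lemma contC_minus (f g : C -> C) (z : C) :
  contC f z -> contC g z -> contC (fun w => f w - g w)%C z.
Proof. intros. apply contC_plus; auto. now apply contC_opp. Qed.

Lemma contC_comp (f g : C -> C) (z : C) :
  contC g z -> contC f (g z) -> contC (fun w => f (g w)) z.
Proof.
  intros Hg Hf e He. destruct (Hf e He) as [d [Hd H]].
  destruct (Hg d Hd) as [d' [Hd' H']]. exists d'. split; auto.
Qed.

Lemma contC_Cinv (z : C) : z <> 0 -> contC Cinv z.
Proof.
  intros Hz e He. assert (P := proj1 (Cmod_gt_0 z) Hz).
  set (d := Rmin (Cmod z / 2) (e * (Cmod z * Cmod z) / 2)).
  exists d. assert (0 < Cmod z * Cmod z) by nra.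
  split; [apply Rmin_glb_lt; unfold Rdiv; repeat apply Rmult_lt_0_compat; lra|]. intros w Hw.
  assert (H1 : Cmod (w - z)%C < Cmod z / 2) by (eapply Rlt_le_trans; [apply Hw|apply Rmin_l]).
  assert (H2 : Cmod (w - z)%C < e * (Cmod z * Cmod z) / 2) by (eapply Rlt_le_trans; [apply Hw|apply Rmin_r]).
  assert (H3 : Cmod z / 2 < Cmod w).
  { assert (T := Cmod_sub_le z w). rewrite Cmod_sub_sym in T. lra. }
  assert (Hw0 : w <> 0) by (apply Cmod_gt_0; lra).
  replace (/ w - / z)%C with (- (w - z) / (w * z))%C by (field; auto).
  rewrite Cmod_div by (now apply Cmult_neq_0). rewrite Cmod_opp, Cmod_mult.
  apply Rmult_lt_reg_r with (Cmod w * Cmod z); [nra|].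
  assert (Pw : 0 < Cmod w * Cmod z) by nra. unfold Rdiv. rewrite Rmult_assoc, Rinv_l by lra.
  assert (e * (Cmod z * (Cmod w - Cmod z / 2)) > 0) by (apply Rmult_lt_0_compat; [lra|apply Rmult_lt_0_compat; lra]). nra.
Qed.

Lemma contC_inv (f : C -> C) (z : C) : f z <> 0 -> contC f z -> contC (fun w => / f w)%C z.
Proof. intros Hz Hf. apply (contC_comp Cinv f); auto. now apply contC_Cinv. Qed.

Lemma contC_div (f g : C -> C) (z : C) :
  g z <> 0 -> contC f z -> contC g z -> contC (fun w => f w / g w)%C z.
Proof. intros. apply contC_mult; auto. now apply contC_inv. Qed.

(* Caratheodory's form of differentiability. *)
Definition isD (f : C -> C) (z d : C) : Prop :=
  exists (phi : C -> C) (r : R), 0 < r /\ contC phi 0 /\ phi 0 = d /\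
    forall h, Cmod h < r -> f (z + h)%C = (f z + phi h * h)%C.

(** The factorised form makes the product and chain rules algebraic; this form is the one for
    estimates. In the converse direction the quotient is completed by the value [d] at [h = 0]. *)
Lemma isD_eps (f : C -> C) (z d : C) :
  isD f z d <-> (forall e, 0 < e -> exists del, 0 < del /\ forall h, Cmod h < del ->
     Cmod (f (z + h) - f z - d * h)%C <= e * Cmod h).
Proof.
  split.
  - intros [phi [r [Hr [Hc [H0 H]]]]] e He. destruct (Hc e He) as [del [Hd Hd']].
    exists (Rmin del r). split; [now apply Rmin_glb_lt|]. intros h Hh.
    rewrite H by (eapply Rlt_le_trans; [apply Hh|apply Rmin_r]).
    replace (f z + phi h * h - f z - d * h)%C with ((phi h - d) * h)%C by ring.
    rewrite Cmod_mult. apply Rmult_le_compat_r; [apply Cmod_ge_0|]. rewrite <- H0.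
    left. apply Hd'. replace (h - 0)%C with h by ring.
    eapply Rlt_le_trans; [apply Hh|apply Rmin_l].
  - intros H.
    exists (fun h => if Ceq_dec h 0 then d else ((f (z + h) - f z) / h)%C), 1.
    split; [lra|]. split; [|split].
    + intros e He. destruct (H (e/2) ltac:(lra)) as [del [Hd Hd']].
      exists del. split; auto. intros h Hh. replace (h - 0)%C with h in Hh by ring.
      destruct (Ceq_dec 0 0) as [_|n]; [|now elim n].
      destruct (Ceq_dec h 0) as [->|n].
      * replace (d - d)%C with (RtoC 0) by ring. rewrite Cmod_0; lra.
      * specialize (Hd' h Hh).
        replace ((f (z + h) - f z) / h - d)%C with ((f (z + h) - f z - d * h) / h)%C by (field; auto).
        rewrite Cmod_div by auto. assert (P := proj1 (Cmod_gt_0 h) n).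
        apply Rmult_lt_reg_r with (Cmod h); auto.
        unfold Rdiv. rewrite Rmult_assoc, Rinv_l by lra. nra.
    + destruct (Ceq_dec 0 0) as [_|n]; [reflexivity|now elim n].
    + intros h Hh. destruct (Ceq_dec h 0) as [->|n].
      * replace (z + 0)%C with z by ring. ring.
      * field. auto.
Qed.

Lemma isD_const (c z : C) : isD (fun _ => c) z 0.
Proof.
  exists (fun _ => RtoC 0), 1. repeat split; [lra|apply contC_const|]. intros. ring.
Qed.

Lemma isD_id (z : C) : isD (fun w => w) z 1.
Proof.
  exists (fun _ => RtoC 1), 1. repeat split; [lra|apply contC_const|]. intros. ring.
Qed.

Lemma isD_plus (f g : C -> C) (z df dg : C) :
  isD f z df -> isD g z dg -> isD (fun w => f w + g w)%C z (df + dg)%C.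
Proof.
  intros [p [r [Hr [Hc [H0 H]]]]] [q [s [Hs [Hd [G0 G]]]]].
  exists (fun h => p h + q h)%C, (Rmin r s). split; [now apply Rmin_glb_lt|].
  split; [now apply contC_plus|]. split; [now rewrite H0, G0|].
  intros h Hh. rewrite H, G. ring.
  eapply Rlt_le_trans; [apply Hh|apply Rmin_r]. eapply Rlt_le_trans; [apply Hh|apply Rmin_l].
Qed.

Lemma isD_contC (f : C -> C) (z d : C) : isD f z d -> contC f z.
Proof.
  intros [p [r [Hr [Hc [H0 H]]]]].
  apply (contC_ext_loc (fun w => f z + p (w - z) * (w - z))%C _ z r); auto.
  - intros w Hw. rewrite <- H by auto. f_equal. ring.
  - apply contC_plus; [apply contC_const|]. apply contC_mult.
    + apply (contC_comp p (fun w => w - z)%C).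
      * apply contC_minus; [apply contC_id|apply contC_const].
      * replace (z - z)%C with (RtoC 0) by ring. auto.
    + apply contC_minus; [apply contC_id|apply contC_const].
Qed.

Lemma contC_shift (f : C -> C) (z : C) : contC f z -> contC (fun h => f (z + h)%C) 0.
Proof.
  intros H. apply (contC_comp f (fun h => z + h)%C).
  - apply contC_plus; [apply contC_const|apply contC_id].
  - replace (z + 0)%C with z by ring. auto.
Qed.

Lemma isD_mult (f g : C -> C) (z df dg : C) :
  isD f z df -> isD g z dg -> isD (fun w => f w * g w)%C z (df * g z + f z * dg)%C.
Proof.
  intros Df Dg. assert (Cg := isD_contC _ _ _ Dg).
  destruct Df as [p [r [Hr [Hc [H0 H]]]]]. destruct Dg as [q [s [Hs [Hd [G0 G]]]]].
  exists (fun h => p h * g (z + h) + f z * q h)%C, (Rmin r s). split; [now apply Rmin_glb_lt|].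
  split; [|split].
  - apply contC_plus; apply contC_mult; auto. now apply contC_shift. apply contC_const.
  - replace (z + 0)%C with z by ring. now rewrite H0, G0.
  - intros h Hh. rewrite H, G. ring.
  eapply Rlt_le_trans; [apply Hh|apply Rmin_r]. eapply Rlt_le_trans; [apply Hh|apply Rmin_l].
Qed.

Lemma isD_ext_loc (f g : C -> C) (z d : C) (r : R) :
  0 < r -> (forall w, Cmod (w - z)%C < r -> f w = g w) -> isD f z d -> isD g z d.
Proof.
  intros Hr He [p [s [Hs [Hc [H0 H]]]]]. exists p, (Rmin r s).
  split; [now apply Rmin_glb_lt|]. repeat split; auto. intros h Hh.
  rewrite <- !He, H; auto.
  - eapply Rlt_le_trans; [apply Hh|apply Rmin_r].
  - replace (z - z)%C with (RtoC 0) by ring. now rewrite Cmod_0.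
  - replace (z + h - z)%C with h by ring. eapply Rlt_le_trans; [apply Hh|apply Rmin_l].
Qed.

Lemma isD_ext (f g : C -> C) (z d : C) : (forall w, f w = g w) -> isD f z d -> isD g z d.
Proof. intros H. apply (isD_ext_loc f g z d 1); [lra|auto]. Qed.

Lemma isD_eq (f : C -> C) (z d d' : C) : d = d' -> isD f z d -> isD f z d'.
Proof. now intros ->. Qed.

Lemma isD_scal (f : C -> C) (c z d : C) : isD f z d -> isD (fun w => c * f w)%C z (c * d)%C.
Proof.
  intros H. eapply isD_eq; [|apply isD_mult; [apply isD_const|apply H]]. cbv beta; ring.
Qed.

Lemma isD_opp (f : C -> C) (z d : C) : isD f z d -> isD (fun w => - f w)%C z (- d)%C.
Proof.
  intros H. apply isD_ext with (fun w => RtoC (-1) * f w)%C.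
  - intros. ring.
  - eapply isD_eq; [|apply isD_scal, H]. ring.
Qed.

Lemma isD_minus (f g : C -> C) (z df dg : C) :
  isD f z df -> isD g z dg -> isD (fun w => f w - g w)%C z (df - dg)%C.
Proof. intros. apply isD_plus; auto. now apply isD_opp. Qed.

Lemma isD_comp (f g : C -> C) (z df dg : C) :
  isD g z dg -> isD f (g z) df -> isD (fun w => f (g w)) z (df * dg)%C.
Proof.
  intros [q [s [Hs [Hd [G0 G]]]]] [p [r [Hr [Hc [H0 H]]]]].
  assert (K : contC (fun h => q h * h)%C 0) by (apply contC_mult; auto; apply contC_id).
  destruct (K r Hr) as [d [Hd0 Hd1]].
  assert (Hq : forall h, Cmod h < d -> Cmod (q h * h)%C < r).
  { intros h Hh. specialize (Hd1 h).
    replace (q h * h - q 0 * 0)%C with (q h * h)%C in Hd1 by ring. apply Hd1.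
    now replace (h - 0)%C with h by ring. }
  exists (fun h => p (q h * h) * q h)%C, (Rmin s d). split; [now apply Rmin_glb_lt|].
  split; [|split].
  - apply contC_mult; auto. apply (contC_comp p (fun h => q h * h)%C); auto.
    replace (q 0 * 0)%C with (RtoC 0) by ring. auto.
  - replace (q 0 * 0)%C with (RtoC 0) by ring. now rewrite H0, G0.
  - intros h Hh. rewrite G, H. ring.
    + apply Hq. eapply Rlt_le_trans; [apply Hh|apply Rmin_r].
    + eapply Rlt_le_trans; [apply Hh|apply Rmin_l].
Qed.

Lemma contC_nz (f : C -> C) (z : C) : contC f z -> f z <> 0 ->
  exists r, 0 < r /\ forall w, Cmod (w - z)%C < r -> f w <> 0.
Proof.
  intros H Hz. assert (P := proj1 (Cmod_gt_0 _) Hz). destruct (H _ P) as [d [Hd Hd']].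
  exists d. split; auto. intros w Hw E. specialize (Hd' w Hw). rewrite E in Hd'.
  replace (0 - f z)%C with (- f z)%C in Hd' by ring. rewrite Cmod_opp in Hd'. lra.
Qed.

Lemma isD_Cinv (z : C) : z <> 0 -> isD Cinv z (- / (z * z))%C.
Proof.
  intros Hz. destruct (contC_nz (fun w => w) z (contC_id z) Hz) as [r [Hr Hr']].
  exists (fun h => - / (z * (z + h)))%C, r. split; auto. split; [|split].
  - apply contC_opp, contC_inv.
    + replace (z + 0)%C with z by ring. now apply Cmult_neq_0.
    + apply contC_mult; [apply contC_const|]. apply contC_plus; [apply contC_const|apply contC_id].
  - now replace (z + 0)%C with z by ring.
  - intros h Hh. assert (z + h <> 0)%C.
    { apply Hr'. now replace (z + h - z)%C with h by ring. }
    field. auto.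
Qed.

Lemma isD_inv (f : C -> C) (z d : C) : f z <> 0 -> isD f z d ->
  isD (fun w => / f w)%C z (- d / (f z * f z))%C.
Proof.
  intros Hz Hf. eapply isD_eq; [|apply (isD_comp Cinv f); [apply Hf|now apply isD_Cinv]].
  field. auto.
Qed.

Lemma isD_div (f g : C -> C) (z df dg : C) : g z <> 0 -> isD f z df -> isD g z dg ->
  isD (fun w => f w / g w)%C z ((df * g z - f z * dg) / (g z * g z))%C.
Proof.
  intros Hz Hf Hg. eapply isD_eq; [|apply isD_mult; [apply Hf|apply isD_inv; [|apply Hg]; auto]].
  cbv beta; field. auto.
Qed.

Lemma isD_pow (f : C -> C) (z d : C) (n : nat) : isD f z d ->
  isD (fun w => f w ^ n)%C z (INR n * f z ^ pred n * d)%C.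
Proof.
  intros Hf. induction n as [|n IH].
  - eapply isD_eq; [|apply (isD_const 1)]. simpl. ring.
  - simpl Cpow. eapply isD_eq; [|apply isD_mult; [apply Hf|apply IH]].
    rewrite S_INR, RtoC_plus. destruct n; simpl; ring.
Qed.

Lemma isD_unique (f : C -> C) (z d d' : C) : isD f z d -> isD f z d' -> d = d'.
Proof.
  intros H H'.
  destruct (Ceq_dec (d - d') 0) as [E|N].
  { replace d with (d - d' + d')%C by ring. rewrite E. ring. }
  (* With a quarter of the gap, two errors of size e |h| cannot add up to the difference (d - d') h,
     of modulus 4 e |h|. *)
  exfalso. assert (P := proj1 (Cmod_gt_0 _) N). set (e := Cmod (d - d') / 4).
  destruct (proj1 (isD_eps _ _ _) H e ltac:(unfold e; lra)) as [r [Hr K]].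
  destruct (proj1 (isD_eps _ _ _) H' e ltac:(unfold e; lra)) as [s [Hs K']].
  assert (Q : 0 < Rmin r s) by now apply Rmin_glb_lt.
  set (h := RtoC (Rmin r s / 2)).
  assert (Hh : Cmod h = Rmin r s / 2).
  { unfold h. rewrite Cmod_R. apply Rabs_pos_eq. lra. }
  specialize (K h ltac:(rewrite Hh; assert (T := Rmin_l r s); lra)).
  specialize (K' h ltac:(rewrite Hh; assert (T := Rmin_r r s); lra)).
  assert (T := Cmod_le_sub (f (z + h) - f z - d' * h)%C (f (z + h) - f z - d * h)%C).
  replace (f (z + h) - f z - d' * h - (f (z + h) - f z - d * h))%C with ((d - d') * h)%C in T by ring.
  rewrite Cmod_mult, Hh in *. unfold e in *. nra.
Qed.

Lemma isD_re (f : C -> C) (z d : C) (y : R) : z = (fst z, y) -> isD f z d ->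
  is_derive (fun x => fst (f (x, y))) (fst z) (fst d) /\
  is_derive (fun x => snd (f (x, y))) (fst z) (snd d).
Proof.
  intros Ez H. assert (K := proj1 (isD_eps _ _ _) H).
  split; apply is_derive_Reals; intros e He; destruct (K (e/2) ltac:(lra)) as [del [Hd Hd']];
  exists (mkposreal _ Hd); simpl; intros h Hh0 Hh;
  specialize (Hd' (RtoC h) ltac:(now rewrite Cmod_R)); rewrite Cmod_R in Hd';
  assert (Ph : 0 < Rabs h) by (now apply Rabs_pos_lt);
  replace (z + RtoC h)%C with (fst z + h, y) in Hd'
    by (rewrite Ez; unfold Cplus, RtoC; simpl; f_equal; ring);
  rewrite Ez in Hd' at 2; simpl in Hd';
  [ assert (T := Rle_trans _ _ _ (fst_le_Cmod _) Hd') | assert (T := Rle_trans _ _ _ (snd_le_Cmod _) Hd')];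
  simpl in T.
  - replace ((fst (f (fst z + h, y)) - fst (f (fst z, y))) / h - fst d)
      with ((fst (f (fst z + h, y)) + - fst (f (fst z, y)) + - (fst d * h - snd d * 0)) / h) by (field; auto).
    rewrite Rabs_div by auto. apply Rmult_lt_reg_r with (Rabs h); auto.
    unfold Rdiv. rewrite Rmult_assoc, Rinv_l by lra. nra.
  - replace ((snd (f (fst z + h, y)) - snd (f (fst z, y))) / h - snd d)
      with ((snd (f (fst z + h, y)) + - snd (f (fst z, y)) + - (fst d * 0 + snd d * h)) / h) by (field; auto).
    rewrite Rabs_div by auto. apply Rmult_lt_reg_r with (Rabs h); auto.
    unfold Rdiv. rewrite Rmult_assoc, Rinv_l by lra. nra.
Qed.

(** An increment i h changes f by about i d h, whose components are [- snd d] and [fst d]: together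
    with [isD_re] these are the Cauchy-Riemann equations. *)
Lemma isD_im (f : C -> C) (z d : C) (x : R) : z = (x, snd z) -> isD f z d ->
  is_derive (fun y => fst (f (x, y))) (snd z) (- snd d) /\
  is_derive (fun y => snd (f (x, y))) (snd z) (fst d).
Proof.
  intros Ez H. assert (K := proj1 (isD_eps _ _ _) H).
  split; apply is_derive_Reals; intros e He; destruct (K (e/2) ltac:(lra)) as [del [Hd Hd']];
  exists (mkposreal _ Hd); simpl; intros h Hh0 Hh;
  specialize (Hd' (Ci * RtoC h)%C ltac:(now rewrite Cmod_mult, Cmod_Ci, Cmod_R, Rmult_1_l));
  rewrite Cmod_mult, Cmod_Ci, Cmod_R, Rmult_1_l in Hd';
  assert (Ph : 0 < Rabs h) by (now apply Rabs_pos_lt);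
  replace (z + Ci * RtoC h)%C with (x, snd z + h) in Hd'
    by (rewrite Ez; unfold Cplus, Cmult, Ci, RtoC; simpl; f_equal; ring);
  rewrite Ez in Hd' at 2; simpl in Hd';
  [ assert (T := Rle_trans _ _ _ (fst_le_Cmod _) Hd') | assert (T := Rle_trans _ _ _ (snd_le_Cmod _) Hd')];
  simpl in T.
  - match type of T with Rabs ?A <= _ =>
      replace ((fst (f (x, snd z + h)) - fst (f (x, snd z))) / h - - snd d) with (A / h) by (field; auto) end.
    rewrite Rabs_div by auto. apply Rmult_lt_reg_r with (Rabs h); auto.
    unfold Rdiv. rewrite Rmult_assoc, Rinv_l by lra. nra.
  - match type of T with Rabs ?A <= _ =>
      replace ((snd (f (x, snd z + h)) - snd (f (x, snd z))) / h - fst d) with (A / h) by (field; auto) end.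
    rewrite Rabs_div by auto. apply Rmult_lt_reg_r with (Rabs h); auto.
    unfold Rdiv. rewrite Rmult_assoc, Rinv_l by lra. nra.
Qed.

(** * The complex exponential *)

(** Written with real functions exactly as [Cexp], so that passing between the two models of the
    complex numbers is a matter of conversion. *)
Definition cexp (z : C) : C := (exp (fst z) * cos (snd z), exp (fst z) * sin (snd z)).

Lemma cexp_plus (z w : C) : cexp (z + w)%C = (cexp z * cexp w)%C.
Proof.
  destruct z as [a b], w as [c d]. unfold cexp, Cplus, Cmult; simpl.
  rewrite exp_plus, cos_plus, sin_plus. f_equal; ring.
Qed.

Lemma cexp_0 : cexp 0 = 1.
Proof. unfold cexp; simpl. rewrite exp_0, cos_0, sin_0. unfold RtoC. f_equal; ring. Qed.

Lemma Cmod_cexp (z : C) : Cmod (cexp z) = exp (fst z).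
Proof.
  unfold Cmod, cexp; simpl.
  replace (_ + _) with (exp (fst z) * exp (fst z) * ((sin (snd z))² + (cos (snd z))²)) by (unfold Rsqr; ring).
  rewrite sin2_cos2, Rmult_1_r. apply sqrt_square. left. apply exp_pos.
Qed.

Lemma cexp_nz (z : C) : cexp z <> 0.
Proof. apply Cmod_gt_0. rewrite Cmod_cexp. apply exp_pos. Qed.

Lemma cexp_opp (z : C) : cexp (- z)%C = (/ cexp z)%C.
Proof.
  assert (H : (cexp (- z) * cexp z)%C = 1).
  { rewrite <- cexp_plus. replace (- z + z)%C with (RtoC 0) by ring. apply cexp_0. }
  assert (N := cexp_nz z). rewrite <- (Cmult_1_l (/ cexp z)), <- H. field. auto.
Qed.

Lemma exp_quad (x : R) : Rabs x <= 1/2 -> 0 <= exp x - 1 - x <= 2 * x ^ 2.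
Proof.
  intros H. apply Rabs_le_between in H. assert (H1 := exp_ineq1_le x). split; [lra|].
  (* The tangent inequality at [- x] reads [(1 - x) * exp x <= 1], which is an upper bound for
     [exp x]. *)
  assert (H2 := exp_ineq1_le (- x)). rewrite exp_Ropp in H2.
  assert (P := exp_pos x).
  assert (H3 : (1 - x) * exp x <= 1).
  { apply Rmult_le_compat_r with (r := exp x) in H2; [|lra]. rewrite Rinv_l in H2 by lra. lra. }
  nra.
Qed.

Lemma abs_sin_le (y : R) : Rabs (sin y) <= Rabs y.
Proof.
  destruct (MVT_gen sin 0 y cos) as [c [_ H]].
  - intros. auto_derive; auto. ring.
  - intros. apply continuity_sin.
  - rewrite sin_0, !Rminus_0_r in H. rewrite H, Rabs_mult.
    assert (T := COS_bound c). assert (Rabs (cos c) <= 1) by (apply Rabs_le; lra).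
    assert (P := Rabs_pos y). nra.
Qed.

Lemma cos_quad (y : R) : 0 <= 1 - cos y <= y ^ 2 / 2.
Proof.
  assert (T := COS_bound y). split; [lra|].
  replace y with (2 * (y / 2)) at 1 by field. rewrite cos_2a_sin.
  assert (H := abs_sin_le (y / 2)). apply Rsqr_le_abs_1 in H. unfold Rsqr in H. nra.
Qed.

Lemma sin_quad (y : R) : Rabs y <= 1 -> Rabs (sin y - y) <= y ^ 2.
Proof.
  intros Hy. destruct (MVT_gen (fun t => sin t - t) 0 y (fun t => cos t - 1)) as [c [Hc H]].
  - intros. auto_derive; auto. ring.
  - intros. apply continuity_pt_minus; [apply continuity_sin|apply continuity_pt_id].
  - rewrite sin_0, !Rminus_0_r in H. rewrite H, Rabs_mult.
    assert (T := cos_quad c).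
    assert (Hcy : Rabs c <= Rabs y).
    { unfold Rmin, Rmax in Hc. destruct (Rle_dec 0 y).
      - rewrite !Rabs_pos_eq; lra.
      - rewrite !Rabs_left1; lra. }
    rewrite Rabs_left1 by lra.
    assert (c ^ 2 <= Rabs y * Rabs y).
    { rewrite <- (pow2_abs c). assert (P := Rabs_pos c). nra. }
    rewrite <- (pow2_abs y). assert (P := Rabs_pos y). nra.
Qed.

(** The constant 8 is 3 for the real part plus 5 for the imaginary part. The quadratic error gives
    the derivative of [cexp] and, later, the convergence of Gauss's product. *)
Lemma cexp_quad (z : C) : Cmod z <= 1/2 -> Cmod (cexp z - 1 - z)%C <= 8 * Cmod z ^ 2.
Proof.
  intros H. destruct z as [x y].
  assert (Hx := fst_le_Cmod (x,y)). assert (Hy := snd_le_Cmod (x,y)). simpl in Hx, Hy.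
  set (r := Cmod (x,y)) in *.
  assert (Q1 := exp_quad x ltac:(lra)). assert (Q2 := cos_quad y). assert (Q3 := sin_quad y ltac:(lra)).
  assert (Sx : x ^ 2 <= r ^ 2) by (rewrite <- pow2_abs; assert (P := Rabs_pos x); nra).
  assert (Sy : y ^ 2 <= r ^ 2) by (rewrite <- pow2_abs; assert (P := Rabs_pos y); nra).
  assert (X := proj1 (Rabs_le_between _ _) Hx). assert (Y := proj1 (Rabs_le_between _ _) Hy).
  assert (T := SIN_bound y). assert (T' := COS_bound y).
  apply Rabs_le_between in Q3.
  assert (Ex : exp x <= 2) by nra. assert (Ep := exp_pos x).
  eapply Rle_trans; [apply Cmod_le_abs|]. unfold cexp, Cminus, Cplus, Copp, RtoC; simpl fst; simpl snd.
  assert (Rabs (exp x * cos y + - (1) + - x) <= 3 * r ^ 2).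
  { apply Rabs_le. split; nra. }
  assert (Rabs (exp x * sin y + - 0 + - y) <= 5 * r ^ 2).
  { replace (exp x * sin y + -0 + - y) with ((exp x - 1) * sin y + (sin y - y)) by ring.
    eapply Rle_trans; [apply Rabs_triang|]. rewrite Rabs_mult.
    assert (Rabs (sin y) <= r) by (eapply Rle_trans; [apply abs_sin_le|auto]).
    assert (Rabs (exp x - 1) <= 2 * r) by (apply Rabs_le; split; nra).
    assert (Rabs (sin y - y) <= r ^ 2) by (apply Rabs_le; split; lra).
    assert (P1 := Rabs_pos (sin y)). assert (P2 := Rabs_pos (exp x - 1)). nra. }
  lra.
Qed.

Lemma isD_cexp (z : C) : isD cexp z (cexp z).
Proof.
  apply isD_eps. intros e He. assert (P : 0 < Cmod (cexp z)) by (apply Cmod_gt_0, cexp_nz).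
  exists (Rmin (1/2) (e / (8 * Cmod (cexp z)))). split.
  { apply Rmin_glb_lt; [lra|]. apply Rdiv_lt_0_compat; lra. }
  intros h Hh. rewrite cexp_plus.
  replace (cexp z * cexp h - cexp z - cexp z * h)%C with (cexp z * (cexp h - 1 - h))%C by ring.
  rewrite Cmod_mult.
  assert (H1 : Cmod h < 1/2) by (eapply Rlt_le_trans; [apply Hh|apply Rmin_l]).
  assert (H2 : Cmod h < e / (8 * Cmod (cexp z))) by (eapply Rlt_le_trans; [apply Hh|apply Rmin_r]).
  assert (Q := cexp_quad h ltac:(lra)). assert (Ph := Cmod_ge_0 h).
  apply Rlt_le in H2. apply Rmult_le_compat_r with (r := 8 * Cmod (cexp z)) in H2; [|lra].
  replace (e / (8 * Cmod (cexp z)) * (8 * Cmod (cexp z))) with e in H2 by (field; lra).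
  nra.
Qed.

(** * Integrals of complex-valued functions *)

(** Equalities of components are often typed in a Coquelicot structure; restated in [R] they are
    accessible to [ring]. *)
Ltac eqR := match goal with |- @eq _ ?a ?b => change (@eq R a b) end.

Definition CI (f : R -> C) (a b : R) : C :=
  (RInt (fun t => fst (f t)) a b, RInt (fun t => snd (f t)) a b).

Definition exCI (f : R -> C) (a b : R) : Prop :=
  ex_RInt (fun t => fst (f t)) a b /\ ex_RInt (fun t => snd (f t)) a b.

Definition contP (f : R -> C) (t : R) : Prop :=
  continuous (fun t => fst (f t)) t /\ continuous (fun t => snd (f t)) t.

Lemma continuous_eps (f : R -> R) (x : R) :
  (forall e, 0 < e -> exists d, 0 < d /\ forall y, Rabs (y - x) < d -> Rabs (f y - f x) < e) ->
  continuous f x.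
Proof.
  intros H. apply filterlim_locally. intros [e He]. destruct (H e He) as [d [Hd Hd']].
  exists (mkposreal d Hd). intros y Hy. apply Hd'. exact Hy.
Qed.

Lemma contC_horiz (f : C -> C) (x y : R) : contC f (x, y) -> contP (fun x => f (x, y)) x.
Proof.
  intros H. split; apply continuous_eps; intros e He; destruct (H e He) as [d [Hd Hd']];
  exists d; (split; [auto|]); intros x' Hx';
  (assert (T : Cmod (f (x', y) - f (x, y))%C < e);
   [apply Hd'; replace ((x', y) - (x, y))%C with (RtoC (x' - x))
      by (unfold RtoC, Cminus, Cplus, Copp; simpl; f_equal; ring); now rewrite Cmod_R|]).
  - eapply Rle_lt_trans; [|apply T]. apply (fst_le_Cmod (f (x', y) - f (x, y))%C).
  - eapply Rle_lt_trans; [|apply T]. apply (snd_le_Cmod (f (x', y) - f (x, y))%C).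
Qed.

Lemma contC_vert (f : C -> C) (x y : R) : contC f (x, y) -> contP (fun y => f (x, y)) y.
Proof.
  intros H. split; apply continuous_eps; intros e He; destruct (H e He) as [d [Hd Hd']];
  exists d; (split; [auto|]); intros y' Hy';
  (assert (T : Cmod (f (x, y') - f (x, y))%C < e);
   [apply Hd'; replace ((x, y') - (x, y))%C with (Ci * RtoC (y' - y))%C
      by (unfold RtoC, Ci, Cmult, Cminus, Cplus, Copp; simpl; f_equal; ring);
    now rewrite Cmod_mult, Cmod_Ci, Cmod_R, Rmult_1_l|]).
  - eapply Rle_lt_trans; [|apply T]. apply (fst_le_Cmod (f (x, y') - f (x, y))%C).
  - eapply Rle_lt_trans; [|apply T]. apply (snd_le_Cmod (f (x, y') - f (x, y))%C).
Qed.

Lemma exCI_cont (f : R -> C) (a b : R) :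
  (forall t, Rmin a b <= t <= Rmax a b -> contP f t) -> exCI f a b.
Proof.
  intros H. split; apply (@ex_RInt_continuous R_CompleteNormedModule); intros; now apply H.
Qed.

Lemma contP_ab (f : R -> C) (a b : R) : a <= b ->
  (forall t, a <= t <= b -> contP f t) -> exCI f a b.
Proof. intros Hab H. apply exCI_cont. rewrite Rmin_left, Rmax_right; auto. Qed.

Lemma CI_ext (f g : R -> C) (a b : R) :
  (forall t, Rmin a b < t < Rmax a b -> f t = g t) -> CI f a b = CI g a b.
Proof. intros H. unfold CI. f_equal; apply RInt_ext; intros; now rewrite H. Qed.

Lemma exCI_ext (f g : R -> C) (a b : R) :
  (forall t, Rmin a b < t < Rmax a b -> f t = g t) -> exCI f a b -> exCI g a b.
Proof.
  intros H [H1 H2]. split.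
  - apply (ex_RInt_ext (fun t => fst (f t))); auto. intros; now rewrite H.
  - apply (ex_RInt_ext (fun t => snd (f t))); auto. intros; now rewrite H.
Qed.

Lemma exCI_plus (f g : R -> C) (a b : R) :
  exCI f a b -> exCI g a b -> exCI (fun t => f t + g t)%C a b.
Proof.
  intros [H1 H2] [H3 H4]. split; simpl.
  - apply (ex_RInt_plus (V := R_NormedModule) (fun t => fst (f t)) (fun t => fst (g t))); auto.
  - apply (ex_RInt_plus (V := R_NormedModule) (fun t => snd (f t)) (fun t => snd (g t))); auto.
Qed.

Lemma CI_plus (f g : R -> C) (a b : R) :
  exCI f a b -> exCI g a b -> CI (fun t => f t + g t)%C a b = (CI f a b + CI g a b)%C.
Proof.
  intros [H1 H2] [H3 H4]. unfold CI, Cplus; simpl. f_equal.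
  - apply (RInt_plus (V := R_CompleteNormedModule) (fun t => fst (f t)) (fun t => fst (g t))); auto.
  - apply (RInt_plus (V := R_CompleteNormedModule) (fun t => snd (f t)) (fun t => snd (g t))); auto.
Qed.

Lemma ex_RInt_ext_R (f g : R -> R) (a b : R) :
  (forall t, Rmin a b < t < Rmax a b -> f t = g t) -> ex_RInt f a b -> ex_RInt g a b.
Proof. intros H. now apply ex_RInt_ext. Qed.

Lemma RInt_ext_R (f g : R -> R) (a b : R) :
  (forall t, Rmin a b < t < Rmax a b -> f t = g t) -> RInt f a b = RInt g a b.
Proof. intros H. now apply RInt_ext. Qed.

Lemma exRInt_lin (f g : R -> R) (k l a b : R) :
  ex_RInt f a b -> ex_RInt g a b -> ex_RInt (fun t => k * f t + l * g t) a b.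
Proof.
  intros H1 H2.
  apply (ex_RInt_plus (V := R_NormedModule) (fun t => k * f t) (fun t => l * g t)).
  - apply (ex_RInt_scal (V := R_NormedModule) f a b k); auto.
  - apply (ex_RInt_scal (V := R_NormedModule) g a b l); auto.
Qed.

Lemma RInt_lin (f g : R -> R) (k l a b : R) :
  ex_RInt f a b -> ex_RInt g a b ->
  RInt (fun t => k * f t + l * g t) a b = k * RInt f a b + l * RInt g a b.
Proof.
  intros H1 H2.
  assert (E1 : ex_RInt (fun t => k * f t) a b)
    by (apply (ex_RInt_scal (V := R_NormedModule) f a b k); auto).
  assert (E2 : ex_RInt (fun t => l * g t) a b)
    by (apply (ex_RInt_scal (V := R_NormedModule) g a b l); auto).
  transitivity (RInt (fun t => k * f t) a b + RInt (fun t => l * g t) a b).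
  - apply (RInt_plus (V := R_CompleteNormedModule) (fun t => k * f t) (fun t => l * g t)); auto.
  - f_equal.
    + apply (RInt_scal (V := R_CompleteNormedModule) f a b k); auto.
    + apply (RInt_scal (V := R_CompleteNormedModule) g a b l); auto.
Qed.

Lemma exCI_scal (f : R -> C) (c : C) (a b : R) : exCI f a b -> exCI (fun t => c * f t)%C a b.
Proof.
  intros [H1 H2]. split; simpl.
  - apply (ex_RInt_ext_R (fun t => fst c * fst (f t) + (- snd c) * snd (f t))).
    + intros; ring.
    + now apply exRInt_lin.
  - apply (ex_RInt_ext_R (fun t => fst c * snd (f t) + snd c * fst (f t))).
    + intros; ring.
    + now apply exRInt_lin.
Qed.

Lemma CI_scal (f : R -> C) (c : C) (a b : R) :
  exCI f a b -> CI (fun t => c * f t)%C a b = (c * CI f a b)%C.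
Proof.
  intros [H1 H2]. unfold CI, Cmult; simpl. f_equal.
  - eqR; rewrite (RInt_ext_R _ (fun t => fst c * fst (f t) + (- snd c) * snd (f t))).
    + rewrite RInt_lin by auto. eqR; ring.
    + intros; ring.
  - rewrite (RInt_lin (fun t => snd (f t)) (fun t => fst (f t))) by auto. eqR; ring.
Qed.

Lemma exCI_minus (f g : R -> C) (a b : R) :
  exCI f a b -> exCI g a b -> exCI (fun t => f t - g t)%C a b.
Proof.
  intros H1 H2. apply (exCI_ext (fun t => f t + (-1) * g t)%C).
  - intros. ring.
  - apply exCI_plus; auto. now apply exCI_scal.
Qed.

Lemma CI_minus (f g : R -> C) (a b : R) :
  exCI f a b -> exCI g a b -> CI (fun t => f t - g t)%C a b = (CI f a b - CI g a b)%C.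
Proof.
  intros H1 H2. rewrite (CI_ext _ (fun t => f t + (-1) * g t)%C) by (intros; ring).
  rewrite CI_plus, CI_scal; auto; [ring|now apply exCI_scal].
Qed.

Lemma CI_const (c : C) (a b : R) : CI (fun _ => c) a b = (RtoC (b - a) * c)%C.
Proof.
  unfold CI. rewrite !RInt_const. unfold scal; simpl. unfold mult; simpl.
  destruct c; unfold RtoC, Cmult; simpl. f_equal; eqR; ring.
Qed.

Lemma exCI_const (c : C) (a b : R) : exCI (fun _ => c) a b.
Proof. split; apply ex_RInt_const. Qed.

Lemma CI_Chasles (f : R -> C) (a b c : R) :
  exCI f a b -> exCI f b c -> (CI f a b + CI f b c)%C = CI f a c.
Proof.
  intros [H1 H2] [H3 H4]. unfold CI, Cplus; simpl. f_equal.
  - apply (RInt_Chasles (V := R_CompleteNormedModule)); auto.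
  - apply (RInt_Chasles (V := R_CompleteNormedModule)); auto.
Qed.

Lemma CI_swap (f : R -> C) (a b : R) : exCI f a b -> CI f b a = (- CI f a b)%C.
Proof.
  intros [H1 H2]. unfold CI, Copp; simpl. f_equal.
  - symmetry. apply (opp_RInt_swap (V := R_CompleteNormedModule)); auto.
  - symmetry. apply (opp_RInt_swap (V := R_CompleteNormedModule)); auto.
Qed.

Lemma exCI_swap (f : R -> C) (a b : R) : exCI f a b -> exCI f b a.
Proof. intros [H1 H2]. split; now apply ex_RInt_swap. Qed.

(* Rotating by the conjugate of the integral reduces the bound to a real integral. *)
Lemma CI_norm (f : R -> C) (g : R -> R) (a b : R) : a <= b -> exCI f a b -> ex_RInt g a b ->
  (forall t, a < t < b -> Cmod (f t) <= g t) -> Cmod (CI f a b) <= RInt g a b.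
Proof.
  intros Hab Hf Hg H.
  assert (Gp : 0 <= RInt g a b).
  { apply RInt_ge_0; auto. intros t Ht. eapply Rle_trans; [apply Cmod_ge_0|now apply H]. }
  destruct (Req_dec (Cmod (CI f a b)) 0) as [E|N]; [lra|].
  assert (P : 0 < Cmod (CI f a b)) by (assert (T := Cmod_ge_0 (CI f a b)); lra).
  set (I := CI f a b) in *.
  assert (K : (Cconj I * I)%C = CI (fun t => Cconj I * f t)%C a b) by (now rewrite CI_scal).
  assert (K1 : Cmod I ^ 2 = fst (CI (fun t => Cconj I * f t)%C a b)).
  { rewrite <- K. rewrite Cmod2_alt. unfold Cconj, Cmult; simpl. unfold Re, Im. ring. }
  unfold CI in K1; simpl fst in K1 at 1.
  assert (K2 : RInt (fun t => fst (Cconj I * f t)%C) a b <= RInt (fun t => Cmod I * g t) a b).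
  { apply RInt_le; auto.
    - apply (exCI_scal f (Cconj I) a b Hf).
    - apply (ex_RInt_scal (V := R_NormedModule) g a b (Cmod I)); auto.
    - intros t Ht. eapply Rle_trans; [apply Rle_abs|]. eapply Rle_trans; [apply fst_le_Cmod|].
      rewrite Cmod_mult, Cmod_conj. apply Rmult_le_compat_l; [apply Cmod_ge_0|auto]. }
  assert (K3 : RInt (fun t => Cmod I * g t) a b = Cmod I * RInt g a b)
    by (apply (RInt_scal (V := R_CompleteNormedModule) g a b (Cmod I)); auto).
  rewrite K3 in K2. simpl in K1, K2. nra.
Qed.

Lemma CI_norm_const (f : R -> C) (M a b : R) : a <= b -> exCI f a b ->
  (forall t, a < t < b -> Cmod (f t) <= M) -> Cmod (CI f a b) <= M * (b - a).
Proof.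
  intros Hab Hf H. assert (T := CI_norm f (fun _ => M) a b Hab Hf (ex_RInt_const _ _ _) H).
  rewrite RInt_const in T. unfold scal in T; simpl in T. unfold mult in T; simpl in T. lra.
Qed.

Lemma CI_norm_abs (f : R -> C) (M a b : R) : exCI f a b ->
  (forall t, Rmin a b < t < Rmax a b -> Cmod (f t) <= M) -> Cmod (CI f a b) <= M * Rabs (b - a).
Proof.
  intros Hf H. destruct (Rle_dec a b) as [L|L].
  - rewrite Rabs_pos_eq by lra. rewrite Rmin_left, Rmax_right in H by lra. now apply CI_norm_const.
  - rewrite Rmin_right, Rmax_left in H by lra.
    rewrite CI_swap by now apply exCI_swap. rewrite Cmod_opp, Rabs_left by lra.
    replace (- (b - a)) with (a - b) by ring. apply CI_norm_const; auto; [lra|now apply exCI_swap].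
Qed.

Lemma CI_FTC_horiz (F f : C -> C) (y a b : R) :
  (forall x, Rmin a b <= x <= Rmax a b -> isD F (x, y) (f (x, y)) /\ contC f (x, y)) ->
  CI (fun x => f (x, y)) a b = (F (b, y) - F (a, y))%C.
Proof.
  intros H. unfold CI. apply injective_projections; simpl.
  - apply is_RInt_unique, (is_RInt_derive (V := R_CompleteNormedModule) (fun x => fst (F (x, y)))).
    + intros x Hx. apply (isD_re F (x, y) (f (x, y)) y); auto. now apply H.
    + intros x Hx. apply (contC_horiz f x y). now apply H.
  - apply is_RInt_unique, (is_RInt_derive (V := R_CompleteNormedModule) (fun x => snd (F (x, y)))).
    + intros x Hx. apply (isD_re F (x, y) (f (x, y)) y); auto. now apply H.
    + intros x Hx. apply (contC_horiz f x y). now apply H.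
Qed.

(** The factor [Ci] is dz = i dy on a vertical segment. *)
Lemma CI_FTC_vert (F f : C -> C) (x a b : R) :
  (forall y, Rmin a b <= y <= Rmax a b -> isD F (x, y) (f (x, y)) /\ contC f (x, y)) ->
  (Ci * CI (fun y => f (x, y)) a b)%C = (F (x, b) - F (x, a))%C.
Proof.
  intros H.
  assert (E : exCI (fun y => f (x, y)) a b).
  { apply exCI_cont. intros y Hy. apply contC_vert. now apply H. }
  rewrite <- CI_scal by auto. unfold CI. apply injective_projections; simpl.
  - eqR; rewrite (RInt_ext_R _ (fun y => - snd (f (x, y)))) by (intros; ring).
    apply is_RInt_unique, (is_RInt_derive (V := R_CompleteNormedModule) (fun y => fst (F (x, y)))).
    + intros y Hy. apply (isD_im F (x, y) (f (x, y)) x); auto. now apply H.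
    + intros y Hy. apply (continuous_opp (V := R_NormedModule) (fun y => snd (f (x, y)))).
      apply (contC_vert f x y). now apply H.
  - eqR; rewrite (RInt_ext_R _ (fun y => fst (f (x, y)))) by (intros; ring).
    apply is_RInt_unique, (is_RInt_derive (V := R_CompleteNormedModule) (fun y => snd (F (x, y)))).
    + intros y Hy. apply (isD_im F (x, y) (f (x, y)) x); auto. now apply H.
    + intros y Hy. apply (contC_vert f x y). now apply H.
Qed.

(** * Cauchy's theorem on rectangles *)

(** The contour integral of [f] round the rectangle, counterclockwise, with dz = dx on the
    horizontal sides and dz = i dy on the vertical ones. *)
Definition bdry (f : C -> C) (x1 x2 y1 y2 : R) : C :=
  (CI (fun x => f (x, y1)) x1 x2 + Ci * CI (fun y => f (x2, y)) y1 y2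
   - CI (fun x => f (x, y2)) x1 x2 - Ci * CI (fun y => f (x1, y)) y1 y2)%C.

Definition onB (x1 x2 y1 y2 : R) (z : C) : Prop :=
  (x1 <= fst z <= x2 /\ (snd z = y1 \/ snd z = y2)) \/
  ((fst z = x1 \/ fst z = x2) /\ y1 <= snd z <= y2).

Section Rect.
Variables x1 x2 y1 y2 : R.
Hypothesis (Hx : x1 <= x2) (Hy : y1 <= y2).

Lemma exCI_bdry (f : C -> C) : (forall z, onB x1 x2 y1 y2 z -> contC f z) ->
  exCI (fun x => f (x, y1)) x1 x2 /\ exCI (fun y => f (x2, y)) y1 y2 /\
  exCI (fun x => f (x, y2)) x1 x2 /\ exCI (fun y => f (x1, y)) y1 y2.
Proof.
  intros H. split; [|split; [|split]]; (apply contP_ab; [assumption|]); intros t Ht;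
  [apply contC_horiz|apply contC_vert|apply contC_horiz|apply contC_vert];
  apply H; unfold onB; simpl; lra.
Qed.

Lemma bdry_plus (f g : C -> C) : (forall z, onB x1 x2 y1 y2 z -> contC f z) ->
  (forall z, onB x1 x2 y1 y2 z -> contC g z) ->
  bdry (fun z => f z + g z)%C x1 x2 y1 y2 = (bdry f x1 x2 y1 y2 + bdry g x1 x2 y1 y2)%C.
Proof.
  intros Hf Hg. destruct (exCI_bdry f Hf) as [A1 [A2 [A3 A4]]].
  destruct (exCI_bdry g Hg) as [B1 [B2 [B3 B4]]]. unfold bdry. rewrite !CI_plus by auto. ring.
Qed.

Lemma bdry_scal (f : C -> C) (c : C) : (forall z, onB x1 x2 y1 y2 z -> contC f z) ->
  bdry (fun z => c * f z)%C x1 x2 y1 y2 = (c * bdry f x1 x2 y1 y2)%C.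
Proof.
  intros Hf. destruct (exCI_bdry f Hf) as [A1 [A2 [A3 A4]]].
  unfold bdry. rewrite !CI_scal by auto. ring.
Qed.

Lemma bdry_ext (f g : C -> C) : (forall z, onB x1 x2 y1 y2 z -> f z = g z) ->
  bdry f x1 x2 y1 y2 = bdry g x1 x2 y1 y2.
Proof.
  intros H. unfold bdry.
  repeat match goal with |- context [CI (fun t => f (@?a t)) ?p ?q] =>
    rewrite (CI_ext (fun t => f (a t)) (fun t => g (a t)) p q) end; auto;
  intros t; try rewrite (Rmin_left x1 x2), (Rmax_right x1 x2) by auto;
  try rewrite (Rmin_left y1 y2), (Rmax_right y1 y2) by auto;
  intros Ht; apply H; unfold onB; simpl; lra.
Qed.

Lemma bdry_bound (f : C -> C) (M : R) : (forall z, onB x1 x2 y1 y2 z -> contC f z) ->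
  (forall z, onB x1 x2 y1 y2 z -> Cmod (f z) <= M) ->
  Cmod (bdry f x1 x2 y1 y2) <= M * (2 * ((x2 - x1) + (y2 - y1))).
Proof.
  intros Hf HM. destruct (exCI_bdry f Hf) as [A1 [A2 [A3 A4]]]. unfold bdry.
  eapply Rle_trans; [apply Cmod_le_sub|]. rewrite Cmod_mult, Cmod_Ci, Rmult_1_l.
  eapply Rle_trans; [apply Rplus_le_compat_r, Cmod_le_sub|].
  eapply Rle_trans; [apply Rplus_le_compat_r, Rplus_le_compat_r, Cmod_triangle|].
  rewrite Cmod_mult, Cmod_Ci, Rmult_1_l.
  assert (B1 := CI_norm_const _ M _ _ Hx A1 ltac:(intros; apply HM; unfold onB; simpl; lra)).
  assert (B2 := CI_norm_const _ M _ _ Hy A2 ltac:(intros; apply HM; unfold onB; simpl; lra)).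
  assert (B3 := CI_norm_const _ M _ _ Hx A3 ltac:(intros; apply HM; unfold onB; simpl; lra)).
  assert (B4 := CI_norm_const _ M _ _ Hy A4 ltac:(intros; apply HM; unfold onB; simpl; lra)).
  lra.
Qed.

Lemma bdry_primitive (F f : C -> C) :
  (forall z, onB x1 x2 y1 y2 z -> isD F z (f z) /\ contC f z) -> bdry f x1 x2 y1 y2 = 0.
Proof.
  intros H. unfold bdry.
  rewrite (CI_FTC_horiz F f y1), (CI_FTC_horiz F f y2), (CI_FTC_vert F f x1), (CI_FTC_vert F f x2).
  ring.
  all: intros t Ht; try rewrite (Rmin_left x1 x2), (Rmax_right x1 x2) in Ht by auto;
  try rewrite (Rmin_left y1 y2), (Rmax_right y1 y2) in Ht by auto;
  apply H; unfold onB; simpl; lra.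
Qed.
End Rect.

Definition inR (x1 x2 y1 y2 : R) (z : C) : Prop := x1 <= fst z <= x2 /\ y1 <= snd z <= y2.

Lemma onB_inR x1 x2 y1 y2 z : x1 <= x2 -> y1 <= y2 -> onB x1 x2 y1 y2 z -> inR x1 x2 y1 y2 z.
Proof. unfold onB, inR. intuition lra. Qed.

Lemma bdry_split_x (f : C -> C) (x1 xm x2 y1 y2 : R) : x1 <= xm <= x2 -> y1 <= y2 ->
  (forall z, onB x1 xm y1 y2 z -> contC f z) -> (forall z, onB xm x2 y1 y2 z -> contC f z) ->
  bdry f x1 x2 y1 y2 = (bdry f x1 xm y1 y2 + bdry f xm x2 y1 y2)%C.
Proof.
  intros Hx Hy H1 H2.
  destruct (exCI_bdry x1 xm y1 y2 ltac:(lra) Hy f H1) as [A1 [A2 [A3 A4]]].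
  destruct (exCI_bdry xm x2 y1 y2 ltac:(lra) Hy f H2) as [B1 [B2 [B3 B4]]].
  unfold bdry. rewrite <- (CI_Chasles (fun x => f (x, y1)) x1 xm x2) by auto.
  rewrite <- (CI_Chasles (fun x => f (x, y2)) x1 xm x2) by auto. ring.
Qed.

Lemma bdry_split_y (f : C -> C) (x1 x2 y1 ym y2 : R) : x1 <= x2 -> y1 <= ym <= y2 ->
  (forall z, onB x1 x2 y1 ym z -> contC f z) -> (forall z, onB x1 x2 ym y2 z -> contC f z) ->
  bdry f x1 x2 y1 y2 = (bdry f x1 x2 y1 ym + bdry f x1 x2 ym y2)%C.
Proof.
  intros Hx Hy H1 H2.
  destruct (exCI_bdry x1 x2 y1 ym Hx ltac:(lra) f H1) as [A1 [A2 [A3 A4]]].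
  destruct (exCI_bdry x1 x2 ym y2 Hx ltac:(lra) f H2) as [B1 [B2 [B3 B4]]].
  unfold bdry. rewrite <- (CI_Chasles (fun y => f (x1, y)) y1 ym y2) by auto.
  rewrite <- (CI_Chasles (fun y => f (x2, y)) y1 ym y2) by auto. ring.
Qed.

(** * Goursat's theorem by repeated bisection *)

Section Goursat.
Variables (f : C -> C) (X1 X2 Y1 Y2 : R).
Hypotheses (HX : X1 <= X2) (HY : Y1 <= Y2)
  (Hf : forall z, inR X1 X2 Y1 Y2 z -> exists d, isD f z d).

Let rect := ((R * R) * (R * R))%type.
Let B (r : rect) : R := Cmod (bdry f (fst (fst r)) (snd (fst r)) (fst (snd r)) (snd (snd r))).

(** Keeps a half that carries at least half of the modulus of the contour integral; if the first
    half fails the test, additivity and the triangle inequality show that the second passes it. One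
    cut in each direction then loses a factor of at most 4. *)
Let halfx (r : rect) : rect :=
  let '((a, b), q) := r in let m := (a + b) / 2 in
  if Rle_dec (B r / 2) (B ((a, m), q)) then ((a, m), q) else ((m, b), q).
Let halfy (r : rect) : rect :=
  let '(q, (a, b)) := r in let m := (a + b) / 2 in
  if Rle_dec (B r / 2) (B (q, (a, m))) then (q, (a, m)) else (q, (m, b)).
Let sub (r r' : rect) : Prop :=
  fst (fst r') <= fst (fst r) /\ fst (fst r) <= snd (fst r) /\ snd (fst r) <= snd (fst r') /\
  fst (snd r') <= fst (snd r) /\ fst (snd r) <= snd (snd r) /\ snd (snd r) <= snd (snd r').
Let top : rect := ((X1, X2), (Y1, Y2)).

Let seqr (n : nat) : rect := Nat.iter n (fun r => halfy (halfx r)) top.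

Lemma goursat_cont (r : rect) (z : C) : sub r top ->
  onB (fst (fst r)) (snd (fst r)) (fst (snd r)) (snd (snd r)) z -> contC f z.
Proof.
  intros H Hz. destruct (Hf z) as [d Hd].
  - unfold sub, top in H; simpl in H. apply onB_inR in Hz; unfold inR in *; lra.
  - now apply isD_contC with d.
Qed.

Lemma goursat_step (r : rect) : sub r top ->
  sub (halfy (halfx r)) r /\ B r <= 4 * B (halfy (halfx r)) /\
  snd (fst (halfy (halfx r))) - fst (fst (halfy (halfx r))) = (snd (fst r) - fst (fst r)) / 2 /\
  snd (snd (halfy (halfx r))) - fst (snd (halfy (halfx r))) = (snd (snd r) - fst (snd r)) / 2.
Proof.
  intros Hr.
  assert (P1 : sub (halfx r) r /\ B r <= 2 * B (halfx r) /\
    snd (fst (halfx r)) - fst (fst (halfx r)) = (snd (fst r) - fst (fst r)) / 2 /\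
    snd (halfx r) = snd r).
  { destruct r as [[a b] [c d]]. assert (Hr' := Hr). unfold sub, top in Hr'; simpl in Hr'.
    set (m := (a + b) / 2). unfold halfx. fold m.
    assert (Hm : a <= m <= b) by (unfold m; lra).
    destruct (Rle_dec _ _) as [L|L].
    - split; [|split; [lra|split; [simpl; unfold m; field|reflexivity]]]. unfold sub; simpl; lra.
    - split; [unfold sub; simpl; lra|split; [|split; [simpl; unfold m; field|reflexivity]]].
      assert (S := bdry_split_x f a m b c d ltac:(lra) ltac:(lra)
        ltac:(intros z Hz; apply (goursat_cont ((a,m),(c,d))); auto; unfold sub, top; simpl; lra)
        ltac:(intros z Hz; apply (goursat_cont ((m,b),(c,d))); auto; unfold sub, top; simpl; lra)).
      unfold B in *; simpl in *. rewrite S in *.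
      assert (T := Cmod_triangle (bdry f a m c d) (bdry f m b c d)). lra. }
  destruct P1 as [S1 [B1 [W1 E1]]].
  assert (Hr1 : sub (halfx r) top) by (unfold sub in *; simpl in *; lra).
  revert S1 B1 W1 E1 Hr1. generalize (halfx r). intros s S1 B1 W1 E1 Hr1.
  assert (P2 : sub (halfy s) s /\ B s <= 2 * B (halfy s) /\
    snd (snd (halfy s)) - fst (snd (halfy s)) = (snd (snd s) - fst (snd s)) / 2 /\
    fst (halfy s) = fst s).
  { destruct s as [[c d] [a b]]. assert (Hr' := Hr1). unfold sub, top in Hr'; simpl in Hr'.
    set (m := (a + b) / 2). unfold halfy. fold m.
    assert (Hm : a <= m <= b) by (unfold m; lra).
    destruct (Rle_dec _ _) as [L|L].
    - split; [|split; [lra|split; [simpl; unfold m; field|reflexivity]]]. unfold sub; simpl; lra.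
    - split; [unfold sub; simpl; lra|split; [|split; [simpl; unfold m; field|reflexivity]]].
      assert (S := bdry_split_y f c d a m b ltac:(lra) ltac:(lra)
        ltac:(intros z Hz; apply (goursat_cont ((c,d),(a,m))); auto; unfold sub, top; simpl; lra)
        ltac:(intros z Hz; apply (goursat_cont ((c,d),(m,b))); auto; unfold sub, top; simpl; lra)).
      unfold B in *; simpl in *. rewrite S in *.
      assert (T := Cmod_triangle (bdry f c d a m) (bdry f c d m b)). lra. }
  destruct P2 as [S2 [B2 [W2 E2]]].
  split; [unfold sub in *; lra|]. split; [lra|]. rewrite E2, W2, E1. split; lra.
Qed.

Lemma goursat_seq (n : nat) : sub (seqr n) top /\ sub (seqr (S n)) (seqr n) /\
  B top <= 4 ^ n * B (seqr n) /\
  snd (fst (seqr n)) - fst (fst (seqr n)) = (X2 - X1) / 2 ^ n /\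
  snd (snd (seqr n)) - fst (snd (seqr n)) = (Y2 - Y1) / 2 ^ n.
Proof.
  assert (Tp : sub top top) by (unfold sub, top; simpl; lra).
  induction n as [|n [IH1 [IH2 [IH3 [IH4 IH5]]]]].
  - split; auto. split; [now apply goursat_step|]. simpl. split; [lra|split; field].
  - assert (S1 : sub (seqr (S n)) top) by (unfold sub in *; lra).
    split; auto. destruct (goursat_step _ IH1) as [_ [Q1 [Q2 Q3]]].
    split; [now apply (goursat_step (seqr (S n)))|].
    change (seqr (S n)) with (halfy (halfx (seqr n))).
    assert (P4 : 0 < 4 ^ n) by (apply pow_lt; lra). assert (P2 : 0 < 2 ^ n) by (apply pow_lt; lra).
    split; [|rewrite Q2, Q3, IH4, IH5; simpl; split; field; lra].
    simpl. eapply Rle_trans; [apply IH3|]. rewrite (Rmult_comm 4), Rmult_assoc.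
    apply Rmult_le_compat_l; lra.
Qed.

Lemma goursat_mono (n k : nat) : sub (seqr (n + k)) (seqr n).
Proof.
  induction k as [|k IH].
  - rewrite Nat.add_0_r. destruct (goursat_seq n) as [A [Bq _]]. unfold sub in *. lra.
  - rewrite Nat.add_succ_r. destruct (goursat_seq (n + k)) as [_ [Bq _]]. unfold sub in *. lra.
Qed.

Lemma goursat_point : exists z : C, forall n,
  inR (fst (fst (seqr n))) (snd (fst (seqr n))) (fst (snd (seqr n))) (snd (snd (seqr n))) z.
Proof.
  (* By nesting, every lower end is below every upper end, so the suprema of the lower ends lie in
     all the rectangles. *)
  assert (cross : forall n k, fst (fst (seqr n)) <= snd (fst (seqr k)) /\ fst (snd (seqr n)) <= snd (snd (seqr k))).
  { intros n k. destruct (Nat.le_gt_cases n k) as [L|L].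
    - replace k with (n + (k - n))%nat by lia. assert (T := goursat_mono n (k - n)). unfold sub in T. lra.
    - replace n with (k + (n - k))%nat by lia. assert (T := goursat_mono k (n - k)). unfold sub in T. lra. }
  destruct (completeness (fun x => exists n, x = fst (fst (seqr n)))) as [x [Ux Lx]].
  { exists (snd (fst (seqr 0))). intros t [n ->]. apply cross. }
  { exists (fst (fst (seqr 0))). now exists 0%nat. }
  destruct (completeness (fun x => exists n, x = fst (snd (seqr n)))) as [y [Uy Ly]].
  { exists (snd (snd (seqr 0))). intros t [n ->]. apply cross. }
  { exists (fst (snd (seqr 0))). now exists 0%nat. }
  exists (x, y). intros n. unfold inR; simpl. repeat split.
  - apply Ux. now exists n.
  - apply Lx. intros t [k ->]. apply cross.
  - apply Uy. now exists n.
  - apply Ly. intros t [k ->]. apply cross.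
Qed.

Lemma goursat : bdry f X1 X2 Y1 Y2 = 0.
Proof.
  apply Cmod_eq_0. change (B top = 0). apply Rle_antisym; [|apply Cmod_ge_0].
  apply le_epsilon. intros e He. rewrite Rplus_0_l.
  destruct goursat_point as [z Hz].
  assert (Hz0 := Hz 0%nat). simpl in Hz0. destruct (Hf z Hz0) as [d Hd].
  set (W := (X2 - X1) + (Y2 - Y1)). assert (HW : 0 <= W) by (unfold W; lra).
  (* The final bound is [e' * (2 * (W * W))], where [W] is the half-perimeter of the first
     rectangle. *)
  set (e' := e / (2 * (W * W) + 1)). assert (PW : 0 < 2 * (W * W) + 1) by nra.
  assert (He' : 0 < e') by (apply Rdiv_lt_0_compat; lra).
  destruct (proj1 (isD_eps _ _ _) Hd e' He') as [del [Hdel Hdel']].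
  destruct (pow_lt_1_zero (1/2) ltac:(rewrite Rabs_pos_eq; lra) (del / (W + 1))
    ltac:(apply Rdiv_lt_0_compat; lra)) as [n Hn].
  specialize (Hn n (le_n n)). rewrite Rabs_pos_eq in Hn by (apply pow_le; lra).
  destruct (goursat_seq n) as [S1 [_ [S3 [S4 S5]]]]. specialize (Hz n).
  destruct (seqr n) as [[a b] [c dd]]. unfold sub, inR, B in *; simpl in *.
  set (q := 2 ^ n) in *. assert (Pq : 0 < q) by (apply pow_lt; lra).
  assert (Eq : (1/2) ^ n = / q) by (unfold q; rewrite <- pow_inv; f_equal; lra).
  rewrite Eq in Hn.
  (* The affine part of [f] at [z] has a primitive and drops out. The rest is at most [e'] times a
     distance, integrated over a perimeter; both scale like 2^(-n), which compensates the factor 4^n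
     of the bisections. *)
  set (g := fun w => (f w - f z - d * (w - z))%C).
  assert (Cf : forall w, onB a b c dd w -> contC f w).
  { intros w Hw. apply (goursat_cont ((a,b),(c,dd))); auto. }
  assert (L0 : forall w, contC (fun w => f z + d * (w - z))%C w).
  { intros w. apply contC_plus; [apply contC_const|]. apply contC_mult; [apply contC_const|].
    apply contC_minus; [apply contC_id|apply contC_const]. }
  assert (Eb : bdry f a b c dd = bdry g a b c dd).
  { transitivity (bdry (fun w => g w + (f z + d * (w - z)))%C a b c dd).
    - apply bdry_ext; try lra. intros w _. unfold g. ring.
    - rewrite bdry_plus; try lra.
      + rewrite (bdry_primitive a b c dd ltac:(lra) ltac:(lra)
          (fun w => f z * (w - z) + d * ((w - z) * (w - z)) / 2)%C (fun w => f z + d * (w - z))%C); [ring|].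
        intros w _. split; [|apply L0].
        eapply isD_eq; cycle 1.
        { apply isD_plus; [apply isD_scal, isD_minus; [apply isD_id|apply isD_const]|].
          apply isD_mult; [|apply isD_const].
          apply isD_scal, isD_mult; apply isD_minus; try apply isD_id; apply isD_const. }
        cbv beta. field.
      + intros w Hw. unfold g. apply (contC_ext_loc (fun w => f w - (f z + d * (w - z)))%C _ w 1); [lra|intros; ring|].
        apply contC_minus; [now apply Cf|apply L0].
      + intros w _. apply L0. }
  rewrite Eb in S3.
  assert (Wq : W / q = (b - a) + (dd - c)) by (rewrite S4, S5; unfold W; field; lra).
  assert (Bg : Cmod (bdry g a b c dd) <= e' * (W / q) * (2 * ((b - a) + (dd - c)))).
  { apply bdry_bound; try lra.
    - intros w Hw. unfold g. apply (contC_ext_loc (fun w => f w - (f z + d * (w - z)))%C _ w 1); [lra|intros; ring|].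
        apply contC_minus; [now apply Cf|apply L0].
    - intros w Hw. apply onB_inR in Hw; try lra. unfold inR in Hw.
      assert (Dw : Cmod (w - z)%C <= W / q).
      { eapply Rle_trans; [apply Cmod_le_abs|]. rewrite Wq. simpl.
        apply Rplus_le_compat; apply Rabs_le; lra. }
      assert (W / q < del).
      { apply Rmult_lt_compat_r with (r := W + 1) in Hn; [|lra].
        replace (del / (W + 1) * (W + 1)) with del in Hn by (field; lra).
        unfold Rdiv. assert (0 < / q) by (now apply Rinv_0_lt_compat). nra. }
      specialize (Hdel' (w - z)%C ltac:(lra)). replace (z + (w - z))%C with w in Hdel' by ring.
      unfold g. eapply Rle_trans; [apply Hdel'|]. apply Rmult_le_compat_l; lra. }
  rewrite <- Wq in Bg.
  assert (P4 : 4 ^ n = q * q).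
  { unfold q. rewrite <- Rpow_mult_distr. f_equal; lra. }
  rewrite P4 in S3. eapply Rle_trans; [apply S3|].
  apply Rle_trans with (q * q * (e' * (W / q) * (2 * (W / q)))).
  { apply Rmult_le_compat_l; nra. }
  replace (q * q * (e' * (W / q) * (2 * (W / q)))) with (e' * (2 * (W * W))) by (field; lra).
  replace e with (e' * (2 * (W * W) + 1)) at 1 by (unfold e'; field; lra). nra.
Qed.
End Goursat.

Ltac rmin_facts e := lazymatch e with
  | Rmin ?a ?b => pose proof (Rmin_l a b); pose proof (Rmin_r a b); rmin_facts a; rmin_facts b
  | _ => idtac end.

Lemma Csub_0_eq (z w : C) : (z - w)%C = 0 -> z = w.
Proof. intros E. replace z with (z - w + w)%C by ring. rewrite E. ring. Qed.

Lemma Cadd_sub (a z : C) : (a + (z - a))%C = z.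
Proof. ring. Qed.

(** A bounded isolated singularity is harmless: cut out a square of side 2e around it. The four
    surrounding rectangles contribute 0, and the square contributes at most 8e times the bound, with
    e as small as desired. *)
Lemma goursat_exc (f : C -> C) (x1 x2 y1 y2 u v M r : R) :
  x1 < u < x2 -> y1 < v < y2 -> 0 < r ->
  (forall z, inR x1 x2 y1 y2 z -> z <> (u, v) -> exists d, isD f z d) ->
  (forall z, z <> (u, v) -> Cmod (z - (u, v))%C < r -> Cmod (f z) <= M) ->
  bdry f x1 x2 y1 y2 = 0.
Proof.
  intros Hu Hv Hr Hf HM. apply Cmod_eq_0. apply Rle_antisym; [|apply Cmod_ge_0].
  apply le_epsilon. intros ep Hep. rewrite Rplus_0_l.
  set (M' := Rmax M 0). assert (HM' : M <= M' /\ 0 <= M') by (split; [apply Rmax_l|apply Rmax_r]).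
  set (e := Rmin (Rmin (Rmin (u - x1) (x2 - u)) (Rmin (v - y1) (y2 - v))) (Rmin (r / 3) (ep / (8 * (M' + 1))))).
  assert (He : 0 < e /\ e <= u - x1 /\ e <= x2 - u /\ e <= v - y1 /\ e <= y2 - v /\ e <= r / 3 /\ e <= ep / (8 * (M' + 1))).
  { split.
    - assert (0 < ep / (8 * (M' + 1))) by (apply Rdiv_lt_0_compat; lra).
      repeat apply Rmin_glb_lt; lra.
    - unfold e. match goal with |- ?g <= _ /\ _ => rmin_facts g end. lra. }
  destruct He as [He [He1 [He2 [He3 [He4 [He5 He6]]]]]].
  assert (Cf : forall z, inR x1 x2 y1 y2 z -> z <> (u, v) -> contC f z).
  { intros z Hz Hn. destruct (Hf z Hz Hn) as [d Hd]. now apply isD_contC with d. }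
  assert (ne : forall z : C, fst z <> u \/ snd z <> v -> z <> (u, v)).
  { intros z [H|H] E; rewrite E in H; simpl in H; lra. }
  assert (S1 := bdry_split_x f x1 (u - e) x2 y1 y2 ltac:(lra) ltac:(lra)
    ltac:(intros z Hz; apply Cf; [unfold onB, inR in *; lra|apply ne; unfold onB in *; lra])
    ltac:(intros z Hz; apply Cf; [unfold onB, inR in *; lra|apply ne; unfold onB in *; lra])).
  assert (S2 := bdry_split_x f (u - e) (u + e) x2 y1 y2 ltac:(lra) ltac:(lra)
    ltac:(intros z Hz; apply Cf; [unfold onB, inR in *; lra|apply ne; unfold onB in *; lra])
    ltac:(intros z Hz; apply Cf; [unfold onB, inR in *; lra|apply ne; unfold onB in *; lra])).
  assert (S3 := bdry_split_y f (u - e) (u + e) y1 (v - e) y2 ltac:(lra) ltac:(lra)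
    ltac:(intros z Hz; apply Cf; [unfold onB, inR in *; lra|apply ne; unfold onB in *; lra])
    ltac:(intros z Hz; apply Cf; [unfold onB, inR in *; lra|apply ne; unfold onB in *; lra])).
  assert (S4 := bdry_split_y f (u - e) (u + e) (v - e) (v + e) y2 ltac:(lra) ltac:(lra)
    ltac:(intros z Hz; apply Cf; [unfold onB, inR in *; lra|apply ne; unfold onB in *; lra])
    ltac:(intros z Hz; apply Cf; [unfold onB, inR in *; lra|apply ne; unfold onB in *; lra])).
  rewrite (goursat f x1 (u - e) y1 y2) in S1; try lra; try (intros z Hz; apply Hf; [|apply ne]; unfold inR in *; lra).
  rewrite (goursat f (u + e) x2 y1 y2) in S2; try lra; try (intros z Hz; apply Hf; [|apply ne]; unfold inR in *; lra).
  rewrite (goursat f (u - e) (u + e) y1 (v - e)) in S3; try lra; try (intros z Hz; apply Hf; [|apply ne]; unfold inR in *; lra).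
  rewrite (goursat f (u - e) (u + e) (v + e) y2) in S4; try lra; try (intros z Hz; apply Hf; [|apply ne]; unfold inR in *; lra).
  rewrite S1, S2, S3, S4, !Cplus_0_l, !Cplus_0_r.
  eapply Rle_trans.
  - apply bdry_bound with (M := M'); try lra.
    + intros z Hz; apply Cf; [unfold onB, inR in *; lra|apply ne; unfold onB in *; lra].
    + intros z Hz. apply Rle_trans with M; [|lra]. apply HM.
      * apply ne; unfold onB in *; lra.
      * eapply Rle_lt_trans; [apply Cmod_le_abs|]. simpl.
        apply onB_inR in Hz; try lra. unfold inR in Hz.
        assert (Rabs (fst z + - u) <= e) by (apply Rabs_le; lra).
        assert (Rabs (snd z + - v) <= e) by (apply Rabs_le; lra). lra.
  - apply Rmult_le_compat_r with (r := 8 * (M' + 1)) in He6; [|lra].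
    replace (ep / (8 * (M' + 1)) * (8 * (M' + 1))) with ep in He6 by (field; lra). nra.
Qed.

(** * The contour integral of 1/(z - w) and Cauchy's formula *)

Lemma RInt_opp_R (f : R -> R) (a b : R) : ex_RInt f a b -> RInt (fun t => - f t) a b = - RInt f a b.
Proof. intros H. apply (RInt_opp (V := R_CompleteNormedModule) f a b H). Qed.

Lemma RInt_log_kernel (u k a b : R) : k <> 0 ->
  RInt (fun t => (t - u) / ((t - u) ^ 2 + k ^ 2)) a b
  = / 2 * ln ((b - u) ^ 2 + k ^ 2) - / 2 * ln ((a - u) ^ 2 + k ^ 2).
Proof.
  intros Hk. assert (P : forall t, 0 < (t - u) ^ 2 + k ^ 2).
  { intros t. assert (0 < k ^ 2) by (now apply pow2_gt_0). assert (T := pow2_ge_0 (t - u)). lra. }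
  apply is_RInt_unique, (is_RInt_derive (V := R_CompleteNormedModule) (fun t => / 2 * ln ((t - u) ^ 2 + k ^ 2))).
  - intros t _. specialize (P t). auto_derive; [simpl in P; lra|]. simpl in P. field. lra.
  - intros t _. apply (ex_derive_continuous (V := R_NormedModule)). specialize (P t). auto_derive. simpl in P; lra.
Qed.

Lemma RInt_atan_kernel (u k a b : R) : k <> 0 ->
  RInt (fun t => k / ((t - u) ^ 2 + k ^ 2)) a b = atan ((b - u) / k) - atan ((a - u) / k).
Proof.
  intros Hk. assert (P : forall t, 0 < (t - u) ^ 2 + k ^ 2).
  { intros t. assert (0 < k ^ 2) by (now apply pow2_gt_0). assert (T := pow2_ge_0 (t - u)). lra. }
  apply is_RInt_unique, (is_RInt_derive (V := R_CompleteNormedModule) (fun t => atan ((t - u) / k))).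
  - intros t _. specialize (P t). auto_derive; [auto|]. unfold Rsqr.
    simpl in P. field. repeat split; auto; nra.
  - intros t _. apply (ex_derive_continuous (V := R_NormedModule)). specialize (P t). auto_derive. simpl in P; lra.
Qed.

Lemma atan_pair (p q : R) : 0 < p -> 0 < q -> atan (p / q) + atan (q / p) = PI / 2.
Proof.
  intros Hp Hq. replace (q / p) with (/ (p / q)) by (field; lra).
  rewrite atan_inv; [ring|]. now apply Rdiv_lt_0_compat.
Qed.

(** On each side the components of 1/(z - w) integrate to a logarithm and an arctangent. The
    logarithms cancel in the real part. In the imaginary part each corner contributes two
    arctangents of reciprocal positive numbers, that is PI/2, and there are four corners. *)
Lemma bdry_inv (x1 x2 y1 y2 u v : R) : x1 < u < x2 -> y1 < v < y2 ->
  bdry (fun z => / (z - (u, v)))%C x1 x2 y1 y2 = (2 * PI * Ci)%C.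
Proof.
  intros Hu Hv.
  assert (HH : forall y, y - v <> 0 -> CI (fun x => / ((x, y) - (u, v)))%C x1 x2 =
    (/ 2 * ln ((x2 - u) ^ 2 + (y - v) ^ 2) - / 2 * ln ((x1 - u) ^ 2 + (y - v) ^ 2),
     - (atan ((x2 - u) / (y - v)) - atan ((x1 - u) / (y - v))))).
  { intros y Hy. unfold CI. f_equal.
    - rewrite <- RInt_log_kernel by auto. apply RInt_ext_R. intros; simpl. unfold Rdiv, Rminus. reflexivity.
    - rewrite <- RInt_atan_kernel by auto. 
      assert (E : ex_RInt (fun t => (y - v) / ((t - u) ^ 2 + (y - v) ^ 2)) x1 x2).
      { apply (ex_RInt_continuous (V := R_CompleteNormedModule)). intros t _.
        apply (ex_derive_continuous (V := R_NormedModule)).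
        assert (0 < (y - v) ^ 2) by (now apply pow2_gt_0). assert (T := pow2_ge_0 (t - u)).
        auto_derive. simpl in *. lra. }
      rewrite <- RInt_opp_R by auto. apply RInt_ext_R. intros; simpl. unfold Rdiv, Rminus. ring. }
  assert (HV : forall x, x - u <> 0 -> CI (fun y => / ((x, y) - (u, v)))%C y1 y2 =
    (atan ((y2 - v) / (x - u)) - atan ((y1 - v) / (x - u)),
     - (/ 2 * ln ((y2 - v) ^ 2 + (x - u) ^ 2) - / 2 * ln ((y1 - v) ^ 2 + (x - u) ^ 2)))).
  { intros x Hx. unfold CI. f_equal.
    - rewrite <- RInt_atan_kernel by auto. apply RInt_ext_R. intros; simpl. unfold Rdiv, Rminus.
      f_equal. f_equal. ring.
    - rewrite <- RInt_log_kernel by auto.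
      assert (E : ex_RInt (fun t => (t - v) / ((t - v) ^ 2 + (x - u) ^ 2)) y1 y2).
      { apply (ex_RInt_continuous (V := R_CompleteNormedModule)). intros t _.
        apply (ex_derive_continuous (V := R_NormedModule)).
        assert (0 < (x - u) ^ 2) by (now apply pow2_gt_0). assert (T := pow2_ge_0 (t - v)).
        auto_derive. simpl in *. lra. }
      rewrite <- RInt_opp_R by auto. apply RInt_ext_R. intros; simpl. unfold Rdiv, Rminus.
      replace ((x + - u) * ((x + - u) * 1) + (t + - v) * ((t + - v) * 1)) with ((t + - v) * ((t + - v) * 1) + (x + - u) * ((x + - u) * 1)) by ring. ring. }
  unfold bdry. rewrite !HH, !HV by lra.
  (* Signs are moved until every arctangent has a positive ratio as argument, the form in which
     [atan_pair] applies. *)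
  assert (neg : forall p q, q <> 0 -> atan (p / q) = - atan (p / (- q))).
  { intros p q Hq. rewrite <- atan_opp. f_equal. field. auto. }
  rewrite (neg (x2 - u) (y1 - v)), (neg (x1 - u) (y1 - v)), (neg (y2 - v) (x1 - u)), (neg (y1 - v) (x1 - u)) by lra.
  replace ((x1 - u) / - (y1 - v)) with (- ((u - x1) / (v - y1))) by (field; lra).
  replace ((y1 - v) / - (x1 - u)) with (- ((v - y1) / (u - x1))) by (field; lra).
  replace ((y1 - v) / (x2 - u)) with (- ((v - y1) / (x2 - u))) by (field; lra).
  replace ((x1 - u) / (y2 - v)) with (- ((u - x1) / (y2 - v))) by (field; lra).
  replace (- (y1 - v)) with (v - y1) by ring. replace (- (x1 - u)) with (u - x1) by ring.
  rewrite !atan_opp.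
  assert (P1 := atan_pair (x2 - u) (v - y1) ltac:(lra) ltac:(lra)).
  assert (P2 := atan_pair (u - x1) (v - y1) ltac:(lra) ltac:(lra)).
  assert (P3 := atan_pair (x2 - u) (y2 - v) ltac:(lra) ltac:(lra)).
  assert (P4 := atan_pair (u - x1) (y2 - v) ltac:(lra) ltac:(lra)).
  replace ((x1 - u) ^ 2 + (y1 - v) ^ 2) with ((y1 - v) ^ 2 + (x1 - u) ^ 2) by ring.
  replace ((x2 - u) ^ 2 + (y1 - v) ^ 2) with ((y1 - v) ^ 2 + (x2 - u) ^ 2) by ring.
  replace ((x1 - u) ^ 2 + (y2 - v) ^ 2) with ((y2 - v) ^ 2 + (x1 - u) ^ 2) by ring.
  replace ((x2 - u) ^ 2 + (y2 - v) ^ 2) with ((y2 - v) ^ 2 + (x2 - u) ^ 2) by ring.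
  apply injective_projections; simpl; lra.
Qed.

(** The difference quotient of [f] at (u, v) is bounded near that point, so [goursat_exc] makes its
    contour integral vanish; what is left is f(u, v) times the integral of 1/(z - w). *)
Lemma cauchy_rect (f : C -> C) (x1 x2 y1 y2 u v : R) : x1 < u < x2 -> y1 < v < y2 ->
  (forall z, inR x1 x2 y1 y2 z -> exists d, isD f z d) ->
  bdry (fun z => f z / (z - (u, v)))%C x1 x2 y1 y2 = (2 * PI * Ci * f (u, v))%C.
Proof.
  intros Hu Hv Hf.
  assert (ne : forall z, onB x1 x2 y1 y2 z -> (z - (u, v) <> 0)%C).
  { intros z Hz E. assert (z = (u, v)) by (now apply Csub_0_eq).
    subst z. unfold onB in Hz; simpl in Hz. lra. }
  assert (Cs : forall z, contC (fun z => z - (u, v))%C z)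
    by (intros; apply contC_minus; [apply contC_id|apply contC_const]).
  assert (Cf : forall z, onB x1 x2 y1 y2 z -> contC f z).
  { intros z Hz. destruct (Hf z) as [d Hd]; [apply onB_inR; auto; lra|]. now apply isD_contC with d. }
  set (q := fun z => ((f z - f (u, v)) / (z - (u, v)))%C).
  assert (Z : bdry q x1 x2 y1 y2 = 0).
  { destruct (Hf (u, v)) as [d Hd]; [unfold inR; simpl; lra|].
    destruct (proj1 (isD_eps _ _ _) Hd 1 ltac:(lra)) as [r [Hr Hr']].
    apply (goursat_exc q x1 x2 y1 y2 u v (1 + Cmod d) r); auto.
    - intros z Hz Hn. destruct (Hf z Hz) as [d' Hd']. eexists. unfold q. apply isD_div.
      + intro E. apply Hn. now apply Csub_0_eq.
      + apply isD_minus; [apply Hd'|apply isD_const].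
      + apply isD_minus; [apply isD_id|apply isD_const].
    - intros z Hn Hz. assert (N : (z - (u, v) <> 0)%C).
      { intro E. apply Hn. now apply Csub_0_eq. }
      assert (P := proj1 (Cmod_gt_0 _) N).
      specialize (Hr' _ Hz). rewrite Cadd_sub in Hr'.
      unfold q. rewrite Cmod_div by auto. apply Rmult_le_reg_r with (Cmod (z - (u, v))); auto.
      unfold Rdiv. rewrite Rmult_assoc, Rinv_l, Rmult_1_r by lra.
      replace (f z - f (u, v))%C with ((f z - f (u, v) - d * (z - (u, v))) + d * (z - (u, v)))%C by ring.
      eapply Rle_trans; [apply Cmod_triangle|]. rewrite Cmod_mult. lra. }
  transitivity (bdry (fun z => q z + f (u, v) * / (z - (u, v)))%C x1 x2 y1 y2).
  - apply bdry_ext; try lra. intros z Hz. unfold q. field. now apply ne.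
  - rewrite bdry_plus, bdry_scal, Z, bdry_inv; try lra; auto.
    + ring.
    + intros z Hz. apply contC_inv; [now apply ne|apply Cs].
    + intros z Hz. unfold q. apply contC_div; [now apply ne| |apply Cs].
      apply contC_minus; [now apply Cf|apply contC_const].
    + intros z Hz. apply contC_mult; [apply contC_const|]. apply contC_inv; [now apply ne|apply Cs].
Qed.

(** * Holomorphy of the derivative and the maximum principle *)

(** Differentiation under the contour integral. A Taylor bound of second order, uniform on the
    boundary, replaces any continuity of [k'] in the parameter. *)
Lemma bdry_param_deriv (k k' : C -> C -> C) (x1 x2 y1 y2 : R) (w : C) (r K : R) :
  x1 <= x2 -> y1 <= y2 -> 0 < r ->
  (forall h z, Cmod h < r -> onB x1 x2 y1 y2 z -> contC (k (w + h)%C) z) ->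
  (forall z, onB x1 x2 y1 y2 z -> contC (k' w) z) ->
  (forall h z, Cmod h < r -> onB x1 x2 y1 y2 z ->
     Cmod (k (w + h)%C z - k w z - h * k' w z)%C <= K * Cmod h ^ 2) ->
  isD (fun w => bdry (k w) x1 x2 y1 y2) w (bdry (k' w) x1 x2 y1 y2).
Proof.
  intros Hx Hy Hr Hk Hk' HK. apply isD_eps. intros e He.
  set (P := 2 * ((x2 - x1) + (y2 - y1))). assert (HP : 0 <= P) by (unfold P; lra).
  set (K' := Rabs K * P + 1). assert (HK' : 1 <= K') by (unfold K'; assert (T := Rabs_pos K); nra).
  exists (Rmin r (e / K')). split; [apply Rmin_glb_lt; auto; apply Rdiv_lt_0_compat; lra|].
  intros h Hh.
  assert (H1 : Cmod h < r) by (eapply Rlt_le_trans; [apply Hh|apply Rmin_l]).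
  assert (H2 : Cmod h < e / K') by (eapply Rlt_le_trans; [apply Hh|apply Rmin_r]).
  assert (C0 : forall z, onB x1 x2 y1 y2 z -> contC (k w) z).
  { intros z Hz. replace w with (w + 0)%C by ring. apply Hk; auto. now rewrite Cmod_0. }
  assert (E : bdry (fun z => (k (w + h)%C z + (-1) * k w z) + (- h) * k' w z)%C x1 x2 y1 y2
    = (bdry (k (w + h)%C) x1 x2 y1 y2 - bdry (k w) x1 x2 y1 y2 - bdry (k' w) x1 x2 y1 y2 * h)%C).
  { rewrite bdry_plus; auto.
    - rewrite bdry_plus; auto.
      + rewrite !bdry_scal; auto. ring.
      + intros z Hz. apply contC_mult; [apply contC_const|auto].
    - intros z Hz. apply contC_plus; auto. apply contC_mult; [apply contC_const|auto].
    - intros z Hz. apply contC_mult; [apply contC_const|auto]. }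
  rewrite <- E. eapply Rle_trans.
  - apply bdry_bound with (M := Rabs K * Cmod h ^ 2); auto.
    + intros z Hz. apply contC_plus; [apply contC_plus|]; auto; apply contC_mult; try apply contC_const; auto.
    + intros z Hz. replace (k (w + h)%C z + -1 * k w z + - h * k' w z)%C with (k (w + h)%C z - k w z - h * k' w z)%C by ring.
      eapply Rle_trans; [now apply HK|]. apply Rmult_le_compat_r; [apply pow2_ge_0|apply Rle_abs].
  - fold P. apply Rlt_le in H2. apply Rmult_le_compat_r with (r := K') in H2; [|lra].
    replace (e / K' * K') with e in H2 by (field; lra). unfold K' in H2.
    assert (T := Cmod_ge_0 h). assert (T' := Rabs_pos K). nra.
Qed.

(** [entire] asks only for pointwise derivatives, while the logarithmic derivative G'/G must itself
    be holomorphic. Cauchy's formula on a small square expresses f', hence its derivative, by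
    contour integrals of f. *)
Lemma isD_deriv (f f' : C -> C) (z : C) (r : R) : 0 < r ->
  (forall w, Cmod (w - z)%C < r -> isD f w (f' w)) -> exists d, isD f' z d.
Proof.
  intros Hr Hf.
  assert (Cz : contC f z).
  { apply isD_contC with (f' z). apply Hf. replace (z - z)%C with (RtoC 0) by ring. now rewrite Cmod_0. }
  destruct (Cz 1 ltac:(lra)) as [r1 [Hr1 Hr1']].
  (* The square of half-side [a] stays within [2 * a] of its centre, inside both discs, and a point
     within [a / 2] of the centre keeps distance at least [a / 2] from its boundary. *)
  set (a := Rmin r r1 / 3).
  assert (Ha : 0 < a /\ 2 * a < r /\ 2 * a < r1).
  { assert (T := Rmin_l r r1). assert (T' := Rmin_r r r1). assert (0 < Rmin r r1) by now apply Rmin_glb_lt.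
    unfold a. lra. }
  destruct Ha as [Ha [Ha1 Ha2]].
  destruct z as [x y]. set (z := (x, y)) in *.
  set (M := Cmod (f z) + 1). assert (HM0 : 0 <= M) by (unfold M; assert (T := Cmod_ge_0 (f z)); lra).
  assert (near : forall w, inR (x - a) (x + a) (y - a) (y + a) w -> Cmod (w - z)%C <= 2 * a).
  { intros w [H1 H2]. eapply Rle_trans; [apply Cmod_le_abs|]. unfold z; simpl.
    assert (Rabs (fst w + - x) <= a) by (apply Rabs_le; lra).
    assert (Rabs (snd w + - y) <= a) by (apply Rabs_le; lra). lra. }
  assert (HfM : forall w, inR (x - a) (x + a) (y - a) (y + a) w -> Cmod (f w) <= M).
  { intros w Hw. specialize (near w Hw). specialize (Hr1' w ltac:(lra)).
    assert (T := Cmod_sub_le (f w) (f z)). unfold M. lra. }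
  assert (Cf : forall w, onB (x - a) (x + a) (y - a) (y + a) w -> contC f w).
  { intros w Hw. apply isD_contC with (f' w). apply Hf.
    assert (T := near w ltac:(apply onB_inR; auto; lra)). lra. }
  assert (far : forall w zeta, Cmod (w - z)%C < a / 2 -> onB (x - a) (x + a) (y - a) (y + a) zeta ->
    a / 2 <= Cmod (zeta - w)%C).
  { intros w ze Hw Hz.
    assert (B1 := fst_le_Cmod (w - z)%C). assert (B2 := snd_le_Cmod (w - z)%C).
    assert (B3 := fst_le_Cmod (ze - w)%C). assert (B4 := snd_le_Cmod (ze - w)%C).
    unfold z in *; simpl in *.
    apply Rabs_le_between in B1, B2, B3, B4. unfold onB in Hz. lra. }
  assert (nz : forall w zeta, Cmod (w - z)%C < a / 2 -> onB (x - a) (x + a) (y - a) (y + a) zeta ->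
    (zeta - w <> 0)%C).
  { intros w ze Hw Hz. apply Cmod_gt_0. assert (T := far w ze Hw Hz). lra. }
  assert (Cs : forall w ze, contC (fun ze => ze - w)%C ze)
    by (intros; apply contC_minus; [apply contC_id|apply contC_const]).
  assert (tri : forall w h, Cmod (w - z)%C < a / 4 -> Cmod h < a / 4 -> Cmod (w + h - z)%C < a / 2).
  { intros w h H1 H2. replace (w + h - z)%C with ((w - z) + h)%C by ring.
    eapply Rle_lt_trans; [apply Cmod_triangle|lra]. }
  assert (invb : forall w ze, Cmod (w - z)%C < a / 2 -> onB (x - a) (x + a) (y - a) (y + a) ze ->
    Cmod (/ (ze - w))%C <= 2 / a).
  { intros w ze Hw Hz. rewrite Cmod_inv by (now apply nz). replace (2 / a) with (/ (a / 2)) by (field; lra).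
    apply Rinv_le_contravar; [lra|now apply far]. }
  set (b := 2 / a) in *. assert (Hb : 0 < b) by (apply Rdiv_lt_0_compat; lra).
  set (pi2 := (2 * PI * Ci)%C).
  assert (Hpi : pi2 <> 0).
  { unfold pi2, Ci, RtoC, Cmult; simpl. intro E. apply (f_equal snd) in E. simpl in E. assert (T := PI_RGT_0). lra. }
  (* Cauchy's kernel and its first two derivatives in [w]. [bdry_param_deriv] is applied twice, from
     [k1] to [k2] and from [k2] to [k3]. *)
  set (k1 := fun w ze => (f ze / (ze - w))%C).
  set (k2 := fun w ze => (f ze / ((ze - w) * (ze - w)))%C).
  set (k3 := fun w ze => (2 * f ze / ((ze - w) * (ze - w) * (ze - w)))%C).
  assert (D1 : forall w, Cmod (w - z)%C < a / 4 ->
    f' w = (/ pi2 * bdry (k2 w) (x - a) (x + a) (y - a) (y + a))%C).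
  { intros w Hw.
    assert (Dw : isD (fun w => / pi2 * bdry (k1 w) (x - a) (x + a) (y - a) (y + a))%C w
      (/ pi2 * bdry (k2 w) (x - a) (x + a) (y - a) (y + a))%C).
    { apply isD_scal. apply (bdry_param_deriv k1 k2 _ _ _ _ w (a / 4) (M * (b * b * b))); try lra.
      - intros h ze Hh Hz. assert (N := nz _ ze (tri w h Hw Hh) Hz). unfold k1. apply contC_div; auto.
      - intros ze Hz. assert (N := nz w ze ltac:(lra) Hz). unfold k2. apply contC_div; auto.
        + now apply Cmult_neq_0.
        + now apply contC_mult.
      - intros h ze Hh Hz. assert (N := nz w ze ltac:(lra) Hz). assert (N' := nz _ ze (tri w h Hw Hh) Hz).
        assert (I1 := invb w ze ltac:(lra) Hz). assert (I2 := invb _ ze (tri w h Hw Hh) Hz).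
        unfold k1, k2.
        replace (f ze / (ze - (w + h)) - f ze / (ze - w) - h * (f ze / ((ze - w) * (ze - w))))%C
          with (f ze * ((/ (ze - w) * / (ze - w)) * / (ze - (w + h))) * (h * h))%C by (field; auto).
        rewrite !Cmod_mult. simpl. rewrite Rmult_1_r.
        assert (F := HfM ze ltac:(apply onB_inR; auto; lra)).
        apply Rmult_le_compat_r; [assert (T := Cmod_ge_0 h); nra|].
        apply Rmult_le_compat; auto; try apply Cmod_ge_0; [repeat apply Rmult_le_pos; apply Cmod_ge_0|].
        apply Rmult_le_compat; auto; try apply Cmod_ge_0; [apply Rmult_le_pos; apply Cmod_ge_0|].
        apply Rmult_le_compat; auto; apply Cmod_ge_0. }
    apply (isD_unique f w).
    - apply Hf. lra.
    - refine (isD_ext_loc _ f w _ (a / 4) _ _ Dw); [lra|]. intros w' Hw'.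
      assert (T := tri w (w' - w)%C Hw Hw'). replace (w + (w' - w) - z)%C with (w' - z)%C in T by ring.
      destruct w' as [p q]. unfold k1. rewrite cauchy_rect.
      + fold pi2. field. auto.
      + assert (B1 := fst_le_Cmod ((p, q) - z)%C). unfold z in *; simpl in *. apply Rabs_le_between in B1. lra.
      + assert (B1 := snd_le_Cmod ((p, q) - z)%C). unfold z in *; simpl in *. apply Rabs_le_between in B1. lra.
      + intros ze Hz. exists (f' ze). apply Hf. assert (T' := near ze Hz). lra. }
  exists (/ pi2 * bdry (k3 z) (x - a) (x + a) (y - a) (y + a))%C.
  apply (isD_ext_loc (fun w => / pi2 * bdry (k2 w) (x - a) (x + a) (y - a) (y + a))%C _ z _ (a / 4)); [lra| |].
  { intros w Hw. symmetry. now apply D1. }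
  assert (Hzz : Cmod (z - z)%C < a / 4) by (replace (z - z)%C with (RtoC 0) by ring; rewrite Cmod_0; lra).
  apply isD_scal. apply (bdry_param_deriv k2 k3 _ _ _ _ z (a / 4) (M * (b * b * b * (2 * b + b)))); try lra.
  - intros h ze Hh Hz. assert (N := nz _ ze (tri z h Hzz Hh) Hz). unfold k2. apply contC_div; auto.
    + now apply Cmult_neq_0.
    + now apply contC_mult.
  - intros ze Hz. assert (N := nz z ze ltac:(lra) Hz). unfold k3. apply contC_div; auto.
    + repeat apply Cmult_neq_0; auto.
    + apply contC_mult; auto. apply contC_const.
    + repeat apply contC_mult; auto.
  - intros h ze Hh Hz. assert (N := nz z ze ltac:(lra) Hz). assert (N' := nz _ ze (tri z h Hzz Hh) Hz).
    assert (I1 := invb z ze ltac:(lra) Hz). assert (I2 := invb _ ze (tri z h Hzz Hh) Hz).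
    unfold k2, k3.
    replace (f ze / ((ze - (z + h)) * (ze - (z + h))) - f ze / ((ze - z) * (ze - z)) - h * (2 * f ze / ((ze - z) * (ze - z) * (ze - z))))%C
      with (f ze * (/ (ze - z) * / (ze - z) * / (ze - (z + h)) * (2 * / (ze - z) + / (ze - (z + h)))) * (h * h))%C by (field; auto).
    rewrite (Cmod_mult _ (h * h)), (Cmod_mult (f ze)), (Cmod_mult _ (_ + _)), (Cmod_mult _ (/ (ze - (z + h)))), (Cmod_mult (/ (ze - z))), (Cmod_mult h).
    simpl. rewrite Rmult_1_r.
    assert (F := HfM ze ltac:(apply onB_inR; auto; lra)).
    assert (I3 : Cmod (2 * / (ze - z) + / (ze - (z + h)))%C <= 2 * b + b).
    { eapply Rle_trans; [apply Cmod_triangle|]. rewrite Cmod_mult, Cmod_R, Rabs_pos_eq by lra. lra. }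
    apply Rmult_le_compat_r; [assert (T := Cmod_ge_0 h); nra|].
    apply Rmult_le_compat; auto; try apply Cmod_ge_0; [repeat apply Rmult_le_pos; apply Cmod_ge_0|].
    apply Rmult_le_compat; auto; try apply Cmod_ge_0; [repeat apply Rmult_le_pos; apply Cmod_ge_0|].
    apply Rmult_le_compat; auto; try apply Cmod_ge_0; [apply Rmult_le_pos; apply Cmod_ge_0|].
    apply Rmult_le_compat; auto; apply Cmod_ge_0.
Qed.

(* Cauchy's formula for all powers of f at once gives the maximum principle. *)
Lemma max_rect (f : C -> C) (x1 x2 y1 y2 u v : R) : x1 < u < x2 -> y1 < v < y2 ->
  (forall z, inR x1 x2 y1 y2 z -> exists d, isD f z d) ->
  (forall z, onB x1 x2 y1 y2 z -> Cmod (f z) <= 1) -> Cmod (f (u, v)) <= 1.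
Proof.
  intros Hu Hv Hf Hb.
  set (de := Rmin (Rmin (u - x1) (x2 - u)) (Rmin (v - y1) (y2 - v))).
  assert (Hde : 0 < de /\ de <= u - x1 /\ de <= x2 - u /\ de <= v - y1 /\ de <= y2 - v).
  { split; [repeat apply Rmin_glb_lt; lra|]. unfold de.
    match goal with |- ?g <= _ /\ _ => rmin_facts g end. lra. }
  assert (far : forall ze, onB x1 x2 y1 y2 ze -> de <= Cmod (ze - (u, v))%C).
  { intros ze Hz. assert (B3 := fst_le_Cmod (ze - (u, v))%C). assert (B4 := snd_le_Cmod (ze - (u, v))%C).
    simpl in *. apply Rabs_le_between in B3, B4. unfold onB in Hz. lra. }
  assert (nz : forall ze, onB x1 x2 y1 y2 ze -> (ze - (u, v) <> 0)%C).
  { intros ze Hz. apply Cmod_gt_0. specialize (far ze Hz). lra. }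
  set (K := / de * (2 * ((x2 - x1) + (y2 - y1)))).
  assert (Hn : forall n, Cmod (f (u, v)) ^ n <= K).
  { intros n. assert (Dn : forall z, inR x1 x2 y1 y2 z -> exists d, isD (fun z => f z ^ n)%C z d).
    { intros z Hz. destruct (Hf z Hz) as [d Hd]. eexists. apply isD_pow, Hd. }
    assert (E := cauchy_rect (fun z => f z ^ n)%C x1 x2 y1 y2 u v Hu Hv Dn). cbv beta in E.
    assert (Bd : Cmod (bdry (fun z => f z ^ n / (z - (u, v)))%C x1 x2 y1 y2) <= K).
    { unfold K. apply bdry_bound; try lra.
      - intros z Hz. destruct (Dn z) as [d Hd]; [apply onB_inR; auto; lra|].
        apply contC_div; [now apply nz|now apply isD_contC with d|].
        apply contC_minus; [apply contC_id|apply contC_const].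
      - intros z Hz. unfold Cdiv. rewrite Cmod_mult, Cmod_pow, Cmod_inv by (now apply nz).
        assert (Cmod (f z) ^ n <= 1).
        { rewrite <- (pow1 n). apply pow_incr. split; [apply Cmod_ge_0|auto]. }
        rewrite <- (Rmult_1_l (/ de)). apply Rmult_le_compat; auto.
        + apply pow_le, Cmod_ge_0.
        + left. apply Rinv_0_lt_compat. specialize (far z Hz). lra.
        + apply Rinv_le_contravar; [lra|auto]. }
    rewrite E in Bd. rewrite Cmod_mult, Cmod_pow in Bd.
    assert (T : Cmod (2 * PI * Ci)%C = 2 * PI).
    { rewrite !Cmod_mult, Cmod_Ci, !Cmod_R. assert (T := PI_RGT_0). rewrite !Rabs_pos_eq; lra. }
    rewrite T in Bd. assert (T1 := PI2_1). assert (0 <= Cmod (f (u, v)) ^ n) by apply pow_le, Cmod_ge_0.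
    unfold PI2 in T1. nra. }
  destruct (Rle_dec (Cmod (f (u, v))) 1) as [L|L]; auto. exfalso.
  destruct (Pow_x_infinity (Cmod (f (u, v))) ltac:(rewrite Rabs_pos_eq; [lra|apply Cmod_ge_0]) (K + 1)) as [N HN].
  specialize (HN N (le_n N)). rewrite Rabs_pos_eq in HN by (apply pow_le, Cmod_ge_0).
  specialize (Hn N). lra.
Qed.

(** * Primitives on a half-plane *)

(** The primitive below integrates from a base point in any direction, so the sides of a rectangle
    may be traversed backwards; this only changes the sign of the contour integral. *)
Lemma goursat_unord (f : C -> C) (x1 x2 y1 y2 : R) :
  (forall z, inR (Rmin x1 x2) (Rmax x1 x2) (Rmin y1 y2) (Rmax y1 y2) z -> exists d, isD f z d) ->
  bdry f x1 x2 y1 y2 = 0.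
Proof.
  intros Hf.
  assert (Cf : forall z, inR (Rmin x1 x2) (Rmax x1 x2) (Rmin y1 y2) (Rmax y1 y2) z -> contC f z).
  { intros z Hz. destruct (Hf z Hz) as [d Hd]. now apply isD_contC with d. }
  assert (Eh : forall y, Rmin y1 y2 <= y <= Rmax y1 y2 -> exCI (fun x => f (x, y)) x1 x2).
  { intros y Hy. apply exCI_cont. intros. apply contC_horiz, Cf. now split. }
  assert (Ev : forall x, Rmin x1 x2 <= x <= Rmax x1 x2 -> exCI (fun y => f (x, y)) y1 y2).
  { intros y Hy. apply exCI_cont. intros. apply contC_vert, Cf. now split. }
  assert (Px1 := conj (Rmin_l x1 x2) (Rmax_l x1 x2)). assert (Px2 := conj (Rmin_r x1 x2) (Rmax_r x1 x2)).
  assert (Py1 := conj (Rmin_l y1 y2) (Rmax_l y1 y2)). assert (Py2 := conj (Rmin_r y1 y2) (Rmax_r y1 y2)).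
  assert (H1 : bdry f x2 x1 y1 y2 = (- bdry f x1 x2 y1 y2)%C).
  { unfold bdry. rewrite (CI_swap (fun x => f (x, y1)) x1 x2), (CI_swap (fun x => f (x, y2)) x1 x2) by auto. ring. }
  assert (H2 : bdry f x1 x2 y2 y1 = (- bdry f x1 x2 y1 y2)%C).
  { unfold bdry. rewrite (CI_swap (fun y => f (x1, y)) y1 y2), (CI_swap (fun y => f (x2, y)) y1 y2) by auto. ring. }
  assert (H3 : bdry f x2 x1 y2 y1 = bdry f x1 x2 y1 y2).
  { unfold bdry. rewrite (CI_swap (fun y => f (x1, y)) y1 y2), (CI_swap (fun y => f (x2, y)) y1 y2) by auto.
    rewrite (CI_swap (fun x => f (x, y1)) x1 x2), (CI_swap (fun x => f (x, y2)) x1 x2) by auto. ring. }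
  assert (G := goursat f (Rmin x1 x2) (Rmax x1 x2) (Rmin y1 y2) (Rmax y1 y2) ltac:(lra) ltac:(lra) Hf).
  assert (opp0 : forall c : C, (- c)%C = 0 -> c = 0).
  { intros c E. replace c with (- - c)%C by ring. rewrite E. ring. }
  unfold Rmin, Rmax in G. destruct (Rle_dec x1 x2), (Rle_dec y1 y2); auto.
  - rewrite H2 in G. auto.
  - rewrite H1 in G. auto.
  - now rewrite H3 in G.
Qed.

(** Integrates along the path that goes horizontally from [(c, 0)] and then vertically. A half-plane
    contains every rectangle needed to compare two such paths. *)
Lemma primitive_halfplane (p : C -> C) (s0 : R) :
  (forall z, s0 < fst z -> exists d, isD p z d) ->
  exists L, forall z, s0 < fst z -> isD L z (p z).
Proof.
  intros Hp. set (c := s0 + 1).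
  exists (fun z => CI (fun x => p (x, 0)) c (fst z) + Ci * CI (fun y => p (fst z, y)) 0 (snd z))%C.
  intros [x y] Hx. simpl in Hx.
  assert (Cp : forall z, s0 < fst z -> contC p z).
  { intros z Hz. destruct (Hp z Hz) as [d Hd]. now apply isD_contC with d. }
  assert (Eh : forall y a b, s0 < a -> s0 < b -> exCI (fun x => p (x, y)) a b).
  { intros y' a b H1 H2. apply exCI_cont. intros t Ht. apply contC_horiz, Cp. simpl.
    unfold Rmin in Ht. destruct (Rle_dec a b); lra. }
  assert (Ev : forall x a b, s0 < x -> exCI (fun y => p (x, y)) a b).
  { intros x' a b H1. apply exCI_cont. intros t Ht. apply contC_vert, Cp. auto. }
  apply isD_eps. intros e He. destruct (Cp (x, y) Hx (e / 2) ltac:(lra)) as [del [Hd Hd']].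
  exists (Rmin del (x - s0)). split; [apply Rmin_glb_lt; lra|]. intros [h1 h2] Hh.
  assert (B1 := fst_le_Cmod (h1, h2)). assert (B2 := snd_le_Cmod (h1, h2)). simpl in B1, B2.
  assert (M1 := Rmin_l del (x - s0)). assert (M2 := Rmin_r del (x - s0)).
  assert (A1 := proj1 (Rabs_le_between _ _) B1). assert (A2 := proj1 (Rabs_le_between _ _) B2).
  simpl fst. simpl snd.
  (* Cauchy's theorem moves the horizontal increment from height 0 up to height [y]; the increment
     of the primitive then takes place along a short path near [(x, y)]. *)
  assert (G : bdry p x (x + h1) 0 y = 0).
  { apply goursat_unord. intros z [Hz _]. apply Hp. unfold Rmin in Hz. destruct (Rle_dec x (x + h1)); lra. }
  unfold bdry in G.
  rewrite <- (CI_Chasles (fun x => p (x, 0)) c x (x + h1)) by (apply Eh; unfold c; lra).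
  rewrite <- (CI_Chasles (fun y => p (x + h1, y)) 0 y (y + h2)) by (apply Ev; lra).
  set (z0 := (x, y)) in *.
  replace (CI (fun x0 => p (x0, 0)) c x + CI (fun x0 => p (x0, 0)) x (x + h1)%R +
    Ci * (CI (fun y0 => p ((x + h1)%R, y0)) 0 y + CI (fun y0 => p ((x + h1)%R, y0)) y (y + h2)%R) -
    (CI (fun x0 => p (x0, 0)) c x + Ci * CI (fun y0 => p (x, y0)) 0 y) - p z0 * (h1, h2))%C
  with ((CI (fun x0 => p (x0, 0)) x (x + h1)%R + Ci * CI (fun y => p ((x + h1)%R, y)) 0 y -
      CI (fun x0 => p (x0, y)) x (x + h1)%R - Ci * CI (fun y => p (x, y)) 0 y) +
      ((CI (fun x0 => p (x0, y)) x (x + h1)%R - RtoC (x + h1 - x)%R * p z0) +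
       Ci * (CI (fun y0 => p ((x + h1)%R, y0)) y (y + h2)%R - RtoC (y + h2 - y)%R * p z0)))%C.
  2:{ replace ((h1, h2) : C) with (RtoC h1 + Ci * RtoC h2)%C
        by (unfold RtoC, Ci, Cplus, Cmult; simpl; f_equal; ring).
      rewrite !RtoC_minus, !RtoC_plus. ring. }
  rewrite G, Cplus_0_l, <- !CI_const.
  assert (E1 : exCI (fun x0 => p (x0, y)) x (x + h1)) by (apply Eh; lra).
  assert (E2 : exCI (fun y0 => p (x + h1, y0)) y (y + h2)) by (apply Ev; lra).
  rewrite <- (CI_minus (fun x0 => p (x0, y)) (fun _ => p z0) _ _ E1 (exCI_const _ _ _)).
  rewrite <- (CI_minus (fun y0 => p (x + h1, y0)) (fun _ => p z0) _ _ E2 (exCI_const _ _ _)).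
  eapply Rle_trans; [apply Cmod_triangle|]. rewrite Cmod_mult, Cmod_Ci, Rmult_1_l.
  assert (C1 : Cmod (CI (fun t => p (t, y) - p z0)%C x (x + h1)) <= e / 2 * Rabs (x + h1 - x)).
  { apply CI_norm_abs; [apply exCI_minus; [apply Eh; lra|apply exCI_const]|].
    intros t Ht. left. apply Hd'. eapply Rle_lt_trans; [apply Cmod_le_abs|]. unfold z0; simpl.
    rewrite Rplus_opp_r, Rabs_R0, Rplus_0_r.
    apply Rle_lt_trans with (Rabs h1); [|lra]. unfold Rmin, Rmax in Ht.
    destruct (Rle_dec x (x + h1)); [rewrite !Rabs_pos_eq; lra|rewrite !Rabs_left; lra]. }
  assert (C2 : Cmod (CI (fun t => p ((x + h1)%R, t) - p z0)%C y (y + h2)) <= e / 2 * Rabs (y + h2 - y)).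
  { apply CI_norm_abs; [apply exCI_minus; [apply Ev; lra|apply exCI_const]|].
    intros t Ht. left. apply Hd'. eapply Rle_lt_trans; [|apply Rlt_le_trans with (1 := Hh); auto].
    unfold Cmod; simpl. apply sqrt_le_1_alt.
    assert ((t + - y) * (t + - y) <= h2 * h2).
    { unfold Rmin, Rmax in Ht. destruct (Rle_dec y (y + h2)); nra. }
    unfold z0; simpl. nra. }
  replace (x + h1 - x) with h1 in C1 by ring. replace (y + h2 - y) with h2 in C2 by ring.
  nra.
Qed.

(** * Circle means and the Borel-Caratheodory inequality *)

(** 2 PI times the mean of [g] over the circle of radius [exp u] about [a]. With the logarithm of
    the radius as parameter, polar coordinates become the holomorphic substitution z = a + exp w. *)
Definition circ (g : C -> C) (a : C) (u : R) : C := CI (fun t => g (a + cexp (u, t))%C) 0 (2 * PI).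

Lemma isD_circ (g : C -> C) (a w d : C) :
  isD g (a + cexp w)%C d -> isD (fun w => g (a + cexp w)%C) w (d * cexp w)%C.
Proof.
  intros H. apply (isD_comp g (fun w => a + cexp w)%C); auto.
  eapply isD_eq; [|apply isD_plus; [apply isD_const|apply isD_cexp]]. ring.
Qed.

(* Cauchy's theorem for w -> g (a + exp w) on a rectangle of height 2 pi. *)
Lemma circ_const (g : C -> C) (a : C) (r u1 u2 : R) : u1 <= u2 -> exp u2 < r ->
  (forall z, z <> a -> Cmod (z - a)%C < r -> exists d, isD g z d) -> circ g a u1 = circ g a u2.
Proof.
  intros Hu Hr Hg. assert (HPI := PI_RGT_0).
  assert (Z : bdry (fun w => g (a + cexp w)%C) u1 u2 0 (2 * PI) = 0).
  { apply goursat; try lra. intros w [[H1 H2] _]. destruct (Hg (a + cexp w)%C) as [d Hd].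
    - intro E. apply (cexp_nz w). rewrite <- (Cplus_0_l (cexp w)).
      replace (0 + cexp w)%C with (a + cexp w - a)%C by ring. rewrite E. ring.
    - replace (a + cexp w - a)%C with (cexp w) by ring. rewrite Cmod_cexp.
      apply Rle_lt_trans with (exp u2); auto. destruct (Rle_lt_or_eq_dec _ _ H2) as [L|L].
      + left. now apply exp_increasing.
      + right. now rewrite L.
    - eexists. apply isD_circ, Hd. }
  unfold bdry in Z.
  (* By periodicity the sides at heights 0 and 2 PI carry the same integrand and cancel. *)
  rewrite (CI_ext (fun x => g (a + cexp (x, (2 * PI)%R))%C) (fun x => g (a + cexp (x, 0))%C)) in Z.
  2:{ intros t _. f_equal. f_equal. unfold cexp; simpl.
      rewrite cos_2PI, sin_2PI, cos_0, sin_0. reflexivity. }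
  unfold circ.
  set (A := CI (fun t => g (a + cexp (u1, t))%C) 0 (2 * PI)) in *.
  set (B := CI (fun t => g (a + cexp (u2, t))%C) 0 (2 * PI)) in *.
  replace (A)%C with (B - (- Ci) * (Ci * B - Ci * A))%C.
  - match type of Z with (?h + ?p - ?h - ?q)%C = _ => replace (h + p - h - q)%C with (p - q)%C in Z by ring end.
    rewrite Z. ring.
  - assert (I2 : (Ci * Ci)%C = (-(1))%C) by (unfold Ci, Cmult, Copp, RtoC; simpl; f_equal; ring).
    replace (B - - Ci * (Ci * B - Ci * A))%C with (B + (Ci * Ci) * (B - A))%C by ring. rewrite I2. ring.
Qed.

Lemma exCI_circ (g : C -> C) (a : C) (r u : R) : exp u < r ->
  (forall z, z <> a -> Cmod (z - a)%C < r -> contC g z) ->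
  exCI (fun t => g (a + cexp (u, t))%C) 0 (2 * PI).
Proof.
  intros Hr Hg. apply exCI_cont. intros t _.
  apply (contC_vert (fun w => g (a + cexp w)%C) u t).
  apply (contC_comp g (fun w => a + cexp w)%C).
  - apply contC_plus; [apply contC_const|]. eapply isD_contC, isD_cexp.
  - apply Hg.
    + intro E. apply (cexp_nz (u, t)). rewrite <- (Cplus_0_l (cexp _)).
      replace (0 + cexp (u, t))%C with (a + cexp (u, t) - a)%C by ring. rewrite E. ring.
    + replace (a + cexp (u, t) - a)%C with (cexp (u, t)) by ring. now rewrite Cmod_cexp.
Qed.

(** The mean does not depend on the radius, so it may be computed on circles so small that [g] is
    within a given error of its limit [l]. *)
Lemma circ_limit (g : C -> C) (a l : C) (r u : R) : exp u < r ->
  (forall z, z <> a -> Cmod (z - a)%C < r -> exists d, isD g z d) ->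
  (forall e, 0 < e -> exists d, 0 < d /\ forall z, z <> a -> Cmod (z - a)%C < d -> Cmod (g z - l)%C <= e) ->
  circ g a u = (RtoC (2 * PI) * l)%C.
Proof.
  intros Hr Hg Hl. assert (HPI := PI_RGT_0).
  apply Csub_0_eq, Cmod_eq_0. apply Rle_antisym; [|apply Cmod_ge_0].
  apply le_epsilon. intros e He. rewrite Rplus_0_l.
  destruct (Hl (e / (2 * PI)) ltac:(apply Rdiv_lt_0_compat; lra)) as [d [Hd Hd']].
  set (u1 := Rmin u (ln d - 1)).
  assert (Hu1 : u1 <= u) by apply Rmin_l.
  assert (Hu2 : exp u1 < d).
  { rewrite <- (exp_ln d) by auto. apply exp_increasing. assert (T := Rmin_r u (ln d - 1)). fold u1 in T. lra. }
  assert (Hu3 : exp u1 < r).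
  { apply Rle_lt_trans with (exp u); auto. destruct (Rle_lt_or_eq_dec _ _ Hu1) as [L|L].
    - left. now apply exp_increasing.
    - right. now rewrite L. }
  rewrite <- (circ_const g a r u1 u Hu1 Hr Hg).
  assert (EX : exCI (fun t => g (a + cexp (u1, t))%C) 0 (2 * PI)).
  { apply exCI_circ with r; auto. intros z H1 H2. destruct (Hg z H1 H2) as [q Hq]. now apply isD_contC with q. }
  replace (RtoC (2 * PI)) with (RtoC (2 * PI - 0)) by (f_equal; ring).
  rewrite <- CI_const. unfold circ. rewrite <- CI_minus by (auto; apply exCI_const).
  eapply Rle_trans; [apply CI_norm_const with (M := e / (2 * PI))|].
  - lra.
  - apply exCI_minus; auto; apply exCI_const.
  - intros t _. apply Hd'.
    + intro E. apply (cexp_nz (u1, t)). rewrite <- (Cplus_0_l (cexp _)).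
      replace (0 + cexp (u1, t))%C with (a + cexp (u1, t) - a)%C by ring. rewrite E. ring.
    + replace (a + cexp (u1, t) - a)%C with (cexp (u1, t)) by ring. now rewrite Cmod_cexp.
  - right. field. lra.
Qed.

Lemma CI_conj (f : R -> C) (a b : R) : exCI f a b -> CI (fun t => Cconj (f t)) a b = Cconj (CI f a b).
Proof.
  intros [H1 H2]. unfold CI, Cconj; simpl. f_equal. now apply RInt_opp_R.
Qed.

Lemma exCI_conj (f : R -> C) (a b : R) : exCI f a b -> exCI (fun t => Cconj (f t)) a b.
Proof. intros [H1 H2]. split; simpl; auto. now apply (ex_RInt_opp (V := R_NormedModule)). Qed.

(** Put M = L - A, whose real part is at most 0 on the circle. The means of M(z)/(z - a) and of (z -
    a) M(z) are d and 0. Conjugating the second and adding a multiple of it to the first turns M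
    into 2 Re M, so |d| is at most 2/r times the mean of - Re M, which is A - Re L(a). *)
Lemma borel_caratheodory (L : C -> C) (a d : C) (A r r' : R) : 0 < r < r' ->
  (forall z, Cmod (z - a)%C < r' -> exists d, isD L z d) -> isD L a d ->
  (forall z, Cmod (z - a)%C = r -> fst (L z) <= A) ->
  Cmod d <= 2 * (A - fst (L a)) / r.
Proof.
  intros Hr HL Hd HA. assert (HPI := PI_RGT_0). set (u := ln r).
  assert (Eu : exp u = r) by (unfold u; apply exp_ln; lra).
  set (M := fun z => (L z - RtoC A)%C).
  assert (DM : forall z, Cmod (z - a)%C < r' -> exists d, isD M z d).
  { intros z Hz. destruct (HL z Hz) as [q Hq]. eexists. apply isD_minus; [apply Hq|apply isD_const]. }
  assert (Hda : isD M a d) by (eapply isD_eq; [|apply isD_minus; [apply Hd|apply isD_const]]; ring).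
  assert (CM : contC M a) by (now apply isD_contC with d).
  assert (C1 : circ M a u = (RtoC (2 * PI) * M a)%C).
  { apply circ_limit with r'; [lra|auto|]. intros e He. destruct (CM e He) as [q [Hq Hq']].
    exists q. split; auto. intros z _ Hz. left; auto. }
  assert (Dsub : forall z, isD (fun z => z - a)%C z 1).
  { intros z. eapply isD_eq; [|apply isD_minus; [apply isD_id|apply isD_const]]. ring. }
  assert (C2 : circ (fun z => (z - a) * M z)%C a u = 0).
  { transitivity (RtoC (2 * PI) * 0)%C; [|ring]. apply circ_limit with r'; [lra| |].
    - intros z _ Hz. destruct (DM z Hz) as [q Hq]. eexists. apply isD_mult; [apply Dsub|apply Hq].
    - assert (Cc : contC (fun z => (z - a) * M z)%C a).
      { apply contC_mult; auto. eapply isD_contC, Dsub. }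
      intros e He. destruct (Cc e He) as [q [Hq Hq']]. exists q. split; auto. intros z _ Hz.
      specialize (Hq' z Hz). replace ((z - a) * M z - (a - a) * M a)%C with ((z - a) * M z - 0)%C in Hq' by ring. lra. }
  assert (C3 : circ (fun z => (M z - M a) / (z - a))%C a u = (RtoC (2 * PI) * d)%C).
  { apply circ_limit with r'; [lra| |].
    - intros z Hn Hz. destruct (DM z Hz) as [q Hq]. eexists. apply isD_div.
      + intro E. apply Hn. now apply Csub_0_eq.
      + apply isD_minus; [apply Hq|apply isD_const].
      + apply Dsub.
    - intros e He. destruct (proj1 (isD_eps _ _ _) Hda e He) as [q [Hq Hq']].
      exists q. split; auto. intros z Hn Hz. specialize (Hq' _ Hz). rewrite Cadd_sub in Hq'.
      assert (N : (z - a <> 0)%C) by (intro E; apply Hn; now apply Csub_0_eq).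
      replace ((M z - M a) / (z - a) - d)%C with ((M z - M a - d * (z - a)) / (z - a))%C by (field; auto).
      rewrite Cmod_div by auto. assert (P := proj1 (Cmod_gt_0 _) N).
      apply Rmult_le_reg_r with (Cmod (z - a)); auto.
      unfold Rdiv. rewrite Rmult_assoc, Rinv_l, Rmult_1_r by lra. lra. }
  (* Removes the constant [M a] from the difference quotient used in [C3]. *)
  assert (C4 : CI (fun t => cexp (- (u, t))%C) 0 (2 * PI) = 0).
  { assert (T := CI_FTC_vert (fun w => - cexp (- w))%C (fun w => cexp (- w))%C u 0 (2 * PI)).
    cbv beta in T.
    assert (Z : (Ci * CI (fun t => cexp (- (u, t))%C) 0 (2 * PI))%C = 0).
    { rewrite T.
      - unfold cexp; simpl. rewrite !sin_neg, !cos_neg, cos_2PI, sin_2PI, cos_0, sin_0. ring.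
      - intros y _. assert (D : isD (fun w => cexp (- w))%C (u, y) (- cexp (- (u, y)))%C).
        { eapply isD_eq; [|apply (isD_comp cexp (fun w => - w)%C); [apply isD_opp, isD_id|apply isD_cexp]].
          cbv beta. ring. }
        split; [|now apply isD_contC with (- cexp (- (u, y)))%C].
        eapply isD_eq; [|apply isD_opp, D]. ring. }
    apply Cmod_eq_0. apply (f_equal Cmod) in Z. rewrite Cmod_mult, Cmod_Ci, Cmod_0, Rmult_1_l in Z. auto. }
  assert (EM : exCI (fun t => M (a + cexp (u, t))%C) 0 (2 * PI)).
  { apply exCI_circ with r'; [lra|]. intros z _ Hz. destruct (DM z Hz) as [q Hq]. now apply isD_contC with q. }
  assert (EZ : exCI (fun t => cexp (- (u, t))%C) 0 (2 * PI)).
  { apply exCI_cont. intros t _. apply (contC_vert (fun w => cexp (- w)%C)).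
    apply (contC_comp cexp Copp); [apply contC_opp, contC_id|eapply isD_contC, isD_cexp]. }
  assert (EZM : exCI (fun t => cexp (- (u, t)) * M (a + cexp (u, t)))%C 0 (2 * PI)).
  { apply exCI_ext with (fun t => (fun z => / (z - a) * M z)%C (a + cexp (u, t))%C).
    - intros t _. cbv beta. replace (a + cexp (u, t) - a)%C with (cexp (u, t)) by ring. now rewrite <- cexp_opp.
    - apply (exCI_circ (fun z => / (z - a) * M z)%C a r'); [lra|]. intros z Hn Hz. destruct (DM z Hz) as [q Hq].
      apply contC_mult; [|now apply isD_contC with q].
      apply contC_inv; [|eapply isD_contC, Dsub]. intro E. apply Hn. now apply Csub_0_eq. }
  assert (J3 : CI (fun t => cexp (- (u, t)) * M (a + cexp (u, t)))%C 0 (2 * PI) = (RtoC (2 * PI) * d)%C).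
  { rewrite <- C3. unfold circ.
    transitivity (CI (fun t => cexp (- (u, t)) * M (a + cexp (u, t)) - M a * cexp (- (u, t)))%C 0 (2 * PI)).
    - rewrite CI_minus, CI_scal, C4; auto; [ring|now apply exCI_scal].
    - apply CI_ext. intros t _. replace (a + cexp (u, t) - a)%C with (cexp (u, t)) by ring.
      rewrite cexp_opp. field. apply cexp_nz. }
  assert (EZM' : exCI (fun t => cexp (u, t) * M (a + cexp (u, t)))%C 0 (2 * PI)).
  { apply exCI_ext with (fun t => (fun z => (z - a) * M z)%C (a + cexp (u, t))%C).
    - intros t _. cbv beta. now replace (a + cexp (u, t) - a)%C with (cexp (u, t)) by ring.
    - apply (exCI_circ (fun z => (z - a) * M z)%C a r'); [lra|]. intros z Hn Hz. destruct (DM z Hz) as [q Hq].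
      apply contC_mult; [|now apply isD_contC with q]. eapply isD_contC, Dsub. }
  (* On the circle the conjugate of exp w is r^2 exp(-w). The conjugated identity therefore has the
     same exponential as [J3], and M and its conjugate can be added. *)
  assert (J2 : CI (fun t => Cconj (cexp (u, t) * M (a + cexp (u, t)))%C) 0 (2 * PI) = 0).
  { rewrite CI_conj by auto. transitivity (Cconj (circ (fun z => (z - a) * M z)%C a u)).
    - f_equal. unfold circ. apply CI_ext. intros t _. now replace (a + cexp (u, t) - a)%C with (cexp (u, t)) by ring.
    - rewrite C2. unfold Cconj, RtoC; simpl. f_equal; ring. }
  assert (Ez : forall t, Cconj (cexp (u, t)) = (RtoC (r * r) * cexp (- (u, t)))%C).
  { intros t. rewrite <- Eu. unfold cexp, Cconj, RtoC, Cmult; simpl. rewrite exp_Ropp, cos_neg, sin_neg.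
    assert (T := exp_pos u). f_equal; field; lra. }
  assert (J4 : CI (fun t => cexp (- (u, t)) * RtoC (2 * fst (M (a + cexp (u, t))%C)))%C 0 (2 * PI) = (RtoC (2 * PI) * d)%C).
  { rewrite <- J3. rewrite <- (Cplus_0_r (CI (fun t => cexp (- (u, t)) * M (a + cexp (u, t)))%C 0 (2 * PI))).
    replace (RtoC 0) with (RtoC (/ (r * r)) * 0)%C by ring.
    rewrite <- J2, <- CI_scal, <- CI_plus.
    - apply CI_ext. intros t _. rewrite Cmult_conj, Ez.
      set (m := M (a + cexp (u, t))%C). set (ze := cexp (- (u, t))%C).
      replace (RtoC (2 * fst m)) with (m + Cconj m)%C
        by (destruct m; unfold Cconj, Cplus, RtoC; simpl; f_equal; ring).
      assert (K : (RtoC (/ (r * r)) * RtoC (r * r))%C = 1).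
      { rewrite <- RtoC_mult. f_equal. field. lra. }
      set (A1 := RtoC (/ (r * r))) in *. set (B1 := RtoC (r * r)) in *.
        replace (A1 * (B1 * ze * Cconj m))%C with ((A1 * B1) * ze * Cconj m)%C by ring.
      rewrite K. ring.
    - auto.
    - apply exCI_scal. now apply exCI_conj.
    - now apply exCI_conj. }
  assert (ER : ex_RInt (fun t => fst (M (a + cexp (u, t))%C)) 0 (2 * PI)) by apply EM.
  assert (N : Cmod (RtoC (2 * PI) * d)%C <= RInt (fun t => (- 2 / r) * fst (M (a + cexp (u, t))%C) + 0 * fst (M (a + cexp (u, t))%C)) 0 (2 * PI)).
  { rewrite <- J4. apply CI_norm.
    - lra.
    - apply exCI_ext with (fun t => cexp (- (u, t)) * M (a + cexp (u, t)) + RtoC (/ (r * r)) * Cconj (cexp (u, t) * M (a + cexp (u, t))))%C.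
      + intros t _. rewrite Cmult_conj, Ez.
        set (m := M (a + cexp (u, t))%C). set (ze := cexp (- (u, t))%C).
        replace (RtoC (2 * fst m)) with (m + Cconj m)%C
          by (destruct m; unfold Cconj, Cplus, RtoC; simpl; f_equal; ring).
        assert (K : (RtoC (/ (r * r)) * RtoC (r * r))%C = 1).
        { rewrite <- RtoC_mult. f_equal. field. lra. }
        set (A1 := RtoC (/ (r * r))) in *. set (B1 := RtoC (r * r)) in *.
        replace (A1 * (B1 * ze * Cconj m))%C with ((A1 * B1) * ze * Cconj m)%C by ring.
        rewrite K. ring.
      + apply exCI_plus; auto. apply exCI_scal. now apply exCI_conj.
    - now apply exRInt_lin.
    - intros t _. rewrite Cmod_mult, Cmod_cexp, Cmod_R. change (fst (- (u, t))%C) with (- u). rewrite exp_Ropp, Eu.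
      assert (B : fst (M (a + cexp (u, t))%C) <= 0).
      { unfold M; simpl. assert (T := HA (a + cexp (u, t))%C).
        replace (a + cexp (u, t) - a)%C with (cexp (u, t)) in T by ring. rewrite Cmod_cexp in T.
        specialize (T Eu). lra. }
      rewrite Rabs_left1 by lra. right. field. lra. }
  rewrite RInt_lin in N by auto.
  assert (J1 : RInt (fun t => fst (M (a + cexp (u, t))%C)) 0 (2 * PI) = 2 * PI * fst (M a)).
  { apply (f_equal fst) in C1. unfold circ, CI in C1. simpl in C1. unfold M; simpl. etransitivity; [exact C1|]. ring. }
  rewrite J1 in N. rewrite Cmod_mult, Cmod_R, Rabs_pos_eq in N by lra.
  unfold M in N; simpl in N.
  apply Rmult_le_reg_l with (2 * PI); [lra|]. eapply Rle_trans; [apply N|]. right. field. lra.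
Qed.

(** * Growth of the logarithmic derivative *)

Lemma const_halfplane (Q : C -> C) (s0 : R) :
  (forall z, s0 < fst z -> isD Q z 0) -> forall z w, s0 < fst z -> s0 < fst w -> Q z = Q w.
Proof.
  intros H [x y] [a b] Hz Hw. simpl in *.
  assert (E1 := CI_FTC_horiz Q (fun _ => RtoC 0) y a x).
  assert (E2 := CI_FTC_vert Q (fun _ => RtoC 0) a b y).
  cbv beta in E1, E2. rewrite CI_const in E1, E2.
  assert (F1 : (Q (x, y) - Q (a, y))%C = 0).
  { rewrite <- E1; [ring|]. intros t Ht. split; [|apply contC_const]. apply H. simpl.
    unfold Rmin in Ht. destruct (Rle_dec a x); lra. }
  assert (F2 : (Q (a, y) - Q (a, b))%C = 0).
  { rewrite <- E2; [ring|]. intros t Ht. split; [|apply contC_const]. now apply H. }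
  transitivity (Q (a, y)); now apply Csub_0_eq.
Qed.

Lemma ln_le_lin (x e : R) : 0 < x -> 0 < e -> ln x <= e * x - 1 - ln e.
Proof.
  intros Hx He. assert (T := exp_ineq1_le (ln (e * x))). rewrite exp_ln in T by nra.
  rewrite ln_mult in T by auto. lra.
Qed.

(* Borel-Caratheodory at each point bounds |(log G)'| by (4/e)(A - log|G|);
   Gronwall's inequality then carries the lower bound for |G| from the line Re z = c leftwards. *)
Lemma logderiv_bound (G G' : C -> C) (s0 c K kap e : R) (N : nat) :
  0 < e <= 1 -> s0 + e < c -> 0 < K -> 0 < kap ->
  (forall z, isD G z (G' z)) -> (forall z, s0 < fst z -> G z <> 0) ->
  (forall z, s0 <= fst z <= c + 1 -> Cmod (G z) <= K * (2 + Rabs (snd z)) ^ N) ->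
  (forall t, kap <= Cmod (G (c, t))) ->
  exists B, 0 < B /\ forall x t, s0 + e <= x <= c ->
    Cmod (G' (x, t) / G (x, t))%C <= B * ln (3 + Rabs t).
Proof.
  intros He Hc HK Hk DG NZ GB LB.
  set (p := fun z => (G' z / G z)%C).
  assert (DG' : forall z, exists d, isD G' z d).
  { intros z. apply (isD_deriv G G' z 1); [lra|auto]. }
  assert (Dp : forall z, s0 < fst z -> exists d, isD p z d).
  { intros z Hz. destruct (DG' z) as [d Hd]. eexists. apply isD_div; [now apply NZ|apply Hd|apply DG]. }
  destruct (primitive_halfplane p s0 Dp) as [L HL].
  (* [Q] is constant, so [L] is a logarithm of [G] up to a constant, and log|G| = Re L + ln q
     without any choice of branch. *)
  set (Q := fun z => (G z * cexp (- L z))%C).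
  assert (DQ : forall z, s0 < fst z -> isD Q z 0).
  { intros z Hz. unfold Q. eapply isD_eq; [|apply isD_mult; [apply DG|]].
    2:{ apply (isD_comp cexp (fun z => - L z)%C); [apply isD_opp, HL; auto|apply isD_cexp]. }
    unfold p. field. now apply NZ. }
  set (z1 := (c, 0)). set (q := Cmod (Q z1)).
  assert (Hq : 0 < q).
  { unfold q, Q. apply Cmod_gt_0. apply Cmult_neq_0; [apply NZ; simpl; lra|apply cexp_nz]. }
  assert (GL : forall z, s0 < fst z -> fst (L z) = ln (Cmod (G z)) - ln q).
  { intros z Hz. assert (E : Cmod (Q z) = q) by (unfold q; f_equal; apply (const_halfplane Q s0); auto; simpl; lra).
    unfold Q in E. rewrite Cmod_mult, Cmod_cexp in E.
    assert (P : 0 < Cmod (G z)) by (apply Cmod_gt_0; now apply NZ).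
    rewrite <- E, ln_mult, ln_exp by (auto; apply exp_pos). simpl. ring. }
  set (AA := fun t => ln K + INR N * ln (3 + Rabs t)).
  assert (GA : forall x t y, s0 < x <= c + 1 -> Rabs (y - t) <= 1 -> ln (Cmod (G (x, y))) <= AA t).
  { intros x t y Hx Hy. unfold AA. assert (T := Rabs_pos t).
    assert (Ty : Rabs y <= 1 + Rabs t).
    { replace y with ((y - t) + t) by ring. eapply Rle_trans; [apply Rabs_triang|lra]. }
    assert (P : 0 < Cmod (G (x, y))) by (apply Cmod_gt_0; apply NZ; simpl; lra).
    rewrite <- ln_pow, <- ln_mult by (try apply pow_lt; lra).
    apply ln_le; auto. eapply Rle_trans; [apply GB; simpl; lra|]. simpl.
    apply Rmult_le_compat_l; [lra|]. apply pow_incr. assert (T' := Rabs_pos y). lra. }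
  (* Borel-Caratheodory on a circle of radius [e / 2], inside a disc of radius [e] that stays to the
     right of [s0]; hence the factor 4/e. *)
  assert (PB : forall x t, s0 + e <= x <= c -> Cmod (p (x, t)) <= 4 / e * (AA t - ln (Cmod (G (x, t))))).
  { intros x t Hx.
    assert (T := borel_caratheodory L (x, t) (p (x, t)) (AA t - ln q) (e / 2) e ltac:(lra)).
    rewrite GL in T by (simpl; lra).
    eapply Rle_trans; [apply T|right; field; lra].
    - intros z Hz. exists (p z). apply HL.
      assert (Tz := fst_le_Cmod (z - (x, t))%C). simpl in Tz. apply Rabs_le_between in Tz. lra.
    - apply HL. simpl; lra.
    - intros [a b] Hz.
      assert (Tz := fst_le_Cmod ((a, b) - (x, t))%C). simpl in Tz. apply Rabs_le_between in Tz.
      assert (Ty := snd_le_Cmod ((a, b) - (x, t))%C). simpl in Ty.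
      rewrite GL by (simpl; lra). assert (T' := GA a t b ltac:(lra) ltac:(unfold Rminus; lra)). lra. }
  set (E := exp (4 / e * (c - s0))).
  assert (HE : 1 <= E).
  { unfold E. rewrite <- exp_0. left. apply exp_increasing. apply Rmult_lt_0_compat; [apply Rdiv_lt_0_compat|]; lra. }
  assert (YB : forall x t, s0 + e <= x <= c ->
    AA t - ln (Cmod (G (x, t))) <= (AA t - ln (Cmod (G (c, t)))) * E).
  { intros x t Hx.
    set (y := fun v => AA t - ln q - fst (L (v, t))).
    assert (Ey : forall v, s0 < v -> AA t - ln (Cmod (G (v, t))) = y v).
    { intros v Hv. unfold y. rewrite GL by (simpl; lra). ring. }
    rewrite !Ey by lra.
    assert (Y0 : forall v, s0 + e <= v <= c -> 0 <= y v).
    { intros v Hv. rewrite <- Ey by lra. assert (T := GA v t t ltac:(lra)).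
      replace (t - t) with 0 in T by ring. rewrite Rabs_R0 in T. lra. }
    (* The gap y = A - log|G| satisfies |y'| <= (4/e) y along the horizontal line, so with this
       integrating factor it is nondecreasing and is controlled by its value on the line Re z = c,
       where |G| is bounded below. *)
    set (phi := fun v => y v * exp (4 / e * v)).
    assert (Dphi : forall v, s0 + e <= v <= c -> is_derive phi v ((4 / e * y v - fst (p (v, t))) * exp (4 / e * v))).
    { intros v Hv. unfold phi, y.
      destruct (isD_re L (v, t) (p (v, t)) t eq_refl (HL (v, t) ltac:(simpl; lra))) as [D1 _]. simpl in D1.
      assert (D2 : is_derive (fun v => exp (4 / e * v)) v (4 / e * exp (4 / e * v)))
        by (auto_derive; auto; ring).
      assert (D3 : is_derive (fun v => AA t - ln q - fst (L (v, t))) v (- fst (p (v, t)))).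
      { apply (is_derive_ext (fun v => minus (AA t - ln q) (fst (L (v, t))))); [reflexivity|].
        replace (- fst (p (v, t))) with (minus 0 (fst (p (v, t)))) by (unfold minus, plus, opp; simpl; ring).
        apply @is_derive_minus; [apply @is_derive_const|exact D1]. }
      evar_last; [apply (is_derive_mult (K := R_AbsRing) _ _ _ _ _ D3 D2); intros; apply Rmult_comm|].
      unfold plus, mult; simpl. ring. }
    destruct (MVT_gen phi x c (fun v => (4 / e * y v - fst (p (v, t))) * exp (4 / e * v))) as [xi [Hxi M]].
    { rewrite Rmin_left, Rmax_right by lra. intros v Hv. apply Dphi. lra. }
    { rewrite Rmin_left, Rmax_right by lra. intros v Hv. apply continuity_pt_filterlim.
      apply (ex_derive_continuous (V := R_NormedModule)). eexists. apply Dphi. lra. }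
    rewrite Rmin_left, Rmax_right in Hxi by lra.
    assert (Inc : phi x <= phi c).
    { assert (T1 := PB xi t ltac:(lra)). rewrite Ey in T1 by lra.
      assert (T2 := fst_le_Cmod (p (xi, t))). apply Rabs_le_between in T2.
      assert (T3 := exp_pos (4 / e * xi)). assert (0 <= c - x) by lra.
      assert (0 <= (4 / e * y xi - fst (p (xi, t))) * exp (4 / e * xi) * (c - x)).
      { apply Rmult_le_pos; auto. apply Rmult_le_pos; lra. }
      lra. }
    unfold phi in Inc.
    assert (P1 := exp_pos (4 / e * x)).
    apply Rmult_le_reg_r with (exp (4 / e * x)); auto. eapply Rle_trans; [apply Inc|].
    rewrite Rmult_assoc. apply Rmult_le_compat_l; [apply Y0; lra|].
    unfold E. rewrite <- exp_plus. apply Rge_le, Rle_ge.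
    destruct (Rle_lt_or_eq_dec (4 / e * c) (4 / e * (c - s0) + 4 / e * x)) as [L1|L1].
    - rewrite <- Rmult_plus_distr_l. apply Rmult_le_compat_l; [left; apply Rdiv_lt_0_compat; lra|lra].
    - left. now apply exp_increasing.
    - right. now rewrite L1. }
  set (D := Rabs (ln K) + Rabs (ln kap)).
  exists (4 / e * ((D + INR N) * E) + 1).
  assert (P4 : 0 < 4 / e) by (apply Rdiv_lt_0_compat; lra).
  assert (PN := pos_INR N). assert (PD : 0 <= D) by (unfold D; assert (T := Rabs_pos (ln K)); assert (T' := Rabs_pos (ln kap)); lra).
  assert (PDN : 0 <= (D + INR N) * E) by (apply Rmult_le_pos; lra).
  split; [nra|]. intros x t Hx.
  eapply Rle_trans; [now apply PB|].
  assert (l3 : 1 <= ln (3 + Rabs t)).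
  { rewrite <- (ln_exp 1). apply ln_le; [apply exp_pos|]. assert (T := exp_le_3). assert (T' := Rabs_pos t). lra. }
  assert (B1 := YB x t Hx).
  assert (B2 : AA t - ln (Cmod (G (c, t))) <= (D + INR N) * ln (3 + Rabs t)).
  { assert (ln kap <= ln (Cmod (G (c, t)))) by (apply ln_le; auto).
    unfold AA. assert (ln K - ln kap <= D).
    { unfold D. assert (T := Rle_abs (ln K)). assert (T' := Rle_abs (- ln kap)). rewrite Rabs_Ropp in T'. lra. }
    nra. }
  assert (B3 : AA t - ln (Cmod (G (x, t))) <= (D + INR N) * E * ln (3 + Rabs t)).
  { eapply Rle_trans; [apply B1|]. replace ((D + INR N) * E * ln (3 + Rabs t)) with ((D + INR N) * ln (3 + Rabs t) * E) by ring.
    apply Rmult_le_compat_r; lra. }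
  assert (B4 : 4 / e * (AA t - ln (Cmod (G (x, t)))) <= 4 / e * ((D + INR N) * E * ln (3 + Rabs t))) by (apply Rmult_le_compat_l; lra).
  lra.
Qed.

(** * The Phragmen-Lindelof principle in a strip *)

Lemma Rpower_exp_bound (m k b : R) : 0 <= m -> 0 < b -> 0 < k ->
  exists K, 0 < K /\ forall T, 0 <= T -> Rpower (T + m + 1) k <= K * exp (b * T).
Proof.
  intros Hm Hb Hk. set (e := b / k). assert (He : 0 < e) by (now apply Rdiv_lt_0_compat).
  exists (exp (k * (e * (m + 1) - 1 - ln e))). split; [apply exp_pos|]. intros T HT.
  unfold Rpower. rewrite <- exp_plus.
  assert (H : k * ln (T + m + 1) <= k * (e * (m + 1) - 1 - ln e) + b * T).
  { assert (L := ln_le_lin (T + m + 1) e ltac:(lra) He).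
    replace (b * T) with (k * (e * T)) by (unfold e; field; lra).
    rewrite <- Rmult_plus_distr_l. apply Rmult_le_compat_l; lra. }
  destruct (Rle_lt_or_eq_dec _ _ H) as [L|L]; [left; now apply exp_increasing|right; now rewrite L].
Qed.

Lemma exp_le_compat (x y : R) : x <= y -> exp x <= exp y.
Proof. intros [H|H]; [left; now apply exp_increasing|right; now rewrite H]. Qed.

Lemma ln_zero : ln 0 = 0.
Proof. unfold ln. destruct (Rlt_dec 0 0) as [H|H]; [exfalso; lra|reflexivity]. Qed.

(** G is divided by (z - a + 2)^N, which has no zero in the strip and matches the polynomial growth,
    and is damped by exp(- eta cos(be (z - mid))). The real part of this cosine grows like exp(be
    |y|), so the damping beats finite order of every exponent k. The maximum principle on tall
    rectangles, followed by eta -> 0, gives the bound. *)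
Lemma phragmen_lindelof (G : C -> C) (a b A k K : R) (N : nat) :
  a < b -> 0 < A -> 0 < k -> 0 < K ->
  (forall z, exists d, isD G z d) ->
  (forall z, Cmod (G z) <= A * exp (Rpower (Cmod z) k)) ->
  (forall t, Cmod (G (a, t)) <= K * (2 + Rabs t) ^ N) ->
  (forall t, Cmod (G (b, t)) <= K * (2 + Rabs t) ^ N) ->
  exists K', 0 < K' /\ forall z, a <= fst z <= b -> Cmod (G z) <= K' * (2 + Rabs (snd z)) ^ N.
Proof.
  intros Hab HA Hk HK DG FO Ba Bb.
  (* With [be] the inverse width, the real angle stays within [-1/2, 1/2], where the cosine is at
     least 1/2. *)
  set (w := b - a). set (be := / w). set (mid := (a + b) / 2).
  assert (Hw : 0 < w) by (unfold w; lra). assert (Hbe : 0 < be) by (now apply Rinv_0_lt_compat).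
  set (cc := fun z : C => ((cexp (Ci * be * (z - mid)) + cexp (- (Ci * be * (z - mid)))) / 2)%C).
  assert (Recc : forall x y, fst (cc (x, y)) = cos (be * (x - mid)) * ((exp (- be * y) + exp (be * y)) / 2)).
  { intros x y. unfold cc, Cdiv, cexp, Ci, RtoC; simpl.
    replace (- ((0 * be - 1 * 0) * (x + - mid) - (0 * 0 + 1 * be) * (y + - 0))) with (be * y) by ring.
    replace ((0 * be - 1 * 0) * (x + - mid) - (0 * 0 + 1 * be) * (y + - 0)) with (- be * y) by ring.
    replace (- ((0 * be - 1 * 0) * (y + - 0) + (0 * 0 + 1 * be) * (x + - mid))) with (- (be * (x - mid))) by ring.
    replace ((0 * be - 1 * 0) * (y + - 0) + (0 * 0 + 1 * be) * (x + - mid)) with (be * (x - mid)) by ring.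
    rewrite cos_neg, sin_neg. field. }
  assert (cos2 : forall x, a <= x <= b -> 1/2 <= cos (be * (x - mid))).
  { intros x Hx. assert (T := cos_quad (be * (x - mid))).
    assert (Rabs (be * (x - mid)) <= 1/2).
    { rewrite Rabs_mult, (Rabs_pos_eq be) by lra.
      assert (Rabs (x - mid) <= w / 2) by (apply Rabs_le; unfold mid, w; lra).
      replace (1/2) with (be * (w / 2)) by (unfold be; field; lra). apply Rmult_le_compat_l; lra. }
    assert ((be * (x - mid)) ^ 2 <= 1/4).
    { rewrite <- pow2_abs. assert (T' := Rabs_pos (be * (x - mid))). nra. }
    lra. }
  assert (Pc : forall x y, a <= x <= b -> / 4 * exp (be * Rabs y) <= fst (cc (x, y))).
  { intros x y Hx. rewrite Recc. specialize (cos2 x Hx).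
    assert (P1 := exp_pos (- be * y)). assert (P2 := exp_pos (be * y)).
    assert (exp (be * Rabs y) <= exp (- be * y) + exp (be * y)).
    { unfold Rabs. destruct (Rcase_abs y); [replace (be * - y) with (- be * y) by ring|]; lra. }
    nra. }
  assert (Dcc : forall z, exists d, isD cc z d).
  { intros z. eexists. unfold cc. apply isD_mult; [|apply isD_const].
    assert (D0 : isD (fun z => Ci * be * (z - mid))%C z (Ci * be * (1 - 0))%C)
      by (apply isD_scal, isD_minus; [apply isD_id|apply isD_const]).
    apply isD_plus.
    - apply (isD_comp cexp (fun z => Ci * be * (z - mid))%C); [apply D0|apply isD_cexp].
    - apply (isD_comp cexp (fun z => - (Ci * be * (z - mid)))%C); [apply isD_opp, D0|apply isD_cexp]. }
  (* The factor 2^N pays for [2 + |y| <= 2 * |q z|] on the vertical sides. *)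
  set (K1 := K * 2 ^ N). assert (HK1 : 0 < K1) by (apply Rmult_lt_0_compat; [auto|apply pow_lt; lra]).
  set (q := fun z : C => (z - RtoC a + 2)%C).
  assert (q2 : forall z, a <= fst z -> (2 + Rabs (snd z)) / 2 <= Cmod (q z) /\ 1 <= Cmod (q z)).
  { intros z Hz. assert (T1 := fst_le_Cmod (q z)). assert (T2 := snd_le_Cmod (q z)).
    unfold q in *; simpl in *. rewrite Rabs_pos_eq in T1 by lra.
    replace (snd z + - 0 + 0) with (snd z) in T2 by ring. lra. }
  assert (qu : forall z, a <= fst z <= b -> Cmod (q z) <= (w + 2) * (2 + Rabs (snd z))).
  { intros z Hz. eapply Rle_trans; [apply Cmod_le_abs|]. unfold q; simpl.
    replace (snd z + - 0 + 0) with (snd z) by ring. rewrite Rabs_pos_eq by lra.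
    assert (T := Rabs_pos (snd z)). unfold w in *. nra. }
  assert (qnz : forall z, a <= fst z -> q z <> 0).
  { intros z Hz. apply Cmod_gt_0. destruct (q2 z Hz). lra. }
  assert (Main : forall z eta, a < fst z < b -> 0 < eta ->
     Cmod (G z) <= K1 * Cmod (q z) ^ N * exp (eta * fst (cc z))).
  { intros [u v] eta Hu Heta. simpl in Hu.
    set (f := fun z => (G z * / (RtoC K1 * q z ^ N) * cexp (- (RtoC eta * cc z)))%C).
    assert (nzd : forall z, a <= fst z -> (RtoC K1 * q z ^ N)%C <> 0).
    { intros z Hz. apply Cmult_neq_0; [intro E; apply RtoC_inj in E; lra|]. apply Cpow_nz. now apply qnz. }
    assert (Df : forall z, a <= fst z -> exists d, isD f z d).
    { intros z Hz. destruct (DG z) as [d Hd]. destruct (Dcc z) as [d' Hd']. eexists. unfold f.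
      apply isD_mult; [apply isD_mult; [apply Hd|apply isD_inv; [now apply nzd|]]|].
      - apply isD_scal, isD_pow. unfold q. apply isD_plus; [apply isD_minus; [apply isD_id|apply isD_const]|apply isD_const].
      - apply (isD_comp cexp (fun z => - (RtoC eta * cc z))%C); [apply isD_opp, isD_scal, Hd'|apply isD_cexp]. }
    assert (Mf : forall z, a <= fst z -> Cmod (f z) = Cmod (G z) / (K1 * Cmod (q z) ^ N) * exp (- (eta * fst (cc z)))).
    { intros z Hz. unfold f. rewrite !Cmod_mult, Cmod_inv, Cmod_cexp, Cmod_mult, Cmod_R, Cmod_pow by (now apply nzd).
      rewrite Rabs_pos_eq by lra. unfold Rdiv. f_equal. f_equal. simpl. ring. }
    assert (qN : forall z, a <= fst z -> 0 < Cmod (q z) ^ N) by (intros z Hz; apply pow_lt; destruct (q2 z Hz); lra).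
    assert (side : forall z, a <= fst z <= b -> Cmod (G z) <= K * (2 + Rabs (snd z)) ^ N -> Cmod (f z) <= 1).
    { intros z Hz Bz. rewrite Mf by lra. specialize (qN z ltac:(lra)).
      assert (E1 : Cmod (G z) / (K1 * Cmod (q z) ^ N) <= 1).
      { apply Rmult_le_reg_r with (K1 * Cmod (q z) ^ N); [nra|]. unfold Rdiv. rewrite Rmult_assoc, Rinv_l by nra.
        rewrite Rmult_1_r, Rmult_1_l. eapply Rle_trans; [apply Bz|]. unfold K1. rewrite Rmult_assoc.
        apply Rmult_le_compat_l; [lra|]. rewrite <- Rpow_mult_distr. apply pow_incr.
        destruct (q2 z ltac:(lra)). assert (T := Rabs_pos (snd z)). lra. }
      assert (E2 : exp (- (eta * fst (cc z))) <= 1).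
      { rewrite <- exp_0. apply exp_le_compat. destruct z as [x y]. assert (T := Pc x y Hz). assert (T' := exp_pos (be * Rabs y)). nra. }
      assert (E3 := exp_pos (- (eta * fst (cc z)))).
      assert (0 <= Cmod (G z) / (K1 * Cmod (q z) ^ N)).
      { apply Rmult_le_pos; [apply Cmod_ge_0|]. left. apply Rinv_0_lt_compat. nra. }
      nra. }
    set (m := Rabs a + Rabs b). assert (Hm : 0 <= m) by (unfold m; assert (T := Rabs_pos a); assert (T' := Rabs_pos b); lra).
    destruct (Rpower_exp_bound m k (be / 2) Hm ltac:(lra) Hk) as [KK [HKK RB]].
    set (BB := Rabs (ln (A / K1))).
    (* At this height X = exp(be T/2) satisfies (eta/4) X >= KK + BB + 1. The damping exponent is at
       least (eta/4) X^2, whereas the growth exponent, together with the constant [BB], is at most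
       (KK + BB + 1) X. *)
    set (T := Rmax (Rabs v + 1) (2 / be * ln (4 * (KK + BB + 1) / eta))).
    assert (HT0 : 0 < 4 * (KK + BB + 1) / eta).
    { apply Rdiv_lt_0_compat; auto. assert (T' := Rabs_pos (ln (A / K1))). unfold BB. lra. }
    assert (HT1 : Rabs v + 1 <= T) by apply Rmax_l.
    assert (HT2 : 2 / be * ln (4 * (KK + BB + 1) / eta) <= T) by apply Rmax_r.
    assert (Tpos : 0 <= T) by (assert (T' := Rabs_pos v); lra).
    assert (HE : 4 * (KK + BB + 1) / eta <= exp (be / 2 * T)).
    { rewrite <- (exp_ln (4 * (KK + BB + 1) / eta)) at 1 by auto. apply exp_le_compat.
      apply Rmult_le_reg_l with (2 / be); [apply Rdiv_lt_0_compat; lra|].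
      eapply Rle_trans; [apply HT2|]. right. field. lra. }
    assert (horiz : forall z, a <= fst z <= b -> Rabs (snd z) = T -> Cmod (f z) <= 1).
    { intros z Hz Ez. rewrite Mf by lra. specialize (qN z ltac:(lra)).
      assert (q1 : 1 <= Cmod (q z) ^ N) by (apply pow_R1_Rle; destruct (q2 z ltac:(lra)); lra).
      assert (E1 : Cmod (G z) / (K1 * Cmod (q z) ^ N) <= A / K1 * exp (Rpower (T + m + 1) k)).
      { apply Rle_trans with (Cmod (G z) / K1).
        - apply Rmult_le_compat_l; [apply Cmod_ge_0|]. apply Rinv_le_contravar; nra.
        - unfold Rdiv. rewrite (Rmult_comm A), Rmult_assoc, (Rmult_comm _ (/ K1)).
          apply Rmult_le_compat_l; [left; now apply Rinv_0_lt_compat|].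
          eapply Rle_trans; [apply FO|]. apply Rmult_le_compat_l; [lra|]. apply exp_le_compat.
          destruct (Rle_lt_dec (Cmod z) 0) as [Z0|Z0].
          (* [Rpower 0 k] is exp(k ln 0) = 1, because [ln 0] is 0; the point 0 needs its own
             comparison. *)
          + assert (Zz : Cmod z = 0) by (assert (T' := Cmod_ge_0 z); lra).
            rewrite Zz. unfold Rpower. rewrite ln_zero. rewrite Rmult_0_r, exp_0.
            rewrite <- exp_0 at 1. apply exp_le_compat. apply Rmult_le_pos; [lra|].
            rewrite <- ln_1. apply ln_le; lra.
          + apply Rle_Rpower_l; [lra|]. split; auto.
            eapply Rle_trans; [apply Cmod_le_abs|]. rewrite Ez.
            assert (Rabs (fst z) <= m).
            { unfold m. apply Rabs_le. assert (T1 := Rle_abs a). assert (T2 := Rle_abs b).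
              assert (T3 := Rle_abs (- a)). assert (T4 := Rle_abs (- b)). rewrite Rabs_Ropp in T3, T4.
              assert (T5 := Rabs_pos a). assert (T6 := Rabs_pos b). lra. }
            lra. }
      assert (AK : A / K1 <= exp BB).
      { rewrite <- (exp_ln (A / K1)) at 1 by (now apply Rdiv_lt_0_compat). apply exp_le_compat, Rle_abs. }
      assert (HS : BB + Rpower (T + m + 1) k <= eta * fst (cc z)).
      { destruct z as [x y]. simpl in Ez. assert (PC := Pc x y Hz). rewrite Ez in PC.
        assert (R1 := RB T Tpos).
        assert (X1 : 1 <= exp (be / 2 * T)) by (rewrite <- exp_0; apply exp_le_compat; nra).
        assert (X2 : exp (be * T) = exp (be / 2 * T) * exp (be / 2 * T)) by (rewrite <- exp_plus; f_equal; field).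
        rewrite X2 in PC. set (X := exp (be / 2 * T)) in *.
        assert (HB0 : 0 <= BB) by apply Rabs_pos.
        assert (Y1 : BB + Rpower (T + m + 1) k <= (KK + BB + 1) * X) by nra.
        assert (Y2 : (KK + BB + 1) <= eta / 4 * X).
        { apply Rmult_le_reg_l with (4 / eta); [apply Rdiv_lt_0_compat; lra|].
          replace (4 / eta * (eta / 4 * X)) with X by (field; lra).
          replace (4 / eta * (KK + BB + 1)) with (4 * (KK + BB + 1) / eta) by (field; lra). auto. }
        assert (Y3 : (KK + BB + 1) * X <= eta / 4 * X * X) by (apply Rmult_le_compat_r; lra).
        assert (Y4 : eta * (/ 4 * (X * X)) <= eta * fst (cc (x, y))) by (apply Rmult_le_compat_l; lra).
        lra. }
      apply Rle_trans with (exp BB * exp (Rpower (T + m + 1) k) * exp (- (eta * fst (cc z)))).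
      { apply Rmult_le_compat_r; [left; apply exp_pos|]. eapply Rle_trans; [apply E1|].
        apply Rmult_le_compat_r; [left; apply exp_pos|auto]. }
      rewrite <- !exp_plus. apply Rle_trans with (exp 0); [apply exp_le_compat; lra|rewrite exp_0; lra]. }
    assert (V1 : - T < v < T).
    { assert (T1 := Rle_abs v). assert (T2 := Rle_abs (- v)). rewrite Rabs_Ropp in T2. lra. }
    assert (MR : Cmod (f (u, v)) <= 1).
    { apply (max_rect f a b (- T) T u v); auto.
      - intros z Hz. apply Df. unfold inR in Hz. lra.
      - intros z [[H1 H2]|[H1 H2]].
        + apply horiz; auto. destruct H2 as [E|E]; rewrite E; [rewrite Rabs_Ropp|]; now apply Rabs_pos_eq.
        + apply side; [lra|]. destruct z as [x y]; simpl in *. destruct H1 as [E|E]; rewrite E; auto. }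
    rewrite Mf in MR by (simpl; lra). specialize (qN (u, v) ltac:(simpl; lra)).
    rewrite exp_Ropp in MR. assert (PE := exp_pos (eta * fst (cc (u, v)))).
    apply Rmult_le_compat_r with (r := (K1 * Cmod (q (u, v)) ^ N) * exp (eta * fst (cc (u, v)))) in MR; [|apply Rmult_le_pos; [apply Rmult_le_pos|]; lra].
    replace (Cmod (G (u, v)) / (K1 * Cmod (q (u, v)) ^ N) * / exp (eta * fst (cc (u, v))) * (K1 * Cmod (q (u, v)) ^ N * exp (eta * fst (cc (u, v))))) with (Cmod (G (u, v))) in MR.
    - lra.
    - field. repeat split; try lra; apply Rgt_not_eq; lra. }
  exists (K + K1 * (w + 2) ^ N). assert (Pw : 0 < (w + 2) ^ N) by (apply pow_lt; lra).
  split; [nra|]. intros [x y] Hz. simpl in Hz |- *.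
  assert (P2 : 0 < (2 + Rabs y) ^ N) by (apply pow_lt; assert (T := Rabs_pos y); lra).
  assert (Hadd : K * (2 + Rabs y) ^ N <= (K + K1 * (w + 2) ^ N) * (2 + Rabs y) ^ N).
  { apply Rmult_le_compat_r; [lra|]. assert (0 < K1 * (w + 2) ^ N) by (now apply Rmult_lt_0_compat). lra. }
  destruct (Req_dec x a) as [->|Na]; [eapply Rle_trans; [apply Ba|auto]|].
  destruct (Req_dec x b) as [->|Nb]; [eapply Rle_trans; [apply Bb|auto]|].
  (* If the bound failed, the [eta] for which the damping costs only the square root of the excess
     would contradict [Main]. *)
  assert (Lim : Cmod (G (x, y)) <= K1 * Cmod (q (x, y)) ^ N).
  { apply Rnot_lt_le. intro Hlt.
    set (Y := K1 * Cmod (q (x, y)) ^ N) in *.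
    assert (HY : 0 < Y) by (apply Rmult_lt_0_compat; auto; apply pow_lt; destruct (q2 (x, y)); simpl; lra).
    assert (Hc : 0 < fst (cc (x, y))).
    { assert (T := Pc x y Hz). assert (T' := exp_pos (be * Rabs y)). lra. }
    set (eta := ln (Cmod (G (x, y)) / Y) / 2 / fst (cc (x, y))).
    assert (Hr : 1 < Cmod (G (x, y)) / Y).
    { apply Rmult_lt_reg_r with Y; auto. unfold Rdiv. rewrite Rmult_assoc, Rinv_l by lra. lra. }
    assert (Hln : 0 < ln (Cmod (G (x, y)) / Y)) by (rewrite <- ln_1; apply ln_increasing; lra).
    assert (Heta : 0 < eta) by (unfold eta; apply Rdiv_lt_0_compat; lra).
    assert (M := Main (x, y) eta ltac:(simpl; lra) Heta). fold Y in M.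
    replace (eta * fst (cc (x, y))) with (ln (Cmod (G (x, y)) / Y) / 2) in M by (unfold eta; field; lra).
    assert (exp (ln (Cmod (G (x, y)) / Y) / 2) < exp (ln (Cmod (G (x, y)) / Y))) by (apply exp_increasing; lra).
    rewrite exp_ln in H by lra.
    assert (Y * exp (ln (Cmod (G (x, y)) / Y) / 2) < Y * (Cmod (G (x, y)) / Y)) by (apply Rmult_lt_compat_l; auto).
    replace (Y * (Cmod (G (x, y)) / Y)) with (Cmod (G (x, y))) in H0 by (field; lra). lra. }
  eapply Rle_trans; [apply Lim|].
  assert (Cmod (q (x, y)) ^ N <= (w + 2) ^ N * (2 + Rabs y) ^ N).
  { rewrite <- Rpow_mult_distr. apply pow_incr. split; [apply Cmod_ge_0|]. apply (qu (x, y)). simpl; lra. }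
  nra.
Qed.

(** * Comparison of the two models of the complex numbers *)

(** The ring operations of the two models correspond by computation, so most transfers between them
    are by [change] or [reflexivity]. *)
Definition toC (z : Cx) : C := (Defs.Re z, Defs.Im z).
Definition ofC (z : C) : Cx := mkC (fst z) (snd z).

Lemma toC_ofC (z : C) : toC (ofC z) = z.
Proof. now destruct z. Qed.

Lemma ofC_toC (z : Cx) : ofC (toC z) = z.
Proof. now destruct z. Qed.

Lemma toC_inj (z w : Cx) : toC z = toC w -> z = w.
Proof. intros H. now rewrite <- (ofC_toC z), H, ofC_toC. Qed.

Lemma toC_pow (z : Cx) (n : nat) : toC (Defs.Cpow z n) = (toC z ^ n)%C.
Proof.
  induction n as [|n IH]; [reflexivity|]. simpl. rewrite <- IH. reflexivity.
Qed.

Lemma toC_isD (f : Cx -> Cx) (z d : Cx) :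
  Cderiv f z d -> isD (fun w => toC (f (ofC w))) (toC z) (toC d).
Proof.
  intros H. apply isD_eps. intros e He. destruct (H e He) as [del [Hd Hd']].
  exists del. split; auto. intros h Hh. rewrite ofC_toC.
  destruct (Ceq_dec h 0) as [->|N].
  - rewrite Cplus_0_r, ofC_toC, Cmod_0, Rmult_0_r.
    replace (toC (f z) - toC (f z) - toC d * 0)%C with (RtoC 0) by ring. rewrite Cmod_0. lra.
  - specialize (Hd' (ofC h)). assert (N' : ofC h <> C0).
    { intro E. apply N. rewrite <- (toC_ofC h), E. reflexivity. }
    specialize (Hd' N' Hh). change (Cmod (toC (Csub (Defs.Cdiv (Csub (f (Cadd z (ofC h))) (f z)) (ofC h)) d)) < e) in Hd'.
    change (toC (Csub (Defs.Cdiv (Csub (f (Cadd z (ofC h))) (f z)) (ofC h)) d))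
      with ((toC (f (Cadd z (ofC h))) - toC (f z)) / toC (ofC h) - toC d)%C in Hd'.
    rewrite toC_ofC in Hd'. change (ofC (toC z + h)%C) with (Cadd z (ofC h)).
    replace (toC (f (Cadd z (ofC h))) - toC (f z) - toC d * h)%C
      with (((toC (f (Cadd z (ofC h))) - toC (f z)) / h - toC d) * h)%C by (field; auto).
    rewrite Cmod_mult. apply Rmult_le_compat_r; [apply Cmod_ge_0|]. lra.
Qed.

(** * Euler's Gamma function *)

Definition limC (u : nat -> C) (l : C) : Prop :=
  forall e, e > 0 -> exists N, forall n, (n >= N)%nat -> Cmod (u n - l)%C < e.

Lemma Cauchy_limC (u : nat -> C) :
  (forall e, 0 < e -> exists N, forall n m, (n >= N)%nat -> (m >= N)%nat -> Cmod (u n - u m)%C < e) ->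
  exists l, limC u l.
Proof.
  intros H.
  destruct (Rcomplete.R_complete (fun n => fst (u n))) as [a Ha].
  { intros e He. destruct (H e He) as [N HN]. exists N. intros n m Hn Hm. unfold Rdist.
    eapply Rle_lt_trans; [|apply (HN n m Hn Hm)]. apply (fst_le_Cmod (u n - u m)%C). }
  destruct (Rcomplete.R_complete (fun n => snd (u n))) as [b Hb].
  { intros e He. destruct (H e He) as [N HN]. exists N. intros n m Hn Hm. unfold Rdist.
    eapply Rle_lt_trans; [|apply (HN n m Hn Hm)]. apply (snd_le_Cmod (u n - u m)%C). }
  exists (a, b). intros e He. destruct (Ha (e/2) ltac:(lra)) as [N1 H1]. destruct (Hb (e/2) ltac:(lra)) as [N2 H2].
  exists (Nat.max N1 N2). intros n Hn. eapply Rle_lt_trans; [apply Cmod_le_abs|].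
  specialize (H1 n ltac:(lia)). specialize (H2 n ltac:(lia)). unfold Rdist in *. simpl.
  unfold Rminus in *. lra.
Qed.

Lemma limC_Cmod_le (u v : nat -> C) (l k : C) (K : R) (n0 : nat) : limC u l -> limC v k -> 0 <= K ->
  (forall n, (n >= n0)%nat -> Cmod (u n) <= K * Cmod (v n)) -> Cmod l <= K * Cmod k.
Proof.
  intros Hu Hv HK H. apply le_epsilon. intros e He.
  destruct (Hu (e/2) ltac:(lra)) as [N1 H1].
  destruct (Hv (e / (2 * (K + 1))) ltac:(apply Rdiv_lt_0_compat; lra)) as [N2 H2].
  set (n := Nat.max n0 (Nat.max N1 N2)).
  specialize (H1 n ltac:(lia)). specialize (H2 n ltac:(lia)). specialize (H n ltac:(lia)).
  assert (T1 := Cmod_sub_le l (u n)). rewrite Cmod_sub_sym in T1.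
  assert (T2 := Cmod_sub_le (v n) k).
  apply Rmult_lt_compat_l with (r := 2 * (K + 1)) in H2; [|lra].
  replace (2 * (K + 1) * (e / (2 * (K + 1)))) with e in H2 by (field; lra).
  assert (P := Cmod_ge_0 (v n - k)). nra.
Qed.

Lemma limC_Cmod_ge (u : nat -> C) (l : C) (k : R) (n0 : nat) : limC u l ->
  (forall n, (n >= n0)%nat -> k <= Cmod (u n)) -> k <= Cmod l.
Proof.
  intros Hu H. apply le_epsilon. intros e He.
  destruct (Hu e He) as [N1 H1]. set (n := Nat.max n0 N1).
  specialize (H1 n ltac:(lia)). specialize (H n ltac:(lia)).
  assert (T2 := Cmod_sub_le (u n) l). lra.
Qed.

(** The relative increments are O(n^(-2)) and are majorised by differences of 2K/n. This bounds the
    moduli above, makes the sequence Cauchy, and keeps the limit away from 0. *)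
Lemma infinite_product (u : nat -> C) (K : R) (n0 : nat) : (n0 >= 1)%nat -> 0 < K ->
  K / INR n0 ^ 2 <= 1 / 2 ->
  (forall n, (n >= n0)%nat -> u n <> 0) ->
  (forall n, (n >= n0)%nat -> Cmod (u (S n) - u n)%C <= K / INR n ^ 2 * Cmod (u n)) ->
  exists l, limC u l /\ l <> 0.
Proof.
  intros Hn0 HK HK2 Hnz Hr.
  assert (Pn : forall n, (n >= n0)%nat -> 1 <= INR n) by (intros n Hn; apply (le_INR 1); lia).
  assert (tel : forall n, (n >= n0)%nat -> K / INR n ^ 2 <= 2 * K / INR n - 2 * K / INR (S n)).
  { intros n Hn. specialize (Pn n Hn). rewrite S_INR.
    replace (2 * K / INR n - 2 * K / (INR n + 1)) with (2 * K / (INR n * (INR n + 1))) by (field; lra).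
    replace (K / INR n ^ 2) with (2 * K / (2 * INR n ^ 2)) by (field; lra).
    apply Rmult_le_compat_l; [lra|]. apply Rinv_le_contravar; nra. }
  assert (small : forall n, (n >= n0)%nat -> 0 < K / INR n ^ 2 <= 1/2).
  { intros n Hn. assert (P := Pn n Hn). split; [apply Rdiv_lt_0_compat; nra|].
    eapply Rle_trans; [|apply HK2]. apply Rmult_le_compat_l; [lra|].
    assert (P0 := Pn n0 (le_n n0)). assert (INR n0 <= INR n) by (apply le_INR; lia).
    apply Rinv_le_contravar; nra. }
  (* |u_n| exp(2K/n) is nonincreasing. *)
  assert (up : forall k, Cmod (u (n0 + k)%nat) * exp (2 * K / INR (n0 + k)) <= Cmod (u n0) * exp (2 * K / INR n0)).
  { induction k as [|k IH]; [rewrite Nat.add_0_r; lra|].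
    rewrite Nat.add_succ_r. set (n := (n0 + k)%nat) in *. eapply Rle_trans; [|apply IH].
    specialize (Hr n ltac:(lia)). specialize (tel n ltac:(lia)). specialize (small n ltac:(lia)).
    assert (T := Cmod_sub_le (u (S n)) (u n)). assert (P := Cmod_ge_0 (u n)).
    assert (E : exp (2 * K / INR n) = exp (2 * K / INR n - 2 * K / INR (S n)) * exp (2 * K / INR (S n)))
      by (rewrite <- exp_plus; f_equal; ring).
    rewrite E, <- Rmult_assoc. apply Rmult_le_compat_r; [left; apply exp_pos|].
    assert (T2 := exp_ineq1_le (2 * K / INR n - 2 * K / INR (S n))). nra. }
  (* |u_n| exp(- 4K/n) is nondecreasing. The constant is doubled because 1 - x >= exp(- 2x) needs x
     <= 1/2, which is the condition imposed at [n0]. *)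
  assert (lo : forall k, Cmod (u n0) * exp (- (4 * K / INR n0)) <= Cmod (u (n0 + k)%nat) * exp (- (4 * K / INR (n0 + k)))).
  { induction k as [|k IH]; [rewrite Nat.add_0_r; lra|].
    rewrite Nat.add_succ_r. set (n := (n0 + k)%nat) in *. eapply Rle_trans; [apply IH|].
    specialize (Hr n ltac:(lia)). specialize (tel n ltac:(lia)). specialize (small n ltac:(lia)).
    set (x := K / INR n ^ 2) in *.
    assert (T := Cmod_sub_le (u n) (u (S n))). rewrite Cmod_sub_sym in T. assert (P := Cmod_ge_0 (u n)).
    assert (E : exp (- (4 * K / INR n)) = exp (- (4 * K / INR n - 4 * K / INR (S n))) * exp (- (4 * K / INR (S n))))
      by (rewrite <- exp_plus; f_equal; ring).
    rewrite E, <- Rmult_assoc. apply Rmult_le_compat_r; [left; apply exp_pos|].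
    assert (E1 : exp (- (4 * K / INR n - 4 * K / INR (S n))) <= exp (- (2 * x))) by (apply exp_le_compat; lra).
    assert (E2 : exp (- (2 * x)) <= 1 - x).
    { rewrite exp_Ropp. assert (T2 := exp_ineq1_le (2 * x)).
      apply Rmult_le_reg_r with (exp (2 * x)); [apply exp_pos|]. rewrite Rinv_l by (apply Rgt_not_eq, exp_pos). nra. }
    nra. }
  set (B := Cmod (u n0) * exp (2 * K / INR n0)).
  assert (HB : 0 < B) by (apply Rmult_lt_0_compat; [apply Cmod_gt_0, Hnz; lia|apply exp_pos]).
  assert (bd : forall n, (n >= n0)%nat -> Cmod (u n) <= B).
  { intros n Hn. replace n with (n0 + (n - n0))%nat by lia. specialize (up (n - n0)%nat).
    eapply Rle_trans; [|apply up]. rewrite <- (Rmult_1_r (Cmod _)) at 1. apply Rmult_le_compat_l; [apply Cmod_ge_0|].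
    rewrite <- exp_0. apply exp_le_compat. left. apply Rdiv_lt_0_compat; [lra|].
    assert (P := Pn (n0 + (n - n0))%nat ltac:(lia)). lra. }
  assert (cau : forall n k, (n >= n0)%nat -> Cmod (u (n + k)%nat - u n)%C <= B * (2 * K / INR n - 2 * K / INR (n + k))).
  { intros n k Hn. induction k as [|k IH].
    - rewrite Nat.add_0_r. replace (u n - u n)%C with (RtoC 0) by ring. rewrite Cmod_0. lra.
    - rewrite Nat.add_succ_r. set (q := (n + k)%nat) in *.
      replace (u (S q) - u n)%C with ((u (S q) - u q) + (u q - u n))%C by ring.
      eapply Rle_trans; [apply Cmod_triangle|].
      specialize (Hr q ltac:(lia)). specialize (tel q ltac:(lia)). specialize (small q ltac:(lia)). specialize (bd q ltac:(lia)).
      assert (P := Cmod_ge_0 (u q)).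
      assert (K / INR q ^ 2 * Cmod (u q) <= (2 * K / INR q - 2 * K / INR (S q)) * B) by (apply Rmult_le_compat; lra).
      lra. }
  destruct (Cauchy_limC u) as [l Hl].
  { intros e He. destruct (INR_unbounded (4 * B * K / e + 1)) as [N HN].
    exists (Nat.max N n0). 
    assert (Hone : forall n, (n >= Nat.max N n0)%nat -> Cmod (u n - u (Nat.max N n0))%C < e / 2).
    { intros n Hn. set (M := Nat.max N n0) in *. replace n with (M + (n - M))%nat by lia.
      eapply Rle_lt_trans; [apply cau; lia|].
      assert (P := Pn M ltac:(lia)). assert (P' := Pn (M + (n - M))%nat ltac:(lia)).
      assert (INR N <= INR M) by (apply le_INR; lia).
      assert (0 < 2 * K / INR (M + (n - M))) by (apply Rdiv_lt_0_compat; lra).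
      assert (B * (2 * K / INR M) < e / 2).
      { apply Rmult_lt_reg_r with (INR M); [lra|]. replace (B * (2 * K / INR M) * INR M) with (2 * B * K) by (field; lra).
        assert (4 * B * K / e < INR M) by lra. apply Rmult_lt_compat_r with (r := e / 2) in H1; [|lra].
        replace (4 * B * K / e * (e / 2)) with (2 * B * K) in H1 by (field; lra). lra. }
      nra. }
    intros n m Hn Hm. assert (A1 := Hone n Hn). assert (A2 := Hone m Hm). rewrite Cmod_sub_sym in A2.
    set (M := Nat.max N n0) in *.
    replace (u n - u m)%C with ((u n - u M) + (u M - u m))%C by ring.
    eapply Rle_lt_trans; [apply Cmod_triangle|lra]. }
  exists l. split; auto. apply Cmod_gt_0.
  apply Rlt_le_trans with (Cmod (u n0) * exp (- (4 * K / INR n0))).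
  { apply Rmult_lt_0_compat; [apply Cmod_gt_0, Hnz; lia|apply exp_pos]. }
  apply limC_Cmod_ge with (u := u) (n0 := n0); auto. intros n Hn.
  replace n with (n0 + (n - n0))%nat by lia. eapply Rle_trans; [apply (lo (n - n0)%nat)|].
  apply Rle_trans with (Cmod (u (n0 + (n - n0))%nat) * 1); [|lra].
  apply Rmult_le_compat_l; [apply Cmod_ge_0|].
  rewrite <- exp_0. apply exp_le_compat. 
  assert (P := Pn (n0 + (n - n0))%nat ltac:(lia)).
  assert (0 < 4 * K / INR (n0 + (n - n0))) by (apply Rdiv_lt_0_compat; lra). lra.
Qed.

Fixpoint cprod (f : nat -> C) (n : nat) : C :=
  match n with O => RtoC 1 | S k => (cprod f k * f k)%C end.

Definition gauss (s : C) (n : nat) : C :=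
  (cexp (s * ln (INR n)) * INR (fact n) / cprod (fun k => s + INR k) (S n))%C.

Lemma toC_gauss (s : Cx) (n : nat) : toC (Gauss_term s n) = gauss (toC s) n.
Proof.
  assert (P : forall n, toC (Cprod n (fun k => Cadd s (Defs.RtoC (INR k)))) = cprod (fun k => toC s + INR k)%C n).
  { clear n. induction n as [|n IH]; [reflexivity|]. simpl cprod. rewrite <- IH. reflexivity. }
  unfold gauss. rewrite <- P. reflexivity.
Qed.

Definition npole (s : C) : Prop := forall k : nat, (s + INR k)%C <> 0.

Lemma cprod_nz (s : C) (n : nat) : npole s -> cprod (fun k => s + INR k)%C n <> 0.
Proof.
  intros H. induction n as [|n IH]; simpl; [apply C1_nz|]. apply Cmult_neq_0; auto.
Qed.

Lemma INR_fact_nz (n : nat) : RtoC (INR (fact n)) <> 0.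
Proof. intro E. apply RtoC_inj in E. now apply (INR_fact_neq_0 n). Qed.

Lemma gauss_nz (s : C) (n : nat) : npole s -> gauss s n <> 0.
Proof.
  intros H. unfold gauss, Cdiv. repeat apply Cmult_neq_0; [apply cexp_nz|apply INR_fact_nz|].
  apply Cmod_gt_0. rewrite Cmod_inv by (now apply cprod_nz). apply Rinv_0_lt_compat, Cmod_gt_0. now apply cprod_nz.
Qed.

Lemma gauss_step (s : C) (n : nat) : npole s -> 
  gauss s (S n) = (gauss s n * (cexp (s * (ln (INR (S n)) - ln (INR n))%R) * INR (S n) / (s + INR (S n))))%C.
Proof.
  intros H. unfold gauss. change (fact (S n)) with (S n * fact n)%nat. rewrite mult_INR.
  change (cprod (fun k => s + INR k)%C (S (S n))) with (cprod (fun k => s + INR k)%C (S n) * (s + INR (S n)))%C.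
  assert (N1 := cprod_nz s (S n) H). assert (N2 := H (S n)).
  replace (s * ln (INR (S n)))%C with (s * ln (INR n) + s * (ln (INR (S n)) - ln (INR n))%R)%C
    by (rewrite RtoC_minus; ring).
  rewrite cexp_plus, RtoC_mult. field. auto.
Qed.

Lemma gauss_lim (s : C) : npole s -> exists g, limC (gauss s) g /\ g <> 0.
Proof.
  intros H. set (r := Cmod s). assert (Hr : 0 <= r) by apply Cmod_ge_0.
  set (K := 2 * (8 * r ^ 2 + r) + 1). assert (HK : 0 < K) by (unfold K; nra).
  destruct (INR_unbounded (2 * K + 2 * r + 1)) as [n0 Hn0].
  assert (H1 : 1 <= INR n0) by lra.
  apply (infinite_product (gauss s) K n0); auto.
  - destruct n0; [simpl in H1; lra|lia].
  - apply Rmult_le_reg_r with (INR n0 ^ 2); [nra|]. unfold Rdiv. rewrite Rmult_assoc, Rinv_l by nra. nra.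
  - intros n _. now apply gauss_nz.
  - intros n Hn. assert (Hn' : INR n0 <= INR n) by (apply le_INR; lia).
    set (x := INR n) in *. assert (Hx : 1 <= x) by lra.
    rewrite gauss_step by auto. set (g := gauss s n). rewrite S_INR. fold x.
    set (l := ln (x + 1) - ln x).
    assert (Hl : / (x + 1) <= l <= / x).
    { assert (L : l = ln ((x + 1) / x)) by (unfold l; rewrite ln_div by lra; ring).
      split.
      - assert (T := exp_ineq1_le (- l)). rewrite L in T. rewrite <- ln_Rinv in T by (apply Rdiv_lt_0_compat; lra).
        rewrite exp_ln in T by (apply Rinv_0_lt_compat, Rdiv_lt_0_compat; lra).
        rewrite ln_Rinv in T by (apply Rdiv_lt_0_compat; lra). rewrite <- L in T.
        replace (/ ((x + 1) / x)) with (1 - / (x + 1)) in T by (field; lra). lra.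
      - assert (T := exp_ineq1_le l). rewrite L in T. rewrite exp_ln in T by (apply Rdiv_lt_0_compat; lra). rewrite <- L in T.
        replace ((x + 1) / x) with (1 + / x) in T by (field; lra). lra. }
    assert (Ix : 0 < / x) by (apply Rinv_0_lt_compat; lra).
    assert (Ix1 : 0 < / (x + 1)) by (apply Rinv_0_lt_compat; lra).
    assert (Dx : / x - / (x + 1) <= / x * / x).
    { replace (/ x - / (x + 1)) with (/ x * / (x + 1)) by (field; lra).
      apply Rmult_le_compat_l; [lra|]. apply Rinv_le_contravar; lra. }
    assert (Mz : Cmod (s * l)%C = r * l) by (rewrite Cmod_mult, Cmod_R, Rabs_pos_eq by lra; reflexivity).
    assert (Rx : r * / x <= 1/2).
    { apply Rmult_le_reg_r with x; [lra|]. rewrite Rmult_assoc, Rinv_l by lra. lra. }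
    assert (Q := cexp_quad (s * l)%C ltac:(rewrite Mz; nra)). rewrite Mz in Q.
    assert (Nx : RtoC (x + 1) <> 0) by (intro E; apply RtoC_inj in E; lra).
    assert (Np : (s + RtoC (x + 1))%C <> 0) by (unfold x; rewrite <- S_INR; apply H).
    (* The terms of first order cancel: l = ln((x+1)/x) differs from 1/(x+1) by at most 1/x^2, and
       the exponential has a quadratic error. The remaining quotient is at most 2 once x exceeds
       2|s|; this is the 2 in [K]. *)
    replace (g * (cexp (s * l) * (x + 1)%R / (s + (x + 1)%R)) - g)%C
      with (((cexp (s * l) - 1 - s * l) + s * (RtoC l - / RtoC (x + 1))) * (RtoC (x + 1) / (s + RtoC (x + 1))) * g)%C
      by (field; auto).
    rewrite !Cmod_mult. apply Rmult_le_compat_r; [apply Cmod_ge_0|].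
    assert (A1 : Cmod (cexp (s * l) - 1 - s * l + s * (RtoC l - / RtoC (x + 1)))%C <= (8 * r ^ 2 + r) * (/ x * / x)).
    { eapply Rle_trans; [apply Cmod_triangle|]. rewrite Cmod_mult, <- RtoC_inv, <- RtoC_minus, Cmod_R, Rabs_pos_eq by lra.
      fold r. assert (l * l <= / x * / x) by nra. nra. }
    assert (A2 : Cmod (RtoC (x + 1) / (s + RtoC (x + 1)))%C <= 2).
    { rewrite Cmod_div by auto. rewrite Cmod_R, Rabs_pos_eq by lra.
      assert (T := Cmod_sub_le (RtoC (x + 1)) (- s)%C). rewrite Cmod_opp, Cmod_R, Rabs_pos_eq in T by lra.
      replace (RtoC (x + 1) - - s)%C with (s + RtoC (x + 1))%C in T by ring. fold r in T.
      apply Rmult_le_reg_r with (Cmod (s + RtoC (x + 1))%C); [lra|]. unfold Rdiv. rewrite Rmult_assoc, Rinv_l by lra. lra. }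
    replace (K / x ^ 2) with (K * (/ x * / x)) by (field; lra).
    assert (0 < / x * / x) by nra.
    apply Rle_trans with ((8 * r ^ 2 + r) * (/ x * / x) * 2).
    + apply Rmult_le_compat; auto; apply Cmod_ge_0.
    + unfold K. nra.
Qed.

Definition Gam (s : C) : C := toC (CGamma (ofC s)).

(** [CGamma] is chosen by [epsilon]; it is the limit of Gauss's terms as soon as some limit exists,
    and by uniqueness it inherits that this limit is not 0. *)
Lemma Gam_lim (s : C) : npole s -> limC (gauss s) (Gam s) /\ Gam s <> 0.
Proof.
  intros H. destruct (gauss_lim s H) as [g [Hg Hg0]].
  assert (E : Ccv (Gauss_term (ofC s)) (CGamma (ofC s))).
  { unfold CGamma. apply epsilon_spec. exists (ofC g). intros e He. destruct (Hg e He) as [N HN].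
    exists N. intros n Hn. specialize (HN n Hn).
    change (Cmod (toC (Gauss_term (ofC s) n) - toC (ofC g))%C < e). now rewrite toC_gauss, !toC_ofC. }
  assert (L : limC (gauss s) (Gam s)).
  { intros e He. destruct (E e He) as [N HN]. exists N. intros n Hn. specialize (HN n Hn).
    change (Cmod (toC (Gauss_term (ofC s) n) - Gam s)%C < e) in HN. now rewrite toC_gauss, toC_ofC in HN. }
  split; auto.
  assert (U : Gam s = g); [|now rewrite U].
  apply Csub_0_eq, Cmod_eq_0. apply Rle_antisym; [|apply Cmod_ge_0]. apply le_epsilon. intros e He.
  destruct (L (e/2) ltac:(lra)) as [N1 H1]. destruct (Hg (e/2) ltac:(lra)) as [N2 H2].
  specialize (H1 (Nat.max N1 N2) ltac:(lia)). specialize (H2 (Nat.max N1 N2) ltac:(lia)).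
  set (v := gauss s (Nat.max N1 N2)) in *. rewrite Cmod_sub_sym in H1.
  replace (Gam s - g)%C with ((Gam s - v) + (v - g))%C by ring.
  eapply Rle_trans; [apply Cmod_triangle|lra].
Qed.

Lemma npole_im (x y : R) : y <> 0 -> npole (x, y).
Proof. intros H k E. apply (f_equal snd) in E. simpl in E. lra. Qed.

Lemma cprod_shift (s : C) (n : nat) :
  (cprod (fun k => s + 1 + INR k)%C n * s)%C = cprod (fun k => s + INR k)%C (S n).
Proof.
  induction n as [|n IH]; [simpl; ring|].
  change (cprod (fun k => s + INR k)%C (S (S n))) with (cprod (fun k => s + INR k)%C (S n) * (s + INR (S n)))%C.
  rewrite <- IH. change (cprod (fun k => s + 1 + INR k)%C (S n)) with (cprod (fun k => s + 1 + INR k)%C n * (s + 1 + INR n))%C.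
  rewrite S_INR, RtoC_plus. ring.
Qed.

Lemma cexp_ln (x : R) : 0 < x -> cexp (RtoC (ln x)) = RtoC x.
Proof. intros H. unfold cexp, RtoC; simpl. rewrite exp_ln, cos_0, sin_0 by auto. f_equal; ring. Qed.

(** At stage n the Gauss terms of s + 1 and s have ratio n s/(s + n + 1) exactly; the factor 2
    bounds n/|s + n + 1| for n large. *)
Lemma Gam_succ (x y : R) : y <> 0 -> Cmod (Gam ((x + 1)%R, y)) <= 2 * Cmod (x, y) * Cmod (Gam (x, y)).
Proof.
  intros Hy. assert (N1 := npole_im x y Hy). assert (N2 := npole_im (x + 1) y Hy).
  set (s := (x, y)) in *.
  assert (Es : (((x + 1)%R, y) : C) = (s + 1)%C) by (unfold s, Cplus, RtoC; simpl; f_equal; ring).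
  rewrite Es in *.
  destruct (Gam_lim _ N1) as [L1 _]. destruct (Gam_lim _ N2) as [L2 _].
  destruct (INR_unbounded (2 * Cmod s + 2)) as [n0 Hn0].
  assert (Ps := Cmod_ge_0 s).
  apply (limC_Cmod_le _ _ _ _ _ n0 L2 L1); [lra|]. intros n Hn.
  assert (Hn' : INR n0 <= INR n) by (apply le_INR; lia).
  assert (E : (gauss (s + 1) n * (s + INR (S n)))%C = (INR n * s * gauss s n)%C).
  { unfold gauss. assert (P1 := cprod_nz _ (S n) N1). assert (P2 := cprod_nz _ (S n) N2).
    assert (C2 : (cprod (fun k => s + 1 + INR k)%C (S n) * s)%C = (cprod (fun k => s + INR k)%C (S n) * (s + INR (S n)))%C)
      by (rewrite cprod_shift; reflexivity).
    replace ((s + 1) * ln (INR n))%C with (s * ln (INR n) + RtoC (ln (INR n)))%C by ring.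
    rewrite cexp_plus, cexp_ln by lra.
    set (u := cprod (fun k => s + 1 + INR k)%C (S n)) in *. set (v := cprod (fun k => s + INR k)%C (S n)) in *.
    replace (s + INR (S n))%C with (u * s / v)%C by (rewrite C2; field; auto). field. auto. }
  apply (f_equal Cmod) in E. rewrite !Cmod_mult, Cmod_R, Rabs_pos_eq in E by apply pos_INR.
  assert (T := Cmod_sub_le (RtoC (INR (S n))) (- s)%C). rewrite Cmod_opp, Cmod_R, Rabs_pos_eq in T by apply pos_INR.
  replace (RtoC (INR (S n)) - - s)%C with (s + INR (S n))%C in T by ring. rewrite S_INR in T.
  rewrite S_INR in E. set (q := Cmod (s + RtoC (INR n + 1))%C) in *.
  assert (Hq : INR n / 2 <= q) by lra.
  apply Rmult_le_reg_r with q; [lra|]. rewrite E.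
  assert (Pg := Cmod_ge_0 (gauss s n)). assert (0 <= Cmod s * Cmod (gauss s n)) by nra. nra.
Qed.

Lemma Cmod_add_INR (x y : R) (k : nat) :
  Rabs y <= Cmod ((x, y) + INR k)%C /\ x + INR k <= Cmod ((x, y) + INR k)%C.
Proof.
  assert (T1 := snd_le_Cmod ((x, y) + INR k)%C). assert (T2 := fst_le_Cmod ((x, y) + INR k)%C).
  simpl in T1, T2. rewrite Rplus_0_r in T1. split; auto. eapply Rle_trans; [apply Rle_abs|apply T2].
Qed.

(** Gauss's products are compared factor by factor, using |s + b + k| <= |s + k| + b. The first
    factors cost at most 2 each, since |s + k| >= |y| >= 1 >= b. Once v = x + k >= 1, the factors 1
    + b/(v + 1) multiply up to at most a constant times n^b, which is the power of n by which the
    Gauss terms of s + b exceed those of s. *)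
Lemma Gam_mono (x b : R) : 0 <= b <= 1 ->
  exists K, 0 < K /\ forall y, 1 <= Rabs y -> Cmod (Gam (x, y)) <= K * Cmod (Gam ((x + b)%R, y)).
Proof.
  intros Hb. destruct (INR_unbounded (Rabs x + 1)) as [k0 Hk0].
  assert (Hx0 : 1 <= x + INR k0) by (assert (T := Rle_abs (- x)); rewrite Rabs_Ropp in T; lra).
  exists (2 ^ S k0 * 2). split; [assert (0 < 2 ^ S k0) by (apply pow_lt; lra); lra|]. intros y Hy.
  assert (Hy0 : y <> 0) by (intro E; rewrite E, Rabs_R0 in Hy; lra).
  assert (N1 := npole_im x y Hy0). assert (N2 := npole_im (x + b) y Hy0).
  destruct (Gam_lim _ N1) as [L1 _]. destruct (Gam_lim _ N2) as [L2 _].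
  set (P := fun n => Cmod (cprod (fun k => (x, y) + INR k)%C n)).
  set (Pb := fun n => Cmod (cprod (fun k => ((x + b)%R, y) + INR k)%C n)).
  assert (PP : forall n, 0 < P n) by (intros n; apply Cmod_gt_0; now apply cprod_nz).
  assert (PPb : forall n, 0 < Pb n) by (intros n; apply Cmod_gt_0; now apply cprod_nz).
  assert (step : forall k, Cmod (((x + b)%R, y) + INR k)%C <= Cmod ((x, y) + INR k)%C + b).
  { intros k. replace (((x + b)%R, y) + INR k)%C with (((x, y) + INR k) + RtoC b)%C
      by (unfold Cplus, RtoC; simpl; f_equal; ring).
    eapply Rle_trans; [apply Cmod_triangle|]. rewrite Cmod_R, (Rabs_pos_eq b) by lra. lra. }
  assert (b1 : forall n, Pb n <= 2 ^ n * P n).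
  { induction n as [|n IH].
    - unfold Pb, P; simpl. rewrite Cmod_1. lra.
    - unfold Pb, P; simpl. rewrite !Cmod_mult. fold (Pb n) (P n).
      destruct (Cmod_add_INR x y n) as [A1 _]. specialize (step n).
      assert (Pn := PP n). assert (Pbn := PPb n).
      apply Rle_trans with (2 ^ n * P n * (2 * Cmod ((x, y) + INR n)%C)); [|right; ring].
      apply Rmult_le_compat; auto; try lra. apply Cmod_ge_0. }
  assert (b2 : forall k, Pb (S (k0 + k)) <= 2 ^ S k0 * Rpower (x + INR (k0 + k)) b * P (S (k0 + k))).
  { induction k as [|k IH].
    - rewrite Nat.add_0_r. eapply Rle_trans; [apply b1|]. assert (Pn := PP (S k0)).
      apply Rmult_le_compat_r; [lra|]. rewrite <- (Rmult_1_r (2 ^ S k0)) at 1.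
      apply Rmult_le_compat_l; [apply pow_le; lra|].
      unfold Rpower. rewrite <- exp_0 at 1. apply exp_le_compat. apply Rmult_le_pos; [lra|].
      rewrite <- ln_1. apply ln_le; lra.
    - rewrite Nat.add_succ_r. set (n := (k0 + k)%nat) in *.
      assert (Hn : INR k0 <= INR n) by (apply le_INR; unfold n; lia).
      assert (EP : P (S (S n)) = P (S n) * Cmod ((x, y) + INR (S n))%C) by (unfold P; simpl cprod; now rewrite !Cmod_mult).
      assert (EPb : Pb (S (S n)) = Pb (S n) * Cmod (((x + b)%R, y) + INR (S n))%C) by (unfold Pb; simpl cprod; now rewrite !Cmod_mult).
      rewrite EP, EPb. destruct (Cmod_add_INR x y (S n)) as [_ A2]. specialize (step (S n)).
      set (c := Cmod ((x, y) + INR (S n))%C) in *. rewrite S_INR in A2.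
      set (v := x + INR n) in *. assert (Hv : 1 <= v) by (unfold v; lra).
      assert (Ev : x + INR (S n) = v + 1) by (rewrite S_INR; unfold v; ring). rewrite Ev.
      assert (Hc : v + 1 <= c) by (unfold v; lra).
      assert (R1 : (1 + b / (v + 1)) * Rpower v b <= Rpower (v + 1) b).
      { unfold Rpower. replace (b * ln (v + 1)) with (b * (ln (v + 1) - ln v) + b * ln v) by ring.
        rewrite exp_plus. apply Rmult_le_compat_r; [left; apply exp_pos|].
        assert (T := exp_ineq1_le (b * (ln (v + 1) - ln v))).
        assert (Lv : / (v + 1) <= ln (v + 1) - ln v).
        { assert (T' := exp_ineq1_le (ln v - ln (v + 1))).
          rewrite <- ln_div, exp_ln in T' by (try apply Rdiv_lt_0_compat; lra).
          rewrite ln_div in T' by lra. replace (v / (v + 1)) with (1 - / (v + 1)) in T' by (field; lra). lra. }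
        unfold Rdiv. assert (b * / (v + 1) <= b * (ln (v + 1) - ln v)) by (apply Rmult_le_compat_l; lra). lra. }
      assert (R2 : Cmod (((x + b)%R, y) + INR (S n))%C <= (1 + b / (v + 1)) * c).
      { eapply Rle_trans; [apply step|]. assert (b <= b / (v + 1) * c).
        { apply Rle_trans with (b / (v + 1) * (v + 1)); [right; field; lra|].
          apply Rmult_le_compat_l; [apply Rmult_le_pos; [lra|left; apply Rinv_0_lt_compat; lra]|lra]. }
        lra. }
      assert (Pn := PP (S n)). assert (Pbn := PPb (S n)). assert (P2 : 0 < 2 ^ S k0) by (apply pow_lt; lra).
      apply Rle_trans with (2 ^ S k0 * Rpower v b * P (S n) * ((1 + b / (v + 1)) * c)).
      + apply Rmult_le_compat; auto; try lra. apply Cmod_ge_0.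
      + replace (2 ^ S k0 * Rpower v b * P (S n) * ((1 + b / (v + 1)) * c))
          with (2 ^ S k0 * ((1 + b / (v + 1)) * Rpower v b) * (P (S n) * c)) by ring.
        apply Rmult_le_compat_r; [apply Rmult_le_pos; lra|]. apply Rmult_le_compat_l; lra. }
  apply (limC_Cmod_le _ _ _ _ _ (S k0) L1 L2); [assert (0 < 2 ^ S k0) by (apply pow_lt; lra); lra|].
  intros n Hn. assert (Hn' : INR k0 <= INR n) by (apply le_INR; lia).
  assert (Hxn : Rabs x + 1 < INR n) by lra. assert (Rx := Rabs_pos x). assert (Rx' := Rle_abs x).
  assert (B2 := b2 (n - k0)%nat). replace (k0 + (n - k0))%nat with n in B2 by lia.
  assert (Rn : Rpower (x + INR n) b <= 2 * Rpower (INR n) b).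
  { apply Rle_trans with (Rpower (2 * INR n) b).
    - apply Rle_Rpower_l; [lra|]. split; [|lra]. assert (T := Rle_abs (- x)). rewrite Rabs_Ropp in T. lra.
    - rewrite <- Rpower_mult_distr by lra. apply Rmult_le_compat_r; [left; apply exp_pos|].
      rewrite <- (Rpower_1 2) at 2 by lra. apply Rle_Rpower; lra. }
  unfold gauss. unfold Cdiv. rewrite !Cmod_mult, !Cmod_inv, !Cmod_cexp by (now apply cprod_nz).
  fold (P (S n)) (Pb (S n)).
  assert (F1 : fst ((x, y) * ln (INR n))%C = x * ln (INR n)) by (simpl; ring).
  assert (F2 : fst (((x + b)%R, y) * ln (INR n))%C = x * ln (INR n) + b * ln (INR n)) by (simpl; ring).
  rewrite F1, F2, exp_plus. fold (Rpower (INR n) b).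
  assert (Pn := PP (S n)). assert (Pbn := PPb (S n)).
  set (g := exp (x * ln (INR n)) * Cmod (INR (fact n))).
  assert (Hg : 0 <= g) by (apply Rmult_le_pos; [left; apply exp_pos|apply Cmod_ge_0]).
  replace (2 ^ S k0 * 2 * (exp (x * ln (INR n)) * Rpower (INR n) b * Cmod (INR (fact n)) * / Pb (S n)))
    with (g * (2 ^ S k0 * (2 * Rpower (INR n) b) * / Pb (S n))) by (unfold g; ring).
  apply Rmult_le_compat_l; auto.
  apply Rmult_le_reg_r with (P (S n) * Pb (S n)); [now apply Rmult_lt_0_compat|].
  replace (/ P (S n) * (P (S n) * Pb (S n))) with (Pb (S n)) by (field; lra).
  replace (2 ^ S k0 * (2 * Rpower (INR n) b) * / Pb (S n) * (P (S n) * Pb (S n)))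
    with (2 ^ S k0 * (2 * Rpower (INR n) b) * P (S n)) by (field; lra).
  eapply Rle_trans; [apply B2|]. apply Rmult_le_compat_r; [lra|].
  apply Rmult_le_compat_l; [apply pow_le; lra|auto].
Qed.

Lemma Gam_add_nat (x : R) (N : nat) : exists K, 0 < K /\ forall y, 1 <= Rabs y ->
  Cmod (Gam (x + INR N, y)) <= K * (2 + Rabs y) ^ N * Cmod (Gam (x, y)).
Proof.
  induction N as [|N [K [HK IH]]].
  - exists 1. split; [lra|]. intros y _. simpl. rewrite Rplus_0_r. lra.
  - exists (2 * (Rabs (x + INR N) + 1) * K).
    assert (PX := Rabs_pos (x + INR N)). split; [nra|]. intros y Hy. specialize (IH y Hy).
    rewrite S_INR, <- Rplus_assoc.
    assert (Hy0 : y <> 0) by (intro E; rewrite E, Rabs_R0 in Hy; lra).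
    eapply Rle_trans; [apply Gam_succ; auto|].
    assert (C1 : Cmod (x + INR N, y) <= (Rabs (x + INR N) + 1) * (2 + Rabs y)).
    { eapply Rle_trans; [apply Cmod_le_abs|]. simpl. nra. }
    replace (2 * (Rabs (x + INR N) + 1) * K * (2 + Rabs y) ^ S N * Cmod (Gam (x, y)))
      with (2 * ((Rabs (x + INR N) + 1) * (2 + Rabs y)) * (K * (2 + Rabs y) ^ N * Cmod (Gam (x, y)))) by (simpl; ring).
    apply Rmult_le_compat; auto; [|apply Cmod_ge_0|lra]. assert (T := Cmod_ge_0 (x + INR N, y)). lra.
Qed.

(** Substitute for Stirling's formula: round [a] up to an integer, pay for the overshoot with
    [Gam_mono], and climb by the recurrence. *)
Lemma Gam_ratio (x a : R) : 0 <= a -> exists K N, 0 < K /\ forall y, 1 <= Rabs y ->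
  Cmod (Gam (x + a, y)) <= K * (2 + Rabs y) ^ N * Cmod (Gam (x, y)).
Proof.
  intros Ha. destruct (nfloor_ex a Ha) as [n Hn].
  destruct (Gam_mono (x + a) (INR (S n) - a)) as [K1 [HK1 M1]].
  { rewrite S_INR. lra. }
  destruct (Gam_add_nat x (S n)) as [K2 [HK2 M2]].
  exists (K1 * K2), (S n). split; [nra|]. intros y Hy. eapply Rle_trans; [now apply M1|].
  replace (x + a + (INR (S n) - a)) with (x + INR (S n)) by ring.
  rewrite !Rmult_assoc. apply Rmult_le_compat_l; [lra|]. rewrite <- Rmult_assoc. now apply M2.
Qed.

(** * Growth of functions in the Selberg class *)

Definition Fc (F : Cx -> Cx) (z : C) : C := toC (F (ofC z)).

(** The functional equation at -1 + it involves the Gamma factors on the lines -1 and 2. For |t| >=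
    t0 their arguments have imaginary part at least 1 in modulus, away from all poles. *)
Lemma Cmod_gamma_prod (r : nat) (lam : nat -> R) (mu : nat -> Cx) :
  (forall j, (j < r)%nat -> lam j > 0 /\ Defs.Re (mu j) >= 0) ->
  exists K N t0, 0 < K /\ forall t, t0 <= Rabs t ->
    (forall j, (j < r)%nat -> 1 <= Rabs (lam j * t + Defs.Im (mu j))) /\
    let P := fun x => Cnorm (Cprod r (fun j => CGamma (Cadd (Cmul (Defs.RtoC (lam j)) (mkC x t)) (mu j)))) in
    P 2 <= K * (2 + Rabs t) ^ N * P (-1) /\ 0 < P (-1).
Proof.
  intros H. induction r as [|r IH].
  - exists 1, 0%nat, 0. split; [lra|]. intros t _. split; [intros; lia|]. simpl.
    change (Cnorm Defs.C1) with (Cmod 1). rewrite Cmod_1. lra.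
  - destruct IH as [K [N [t0 [HK IH]]]]; [intros; apply H; lia|].
    destruct (H r ltac:(lia)) as [Hl _]. set (l := lam r) in *. set (m := mu r) in *.
    destruct (Gam_ratio (- l + Defs.Re m) (3 * l) ltac:(lra)) as [K' [N' [HK' R1]]].
    set (b := 2 + l + Rabs (Defs.Im m)). assert (Pm := Rabs_pos (Defs.Im m)).
    assert (Hb : 0 < b ^ N') by (apply pow_lt; unfold b; lra).
    exists (K * (K' * b ^ N')), (N + N')%nat, (Rmax t0 ((1 + Rabs (Defs.Im m)) / l)).
    split; [apply Rmult_lt_0_compat; [auto|now apply Rmult_lt_0_compat]|].
    intros t Ht.
    assert (Ht0 : t0 <= Rabs t) by (eapply Rle_trans; [apply Rmax_l|apply Ht]).
    assert (Ht1 : (1 + Rabs (Defs.Im m)) / l <= Rabs t) by (eapply Rle_trans; [apply Rmax_r|apply Ht]).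
    destruct (IH t Ht0) as [I1 [I2 I3]].
    set (y := l * t + Defs.Im m).
    assert (Hy : 1 <= Rabs y).
    { apply Rmult_le_compat_l with (r := l) in Ht1; [|lra].
      replace (l * ((1 + Rabs (Defs.Im m)) / l)) with (1 + Rabs (Defs.Im m)) in Ht1 by (field; lra).
      assert (T := Rabs_triang y (- Defs.Im m)). unfold y in T.
      replace (l * t + Defs.Im m + - Defs.Im m) with (l * t) in T by ring. rewrite Rabs_Ropp, Rabs_mult, (Rabs_pos_eq l) in T by lra.
      unfold y. lra. }
    assert (Hy2 : 2 + Rabs y <= b * (2 + Rabs t)).
    { unfold y. assert (T := Rabs_triang (l * t) (Defs.Im m)). rewrite Rabs_mult, (Rabs_pos_eq l) in T by lra.
      assert (T' := Rabs_pos t). unfold b. nra. }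
    split.
    { intros j Hj. destruct (Nat.eq_dec j r) as [->|Nj]; [exact Hy|]. apply I1. lia. }
    assert (Q : forall x, Cnorm (CGamma (Cadd (Cmul (Defs.RtoC l) (mkC x t)) m)) = Cmod (Gam (l * x + Defs.Re m, y))).
    { intros x. unfold Gam. change (Cnorm (CGamma (Cadd (Cmul (Defs.RtoC l) (mkC x t)) m))) with (Cmod (toC (CGamma (Cadd (Cmul (Defs.RtoC l) (mkC x t)) m)))).
      f_equal. f_equal. f_equal. unfold ofC, Cadd, Cmul, Defs.RtoC, y; simpl. f_equal; ring. }
    assert (M : forall z w, Cnorm (Cmul z w) = Cnorm z * Cnorm w).
    { intros z w. exact (Cmod_mult (toC z) (toC w)). }
    cbv beta zeta. simpl Cprod. fold l m. rewrite !M, !Q.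
    replace (l * 2 + Defs.Re m) with (- l + Defs.Re m + 3 * l) by ring.
    replace (l * -1 + Defs.Re m) with (- l + Defs.Re m) by ring.
    specialize (R1 y Hy).
    assert (Hy0 : y <> 0) by (intro E; rewrite E, Rabs_R0 in Hy; lra).
    assert (Gp : 0 < Cmod (Gam (- l + Defs.Re m, y))) by (apply Cmod_gt_0, Gam_lim, npole_im; auto).
    split; [|now apply Rmult_lt_0_compat].
    cbv beta zeta in I2, I3.
    set (P2 := Cnorm (Cprod r (fun j => CGamma (Cadd (Cmul (Defs.RtoC (lam j)) (mkC 2 t)) (mu j))))) in *.
    set (P1 := Cnorm (Cprod r (fun j => CGamma (Cadd (Cmul (Defs.RtoC (lam j)) (mkC (-1) t)) (mu j))))) in *.
    set (g := Cmod (Gam (- l + Defs.Re m, y))) in *.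
    assert (R2 : Cmod (Gam (- l + Defs.Re m + 3 * l, y)) <= K' * b ^ N' * (2 + Rabs t) ^ N' * g).
    { eapply Rle_trans; [apply R1|]. apply Rmult_le_compat_r; [lra|]. rewrite (Rmult_assoc K').
      apply Rmult_le_compat_l; [lra|]. rewrite <- Rpow_mult_distr. apply pow_incr. assert (T := Rabs_pos y). lra. }
    rewrite pow_add.
    replace (K * (K' * b ^ N') * ((2 + Rabs t) ^ N * (2 + Rabs t) ^ N') * (P1 * g))
      with (K * (2 + Rabs t) ^ N * P1 * (K' * b ^ N' * (2 + Rabs t) ^ N' * g)) by ring.
    apply Rmult_le_compat; auto; [|apply Cmod_ge_0]. apply (Cmod_ge_0 (toC (Cprod r (fun j => CGamma (Cadd (Cmul (Defs.RtoC (lam j)) (mkC 2 t)) (mu j)))))).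
Qed.

Fixpoint csum (f : nat -> C) (n : nat) : C :=
  match n with O => RtoC 0 | S k => (csum f k + f k)%C end.

Lemma toC_Csum (f : nat -> Cx) (n : nat) : toC (Csum n f) = csum (fun k => toC (f k)) n.
Proof. induction n as [|n IH]; [reflexivity|]. simpl csum. rewrite <- IH. reflexivity. Qed.

Lemma csum_norm (f : nat -> C) (n : nat) : Cmod (csum f (S n)) <= sum_f_R0 (fun k => Cmod (f k)) n.
Proof.
  induction n as [|n IH].
  - simpl. rewrite Cplus_0_l. lra.
  - change (csum f (S (S n))) with (csum f (S n) + f (S n))%C. simpl sum_f_R0.
    eapply Rle_trans; [apply Cmod_triangle|lra].
Qed.

Definition dterm (a : nat -> Cx) (s : C) (n : nat) : C :=
  (toC (a (S n)) * cexp (- s * ln (INR (S n))))%C.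

Lemma Cmod_dterm (a : nat -> Cx) (s : C) (n : nat) :
  Cmod (dterm a s n) = Cnorm (a (S n)) * Rpower (INR (S n)) (- fst s).
Proof.
  unfold dterm. rewrite Cmod_mult, Cmod_cexp. f_equal. unfold Rpower. f_equal. simpl. ring.
Qed.

Lemma dirichlet_lim (a : nat -> Cx) (s : C) (l : Cx) :
  Cseries_sum (fun n => Cmul (a (S n)) (Cpow_pos (INR (S n)) (Defs.Copp (ofC s)))) l ->
  limC (fun n => csum (dterm a s) (S n)) (toC l).
Proof.
  intros H e He. destruct (H e He) as [N HN]. exists N. intros n Hn. specialize (HN n Hn).
  change (Cmod (toC (Csum (S n) (fun n => Cmul (a (S n)) (Cpow_pos (INR (S n)) (Defs.Copp (ofC s))))) - toC l)%C < e) in HN.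
  rewrite toC_Csum in HN. exact HN.
Qed.

Lemma ex_min (P : nat -> Prop) (n : nat) : P n -> exists m, P m /\ forall k, (k < m)%nat -> ~ P k.
Proof.
  induction n as [n IH] using lt_wf_ind. intros Hn.
  destruct (classic (exists k, (k < n)%nat /\ P k)) as [[k [Hk Pk]]|H].
  - now apply (IH k).
  - exists n. split; auto. intros k Hk Pk. apply H. now exists k.
Qed.

Section Growth.
Variables (F : Cx -> Cx) (a : nat -> Cx) (m r : nat) (Q : R) (lam : nat -> R) (mu : nat -> Cx) (epsF : Cx).
Hypotheses (HS : selberg_data F a m r Q lam mu epsF) (HGRH : GRH F m r lam mu).

Lemma no_gamma_pole (s : Cx) : Defs.Re s > 0 -> ~ gamma_pole_at r lam mu s.
Proof.
  intros Hs [j [Hj [k Hk]]]. destruct HS as [_ [_ [_ [Hl _]]]]. destruct (Hl j Hj) as [H1 H2].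
  apply (f_equal Defs.Re) in Hk. simpl in Hk. assert (T := pos_INR k). nra.
Qed.

(** Zeros at poles of the Gamma factors escape [GRH], but as lam > 0 and Re mu >= 0 these poles lie
    in Re s <= 0. *)
Lemma Fc_nz (z : C) : 1/2 < fst z -> m = 0%nat \/ z <> 1 -> Fc F z <> 0.
Proof.
  intros Hz H1 E. assert (E' : F (ofC z) = C0) by (apply toC_inj; exact E).
  assert (T := HGRH (ofC z) E'). simpl in T.
  assert (fst z = 1/2); [|lra]. apply T.
  - destruct H1 as [H1|H1]; [now left|right]. intro E1. apply H1. rewrite <- (toC_ofC z), E1. reflexivity.
  - apply no_gamma_pole. simpl. lra.
Qed.

Lemma abs_sum_2 : exists l, 0 < l /\ forall N, sum_f_R0 (fun n => Cnorm (a (S n)) * Rpower (INR (S n)) (- 2)) N <= l.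
Proof.
  destruct HS as [H _]. destruct (H (mkC 2 0) ltac:(simpl; lra)) as [[l Hl] _]. simpl in Hl.
  exists (Rabs l + 1). assert (T := Rabs_pos l). split; [lra|]. intros N.
  apply Rle_trans with l; [|assert (T' := Rle_abs l); lra].
  apply sum_incr; auto. intros n. apply Rmult_le_pos; [apply (Cmod_ge_0 (toC (a (S n))))|left; apply exp_pos].
Qed.

Lemma INR_S_ge1 (n : nat) : 1 <= INR (S n).
Proof. rewrite S_INR. assert (T := pos_INR n). lra. Qed.

Lemma Fc_upper : exists S2, 0 < S2 /\ forall z, 2 <= fst z -> Cmod (Fc F z) <= S2.
Proof.
  destruct abs_sum_2 as [l [Hl Hs]]. exists l. split; auto. intros z Hz.
  destruct HS as [H _]. destruct (H (ofC z) ltac:(simpl; lra)) as [_ Hc].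
  apply dirichlet_lim in Hc. fold (Fc F z) in Hc.
  rewrite <- (Rmult_1_r l), <- Cmod_1.
  apply (limC_Cmod_le _ (fun _ => RtoC 1) _ _ _ 0 Hc); [|lra|].
  - intros e He. exists 0%nat. intros n _. replace (1 - 1)%C with (RtoC 0) by ring. now rewrite Cmod_0.
  - intros n _. rewrite Cmod_1, Rmult_1_r. eapply Rle_trans; [apply csum_norm|].
    eapply Rle_trans; [|apply (Hs n)]. apply sum_Rle. intros k _. rewrite Cmod_dterm.
    apply Rmult_le_compat_l; [apply (Cmod_ge_0 (toC (a (S k))))|]. apply Rle_Rpower; [apply INR_S_ge1|lra].
Qed.

(** Far to the right the first nonzero coefficient dominates the Dirichlet series. Such a
    coefficient exists, since otherwise F would vanish at 2. *)
Lemma Fc_lower : exists c kap, 5 <= c /\ 0 < kap /\ forall t, kap <= Cmod (Fc F (c, t)).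
Proof.
  destruct abs_sum_2 as [l [Hl Hs]].
  assert (Ex : exists n, Cnorm (a (S n)) <> 0).
  { apply NNPP. intro Hn. assert (F2 : Fc F (2, 0) <> 0).
    { apply Fc_nz; [simpl; lra|right]. intro E. apply (f_equal fst) in E. simpl in E. lra. }
    apply F2. destruct HS as [H _]. destruct (H (ofC (2, 0)) ltac:(simpl; lra)) as [_ Hc].
    apply dirichlet_lim in Hc. fold (Fc F (2, 0)) in Hc.
    apply Cmod_eq_0. apply Rle_antisym; [|apply Cmod_ge_0]. apply Rle_trans with (0 * Cmod 1); [|lra].
    apply (limC_Cmod_le _ (fun _ => RtoC 1) _ _ _ 0 Hc); [|lra|].
    - intros e He. exists 0%nat. intros n _. replace (1 - 1)%C with (RtoC 0) by ring. now rewrite Cmod_0.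
    - intros n _. rewrite Rmult_0_l. eapply Rle_trans; [apply csum_norm|]. right.
      rewrite (sum_eq _ (fun _ => 0)); [rewrite sum_cte; ring|]. intros k _. rewrite Cmod_dterm.
      destruct (Req_dec (Cnorm (a (S k))) 0) as [->|N]; [ring|]. elim Hn. now exists k. }
  destruct Ex as [n1 Hn1]. destruct (ex_min (fun n => Cnorm (a (S n)) <> 0) n1 Hn1) as [n0 [Hn0 Hmin]].
  assert (Pa : 0 < Cnorm (a (S n0))) by (assert (T := Cmod_ge_0 (toC (a (S n0)))); change (0 <= Cnorm (a (S n0))) in T; lra).
  set (al := Cnorm (a (S n0))) in *. set (A := INR (S n0)). assert (HA : 1 <= A) by apply INR_S_ge1.
  (* Chosen so that the tail is at most half of the leading term once ((A+1)/A)^c >= W. *)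
  set (W := 2 * l * (A + 1) ^ 2 / al + 1). assert (HW : 0 < W).
  { unfold W. assert (0 < 2 * l * (A + 1) ^ 2 / al) by (apply Rdiv_lt_0_compat; nra). lra. }
  set (rho := ln ((A + 1) / A)).
  assert (Hrho : 0 < rho).
  { unfold rho. rewrite <- ln_1. apply ln_increasing; [lra|]. apply Rmult_lt_reg_r with A; [lra|].
    unfold Rdiv. rewrite Rmult_assoc, Rinv_l by lra. lra. }
  (* The lower limit 5 serves the inversion on the line Re z = c, where coefficients of size n^2
     have to be summed with room to spare. *)
  set (c := Rmax 5 (ln W / rho)). assert (Hc5 : 5 <= c) by apply Rmax_l.
  assert (HcW : W <= Rpower ((A + 1) / A) c).
  { rewrite <- (exp_ln W) by auto. unfold Rpower. fold rho. apply exp_le_compat.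
    apply Rmult_le_reg_r with (/ rho); [now apply Rinv_0_lt_compat|]. rewrite Rmult_assoc, Rinv_r, Rmult_1_r by lra. apply Rmax_r. }
  set (q := Rpower (A + 1) (- (c - 2))).
  exists c, (al * Rpower A (- c) / 2). split; auto.
  assert (PAc : 0 < Rpower A (- c)) by apply exp_pos. split; [nra|]. intros t.
  destruct HS as [H _]. destruct (H (ofC (c, t)) ltac:(simpl; lra)) as [_ Hc].
  apply dirichlet_lim in Hc. fold (Fc F (c, t)) in Hc.
  assert (tail : forall j, Cmod (csum (dterm a (c, t)) (S (n0 + j)) - dterm a (c, t) n0)%C
    <= q * sum_f_R0 (fun n => Cnorm (a (S n)) * Rpower (INR (S n)) (- 2)) (n0 + j)).
  { induction j as [|j IH].
    - rewrite Nat.add_0_r. simpl csum.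
      assert (Z : forall k, (k <= n0)%nat -> csum (dterm a (c, t)) k = 0).
      { induction k as [|k IHk]; [reflexivity|]. intros Hk. simpl. rewrite IHk by lia.
        rewrite Cplus_0_l. apply Cmod_eq_0. rewrite Cmod_dterm.
        destruct (Req_dec (Cnorm (a (S k))) 0) as [->|N]; [ring|]. elim (Hmin k ltac:(lia)); auto. }
      rewrite Z by lia. replace (0 + dterm a (c, t) n0 - dterm a (c, t) n0)%C with (RtoC 0) by ring. rewrite Cmod_0.
      apply Rmult_le_pos; [left; apply exp_pos|]. apply cond_pos_sum. intros k.
      apply Rmult_le_pos; [apply (Cmod_ge_0 (toC (a (S k))))|left; apply exp_pos].
    - rewrite Nat.add_succ_r. set (k := S (n0 + j)) in *.
      change (csum (dterm a (c, t)) (S k)) with (csum (dterm a (c, t)) k + dterm a (c, t) k)%C.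
      replace (csum (dterm a (c, t)) k + dterm a (c, t) k - dterm a (c, t) n0)%C
        with ((csum (dterm a (c, t)) k - dterm a (c, t) n0) + dterm a (c, t) k)%C by ring.
      eapply Rle_trans; [apply Cmod_triangle|]. unfold k at 3. simpl sum_f_R0. fold k.
      rewrite Rmult_plus_distr_l. apply Rplus_le_compat; auto. rewrite Cmod_dterm. simpl fst.
      assert (Hk : A + 1 <= INR (S k)).
      { unfold A. rewrite <- S_INR. apply le_INR. unfold k. lia. }
      replace (- c) with (- (c - 2) + - 2) by ring. rewrite Rpower_plus.
      assert (E : Rpower (INR (S k)) (- (c - 2)) <= q).
      { unfold q. rewrite !Rpower_Ropp. apply Rinv_le_contravar; [apply exp_pos|].
        apply Rle_Rpower_l; lra. }
      assert (0 <= Cnorm (a (S k))) by apply (Cmod_ge_0 (toC (a (S k)))).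
      assert (0 < Rpower (INR (S k)) (- 2)) by apply exp_pos.
      change (Cnorm (a (S k)) * (Rpower (INR (S k)) (- (c - 2)) * Rpower (INR (S k)) (- 2)) <= q * (Cnorm (a (S k)) * Rpower (INR (S k)) (- 2))).
      replace (q * (Cnorm (a (S k)) * Rpower (INR (S k)) (- 2))) with (Cnorm (a (S k)) * (q * Rpower (INR (S k)) (- 2))) by ring.
      apply Rmult_le_compat_l; auto. apply Rmult_le_compat_r; lra. }
  assert (qs : q * l <= al * Rpower A (- c) / 2).
  { unfold q. replace (- (c - 2)) with (2 + - c) by ring. rewrite Rpower_plus.
    replace (Rpower (A + 1) 2) with ((A + 1) ^ 2) by (symmetry; apply (Rpower_pow 2); lra).
    assert (E : Rpower (A + 1) (- c) * Rpower ((A + 1) / A) c = Rpower A (- c)).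
    { unfold Rpower. rewrite <- exp_plus. f_equal. rewrite ln_div by lra. ring. }
    rewrite <- E. assert (P1 : 0 < Rpower (A + 1) (- c)) by apply exp_pos.
    assert (X : 2 * l * (A + 1) ^ 2 <= al * W).
    { unfold W. replace (al * (2 * l * (A + 1) ^ 2 / al + 1)) with (2 * l * (A + 1) ^ 2 + al) by (field; lra). lra. }
    assert (al * W <= al * Rpower ((A + 1) / A) c) by (apply Rmult_le_compat_l; lra).
    assert (Rpower (A + 1) (- c) * (2 * l * (A + 1) ^ 2) <= Rpower (A + 1) (- c) * (al * Rpower ((A + 1) / A) c)) by (apply Rmult_le_compat_l; lra).
    lra. }
  apply (limC_Cmod_ge _ _ _ n0 Hc). intros n Hn. replace n with (n0 + (n - n0))%nat by lia.
  specialize (tail (n - n0)%nat). specialize (Hs (n0 + (n - n0))%nat).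
  assert (T := Cmod_sub_le (dterm a (c, t) n0) (csum (dterm a (c, t)) (S (n0 + (n - n0))))).
  rewrite (Cmod_sub_sym (dterm a (c, t) n0)), Cmod_dterm in T. fold al A in T. change (fst (c, t)) with c in T.
  assert (q * sum_f_R0 (fun n => Cnorm (a (S n)) * Rpower (INR (S n)) (- 2)) (n0 + (n - n0)) <= q * l)
    by (apply Rmult_le_compat_l; [left; apply exp_pos|auto]).
  lra.
Qed.

(** The functional equation reflects -1 + it to 2 + it, where F is bounded; the quotient of the
    Gamma factors is polynomial in t. *)
Lemma Fc_left : exists K N t0, 0 < K /\ forall t, t0 <= Rabs t -> Cmod (Fc F (-1, t)) <= K * (2 + Rabs t) ^ N.
Proof.
  destruct Fc_upper as [S2 [HS2 U2]].
  destruct HS as [_ [_ [HQ [Hl [He [FE _]]]]]].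
  destruct (Cmod_gamma_prod r lam mu Hl) as [K [N [t0 [HK GP]]]].
  exists (Rpower Q 3 * K * S2), N, (Rmax t0 1).
  split; [repeat apply Rmult_lt_0_compat; auto; apply exp_pos|]. intros t Ht.
  assert (Ht0 : t0 <= Rabs t) by (eapply Rle_trans; [apply Rmax_l|apply Ht]).
  assert (Ht1 : 1 <= Rabs t) by (eapply Rle_trans; [apply Rmax_r|apply Ht]).
  assert (Htn : t <> 0) by (intro E; rewrite E, Rabs_R0 in Ht1; lra).
  destruct (GP t Ht0) as [Hy [G1 G2]]. cbv beta zeta in G1, G2.
  assert (np : forall x, ~ gamma_pole_at r lam mu (mkC x t)).
  { intros x [j [Hj [k Hk]]]. apply (f_equal Defs.Im) in Hk. simpl in Hk. specialize (Hy j Hj).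
    replace (lam j * t + Defs.Im (mu j)) with 0 in Hy by lra. rewrite Rabs_R0 in Hy. lra. }
  assert (E1 : Csub Defs.C1 (Defs.Cconj (mkC (-1) t)) = mkC 2 t) by (unfold Csub, Cadd, Defs.Copp, Defs.Cconj, Defs.C1, Defs.RtoC; simpl; f_equal; ring).
  assert (FEt := FE (mkC (-1) t)). rewrite E1 in FEt.
  specialize (FEt ltac:(intro E; apply (f_equal Defs.Re) in E; simpl in E; lra) ltac:(intro E; apply (f_equal Defs.Re) in E; simpl in E; lra) (np _) (np _)).
  apply (f_equal Cnorm) in FEt. unfold Phi, gamma_factor in FEt.
  assert (M : forall z w, Cnorm (Cmul z w) = Cnorm z * Cnorm w) by (intros z w; exact (Cmod_mult (toC z) (toC w))).
  assert (Cj : forall z, Cnorm (Defs.Cconj z) = Cnorm z) by (intros z; exact (Cmod_conj (toC z))).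
  rewrite M, M, M, He, Cj, M, M in FEt.
  assert (EQ : forall x, Cnorm (Cpow_pos Q (mkC x t)) = Rpower Q x).
  { intros x. change (Cnorm (Cpow_pos Q (mkC x t))) with (Cmod (cexp (toC (Cmul (mkC x t) (Defs.RtoC (ln Q)))))).
    rewrite Cmod_cexp. unfold Rpower. f_equal. simpl. ring. }
  rewrite !EQ in FEt. specialize (U2 (2, t) ltac:(simpl; lra)).
  change (Cmod (Fc F (-1, t))) with (Cnorm (F (mkC (-1) t))). change (Cmod (Fc F (2, t))) with (Cnorm (F (mkC 2 t))) in U2.
  set (P2 := Cnorm (Cprod r (fun j => CGamma (Cadd (Cmul (Defs.RtoC (lam j)) (mkC 2 t)) (mu j))))) in *.
  set (P1 := Cnorm (Cprod r (fun j => CGamma (Cadd (Cmul (Defs.RtoC (lam j)) (mkC (-1) t)) (mu j))))) in *.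
  assert (Q1 : 0 < Rpower Q (-1)) by apply exp_pos. assert (Q3 : 0 < Rpower Q 3) by apply exp_pos.
  assert (Q2 : Rpower Q 2 = Rpower Q (-1) * Rpower Q 3) by (rewrite <- Rpower_plus; f_equal; ring).
  assert (F2 : 0 <= Cnorm (F (mkC 2 t))) by apply (Cmod_ge_0 (toC (F (mkC 2 t)))).
  assert (PP2 : 0 <= P2) by apply (Cmod_ge_0 (toC (Cprod r (fun j => CGamma (Cadd (Cmul (Defs.RtoC (lam j)) (mkC 2 t)) (mu j)))))).
  apply Rmult_le_reg_l with (Rpower Q (-1) * P1); [now apply Rmult_lt_0_compat|].
  rewrite FEt, Q2, Rmult_1_l.
  apply Rle_trans with (Rpower Q (-1) * Rpower Q 3 * (K * (2 + Rabs t) ^ N * P1) * S2); [|right; ring].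
  apply Rmult_le_compat; auto.
  - apply Rmult_le_pos; [apply Rmult_le_pos; lra|auto].
  - apply Rmult_le_compat_l; [apply Rmult_le_pos; lra|auto].
Qed.

Lemma contP_bounded (f : R -> C) (a0 b0 : R) : a0 <= b0 -> (forall t, a0 <= t <= b0 -> contP f t) ->
  exists M, 0 < M /\ forall t, a0 <= t <= b0 -> Cmod (f t) <= M.
Proof.
  intros Hab Hf.
  assert (Hb : forall g : R -> R, (forall t, a0 <= t <= b0 -> continuous g t) ->
    exists M, forall t, a0 <= t <= b0 -> Rabs (g t) <= M).
  { intros g Hg. destruct (continuity_ab_maj (fun t => Rabs (g t)) a0 b0 Hab) as [x [Hx _]].
    - intros t Ht. apply (continuity_pt_comp g Rabs); [|apply Rcontinuity_abs].
      apply continuity_pt_filterlim. now apply Hg.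
    - exists (Rabs (g x)). intros t Ht. now apply Hx. }
  destruct (Hb (fun t => fst (f t)) ltac:(intros; now apply Hf)) as [M1 H1].
  destruct (Hb (fun t => snd (f t)) ltac:(intros; now apply Hf)) as [M2 H2].
  exists (Rabs M1 + Rabs M2 + 1). assert (T1 := Rabs_pos M1). assert (T2 := Rabs_pos M2). split; [lra|].
  intros t Ht. eapply Rle_trans; [apply Cmod_le_abs|]. specialize (H1 t Ht). specialize (H2 t Ht).
  assert (T3 := Rle_abs M1). assert (T4 := Rle_abs M2). lra.
Qed.

(** G = (s - 1)^m F is polynomially bounded on Re z = -1 by reflection, in the strip up to Re z = 2
    by Phragmen-Lindelof, and beyond it by the Dirichlet series; [logderiv_bound] then applies with
    s0 = 1/2. One line Re z = c serves every distance [e]. *)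
Lemma selberg_logderiv : exists (G G' : C -> C) (c : R), 5 <= c /\
  (forall z, isD G z (G' z)) /\ (forall z, 1/2 < fst z -> G z <> 0) /\
  (forall z, 1 < fst z -> G z = ((z - 1) ^ m * Fc F z)%C) /\
  forall e, 0 < e <= 1 -> exists B, 0 < B /\ forall x t, 1/2 + e <= x <= c ->
    Cmod (G' (x, t) / G (x, t))%C <= B * ln (3 + Rabs t).
Proof.
  assert (HS' := HS). destruct HS' as [_ [[G0 [EG [[A [k [HA [Hk FO]]]] [GF G1]]]] _]].
  set (G := fun z => toC (G0 (ofC z))).
  assert (DG : forall z, exists d, isD G z d).
  { intros z. destruct (EG (ofC z)) as [d Hd]. exists (toC d). rewrite <- (toC_ofC z). now apply toC_isD. }
  set (G' := fun z => proj1_sig (constructive_indefinite_description _ (DG z))).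
  assert (HG' : forall z, isD G z (G' z)) by (intros z; unfold G'; destruct (constructive_indefinite_description _ (DG z)); auto).
  assert (GE : forall z : C, (m = 0%nat \/ z <> 1) -> G z = ((z - 1) ^ m * Fc F z)%C).
  { intros z Hz. unfold G. rewrite GF.
    - change (toC (Cmul (Defs.Cpow (Csub (ofC z) Defs.C1) m) (F (ofC z)))) with (toC (Defs.Cpow (Csub (ofC z) Defs.C1) m) * Fc F z)%C.
      rewrite toC_pow. reflexivity.
    - destruct Hz as [Hz|Hz]; [now left|right]. intro E. apply Hz. rewrite <- (toC_ofC z), E. reflexivity. }
  (* At z = 1 with m > 0 the value of G is nonzero because m is the exact order of the pole. *)
  assert (NZ : forall z, 1/2 < fst z -> G z <> 0).
  { intros z Hz. destruct (Nat.eq_dec m 0) as [M0|M0].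
    - rewrite GE by auto. rewrite M0. simpl. rewrite Cmult_1_l. apply Fc_nz; auto.
    - destruct (Ceq_dec z 1) as [->|N1].
      + intro E. apply G1; [lia|]. apply toC_inj. exact E.
      + rewrite GE by auto. apply Cmult_neq_0; [|apply Fc_nz; auto].
        apply Cpow_nz. intro E. apply N1. now apply Csub_0_eq. }
  assert (FO' : forall z, Cmod (G z) <= A * exp (Rpower (Cmod z) k)) by (intros z; apply (FO (ofC z))).
  destruct Fc_upper as [S2 [HS2 U2]]. destruct Fc_left as [K1 [N [t0 [HK1 L1]]]].
  destruct Fc_lower as [c [kap [Hc [Hkap Lo]]]].
  assert (pw : forall t (i j : nat), (i <= j)%nat -> (2 + Rabs t) ^ i <= (2 + Rabs t) ^ j).
  { intros t i j Hij. apply Rle_pow; auto. assert (T := Rabs_pos t). lra. }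
  assert (ne1 : forall x t, x <> 1 -> ((x, t) : C) <> 1) by (intros x t Hx E; apply (f_equal fst) in E; simpl in E; lra).
  assert (sm : forall x t, Cmod ((x, t) - 1)%C ^ m <= (Rabs x + 1) ^ m * (2 + Rabs t) ^ m).
  { intros x t. rewrite <- Rpow_mult_distr. apply pow_incr. split; [apply Cmod_ge_0|].
    eapply Rle_trans; [apply Cmod_le_abs|]. simpl. rewrite Ropp_0, Rplus_0_r.
    assert (T := Rabs_triang x (- (1))). rewrite Rabs_Ropp, Rabs_R1 in T.
    assert (T1 := Rabs_pos x). assert (T2 := Rabs_pos t). nra. }
  assert (Rgt : forall x t, 2 <= x -> Cmod (G (x, t)) <= S2 * (Rabs x + 1) ^ m * (2 + Rabs t) ^ (N + m)).
  { intros x t Hx. rewrite GE by (right; apply ne1; lra). rewrite Cmod_mult, Cmod_pow.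
    specialize (U2 (x, t) Hx). specialize (sm x t). specialize (pw t m (N + m)%nat ltac:(lia)).
    assert (P1 := Cmod_ge_0 (Fc F (x, t))). assert (P2 : 0 <= Cmod ((x, t) - 1)%C ^ m) by (apply pow_le, Cmod_ge_0).
    assert (P3 : 0 <= (Rabs x + 1) ^ m) by (apply pow_le; assert (T := Rabs_pos x); lra).
    apply Rle_trans with (((Rabs x + 1) ^ m * (2 + Rabs t) ^ m) * S2); [apply Rmult_le_compat; auto|].
    replace (S2 * (Rabs x + 1) ^ m * (2 + Rabs t) ^ (N + m)) with ((Rabs x + 1) ^ m * (2 + Rabs t) ^ (N + m) * S2) by ring.
    apply Rmult_le_compat_r; [lra|]. apply Rmult_le_compat_l; auto. }
  (* The reflection bound holds only for |t| >= t0; the remaining segment is compact. *)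
  assert (Lft : exists K2, 0 < K2 /\ forall t, Cmod (G (-1, t)) <= K2 * (2 + Rabs t) ^ (N + m)).
  { destruct (contP_bounded (fun t => G (-1, t)) (- Rabs t0) (Rabs t0)) as [M [HM BM]].
    - assert (T := Rabs_pos t0). lra.
    - intros t _. apply contC_vert. eapply isD_contC, HG'.
    - exists (M + 2 ^ m * K1). assert (P2 : 0 < 2 ^ m) by (apply pow_lt; lra).
      split; [nra|]. intros t. assert (P3 : 1 <= (2 + Rabs t) ^ (N + m)) by (apply pow_R1_Rle; assert (T := Rabs_pos t); lra).
      destruct (Rle_lt_dec t0 (Rabs t)) as [Ht|Ht].
      + rewrite GE by (right; apply ne1; lra). rewrite Cmod_mult, Cmod_pow.
        specialize (L1 t Ht). specialize (sm (-1) t). replace (Rabs (-1) + 1) with 2 in sm by (rewrite Rabs_left; lra).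
        apply Rle_trans with (2 ^ m * (2 + Rabs t) ^ m * (K1 * (2 + Rabs t) ^ N)).
        * apply Rmult_le_compat; auto; [apply pow_le|]; apply Cmod_ge_0.
        * rewrite pow_add. assert (0 < (2 + Rabs t) ^ N * (2 + Rabs t) ^ m) by (rewrite <- pow_add; lra). nra.
      + assert (T : Cmod (G (-1, t)) <= M).
        { apply BM. apply Rabs_le_between. assert (T := Rle_abs t0). lra. }
        assert (0 < 2 ^ m * K1) by (now apply Rmult_lt_0_compat). nra. }
  destruct Lft as [K2 [HK2 Lft]].
  destruct (phragmen_lindelof G (-1) 2 A k (K2 + S2 * 3 ^ m) (N + m)) as [K3 [HK3 PL]]; auto; try lra.
  { assert (0 < 3 ^ m) by (apply pow_lt; lra). nra. }
  { intros t. eapply Rle_trans; [apply Lft|]. apply Rmult_le_compat_r; [apply pow_le; assert (T := Rabs_pos t); lra|].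
    assert (0 < S2 * 3 ^ m) by (apply Rmult_lt_0_compat; [auto|apply pow_lt; lra]). lra. }
  { intros t. eapply Rle_trans; [apply Rgt; lra|]. rewrite (Rabs_pos_eq 2) by lra. replace (2 + 1) with 3 by ring.
    apply Rmult_le_compat_r; [apply pow_le; assert (T := Rabs_pos t); lra|lra]. }
  exists G, G', c. split; [auto|]. split; [auto|]. split; [auto|]. split.
  { intros z Hz. apply GE. right. intro E. rewrite E in Hz. simpl in Hz. lra. }
  intros e He.
  set (K4 := K3 + S2 * (c + 2) ^ m).
  assert (HP : 0 < S2 * (c + 2) ^ m) by (apply Rmult_lt_0_compat; [auto|apply pow_lt; lra]).
  apply (logderiv_bound G G' (1/2) c K4 kap e (N + m)); auto; try lra; [unfold K4; lra| |].
  - intros [x t] Hx. simpl in Hx |- *.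
    assert (P3 : 0 <= (2 + Rabs t) ^ (N + m)) by (apply pow_le; assert (T := Rabs_pos t); lra).
    destruct (Rle_lt_dec x 2) as [Hx2|Hx2].
    + eapply Rle_trans; [apply PL; simpl; lra|]. simpl. apply Rmult_le_compat_r; auto. unfold K4; lra.
    + eapply Rle_trans; [apply Rgt; lra|]. apply Rmult_le_compat_r; auto. rewrite Rabs_pos_eq by lra.
      assert ((x + 1) ^ m <= (c + 2) ^ m) by (apply pow_incr; lra).
      assert (S2 * (x + 1) ^ m <= S2 * (c + 2) ^ m) by (apply Rmult_le_compat_l; lra). unfold K4. lra.
  - intros t. eapply Rle_trans; [apply Lo|]. rewrite GE by (right; apply ne1; lra).
    rewrite Cmod_mult, Cmod_pow. rewrite <- (Rmult_1_l (Cmod (Fc F (c, t)))) at 1.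
    apply Rmult_le_compat_r; [apply Cmod_ge_0|]. apply pow_R1_Rle.
    assert (T := fst_le_Cmod ((c, t) - 1)%C). simpl in T. rewrite Rabs_pos_eq in T by lra. lra.
Qed.
End Growth.

(** * A truncated Perron formula *)

(** Perron's kernel for sums integrated once: the factor 1/(z + 1) makes it absolutely integrable on
    vertical lines. The value p = 0 serves the coefficients, p = 1 the linear term m x. *)
Definition kern (p v : R) (z : C) : C := (cexp ((z + 1) * v) / ((z - p) * (z + 1)))%C.

Lemma isD_cexp_lin (a b z : C) : isD (fun z => cexp ((z + a) * b))%C z (cexp ((z + a) * b) * b)%C.
Proof.
  apply (isD_comp cexp (fun z => (z + a) * b)%C); [|apply isD_cexp].
  eapply isD_eq; [|apply isD_mult; [apply isD_plus; [apply isD_id|apply isD_const]|apply isD_const]].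
  cbv beta. ring.
Qed.

Lemma isD_shift (a z : C) : isD (fun z => z + a)%C z 1.
Proof. eapply isD_eq; [|apply isD_plus; [apply isD_id|apply isD_const]]. ring. Qed.

Lemma isD_shift' (a z : C) : isD (fun z => z - a)%C z 1.
Proof. eapply isD_eq; [|apply isD_minus; [apply isD_id|apply isD_const]]. ring. Qed.

Lemma Cne (z w : C) : z <> w -> (z - w)%C <> 0.
Proof. intros H E. apply H. now apply Csub_0_eq. Qed.

Lemma isD_kern (p v : R) (z : C) : (z - p)%C <> 0 -> (z + 1)%C <> 0 -> exists d, isD (kern p v) z d.
Proof.
  intros H1 H2. eexists. unfold kern. apply isD_div; [now apply Cmult_neq_0|apply isD_cexp_lin|].
  apply isD_mult; [apply isD_shift'|apply isD_shift].
Qed.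

Lemma Cmod_kern (p v : R) (z : C) : (z - p)%C <> 0 -> (z + 1)%C <> 0 ->
  Cmod (kern p v z) = exp ((fst z + 1) * v) / (Cmod (z - p)%C * Cmod (z + 1)%C).
Proof.
  intros H1 H2. unfold kern. rewrite Cmod_div by (now apply Cmult_neq_0). rewrite Cmod_mult, Cmod_cexp.
  f_equal. f_equal. simpl. ring.
Qed.

Lemma RInt_atan_le (q T a b : R) : 0 < T -> a <= b ->
  ex_RInt (fun x => / ((x - q) ^ 2 + T ^ 2)) a b /\ RInt (fun x => / ((x - q) ^ 2 + T ^ 2)) a b <= PI / T.
Proof.
  intros HT Hab.
  assert (E : ex_RInt (fun x => / ((x - q) ^ 2 + T ^ 2)) a b).
  { apply (ex_RInt_continuous (V := R_CompleteNormedModule)). intros t _.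
    apply (ex_derive_continuous (V := R_NormedModule)).
    assert (0 < T ^ 2) by nra. assert (T' := pow2_ge_0 (t - q)). auto_derive. simpl in *. lra. }
  split; auto.
  assert (K := RInt_atan_kernel q T a b ltac:(lra)).
  assert (K2 : RInt (fun t => T / ((t - q) ^ 2 + T ^ 2)) a b = T * RInt (fun x => / ((x - q) ^ 2 + T ^ 2)) a b).
  { apply (RInt_scal (V := R_CompleteNormedModule) (fun x => / ((x - q) ^ 2 + T ^ 2)) a b T E). }
  rewrite K2 in K. assert (B1 := atan_bound ((b - q) / T)). assert (B2 := atan_bound ((a - q) / T)).
  apply Rmult_le_reg_l with T; auto. rewrite K. replace (T * (PI / T)) with PI by (field; lra). lra.
Qed.

Lemma kern_nz (p x y : R) : y <> 0 -> ((x, y) - p)%C <> 0 /\ ((x, y) + 1)%C <> 0.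
Proof. intros Hy. split; intro E; apply (f_equal snd) in E; simpl in E; lra. Qed.

(** 1/(|z - p||z + 1|) is at most the mean of the two inverse squares, and each of these integrates
    to at most PI/|y|, whatever the length of the segment. *)
Lemma kern_horiz (p v a b y M : R) : a <= b -> y <> 0 ->
  (forall x, a <= x <= b -> exp ((x + 1) * v) <= M) ->
  exCI (fun x => kern p v (x, y)) a b /\ Cmod (CI (fun x => kern p v (x, y)) a b) <= M * (PI / Rabs y).
Proof.
  intros Hab Hy HM.
  assert (Py : 0 < Rabs y) by (now apply Rabs_pos_lt).
  assert (EX : exCI (fun x => kern p v (x, y)) a b).
  { apply contP_ab; auto. intros x _. apply contC_horiz. destruct (kern_nz p x y Hy) as [N1 N2].
    destruct (isD_kern p v (x, y) N1 N2) as [d Hd]. now apply isD_contC with d. }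
  split; auto.
  destruct (RInt_atan_le p (Rabs y) a b Py Hab) as [E1 B1].
  destruct (RInt_atan_le (-1) (Rabs y) a b Py Hab) as [E2 B2].
  assert (M0 : 0 <= M) by (eapply Rle_trans; [|apply (HM a); lra]; left; apply exp_pos).
  eapply Rle_trans.
  - apply (CI_norm _ (fun x => M / 2 * / ((x - p) ^ 2 + Rabs y ^ 2) + M / 2 * / ((x - -1) ^ 2 + Rabs y ^ 2)) a b); auto.
    + now apply exRInt_lin.
    + intros x Hx. destruct (kern_nz p x y Hy) as [N1 N2]. rewrite Cmod_kern by auto. simpl fst.
      assert (P1 := proj1 (Cmod_gt_0 _) N1). assert (P2 := proj1 (Cmod_gt_0 _) N2).
      assert (S1 : Cmod ((x, y) - p)%C ^ 2 = (x - p) ^ 2 + Rabs y ^ 2).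
      { rewrite Cmod2_alt, pow2_abs. unfold Re, Im; simpl. ring. }
      assert (S2 : Cmod ((x, y) + 1)%C ^ 2 = (x - -1) ^ 2 + Rabs y ^ 2).
      { rewrite Cmod2_alt, pow2_abs. unfold Re, Im; simpl. ring. }
      rewrite <- S1, <- S2. set (u := Cmod ((x, y) - p)%C) in *. set (w := Cmod ((x, y) + 1)%C) in *.
      specialize (HM x ltac:(lra)).
      apply Rle_trans with (M / (u * w)).
      { apply Rmult_le_compat_r; [left; apply Rinv_0_lt_compat; nra|auto]. }
      replace (M / (u * w)) with (M * (/ u * / w)) by (field; lra).
      replace (M / 2 * / u ^ 2 + M / 2 * / w ^ 2) with (M * ((/ u * / u + / w * / w) / 2)) by (field; lra).
      apply Rmult_le_compat_l; auto. assert (T := pow2_ge_0 (/ u - / w)). nra.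
  - rewrite RInt_lin by auto.
    assert (M / 2 * RInt (fun x => / ((x - p) ^ 2 + Rabs y ^ 2)) a b <= M / 2 * (PI / Rabs y)) by (apply Rmult_le_compat_l; lra).
    assert (M / 2 * RInt (fun x => / ((x - -1) ^ 2 + Rabs y ^ 2)) a b <= M / 2 * (PI / Rabs y)) by (apply Rmult_le_compat_l; lra).
    lra.
Qed.

Lemma kern_vert (p v x T d : R) : 0 < T -> 0 < d -> d <= Rabs (x - p) -> d <= Rabs (x + 1) ->
  (x + 1) * v <= 0 ->
  exCI (fun t => kern p v (x, t)) (- T) T /\ Cmod (CI (fun t => kern p v (x, t)) (- T) T) <= / (d * d) * (2 * T).
Proof.
  intros HT Hd D1 D2 Hv.
  assert (Nz : forall t, d <= Cmod ((x, t) - p)%C /\ d <= Cmod ((x, t) + 1)%C).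
  { intros t. split; [eapply Rle_trans; [apply D1|apply (fst_le_Cmod ((x, t) - p)%C)]|eapply Rle_trans; [apply D2|apply (fst_le_Cmod ((x, t) + 1)%C)]]. }
  assert (N1 : forall t, ((x, t) - p)%C <> 0) by (intros t; apply Cmod_gt_0; destruct (Nz t); lra).
  assert (N2 : forall t, ((x, t) + 1)%C <> 0) by (intros t; apply Cmod_gt_0; destruct (Nz t); lra).
  assert (EX : exCI (fun t => kern p v (x, t)) (- T) T).
  { apply contP_ab; [lra|]. intros t _. apply contC_vert.
    destruct (isD_kern p v (x, t) (N1 t) (N2 t)) as [q Hq]. now apply isD_contC with q. }
  split; auto. replace (2 * T) with (T - - T) by ring. apply CI_norm_const; auto; [lra|].
  intros t _. rewrite Cmod_kern by auto. simpl fst. destruct (Nz t) as [A1 A2].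
  rewrite <- (Rmult_1_l (/ (d * d))). apply Rmult_le_compat.
  - left; apply exp_pos.
  - left; apply Rinv_0_lt_compat; nra.
  - apply Rle_trans with (exp 0); [now apply exp_le_compat|rewrite exp_0; lra].
  - apply Rinv_le_contravar; nra.
Qed.

Lemma bdry_vert (f : C -> C) (a b y1 y2 : R) (w : C) : bdry f a b y1 y2 = (Ci * w)%C ->
  (CI (fun t => f (b, t)) y1 y2 - w = CI (fun t => f (a, t)) y1 y2
    + Ci * (CI (fun x => f (x, y1)) a b - CI (fun x => f (x, y2)) a b))%C.
Proof.
  intros H. unfold bdry in H.
  assert (I2 : (Ci * Ci)%C = (-(1))%C) by (unfold Ci, Cmult, Copp, RtoC; simpl; f_equal; ring).
  apply (f_equal (fun z => - Ci * z)%C) in H.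
  set (A := CI (fun x => f (x, y1)) a b) in *. set (B := CI (fun x => f (x, y2)) a b) in *.
  set (P := CI (fun t => f (a, t)) y1 y2) in *. set (Qq := CI (fun t => f (b, t)) y1 y2) in *.
  replace (- Ci * (A + Ci * Qq - B - Ci * P))%C with (- Ci * (A - B) - (Ci * Ci) * (Qq - P))%C in H by ring.
  replace (- Ci * (Ci * w))%C with (- ((Ci * Ci) * w))%C in H by ring. rewrite I2 in H.
  replace (Qq - w)%C with ((- Ci * (A - B) - - (1) * (Qq - P)) - - (- (1) * w) + P + Ci * (A - B))%C by ring.
  rewrite H. ring.
Qed.

(** For v >= 0 the line is moved to the left past the poles p and -1, whose residues give the main
    term; for v < 0 it is moved to the right, where there is no pole. The horizontal sides give the
    truncation error. *)
Lemma perron (p v c T : R) : 0 <= p < c -> 0 < T ->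
  exCI (fun t => kern p v (c, t)) (- T) T /\
  Cmod (CI (fun t => kern p v (c, t)) (- T) T
        - RtoC (2 * PI * (if Rle_dec 0 v then (exp ((p + 1) * v) - 1) / (p + 1) else 0)))%C
  <= exp ((c + 1) * v) * (2 * PI / T).
Proof.
  intros Hp HT. assert (HPI := PI_RGT_0).
  assert (EX : exCI (fun t => kern p v (c, t)) (- T) T).
  { apply contP_ab; [lra|]. intros t _. apply contC_vert.
    destruct (isD_kern p v (c, t)) as [q Hq]; [| |now apply isD_contC with q];
    intro E; apply (f_equal fst) in E; simpl in E; lra. }
  split; auto. apply le_epsilon. intros e He.
  (* The far vertical side has length 2T and integrand at most R0^(-2), which is made negligible
     before anything else. *)
  assert (HR : exists R0, 0 < R0 /\ / (R0 * R0) * (2 * T) <= e).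
  { exists (Rmax 1 (2 * T / e)). assert (M1 := Rmax_l 1 (2 * T / e)). assert (M2 := Rmax_r 1 (2 * T / e)).
    set (R0 := Rmax 1 (2 * T / e)) in *. split; [lra|].
    apply Rmult_le_reg_l with (R0 * R0); [nra|]. rewrite <- Rmult_assoc, Rinv_r, Rmult_1_l by nra.
    apply Rmult_le_compat_l with (r := e) in M2; [|lra]. replace (e * (2 * T / e)) with (2 * T) in M2 by (field; lra). nra. }
  destruct HR as [R0 [HR0 HRe]].
  assert (ET : Rabs (- T) = T) by (rewrite Rabs_Ropp; apply Rabs_pos_eq; lra).
  assert (ET' : Rabs T = T) by (apply Rabs_pos_eq; lra).
  destruct (Rle_dec 0 v) as [Hv|Hv].
  (* [xm] is midway between the two poles, so each half of the rectangle contains exactly one and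
     Cauchy's formula applies to each. *)
  - set (a := - 1 - R0). set (xm := (p - 1) / 2).
    assert (Dk : forall z, z <> RtoC p -> z <> RtoC (-1) -> exists d, isD (kern p v) z d).
    { intros z N1 N2. apply isD_kern; [now apply Cne|]. replace (z + 1)%C with (z - RtoC (-1))%C by ring. now apply Cne. }
    assert (ne : forall x y q, x <> q \/ y <> 0 -> ((x, y) : C) <> RtoC q).
    { intros x y q H E. injection E. intros. lra. }
    assert (Cb : forall x1 x2 z, (x1 < p \/ x1 > p) -> (x2 < p \/ x2 > p) -> (x1 < -1 \/ x1 > -1) -> (x2 < -1 \/ x2 > -1) ->
      onB x1 x2 (- T) T z -> contC (kern p v) z).
    { intros x1 x2 [x y] H1 H2 H3 H4 Hz. unfold onB in Hz; simpl in Hz.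
      destruct (Dk (x, y)) as [d Hd]; [apply ne; lra|apply ne; lra|now apply isD_contC with d]. }
    assert (S := bdry_split_x (kern p v) a xm c (- T) T ltac:(unfold a, xm; lra) ltac:(lra)
      ltac:(intros z Hz; apply (Cb a xm); auto; unfold a, xm; lra)
      ltac:(intros z Hz; apply (Cb xm c); auto; unfold a, xm; lra)).
    assert (B1 : bdry (kern p v) xm c (- T) T = (2 * PI * Ci * RtoC (exp ((p + 1) * v) / (p + 1)))%C).
    { transitivity (bdry (fun z => (cexp ((z + 1) * v) / (z + 1)) / (z - (p, 0)))%C xm c (- T) T).
      - apply bdry_ext; try (unfold xm; lra). intros [x y] Hz. unfold kern. unfold onB in Hz; simpl in Hz.
        change ((p, 0) : C) with (RtoC p).
        assert (N1 : ((x, y) - p)%C <> 0) by (apply Cne, ne; unfold xm in Hz; lra).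
        assert (N2 : ((x, y) - RtoC (-1))%C <> 0) by (apply Cne, ne; unfold xm in Hz; lra).
        generalize dependent ((x, y) : C). intros z N1 N2.
        replace (z - RtoC (-1))%C with (z + 1)%C in N2 by ring. field. auto.
      - rewrite (cauchy_rect (fun z => cexp ((z + 1) * v) / (z + 1))%C); try (unfold xm; lra).
        + f_equal. rewrite RtoC_div by lra. f_equal.
          * unfold cexp, RtoC; simpl. replace ((p + 1) * 0 + (0 + 0) * v) with 0 by ring.
            rewrite cos_0, sin_0. f_equal; [|ring]. rewrite Rmult_1_r. f_equal. ring.
          * unfold RtoC, Cplus; simpl. f_equal. ring.
        + intros [x y] [Hz _]. simpl in Hz. eexists. apply isD_div; [|apply isD_cexp_lin|apply isD_shift].
          intro E. apply (f_equal fst) in E. simpl in E. unfold xm in Hz. lra. }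
    assert (B2 : bdry (kern p v) a xm (- T) T = (2 * PI * Ci * RtoC (- / (p + 1)))%C).
    { transitivity (bdry (fun z => (cexp ((z + 1) * v) / (z - p)) / (z - (-1, 0)))%C a xm (- T) T).
      - apply bdry_ext; try (unfold a, xm; lra). intros [x y] Hz. unfold kern. unfold onB in Hz; simpl in Hz.
        change ((-1, 0) : C) with (RtoC (-1)).
        assert (N1 : ((x, y) - p)%C <> 0) by (apply Cne, ne; unfold a, xm in Hz; lra).
        assert (N2 : ((x, y) - RtoC (-1))%C <> 0) by (apply Cne, ne; unfold a, xm in Hz; lra).
        generalize dependent ((x, y) : C). intros z N1 N2.
        replace (z - RtoC (-1))%C with (z + 1)%C in * by ring. field. auto.
      - rewrite (cauchy_rect (fun z => cexp ((z + 1) * v) / (z - p))%C); try (unfold a, xm; lra).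
        + f_equal. replace ((-1, 0) + 1)%C with (RtoC 0) by (unfold RtoC, Cplus; simpl; f_equal; ring).
          rewrite Cmult_0_l, cexp_0. change ((-1, 0) : C) with (RtoC (-1)).
          rewrite RtoC_opp, RtoC_inv, RtoC_plus by lra. field.
          split; [rewrite <- RtoC_plus; intro E; apply RtoC_inj in E; lra|].
          rewrite <- RtoC_minus; intro E; apply RtoC_inj in E; lra.
        + intros [x y] [Hz _]. simpl in Hz. eexists. apply isD_div; [|apply isD_cexp_lin|apply isD_shift'].
          apply Cne, ne. unfold xm in Hz. lra. }
    rewrite B1, B2 in S.
    set (w := RtoC (2 * PI * ((exp ((p + 1) * v) - 1) / (p + 1)))).
    assert (S' : bdry (kern p v) a c (- T) T = (Ci * w)%C).
    { rewrite S. unfold w.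
      replace (2 * PI * ((exp ((p + 1) * v) - 1) / (p + 1))) with (2 * PI * (exp ((p + 1) * v) / (p + 1)) + 2 * PI * (- / (p + 1))) by (field; lra).
      rewrite RtoC_plus, !RtoC_mult. ring. }
    apply bdry_vert in S'. rewrite S'.
    assert (Mx : forall x, a <= x <= c -> exp ((x + 1) * v) <= exp ((c + 1) * v)).
    { intros x Hx. apply exp_le_compat. apply Rmult_le_compat_r; lra. }
    destruct (kern_horiz p v a c (- T) (exp ((c + 1) * v)) ltac:(unfold a; lra) ltac:(lra) Mx) as [_ H1].
    destruct (kern_horiz p v a c T (exp ((c + 1) * v)) ltac:(unfold a; lra) ltac:(lra) Mx) as [_ H2].
    rewrite ET in H1. rewrite ET' in H2.
    destruct (kern_vert p v a T R0 HT HR0) as [_ H3].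
    { unfold a. rewrite Rabs_left by lra. lra. } { unfold a. rewrite Rabs_left by lra. lra. }
    { unfold a. assert (0 <= R0 * v) by (apply Rmult_le_pos; lra). lra. }
    eapply Rle_trans; [apply Cmod_triangle|]. rewrite Cmod_mult, Cmod_Ci, Rmult_1_l.
    eapply Rle_trans; [apply Rplus_le_compat_l, Cmod_le_sub|]. lra.
  - set (b := c + R0). rewrite Rmult_0_r.
    assert (ne : forall z : C, c <= fst z -> (z - p)%C <> 0 /\ (z + 1)%C <> 0).
    { intros z Hz. split; intro E; apply (f_equal fst) in E; simpl in E; lra. }
    assert (Z : bdry (kern p v) c b (- T) T = (Ci * 0)%C).
    { rewrite Cmult_0_r. apply goursat; [unfold b; lra|lra|]. intros z [Hz _]. destruct (ne z) as [N1 N2]; [lra|]. now apply isD_kern. }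
    apply bdry_vert in Z.
    assert (Mx : forall x, c <= x <= b -> exp ((x + 1) * v) <= exp ((c + 1) * v)).
    { intros x Hx. apply exp_le_compat. nra. }
    destruct (kern_horiz p v c b (- T) (exp ((c + 1) * v)) ltac:(unfold b; lra) ltac:(lra) Mx) as [_ H1].
    destruct (kern_horiz p v c b T (exp ((c + 1) * v)) ltac:(unfold b; lra) ltac:(lra) Mx) as [_ H2].
    rewrite ET in H1. rewrite ET' in H2.
    destruct (kern_vert p v b T R0 HT HR0) as [_ H3].
    { unfold b. rewrite Rabs_pos_eq by lra. lra. } { unfold b. rewrite Rabs_pos_eq by lra. lra. }
    { unfold b. assert (0 < (c + R0 + 1) * (- v)) by (apply Rmult_lt_0_compat; lra). lra. }
    set (K1 := CI (fun t => kern p v (b, t)) (- T) T) in *. set (K2 := CI (fun t => kern p v (c, t)) (- T) T) in *.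
    set (h1 := CI (fun x => kern p v (x, - T)) c b) in *. set (h2 := CI (fun x => kern p v (x, T)) c b) in *.
    replace (K2 - 0)%C with ((K1 - 0) - Ci * (h1 - h2))%C by (rewrite Z; ring).
    replace (K1 - 0)%C with K1 by ring.
    eapply Rle_trans; [apply Cmod_le_sub|]. rewrite Cmod_mult, Cmod_Ci, Rmult_1_l.
    eapply Rle_trans; [apply Rplus_le_compat_l, Cmod_le_sub|]. lra.
Qed.

Lemma csum_ext (f g : nat -> C) (n : nat) : (forall k, (k < n)%nat -> f k = g k) -> csum f n = csum g n.
Proof. induction n as [|n IH]; intros H; [reflexivity|]. simpl. rewrite IH, H; auto. Qed.

Lemma csum_stable (f : nat -> C) (n k : nat) :
  (forall j, (n <= j)%nat -> f j = 0) -> csum f (n + k) = csum f n.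
Proof.
  intros H. induction k as [|k IH]; [now rewrite Nat.add_0_r|].
  rewrite Nat.add_succ_r. simpl. rewrite IH, H by lia. ring.
Qed.

Lemma csum_mult_l (f : nat -> C) (a : C) (n : nat) : csum (fun k => a * f k)%C n = (a * csum f n)%C.
Proof. induction n as [|n IH]; simpl; [ring|]. rewrite IH. ring. Qed.

Lemma csum_plus (f g : nat -> C) (n : nat) : csum (fun k => f k + g k)%C n = (csum f n + csum g n)%C.
Proof. induction n as [|n IH]; simpl; [ring|]. rewrite IH. ring. Qed.

Lemma CI_csum (a : nat -> C) (f : nat -> R -> C) (n : nat) (u v : R) :
  (forall k, exCI (f k) u v) ->
  exCI (fun t => csum (fun k => a k * f k t)%C n) u v /\
  CI (fun t => csum (fun k => a k * f k t)%C n) u v = csum (fun k => a k * CI (f k) u v)%C n.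
Proof.
  intros H. induction n as [|n [E1 E2]]; simpl.
  - split; [apply exCI_const|]. rewrite CI_const. ring.
  - assert (E3 := exCI_scal _ (a n) _ _ (H n)). split; [now apply exCI_plus|].
    rewrite CI_plus, CI_scal, E2; auto.
Qed.

Fixpoint rsum (f : nat -> R) (n : nat) : R := match n with O => 0 | S k => rsum f k + f k end.

Lemma csum_norm_le (f : nat -> C) (g : nat -> R) (n : nat) :
  (forall k, (k < n)%nat -> Cmod (f k) <= g k) -> Cmod (csum f n) <= rsum g n.
Proof.
  induction n as [|n IH]; intros H; simpl; [rewrite Cmod_0; lra|].
  eapply Rle_trans; [apply Cmod_triangle|]. apply Rplus_le_compat; auto.
Qed.

Lemma rsum_inv_sq (n : nat) : rsum (fun k => / INR (S k) ^ 2) (S n) <= 2 - / INR (S n).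
Proof.
  induction n as [|n IH]; [simpl; lra|].
  change (rsum (fun k => / INR (S k) ^ 2) (S (S n))) with (rsum (fun k => / INR (S k) ^ 2) (S n) + / INR (S (S n)) ^ 2).
  set (x := INR (S n)) in *. assert (Hx : 1 <= x) by apply INR_S_ge1.
  assert (E : INR (S (S n)) = x + 1) by apply S_INR. rewrite E.
  assert (/ (x + 1) ^ 2 <= / x - / (x + 1)).
  { replace (/ x - / (x + 1)) with (/ (x * (x + 1))) by (field; lra). apply Rinv_le_contravar; nra. }
  lra.
Qed.

Lemma rsum_scal (f : nat -> R) (a : R) (n : nat) : rsum (fun k => a * f k) n = a * rsum f n.
Proof. induction n as [|n IH]; simpl; [ring|]. rewrite IH. ring. Qed.

(** * Inversion of the Mellin transform of the integrated error term *)

Section Inversion.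
Variables (l : nat -> C) (m : nat) (G G' : C -> C) (c B : R).
Hypotheses (Hc : 5 <= c) (DG : forall z, isD G z (G' z)) (NZ : forall z, 1/2 < fst z -> G z <> 0)
  (LD : forall e, 0 < e <= 1 -> exists B, 0 < B /\ forall x t, 1/2 + e <= x <= c ->
    Cmod (G' (x, t) / G (x, t))%C <= B * ln (3 + Rabs t))
  (HD : forall t, limC (fun n => csum (fun k => l k * cexp (- (c, t) * ln (INR (S k))))%C (S n))
    (- (G' (c, t) / G (c, t) - INR m / ((c, t) - 1)))%C)
  (HB : 0 < B) (Hl : forall n, Cmod (l n) <= B * INR (S n) ^ 2).

(* The Mellin transform of [psi(x) - m x] on [x >= 1], when [G = (s - 1)^m F] and [l] lists the
   coefficients of [- F'/F]. *)
Definition Hm (z : C) : C := (- (G' z / G z + INR m) / z)%C.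

(* The integral of [psi(u) - m u] over [1 <= u <= x]. *)
Definition E1 (x : R) : C :=
  (csum (fun k => l k * Rmax 0 (x - INR (S k)))%C (Z.to_nat (up x)) - RtoC (INR m * (x ^ 2 - 1) / 2))%C.

(** Summands with index beyond x vanish, so all points below N share one finite sum; this makes
    continuity and differences of [E1] accessible. *)
Lemma E1_N (x : R) (N : nat) : 0 <= x -> x <= INR N ->
  E1 x = (csum (fun k => l k * Rmax 0 (x - INR (S k)))%C N - RtoC (INR m * (x ^ 2 - 1) / 2))%C.
Proof.
  intros H0 HN. unfold E1. f_equal.
  assert (Z : forall n, x <= INR n -> forall j, (n <= j)%nat -> (l j * Rmax 0 (x - INR (S j)))%C = 0).
  { intros n Hn j Hj. rewrite Rmax_left; [ring|]. assert (INR n <= INR j) by (apply le_INR; lia). rewrite S_INR. lra. }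
  set (M := Z.to_nat (up x)).
  assert (HM : x <= INR M).
  { unfold M. destruct (archimed x) as [A1 _]. rewrite INR_IZR_INZ, Z2Nat.id; [lra|].
    apply le_IZR. lra. }
  destruct (Nat.le_ge_cases M N) as [L|L].
  - replace N with (M + (N - M))%nat by lia. symmetry. apply csum_stable. now apply Z.
  - replace M with (N + (M - N))%nat by lia. apply csum_stable. now apply Z.
Qed.

Lemma isD_Hm (z : C) : 1/2 < fst z -> exists d, isD Hm z d.
Proof.
  intros Hz. destruct (isD_deriv G G' z 1 ltac:(lra) ltac:(auto)) as [d Hd]. eexists. unfold Hm.
  apply isD_div.
  - intro E. rewrite E in Hz. simpl in Hz. lra.
  - apply isD_opp, isD_plus; [apply isD_div; [now apply NZ|apply Hd|apply DG]|apply isD_const].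
  - apply isD_id.
Qed.

(** The integrand that recovers [E1] at x = exp v: integrating x^z over the range of E produces
    x^(z+1)/(z + 1). *)
Definition Hx (v : R) (z : C) : C := (Hm z * (cexp ((z + 1) * v) / (z + 1)))%C.

Lemma isD_Hx (v : R) (z : C) : 1/2 < fst z -> exists d, isD (Hx v) z d.
Proof.
  intros Hz. destruct (isD_Hm z Hz) as [d Hd]. eexists. unfold Hx. apply isD_mult; [apply Hd|].
  apply isD_div; [|apply isD_cexp_lin|apply isD_shift].
  intro E. apply (f_equal fst) in E. simpl in E. lra.
Qed.

Lemma exCI_Hx (v x T : R) : 1/2 < x -> exCI (fun t => Hx v (x, t)) (- T) T.
Proof.
  intros Hx0. apply exCI_cont. intros t _. apply contC_vert. destruct (isD_Hx v (x, t) Hx0) as [d Hd].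
  now apply isD_contC with d.
Qed.

(** Since c >= 5, the term of index n is at most B n^(-3), which telescopes against 1/n. *)
Lemma tail_bound (t : R) (N : nat) : (1 <= N)%nat ->
  Cmod (- (G' (c, t) / G (c, t) - INR m / ((c, t) - 1)) - csum (fun k => l k * cexp (- (c, t) * ln (INR (S k)))) N)%C
  <= B / INR N.
Proof.
  intros HN. set (D := (- (G' (c, t) / G (c, t) - INR m / ((c, t) - 1)))%C).
  set (f := fun k => (l k * cexp (- (c, t) * ln (INR (S k))))%C).
  assert (PN : 1 <= INR N) by (apply (le_INR 1); lia).
  assert (st : forall j, Cmod (csum f (N + j) - csum f N)%C <= B * (/ INR N - / INR (N + j))).
  { induction j as [|j IH].
    - rewrite Nat.add_0_r. replace (csum f N - csum f N)%C with (RtoC 0) by ring. rewrite Cmod_0. lra.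
    - rewrite Nat.add_succ_r. simpl csum. set (q := (N + j)%nat) in *.
      assert (Pq : 1 <= INR q) by (apply (le_INR 1); unfold q; lia).
      replace (csum f q + f q - csum f N)%C with ((csum f q - csum f N) + f q)%C by ring.
      eapply Rle_trans; [apply Cmod_triangle|].
      assert (F : Cmod (f q) <= B * (/ INR q - / INR (S q))).
      { unfold f. rewrite Cmod_mult, Cmod_cexp.
        change (fst (- (c, t) * ln (INR (S q)))%C) with (- c * ln (INR (S q)) - - t * 0).
        rewrite S_INR. set (x := INR q) in *.
        specialize (Hl q). rewrite S_INR in Hl. fold x in Hl.
        assert (E : exp (- c * ln (x + 1) - - t * 0) <= / (x + 1) ^ 5).
        { rewrite <- (Rpower_pow 5) by lra. rewrite <- Rpower_Ropp. unfold Rpower. apply exp_le_compat.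
          assert (0 <= ln (x + 1)) by (rewrite <- ln_1; apply ln_le; lra). simpl INR. nra. }
        apply Rle_trans with (B * (x + 1) ^ 2 * / (x + 1) ^ 5).
        - apply Rmult_le_compat; [apply Cmod_ge_0|left; apply exp_pos|exact Hl|exact E].
        - replace (B * (x + 1) ^ 2 * / (x + 1) ^ 5) with (B * / (x + 1) ^ 3) by (field; lra).
          apply Rmult_le_compat_l; [lra|]. replace (/ x - / (x + 1)) with (/ (x * (x + 1))) by (field; lra).
          apply Rinv_le_contravar; nra. }
      lra. }
  apply le_epsilon. intros e He. destruct (HD t e He) as [n0 Hn0]. fold D f in Hn0.
  set (n := Nat.max n0 N). specialize (Hn0 n ltac:(lia)).
  replace (S n) with (N + (S n - N))%nat in Hn0 by lia. specialize (st (S n - N)%nat).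
  assert (P1 : 0 < / INR (N + (S n - N))) by (apply Rinv_0_lt_compat, lt_0_INR; lia).
  set (w := csum f (N + (S n - N))) in *.
  replace (D - csum f N)%C with ((w - csum f N) - (w - D))%C by ring.
  eapply Rle_trans; [apply Cmod_le_sub|]. unfold Rdiv. nra.
Qed.

(** Perron's formula is applied term by term to a truncated Dirichlet series. The weight of the term
    n is n, because max(0, x - n) is n times max(0, x/n - 1); the errors sum like n^(-2), whence the
    factor 2 of B. *)
Lemma inversion_c : exists K, 0 < K /\ forall x T, 1 <= x -> 1 <= T ->
  Cmod (RtoC (2 * PI) * E1 x - CI (fun t => Hx (ln x) (c, t)) (- T) T)%C <= K * exp ((c + 1) * ln x) / T.
Proof.
  assert (HPI := PI_RGT_0). assert (Pm := pos_INR m).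
  exists (2 * PI * (2 * B + INR m)). split; [nra|]. intros x T Hx1 HT.
  set (lx := ln x). assert (X : 0 < exp ((c + 1) * lx)) by apply exp_pos. set (XX := exp ((c + 1) * lx)) in *.
  apply le_epsilon. intros e He.
  (* [N] exceeds x, so that no term of [E1] is lost, and is so large that the discarded part of the
     series contributes at most [e] up to height [T]. *)
  destruct (INR_unbounded (x + 1 + B * XX * (2 * T) / e)) as [N HN].
  assert (BX : 0 <= B * XX * (2 * T) / e) by (apply Rmult_le_pos; [repeat apply Rmult_le_pos; lra|left; now apply Rinv_0_lt_compat]).
  assert (HN1 : (1 <= N)%nat) by (apply INR_le; simpl; lra).
  set (n_ := fun k => INR (S k)).
  assert (n1 : forall k, 1 <= n_ k) by (intros; apply INR_S_ge1).
  set (v_ := fun k => lx - ln (n_ k)).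
  set (S0 := fun z => csum (fun k => (l k * n_ k) * kern 0 (v_ k) z)%C N).
  (* With D = - (G'/G - m/(z - 1)), the value of the Dirichlet series, [Hm] equals D/z - m/(z - 1):
     the coefficients use the kernel with p = 0, and the pole uses the one with p = 1. *)
  set (Rem := fun t => (Hx lx (c, t) - (S0 (c, t) - INR m * kern 1 lx (c, t)))%C).
  assert (nz0 : forall t, ((c, t) : C) <> 0) by (intros t E; apply (f_equal fst) in E; simpl in E; lra).
  assert (nz1 : forall t, ((c, t) - 1)%C <> 0) by (intros t E; apply (f_equal fst) in E; simpl in E; lra).
  assert (nz2 : forall t, ((c, t) + 1)%C <> 0) by (intros t E; apply (f_equal fst) in E; simpl in E; lra).
  assert (Rem_eq : forall t, Rem t = ((- (G' (c, t) / G (c, t) - INR m / ((c, t) - 1)) - csum (fun k => l k * cexp (- (c, t) * ln (INR (S k)))) N)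
      * (cexp (((c, t) + 1) * lx) / ((c, t) * ((c, t) + 1))))%C).
  { intros t. unfold Rem, Hx, Hm.
    assert (ES : S0 (c, t) = (csum (fun k => l k * cexp (- (c, t) * ln (INR (S k)))) N * (cexp (((c, t) + 1) * lx) / ((c, t) * ((c, t) + 1))))%C).
    { unfold S0. rewrite Cmult_comm, <- csum_mult_l. apply csum_ext. intros k _. unfold kern.
      assert (K1 : (n_ k * cexp (((c, t) + 1) * v_ k))%C = (cexp (((c, t) + 1) * lx) * cexp (- (c, t) * ln (INR (S k))))%C).
      { unfold v_. fold (n_ k). specialize (n1 k).
        assert (EL : (cexp (RtoC (- ln (n_ k))) * RtoC (n_ k))%C = 1).
        { rewrite RtoC_opp, cexp_opp, cexp_ln by lra. field. intro E. apply RtoC_inj in E. lra. }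
        rewrite <- cexp_plus.
        replace (((c, t) + 1) * lx + - (c, t) * ln (n_ k))%C with (((c, t) + 1) * (lx - ln (n_ k))%R - RtoC (- ln (n_ k)))%C
          by (rewrite RtoC_minus, RtoC_opp; ring).
        unfold Cminus. rewrite cexp_plus, cexp_opp.
        assert (N0 := cexp_nz (RtoC (- ln (n_ k)))).
        assert (E3 : (/ cexp (RtoC (- ln (n_ k))))%C = RtoC (n_ k)).
        { rewrite <- (Cmult_1_l (/ _)), <- EL. field. auto. }
        rewrite E3. ring. }
      specialize (nz0 t). specialize (nz2 t).
      replace (l k * n_ k * (cexp (((c, t) + 1) * v_ k) / (((c, t) - 0) * ((c, t) + 1))))%C
        with (l k * (n_ k * cexp (((c, t) + 1) * v_ k)) / ((c, t) * ((c, t) + 1)))%C.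
      - rewrite K1. revert nz0 nz2. generalize ((c, t) : C). intros z n0 n2. field. auto.
      - revert nz0 nz2. generalize ((c, t) : C). intros z n0 n2. field. auto. }
    rewrite ES. unfold kern. assert (nG : G (c, t) <> 0) by (apply NZ; simpl; lra).
    specialize (nz0 t). specialize (nz1 t). specialize (nz2 t).
    generalize (csum (fun k => l k * cexp (- (c, t) * ln (INR (S k))))%C N). intros w.
    revert nz0 nz1 nz2 nG. generalize ((c, t) : C). intros z a0 a1 a2 aG. field. auto. }
  assert (EkA : forall p v, 0 <= p < c -> exCI (fun t => kern p v (c, t)) (- T) T).
  { intros p v Hp. apply (perron p v c T); lra. }
  destruct (CI_csum (fun k => l k * n_ k)%C (fun k t => kern 0 (v_ k) (c, t)) N (- T) T) as [ES CS].
  { intros k. apply EkA. lra. }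
  assert (EH : exCI (fun t => Hx lx (c, t)) (- T) T) by (apply exCI_Hx; lra).
  assert (EK : exCI (fun t => INR m * kern 1 lx (c, t))%C (- T) T) by (apply exCI_scal, EkA; lra).
  assert (ER : exCI Rem (- T) T) by (apply exCI_minus; auto; apply exCI_minus; auto).
  assert (CR : CI (fun t => Hx lx (c, t)) (- T) T =
    (CI Rem (- T) T + (csum (fun k => (l k * n_ k) * CI (fun t => kern 0 (v_ k) (c, t)) (- T) T) N
       - INR m * CI (fun t => kern 1 lx (c, t)) (- T) T))%C).
  { unfold Rem. rewrite CI_minus; auto; [|apply exCI_minus; auto].
    rewrite (CI_minus (fun t => S0 (c, t))); auto. rewrite CI_scal by (apply EkA; lra).
    unfold S0. rewrite CS. ring. }
  assert (BR : Cmod (CI Rem (- T) T) <= e).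
  { apply Rle_trans with (B / INR N * XX * (T - - T)).
    - apply CI_norm_const; auto; [lra|]. intros t _. rewrite Rem_eq, Cmod_mult.
      assert (TB := tail_bound t N HN1).
      assert (KB : Cmod (cexp (((c, t) + 1) * lx) / ((c, t) * ((c, t) + 1)))%C <= XX).
      { rewrite Cmod_div by (apply Cmult_neq_0; auto). rewrite Cmod_mult, Cmod_cexp.
        replace (fst (((c, t) + 1) * lx)%C) with ((c + 1) * lx) by (simpl; ring). fold XX.
        assert (F1 := fst_le_Cmod (c, t)). assert (F2 := fst_le_Cmod ((c, t) + 1)%C). simpl in F1, F2.
        rewrite Rabs_pos_eq in F1, F2 by lra.
        rewrite <- (Rmult_1_r XX) at 2. apply Rmult_le_compat_l; [lra|].
        apply Rle_trans with (/ 1); [apply Rinv_le_contravar; nra|rewrite Rinv_1; lra]. }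
      apply Rmult_le_compat; auto; apply Cmod_ge_0.
    - apply Rmult_le_reg_r with (INR N / e); [apply Rdiv_lt_0_compat; lra|].
      replace (B / INR N * XX * (T - - T) * (INR N / e)) with (B * XX * (2 * T) / e) by (field; lra).
      replace (e * (INR N / e)) with (INR N) by (field; lra). lra. }
  assert (P1 : Cmod (csum (fun k => (l k * n_ k) * CI (fun t => kern 0 (v_ k) (c, t)) (- T) T) N
     - RtoC (2 * PI) * csum (fun k => l k * Rmax 0 (x - INR (S k))) N)%C <= 2 * B * XX * (2 * PI / T)).
  { replace (csum (fun k => (l k * n_ k) * CI (fun t => kern 0 (v_ k) (c, t)) (- T) T) N
     - RtoC (2 * PI) * csum (fun k => l k * Rmax 0 (x - INR (S k))) N)%C with
      (csum (fun k => (l k * n_ k) * CI (fun t => kern 0 (v_ k) (c, t)) (- T) T + (- RtoC (2 * PI)) * (l k * Rmax 0 (x - INR (S k)))) N)%C.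
    2:{ rewrite csum_plus, csum_mult_l. ring. }
    apply Rle_trans with (rsum (fun k => (B * XX * (2 * PI / T)) * / INR (S k) ^ 2) N).
    - apply csum_norm_le. intros k _. fold (n_ k). specialize (n1 k). specialize (Hl k). fold (n_ k) in Hl.
      destruct (perron 0 (v_ k) c T ltac:(lra) ltac:(lra)) as [_ PB].
      replace (2 * PI * (if Rle_dec 0 (v_ k) then (exp ((0 + 1) * v_ k) - 1) / (0 + 1) else 0)) with (2 * PI * (Rmax 0 (x - n_ k) / n_ k)) in PB.
      2:{ f_equal. assert (EV : exp (v_ k) = x / n_ k) by (unfold v_, lx; rewrite <- ln_div by lra; apply exp_ln, Rdiv_lt_0_compat; lra).
          destruct (Rle_dec 0 (v_ k)) as [L|L].
          - assert (1 <= x / n_ k) by (rewrite <- EV, <- exp_0; now apply exp_le_compat).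
            assert (n_ k <= x) by (apply Rmult_le_reg_r with (/ n_ k); [apply Rinv_0_lt_compat; lra|]; rewrite Rinv_r by lra; exact H).
            rewrite Rmax_right by lra. rewrite Rplus_0_l, Rmult_1_l, EV. field. lra.
          - assert (x / n_ k < 1) by (rewrite <- EV, <- exp_0; apply exp_increasing; lra).
            assert (x < n_ k) by (apply Rmult_lt_reg_r with (/ n_ k); [apply Rinv_0_lt_compat; lra|]; rewrite Rinv_r by lra; exact H).
            rewrite Rmax_left by lra. field. lra. }
      set (KK := CI (fun t => kern 0 (v_ k) (c, t)) (- T) T) in *.
      replace (l k * n_ k * KK + - RtoC (2 * PI) * (l k * Rmax 0 (x - n_ k)))%C
        with (l k * n_ k * (KK - RtoC (2 * PI * (Rmax 0 (x - n_ k) / n_ k))))%C.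
      2:{ rewrite (RtoC_mult (2 * PI)), (RtoC_div (Rmax 0 (x - n_ k))) by lra. field. intro E. apply RtoC_inj in E. lra. }
      rewrite !Cmod_mult, Cmod_R, Rabs_pos_eq by lra.
      assert (EE : exp ((c + 1) * v_ k) <= XX * / n_ k ^ 5).
      { unfold v_. replace ((c + 1) * (lx - ln (n_ k))) with ((c + 1) * lx + - ((c + 1) * ln (n_ k))) by ring.
        rewrite exp_plus. fold XX. apply Rmult_le_compat_l; [lra|].
        rewrite <- (Rpower_pow 5) by lra. rewrite <- Rpower_Ropp. unfold Rpower. apply exp_le_compat.
        assert (0 <= ln (n_ k)) by (rewrite <- ln_1; apply ln_le; lra). simpl INR. nra. }
      assert (PT : 0 < 2 * PI / T) by (apply Rdiv_lt_0_compat; lra).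
      apply Rle_trans with (B * n_ k ^ 2 * n_ k * (XX * / n_ k ^ 5 * (2 * PI / T))).
      + apply Rmult_le_compat.
        * apply Rmult_le_pos; [apply Cmod_ge_0|lra].
        * apply Cmod_ge_0.
        * apply Rmult_le_compat_r; lra.
        * eapply Rle_trans; [apply PB|]. apply Rmult_le_compat_r; lra.
      + right. field. lra.
    - rewrite rsum_scal. replace N with (S (N - 1)) by lia.
      assert (RS := rsum_inv_sq (N - 1)). assert (0 < / INR (S (N - 1))) by (apply Rinv_0_lt_compat; assert (T1 := INR_S_ge1 (N - 1)); lra).
      assert (0 < 2 * PI / T) by (apply Rdiv_lt_0_compat; lra).
      replace (2 * B * XX * (2 * PI / T)) with (B * XX * (2 * PI / T) * 2) by ring.
      apply Rmult_le_compat_l; [apply Rmult_le_pos; [apply Rmult_le_pos|]; lra|lra]. }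
  destruct (perron 1 lx c T ltac:(lra) ltac:(lra)) as [_ P2].
  assert (lx0 : 0 <= lx) by (unfold lx; rewrite <- ln_1; apply ln_le; lra).
  destruct (Rle_dec 0 lx) as [_|]; [|lra].
  replace (exp ((1 + 1) * lx)) with (x ^ 2) in P2.
  2:{ replace ((1 + 1) * lx) with (lx + lx) by ring. rewrite exp_plus. unfold lx. rewrite exp_ln by lra. ring. }
  fold XX in P2.
  rewrite (E1_N x N) by lra. rewrite CR.
  set (SA := csum (fun k => (l k * n_ k) * CI (fun t => kern 0 (v_ k) (c, t)) (- T) T)%C N) in *.
  set (SB := csum (fun k => l k * Rmax 0 (x - INR (S k)))%C N) in *.
  set (K1 := CI (fun t => kern 1 lx (c, t)) (- T) T) in *.
  replace (RtoC (2 * PI) * (SB - RtoC (INR m * (x ^ 2 - 1) / 2)) - (CI Rem (- T) T + (SA - INR m * K1)))%C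
    with (- (SA - RtoC (2 * PI) * SB) + INR m * (K1 - RtoC (2 * PI * ((x ^ 2 - 1) / (1 + 1)))) - CI Rem (- T) T)%C.
  2:{ replace (INR m * (x ^ 2 - 1) / 2) with (INR m * ((x ^ 2 - 1) / (1 + 1))) by (field).
      rewrite (RtoC_mult (INR m)), (RtoC_mult (2 * PI)). ring. }
  eapply Rle_trans; [apply Cmod_le_sub|].
  eapply Rle_trans; [apply Rplus_le_compat_r, Cmod_triangle|].
  rewrite Cmod_opp, Cmod_mult, Cmod_R, (Rabs_pos_eq (INR m)) by lra.
  assert (INR m * Cmod (K1 - RtoC (2 * PI * ((x ^ 2 - 1) / (1 + 1))))%C <= INR m * (XX * (2 * PI / T))) by (apply Rmult_le_compat_l; auto).
  replace (2 * PI * (2 * B + INR m) * XX / T) with (2 * B * XX * (2 * PI / T) + INR m * (XX * (2 * PI / T))) by (field; lra).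
  lra.
Qed.

(** [Hm] is holomorphic to the right of 1/2, even at 1 because G is entire and nonzero there, so
    moving the line picks up no residue. On the horizontal sides ln(3 + T) <= 3T against T^2 is
    enough. *)
Lemma inversion (e : R) : 0 < e <= 1 -> exists K, 0 < K /\ forall x T, 1 <= x -> 1 <= T ->
  Cmod (RtoC (2 * PI) * E1 x - CI (fun t => Hx (ln x) ((1/2 + e)%R, t)) (- T) T)%C <= K * exp ((c + 1) * ln x) / T.
Proof.
  intros He. destruct (LD e He) as [B0 [HB0 L0]]. destruct inversion_c as [K [HK I]].
  assert (Pm := pos_INR m). set (s := 1/2 + e).
  exists (K + 2 * (3 * B0 + INR m) * (c - s)).
  assert (Hs : s < c) by (unfold s; lra).
  split; [assert (0 <= 2 * (3 * B0 + INR m) * (c - s)) by (repeat apply Rmult_le_pos; lra); lra|].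
  intros x T Hx1 HT. specialize (I x T Hx1 HT).
  set (lx := ln x) in *. set (XX := exp ((c + 1) * lx)) in *.
  assert (PX : 0 < XX) by apply exp_pos.
  assert (lx0 : 0 <= lx) by (unfold lx; rewrite <- ln_1; apply ln_le; lra).
  assert (Z : bdry (Hx lx) s c (- T) T = (Ci * 0)%C).
  { rewrite Cmult_0_r. apply goursat; try lra. intros z [Hz _]. apply isD_Hx. unfold s in Hz. lra. }
  apply bdry_vert in Z.
  assert (hb : forall y, Rabs y = T -> Cmod (CI (fun x => Hx lx (x, y)) s c) <= (3 * B0 + INR m) * (XX / T) * (c - s)).
  { intros y Hy. apply CI_norm_const; [lra| |].
    - apply contP_ab; [lra|]. intros q Hq. apply contC_horiz. destruct (isD_Hx lx (q, y)) as [d Hd]; [simpl; unfold s in Hq; lra|].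
      now apply isD_contC with d.
    - intros q Hq. unfold Hx, Hm.
      assert (n0 : ((q, y) : C) <> 0) by (intro E; apply (f_equal fst) in E; simpl in E; unfold s in Hq; lra).
      assert (n2 : ((q, y) + 1)%C <> 0) by (intro E; apply (f_equal fst) in E; simpl in E; unfold s in Hq; lra).
      rewrite Cmod_mult, !Cmod_div, Cmod_opp, Cmod_cexp by auto.
      replace (fst (((q, y) + 1) * lx)%C) with ((q + 1) * lx) by (simpl; ring).
      assert (F1 := snd_le_Cmod (q, y)). assert (F2 := snd_le_Cmod ((q, y) + 1)%C). simpl in F1, F2.
      rewrite Rplus_0_r in F2. rewrite Hy in F1, F2.
      apply Rmult_le_compat.
      + apply Rmult_le_pos; [apply Cmod_ge_0|left; apply Rinv_0_lt_compat; lra].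
      + apply Rmult_le_pos; [left; apply exp_pos|left; apply Rinv_0_lt_compat; lra].
      + assert (LB := L0 q y ltac:(unfold s in Hq; lra)). rewrite Hy in LB.
        assert (ln (3 + T) <= 3 * T).
        { assert (T1 := exp_ineq1_le (ln (3 + T))). rewrite exp_ln in T1 by lra. lra. }
        assert (NB : Cmod (G' (q, y) / G (q, y) + INR m)%C <= (3 * B0 + INR m) * T).
        { eapply Rle_trans; [apply Cmod_triangle|]. rewrite Cmod_R, (Rabs_pos_eq (INR m)) by lra. nra. }
        apply Rmult_le_reg_r with (Cmod (q, y)); [lra|]. unfold Rdiv. rewrite Rmult_assoc, Rinv_l, Rmult_1_r by lra.
        eapply Rle_trans; [apply NB|]. apply Rmult_le_compat_l; lra.
      + unfold Rdiv. apply Rmult_le_compat.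
        * left; apply exp_pos.
        * left; apply Rinv_0_lt_compat; lra.
        * apply exp_le_compat. apply Rmult_le_compat_r; lra.
        * apply Rinv_le_contravar; lra. }
  assert (H1 := hb (- T) ltac:(rewrite Rabs_Ropp; apply Rabs_pos_eq; lra)).
  assert (H2 := hb T ltac:(apply Rabs_pos_eq; lra)).
  set (A := CI (fun t => Hx lx (s, t)) (- T) T) in *. set (Bc := CI (fun t => Hx lx (c, t)) (- T) T) in *.
  set (h1 := CI (fun x => Hx lx (x, - T)) s c) in *. set (h2 := CI (fun x => Hx lx (x, T)) s c) in *.
  replace (RtoC (2 * PI) * E1 x - A)%C with ((RtoC (2 * PI) * E1 x - Bc) + (Bc - 0 - A))%C by ring.
  rewrite Z. replace (A + Ci * (h1 - h2) - A)%C with (Ci * (h1 - h2))%C by ring.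
  eapply Rle_trans; [apply Cmod_triangle|]. rewrite Cmod_mult, Cmod_Ci, Rmult_1_l.
  eapply Rle_trans; [apply Rplus_le_compat_l, Cmod_le_sub|].
  replace ((K + 2 * (3 * B0 + INR m) * (c - s)) * XX / T) with (K * XX / T + 2 * ((3 * B0 + INR m) * (XX / T) * (c - s))) by (field; lra).
  lra.
Qed.
End Inversion.

(** * A Plancherel identity on windows of length one *)

(** The squared modulus as a polynomial in the components: continuity and integrability follow
    without the square root. *)
Definition N2 (z : C) : R := fst z * fst z + snd z * snd z.

Lemma N2_Cmod (z : C) : N2 z = Cmod z ^ 2.
Proof. rewrite Cmod2_alt. unfold N2, Re, Im. ring. Qed.

Lemma N2_pos (z : C) : 0 <= N2 z.
Proof. rewrite N2_Cmod. apply pow2_ge_0. Qed.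

Lemma contP_plus (f g : R -> C) (t : R) : contP f t -> contP g t -> contP (fun t => f t + g t)%C t.
Proof.
  intros [H1 H2] [H3 H4]. split.
  - now apply (continuous_plus (V := R_NormedModule) (fun t => fst (f t)) (fun t => fst (g t))).
  - now apply (continuous_plus (V := R_NormedModule) (fun t => snd (f t)) (fun t => snd (g t))).
Qed.

Lemma contP_mult (f g : R -> C) (t : R) : contP f t -> contP g t -> contP (fun t => f t * g t)%C t.
Proof.
  intros [H1 H2] [H3 H4].
  assert (M : forall a b : R -> R, continuous a t -> continuous b t -> continuous (fun t => a t * b t) t)
    by (intros; now apply (continuous_mult (K := R_AbsRing))).
  split.
  - apply (continuous_minus (V := R_NormedModule) (fun t => fst (f t) * fst (g t)) (fun t => snd (f t) * snd (g t))); auto.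
  - apply (continuous_plus (V := R_NormedModule) (fun t => fst (f t) * snd (g t)) (fun t => snd (f t) * fst (g t))); auto.
Qed.

Lemma contP_const (c : C) (t : R) : contP (fun _ => c) t.
Proof. split; apply continuous_const. Qed.

Lemma contP_conj (f : R -> C) (t : R) : contP f t -> contP (fun t => Cconj (f t)) t.
Proof. intros [H1 H2]. split; auto. now apply (continuous_opp (V := R_NormedModule) (fun t => snd (f t))). Qed.

Lemma contP_N2 (f : R -> C) (t : R) : contP f t -> continuous (fun t => N2 (f t)) t.
Proof.
  intros [H1 H2].
  apply (continuous_plus (V := R_NormedModule) (fun t => fst (f t) * fst (f t)) (fun t => snd (f t) * snd (f t)));
  now apply (continuous_mult (K := R_AbsRing)).
Qed.

Lemma contP_csum (f : nat -> R -> C) (n : nat) (t : R) :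
  (forall k, contP (f k) t) -> contP (fun t => csum (fun k => f k t) n) t.
Proof.
  intros H. induction n as [|n IH]; simpl; [apply contP_const|]. now apply contP_plus.
Qed.

Lemma contP_exp (a : R) (t : R) : contP (fun t => cexp (0, t * a)) t.
Proof.
  assert (K : contP (fun y => (fun w => cexp (w * a))%C (0, y)) t).
  { apply (contC_vert (fun w => cexp (w * a))%C 0 t).
    apply (contC_comp cexp (fun w => w * a)%C); [apply contC_mult; [apply contC_id|apply contC_const]|].
    eapply isD_contC, isD_cexp. }
  assert (E : forall y, cexp ((0, y) * a)%C = cexp (0, y * a)).
  { intros y. f_equal. unfold Cmult, RtoC; simpl. f_equal; ring. }
  destruct K as [K1 K2]. split.
  - apply (continuous_ext (fun y => fst (cexp ((0, y) * a)%C))); auto. intros. now rewrite E.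
  - apply (continuous_ext (fun y => snd (cexp ((0, y) * a)%C))); auto. intros. now rewrite E.
Qed.

Lemma contP_shift (f : R -> C) (a t : R) : (forall t, contP f t) -> contP (fun t => f (a + t)) t.
Proof.
  intros H. assert (S : continuous (fun t => a + t) t)
    by (apply (continuous_plus (V := R_NormedModule) (fun _ => a) (fun t => t)); [apply continuous_const|apply continuous_id]).
  split.
  - apply (continuous_comp (fun t => a + t) (fun s => fst (f s))); [exact S|exact (proj1 (H (a + t)))].
  - apply (continuous_comp (fun t => a + t) (fun s => snd (f s))); [exact S|exact (proj2 (H (a + t)))].
Qed.

Lemma RInt_shift (g : R -> R) (a p : R) : (forall t, continuous g t) ->
  RInt (fun t => g (a + t)) 0 p = RInt g a (a + p).
Proof.
  intros H. assert (E := RInt_comp_lin (V := R_CompleteNormedModule) g 1 a 0 p).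
  replace (1 * 0 + a) with a in E by ring. replace (1 * p + a) with (a + p) in E by ring.
  rewrite <- E.
  - apply RInt_ext_R. intros t _. unfold scal; simpl. unfold mult; simpl. rewrite Rmult_1_l. f_equal. ring.
  - apply (ex_RInt_continuous (V := R_CompleteNormedModule)). auto.
Qed.

Lemma CI_shift (f : R -> C) (a p : R) : (forall t, contP f t) ->
  CI (fun t => f (a + t)) 0 p = CI f a (a + p).
Proof.
  intros H. unfold CI. f_equal.
  - apply (RInt_shift (fun t => fst (f t))). intros t; exact (proj1 (H t)).
  - apply (RInt_shift (fun t => snd (f t))). intros t; exact (proj2 (H t)).
Qed.

Lemma ex_RInt_cont (g : R -> R) (a b : R) : (forall t, continuous g t) -> ex_RInt g a b.
Proof. intros H. apply (ex_RInt_continuous (V := R_CompleteNormedModule)). auto. Qed.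

Lemma CI_Cauchy_Schwarz (f : R -> C) (a b : R) : a < b -> exCI f a b ->
  ex_RInt (fun t => N2 (f t)) a b -> N2 (CI f a b) <= (b - a) * RInt (fun t => N2 (f t)) a b.
Proof.
  intros Hab Hf EN. rewrite N2_Cmod.
  set (J := RInt (fun t => N2 (f t)) a b).
  assert (HJ : 0 <= J) by (apply RInt_ge_0; [lra|auto|intros; apply N2_pos]).
  set (I := Cmod (CI f a b)). assert (HI : 0 <= I) by apply Cmod_ge_0.
  destruct (Req_dec I 0) as [E|N]; [rewrite E; nra|].
  (* |f| <= k/2 + |f|^2/(2k); the best constant [k] is the modulus of the mean of f. *)
  set (k := I / (b - a)). assert (Hk : 0 < k) by (apply Rdiv_lt_0_compat; lra).
  assert (B : I <= RInt (fun t => (k / 2) * 1 + (/ (2 * k)) * N2 (f t)) a b).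
  { apply CI_norm; [lra|auto| |].
    - apply (exRInt_lin (fun _ => 1)); auto. apply ex_RInt_const.
    - intros t _. rewrite N2_Cmod. set (q := Cmod (f t)).
      replace (k / 2 * 1 + / (2 * k) * q ^ 2) with (q + (k - q) ^ 2 * / (2 * k)) by (field; lra).
      assert (0 <= (k - q) ^ 2 * / (2 * k)) by (apply Rmult_le_pos; [apply pow2_ge_0|left; apply Rinv_0_lt_compat; lra]). lra. }
  rewrite (RInt_lin (fun _ => 1)) in B by (auto; apply ex_RInt_const). rewrite RInt_const in B.
  unfold scal in B; simpl in B. unfold mult in B; simpl in B. fold J in B.
  replace (k / 2 * ((b - a) * 1)) with (I / 2) in B by (unfold k; field; lra).
  replace (/ (2 * k) * J) with ((b - a) * J / (2 * I)) in B by (unfold k; field; lra).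
  assert (I / 2 * (2 * I) <= (b - a) * J / (2 * I) * (2 * I)) by (apply Rmult_le_compat_r; lra).
  replace ((b - a) * J / (2 * I) * (2 * I)) with ((b - a) * J) in H by (field; lra). simpl. lra.
Qed.

Lemma CI_harmonic (j : nat) (U : R) : (0 < j)%nat -> CI (fun u => cexp (0, u * (- (2 * INR j * PI)))) U (U + 1) = 0.
Proof.
  intros Hj. set (a := - (2 * INR j * PI)).
  assert (Ha : RtoC a <> 0).
  { intro E. apply RtoC_inj in E. unfold a in E. assert (T := PI_RGT_0). assert (0 < INR j) by (apply lt_0_INR; lia). nra. }
  assert (D : forall w, isD (fun w => cexp (w * a) / a)%C w (cexp (w * a))%C).
  { intros w. eapply isD_eq; cycle 1.
    { apply isD_mult; [|apply isD_const].
      apply (isD_comp cexp (fun w => w * a)%C); [apply isD_mult; [apply isD_id|apply isD_const]|apply isD_cexp]. }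
    cbv beta. field. auto. }
  assert (F := CI_FTC_vert (fun w => cexp (w * a) / a)%C (fun w => cexp (w * a))%C 0 U (U + 1)).
  cbv beta in F.
  assert (E : forall y, cexp ((0, y) * a)%C = cexp (0, y * a)).
  { intros y. f_equal. unfold Cmult, RtoC; simpl. f_equal; ring. }
  rewrite (CI_ext _ (fun u => cexp (0, u * a))) in F by (intros; apply E).
  assert (Z : (Ci * CI (fun u => cexp (0, (u * a)%R)) U (U + 1)%R)%C = 0).
  { rewrite F.
    - rewrite !E. replace (cexp (0, ((U + 1) * a)%R)) with (cexp (0, (U * a)%R)); [ring|].
      unfold cexp; simpl. replace (U * a) with ((U + 1) * a + 2 * INR j * PI) by (unfold a; ring).
      now rewrite cos_period, sin_period.
    - intros y _. split; [apply D|]. apply (contC_comp cexp (fun w => w * a)%C); [apply contC_mult; [apply contC_id|apply contC_const]|].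
      eapply isD_contC, isD_cexp. }
  apply Cmod_eq_0. apply (f_equal Cmod) in Z. rewrite Cmod_mult, Cmod_Ci, Cmod_0, Rmult_1_l in Z. auto.
Qed.

Section Plancherel.
Variables (b : R -> C) (T U : R).
Hypothesis (Hb : forall t, contP b t).
(** The range of t is folded into n periods of length 2 PI. The k-th period acquires the factor
    exp(2 pi i k u), and these characters are orthonormal over any window of u of length 1:
    Plancherel's theorem becomes a finite identity. *)
Let w := 2 * PI.
Let bk (k : nat) (t : R) : C := b (- T + w * INR k + t).
Let ek (k : nat) (u : R) : C := cexp (0, u * (2 * INR k * PI)).
Let Qn (n : nat) (t u : R) : C := csum (fun k => bk k t * ek k u)%C n.
Let J (n : nat) (u : R) : R := RInt (fun t => N2 (Qn n t u)) 0 w.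

Lemma bk_cont (k : nat) (t : R) : contP (bk k) t.
Proof. unfold bk. now apply (contP_shift b). Qed.

Lemma Qn_cont (n : nat) (u t : R) : contP (fun t => Qn n t u) t.
Proof.
  unfold Qn. apply (contP_csum (fun k t => bk k t * ek k u)%C). intros k.
  apply contP_mult; [apply bk_cont|apply contP_const].
Qed.

Lemma w_pos : 0 < w.
Proof. unfold w. assert (T0 := PI_RGT_0). lra. Qed.

Lemma planch_split (n : nat) (u : R) :
  CI (fun t => b t * cexp (0, (t * u)%R))%C (- T) (- T + w * INR n) =
  CI (fun t => cexp (0, ((- T + t) * u)%R) * Qn n t u)%C 0 w.
Proof.
  assert (Cb : forall t, contP (fun t => b t * cexp (0, (t * u)%R))%C t).
  { intros t. apply contP_mult; auto. apply contP_exp. }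
  assert (Ce : forall t, contP (fun t => cexp (0, ((- T + t) * u)%R)) t).
  { intros t. apply (contP_shift (fun t => cexp (0, (t * u)%R))). intros. apply contP_exp. }
  induction n as [|n IH].
  - simpl INR. replace (- T + w * 0) with (- T) by ring.
    rewrite (CI_ext (fun t => cexp (0, ((- T + t) * u)%R) * Qn 0 t u)%C (fun _ => RtoC 0)).
    + rewrite CI_const. apply injective_projections; simpl; eqR.
      * rewrite (RInt_point (V := R_CompleteNormedModule)). unfold zero; simpl. ring.
      * rewrite (RInt_point (V := R_CompleteNormedModule)). unfold zero; simpl. ring.
    + intros t _. unfold Qn; simpl. ring.
  - rewrite S_INR. replace (- T + w * (INR n + 1)) with (- T + w * INR n + w) by ring.
    rewrite <- (CI_Chasles _ (- T) (- T + w * INR n)).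
    2,3: apply exCI_cont; auto.
    rewrite IH, <- (CI_shift _ (- T + w * INR n) w Cb), <- CI_plus.
    + apply CI_ext. intros t _. unfold Qn. simpl csum. fold (Qn n t u).
      change (bk n t) with (b (- T + w * INR n + t)). change (ek n u) with (cexp (0, (u * (2 * INR n * PI))%R)).
      replace (cexp (0, ((- T + w * INR n + t) * u)%R)) with (cexp (0, ((- T + t) * u)%R) * cexp (0, (u * (2 * INR n * PI))%R))%C.
      * ring.
      * rewrite <- cexp_plus. f_equal. unfold Cplus, w; simpl. f_equal; ring.
    + apply exCI_cont. intros t _. apply contP_mult; auto. apply Qn_cont.
    + apply exCI_cont. intros t _. apply (contP_shift (fun t => b t * cexp (0, (t * u)%R))%C); auto.
Qed.

Lemma N2_plus (x y : C) : N2 (x + y)%C = N2 x + N2 y + 2 * fst (x * Cconj y)%C.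
Proof. unfold N2; destruct x, y; simpl. ring. Qed.

Lemma N2_mult (x y : C) : N2 (x * y)%C = N2 x * N2 y.
Proof. unfold N2; destruct x, y; simpl. ring. Qed.

Lemma N2_unit (y : R) : N2 (cexp (0, y)) = 1.
Proof. rewrite N2_Cmod, Cmod_cexp. simpl. rewrite exp_0. ring. Qed.

Lemma J_step (n : nat) (u : R) :
  J (S n) u = J n u + RInt (fun t => N2 (bk n t)) 0 w
    + 2 * fst (csum (fun k => CI (fun t => bk k t * Cconj (bk n t))%C 0 w * (ek k u * Cconj (ek n u))) n)%C.
Proof.
  assert (Cx : forall t, contP (fun t => Qn n t u * Cconj (bk n t * ek n u))%C t).
  { intros t. apply contP_mult; [apply Qn_cont|]. apply contP_conj, contP_mult; [apply bk_cont|apply contP_const]. }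
  assert (Sx : CI (fun t => Qn n t u * Cconj (bk n t * ek n u))%C 0 w =
     csum (fun k => CI (fun t => bk k t * Cconj (bk n t)) 0 w * (ek k u * Cconj (ek n u)))%C n).
  { destruct (CI_csum (fun k => ek k u * Cconj (ek n u))%C (fun k t => bk k t * Cconj (bk n t))%C n 0 w) as [_ CS].
    { intros k. apply exCI_cont. intros t _. apply contP_mult; [apply bk_cont|apply contP_conj, bk_cont]. }
    transitivity (csum (fun k => ek k u * Cconj (ek n u) * CI (fun t => bk k t * Cconj (bk n t)) 0 w)%C n).
    - rewrite <- CS. apply CI_ext. intros t _. unfold Qn. rewrite Cmult_comm, <- csum_mult_l. apply csum_ext. intros k _.
      rewrite Cmult_conj. ring.
    - apply csum_ext. intros. ring. }
  rewrite <- Sx. unfold J.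
  assert (E0 : ex_RInt (fun t => N2 (Qn n t u)) 0 w) by (apply ex_RInt_cont; intros; apply contP_N2, Qn_cont).
  assert (E1' : ex_RInt (fun t => N2 (bk n t)) 0 w) by (apply ex_RInt_cont; intros; apply contP_N2, bk_cont).
  assert (E2 : ex_RInt (fun t => fst (Qn n t u * Cconj (bk n t * ek n u))%C) 0 w) by (apply ex_RInt_cont; intros t; exact (proj1 (Cx t))).
  rewrite (RInt_ext_R _ (fun t => 1 * (1 * N2 (Qn n t u) + 1 * N2 (bk n t)) + 2 * fst (Qn n t u * Cconj (bk n t * ek n u))%C)).
  - rewrite (RInt_lin (fun t => 1 * N2 (Qn n t u) + 1 * N2 (bk n t))), RInt_lin; auto; [|now apply exRInt_lin].
    unfold CI; simpl. ring.
  - intros t _. unfold Qn. simpl csum. fold (Qn n t u). rewrite N2_plus, N2_mult. unfold ek at 1. rewrite N2_unit. ring.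
Qed.

(** Adding a period to [Qn] creates cross terms carrying the characters exp(- 2 pi i (n - k) u) with
    k < n, all of mean 0 over the window; only the diagonal survives. *)
Lemma J_int (n : nat) : is_RInt (J n) U (U + 1) (RInt (fun t => N2 (b t)) (- T) (- T + w * INR n)).
Proof.
  assert (Cn : forall t, continuous (fun t => N2 (b t)) t) by (intros; now apply contP_N2).
  induction n as [|n IH].
  - replace (- T + w * INR 0) with (- T) by (simpl; ring). rewrite (RInt_point (V := R_CompleteNormedModule)).
    apply (is_RInt_ext (fun _ => 0)).
    + intros u _. unfold J. rewrite (RInt_ext_R _ (fun _ => 0)).
      * rewrite RInt_const. unfold scal; simpl. unfold mult; simpl. eqR. ring.
      * intros t _. unfold Qn; simpl. unfold N2; simpl. ring.
    + replace (zero : R_CompleteNormedModule) with (scal (U + 1 - U) 0 : R_CompleteNormedModule).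
      * apply (is_RInt_const (V := R_CompleteNormedModule)).
      * unfold scal, zero; simpl. unfold mult; simpl. eqR. ring.
  - set (cr := fun u => csum (fun k => CI (fun t => bk k t * Cconj (bk n t)) 0 w * (ek k u * Cconj (ek n u)))%C n).
    assert (ekE : forall k u, (k < n)%nat -> (ek k u * Cconj (ek n u))%C = cexp (0, u * (- (2 * INR (n - k) * PI)))).
    { intros k u Hk. unfold ek.
      replace (Cconj (cexp (0, u * (2 * INR n * PI)))) with (cexp (0, - (u * (2 * INR n * PI)))).
      - rewrite <- cexp_plus. f_equal. unfold Cplus; simpl. rewrite minus_INR by lia. f_equal; ring.
      - unfold cexp, Cconj; simpl. rewrite cos_neg, sin_neg. f_equal; ring. }
    assert (Eek : forall k, exCI (fun u => ek k u * Cconj (ek n u))%C U (U + 1)).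
    { intros k. apply exCI_cont. intros u _. apply contP_mult; [|apply contP_conj]; apply contP_exp. }
    destruct (CI_csum (fun k => CI (fun t => bk k t * Cconj (bk n t)) 0 w)%C (fun k u => ek k u * Cconj (ek n u))%C n U (U + 1) Eek) as [Ecr Ccr].
    assert (Z : CI cr U (U + 1) = 0).
    { unfold cr. rewrite Ccr.
      assert (Z0 : forall j, (j <= n)%nat -> csum (fun k => CI (fun t => bk k t * Cconj (bk n t)) 0 w * CI (fun u => ek k u * Cconj (ek n u)) U (U + 1)%R)%C j = 0).
      { induction j as [|j IHj]; intros Hj; [reflexivity|]. simpl csum. rewrite IHj by lia.
        rewrite (CI_ext (fun u => ek j u * Cconj (ek n u))%C (fun u => cexp (0, u * (- (2 * INR (n - j) * PI)))) U (U + 1)) by (intros; apply ekE; lia).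
        rewrite CI_harmonic by lia. ring. }
      now apply Z0. }
    apply (is_RInt_ext (fun u => plus (plus (J n u) (RInt (fun t => N2 (bk n t)) 0 w)) (scal 2 (fst (cr u))))).
    + intros u _. rewrite J_step. unfold plus, scal; simpl. unfold mult; simpl. reflexivity.
    + replace (RInt (fun t => N2 (b t)) (- T) (- T + w * INR (S n)))
        with (plus (plus (RInt (fun t => N2 (b t)) (- T) (- T + w * INR n)) (scal (U + 1 - U) (RInt (fun t => N2 (bk n t)) 0 w))) (scal 2 (fst (CI cr U (U + 1))))).
      * apply (is_RInt_plus (V := R_NormedModule)).
        -- apply (is_RInt_plus (V := R_NormedModule)); auto. apply (is_RInt_const (V := R_NormedModule)).
        -- apply (is_RInt_scal (V := R_NormedModule)). apply (RInt_correct (V := R_CompleteNormedModule)). apply Ecr.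
      * rewrite Z, S_INR. replace (- T + w * (INR n + 1)) with (- T + w * INR n + w) by ring.
        rewrite <- (RInt_Chasles (V := R_CompleteNormedModule) (fun t => N2 (b t)) (- T) (- T + w * INR n) (- T + w * INR n + w)) by (apply ex_RInt_cont; auto).
        rewrite <- (RInt_shift (fun t => N2 (b t)) (- T + w * INR n) w Cn).
        match goal with |- plus (plus ?a (scal ?b ?c)) _ = plus ?a ?d => change (a + b * c + 2 * 0 = a + c) end. ring.
Qed.

(** Cauchy-Schwarz over one period bounds the transform pointwise by a function of u whose integral
    is exactly the energy of [b]. Its independence of [U] is what makes the mean squares uniform. *)
Lemma plancherel_window (n : nat) : T = PI * INR n -> exists Jf : R -> R,
  is_RInt Jf U (U + 1) (RInt (fun t => N2 (b t)) (- T) T) /\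
  forall u, N2 (CI (fun t => b t * cexp (0, (t * u)%R))%C (- T) T) <= 2 * PI * Jf u.
Proof.
  intros HT. exists (J n).
  assert (E : - T + w * INR n = T) by (rewrite HT; unfold w; ring).
  split.
  - rewrite <- E at 2. apply J_int.
  - intros u. rewrite <- E at 2. rewrite planch_split. eapply Rle_trans.
    + assert (Cp : forall t, contP (fun t => cexp (0, ((- T + t) * u)%R) * Qn n t u)%C t).
      { intros t. apply contP_mult; [|apply Qn_cont].
        apply (contP_shift (fun t => cexp (0, (t * u)%R))). intros. apply contP_exp. }
      apply CI_Cauchy_Schwarz; [apply w_pos|now apply exCI_cont|].
      apply ex_RInt_cont. intros. now apply contP_N2.
    + right. unfold w at 1. replace (2 * PI - 0) with (2 * PI) by ring. f_equal. unfold J. apply RInt_ext_R.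
      intros t _. rewrite N2_mult, N2_unit. ring.
Qed.
End Plancherel.

(** * Piecewise continuous functions *)

(* Agreement with a continuous function on either side of each point; values at the jumps are free. *)
Definition lpc (f : R -> R) : Prop := forall x, exists e gl gr, 0 < e /\
  (forall t, continuous gl t) /\ (forall t, continuous gr t) /\
  (forall t, x - e < t < x -> f t = gl t) /\ (forall t, x < t < x + e -> f t = gr t).

(** Compactness in the form of a supremum: the last point up to which [f] is integrable can be
    reached by the one-sided function on its left and passed by the one on its right. *)
Lemma lpc_int (f : R -> R) (a b : R) : lpc f -> ex_RInt f a b.
Proof.
  intros H.
  assert (main : forall a b, a <= b -> ex_RInt f a b).
  { clear a b. intros a b Hab.
    assert (left : forall x y, exists e, 0 < e /\ (x - e < y <= x -> ex_RInt f y x)).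
    { intros x y. destruct (H x) as [e [gl [gr [He [Cl [Cr [Hl Hr]]]]]]]. exists e. split; auto. intros Hy.
      apply (ex_RInt_ext_R gl).
      - rewrite Rmin_left, Rmax_right by lra. intros t Ht. symmetry. apply Hl. lra.
      - now apply ex_RInt_cont. }
    assert (right : forall x, exists e, 0 < e /\ forall y, x <= y < x + e -> ex_RInt f x y).
    { intros x. destruct (H x) as [e [gl [gr [He [Cl [Cr [Hl Hr]]]]]]]. exists e. split; auto. intros y Hy.
      apply (ex_RInt_ext_R gr).
      - rewrite Rmin_left, Rmax_right by lra. intros t Ht. symmetry. apply Hr. lra.
      - now apply ex_RInt_cont. }
    destruct (completeness (fun y => a <= y <= b /\ ex_RInt f a y)) as [s [Us Ls]].
    - exists b. intros y [Hy _]. lra.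
    - exists a. split; [lra|apply ex_RInt_point].
    - assert (Has : a <= s) by (apply Us; split; [lra|apply ex_RInt_point]).
      assert (Hsb : s <= b) by (apply Ls; intros y [Hy _]; lra).
      assert (Es : ex_RInt f a s).
      { destruct (H s) as [e [gl [gr [He [Cl [Cr [Hl Hr]]]]]]].
        destruct (Classical_Prop.classic (exists y, s - e < y <= s /\ a <= y <= b /\ ex_RInt f a y)) as [[y [Hy [_ Ey]]]|N].
        - apply (ex_RInt_Chasles _ _ y); auto. apply (ex_RInt_ext_R gl).
          + rewrite Rmin_left, Rmax_right by lra. intros t Ht. symmetry. apply Hl. lra.
          + now apply ex_RInt_cont.
        - exfalso. assert (s <= s - e); [|lra]. apply Ls. intros y [Hy Ey].
          destruct (Rle_lt_dec y (s - e)); auto. exfalso. apply N. exists y. assert (y <= s) by (apply Us; now split).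
          repeat split; auto; lra. }
      destruct (Rle_lt_or_eq_dec s b Hsb) as [L|L]; [|now rewrite <- L].
      exfalso. destruct (right s) as [e [He Hr]].
      set (y := Rmin b (s + e / 2)). assert (y1 : y <= b) by apply Rmin_l. assert (y2 : y <= s + e / 2) by apply Rmin_r.
      assert (y3 : s < y) by (apply Rmin_glb_lt; lra).
      assert (y <= s); [|lra]. apply Us. split; [lra|]. apply (ex_RInt_Chasles _ _ s); auto. apply Hr. lra. }
  destruct (Rle_dec a b) as [L|L]; auto. apply ex_RInt_swap. apply main. lra.
Qed.

Lemma lpc_cont (f : R -> R) : (forall t, continuous f t) -> lpc f.
Proof. intros H x. exists 1, f, f. repeat split; auto. lra. Qed.

Lemma lpc_op (op : R -> R -> R) (f g : R -> R) :
  (forall (u v : R -> R) (t : R), continuous u t -> continuous v t -> continuous (fun t => op (u t) (v t)) t) ->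
  lpc f -> lpc g -> lpc (fun t => op (f t) (g t)).
Proof.
  intros Hop Hf Hg x. destruct (Hf x) as [e [fl [fr [He [Cl [Cr [Hl Hr]]]]]]].
  destruct (Hg x) as [e' [gl [gr [He' [Cl' [Cr' [Hl' Hr']]]]]]].
  exists (Rmin e e'), (fun t => op (fl t) (gl t)), (fun t => op (fr t) (gr t)).
  assert (M1 := Rmin_l e e'). assert (M2 := Rmin_r e e').
  split; [now apply Rmin_glb_lt|]. split; [auto|]. split; [auto|].
  split; intros t Ht; [rewrite Hl, Hl'|rewrite Hr, Hr']; auto; lra.
Qed.

Lemma lpc_plus (f g : R -> R) : lpc f -> lpc g -> lpc (fun t => f t + g t).
Proof. apply (lpc_op Rplus). intros. now apply (continuous_plus (V := R_NormedModule)). Qed.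

Lemma lpc_minus (f g : R -> R) : lpc f -> lpc g -> lpc (fun t => f t - g t).
Proof. apply (lpc_op Rminus). intros. now apply (continuous_minus (V := R_NormedModule)). Qed.

Lemma lpc_mult (f g : R -> R) : lpc f -> lpc g -> lpc (fun t => f t * g t).
Proof. apply (lpc_op Rmult). intros. now apply (continuous_mult (K := R_AbsRing)). Qed.

Lemma lpc_const (k : R) : lpc (fun _ => k).
Proof. apply lpc_cont. intros. apply continuous_const. Qed.

Lemma lpc_scal (k : R) (f : R -> R) : lpc f -> lpc (fun t => k * f t).
Proof. intros H. apply (lpc_mult (fun _ => k)); auto. apply lpc_const. Qed.

Lemma lpc_ext (f g : R -> R) : (forall t, f t = g t) -> lpc f -> lpc g.
Proof.
  intros E H x. destruct (H x) as [e [gl [gr [He [Cl [Cr [Hl Hr]]]]]]]. exists e, gl, gr.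
  repeat split; auto; intros; rewrite <- E; auto.
Qed.

Lemma continuous_aff (g : R -> R) (a b t : R) : (forall t, continuous g t) -> continuous (fun t => g (a * t + b)) t.
Proof.
  intros H. apply (continuous_comp (fun t => a * t + b) g); auto.
  apply (continuous_plus (V := R_NormedModule) (fun t => a * t) (fun _ => b)); [|apply continuous_const].
  apply (continuous_mult (K := R_AbsRing) (fun _ => a) (fun t => t)); [apply continuous_const|apply continuous_id].
Qed.

Lemma lpc_aff (f : R -> R) (a b : R) : 0 < a -> lpc f -> lpc (fun t => f (a * t + b)).
Proof.
  intros Ha H x. destruct (H (a * x + b)) as [e [gl [gr [He [Cl [Cr [Hl Hr]]]]]]].
  exists (e / a), (fun t => gl (a * t + b)), (fun t => gr (a * t + b)).
  assert (E : a * (e / a) = e) by (field; lra).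
  split; [now apply Rdiv_lt_0_compat|]. split; [intros; now apply continuous_aff|]. split; [intros; now apply continuous_aff|].
  split; intros t Ht; [apply Hl|apply Hr]; nra.
Qed.

Definition lpcC (f : R -> C) : Prop := lpc (fun t => fst (f t)) /\ lpc (fun t => snd (f t)).

Lemma lpcC_minus (f g : R -> C) : lpcC f -> lpcC g -> lpcC (fun t => f t - g t)%C.
Proof. intros [H1 H2] [H3 H4]. split; simpl; now apply lpc_minus. Qed.

Lemma lpcC_aff (f : R -> C) (a b : R) : 0 < a -> lpcC f -> lpcC (fun t => f (a * t + b)).
Proof.
  intros Ha [H1 H2]. split; [apply (lpc_aff (fun t => fst (f t)))|apply (lpc_aff (fun t => snd (f t)))]; auto.
Qed.

Lemma lpc_N2 (f : R -> C) : lpcC f -> lpc (fun t => N2 (f t)).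
Proof. intros [H1 H2]. apply lpc_plus; now apply lpc_mult. Qed.

Lemma exCI_lpc (f : R -> C) (a b : R) : lpcC f -> exCI f a b.
Proof. intros [H1 H2]. split; now apply lpc_int. Qed.

Lemma Int_part_between (k : Z) (t : R) : IZR k <= t < IZR k + 1 -> Int_part t = k.
Proof. intros H. symmetry. apply Int_part_spec. lra. Qed.

Lemma lpc_Int_part (f : Z -> R) : lpc (fun t => f (Int_part t)).
Proof.
  intros x. set (k := Int_part x). destruct (base_Int_part x) as [B1 B2]. fold k in B1, B2.
  destruct (Req_dec x (IZR k)) as [E|N].
  - exists 1, (fun _ => f (k - 1)%Z), (fun _ => f k). split; [lra|].
    split; [intros; apply continuous_const|]. split; [intros; apply continuous_const|].
    split; intros t Ht; f_equal; apply Int_part_between; rewrite ?minus_IZR; lra.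
  - exists (Rmin (x - IZR k) (IZR k + 1 - x)), (fun _ => f k), (fun _ => f k).
    assert (M1 := Rmin_l (x - IZR k) (IZR k + 1 - x)). assert (M2 := Rmin_r (x - IZR k) (IZR k + 1 - x)).
    split; [apply Rmin_glb_lt; lra|].
    split; [intros; apply continuous_const|]. split; [intros; apply continuous_const|].
    split; intros t Ht; f_equal; apply Int_part_between; lra.
Qed.

(** * The error term and its averages *)

(** After substitution everything cancels up to the end piece [b, (1+d)b]: monotone functions have
    an L1 modulus of continuity even though they jump. *)
Lemma RInt_monotone_shift (W : R -> R) (d a b : R) : 0 < d -> 0 <= a <= b ->
  (forall x y, 0 <= x <= y -> W x <= W y) -> (forall x, 0 <= x -> 0 <= W x) -> lpc W ->
  RInt (fun x => W ((1 + d) * x) - W x) a b <= d * b * W ((1 + d) * b).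
Proof.
  intros Hd Hab HW W0 LW.
  assert (I : forall p q, ex_RInt W p q) by (intros; now apply lpc_int).
  assert (L1 : lpc (fun x => W ((1 + d) * x))).
  { apply (lpc_ext (fun x => W ((1 + d) * x + 0))); [intros; f_equal; ring|]. apply lpc_aff; auto. lra. }
  assert (E : RInt (fun x => W ((1 + d) * x) - W x) a b = RInt (fun x => W ((1 + d) * x)) a b - RInt W a b).
  { apply (RInt_minus (V := R_CompleteNormedModule) (fun x => W ((1 + d) * x)) W); [now apply lpc_int|auto]. }
  rewrite E.
  assert (S := RInt_comp_lin (V := R_CompleteNormedModule) W (1 + d) 0 a b (I _ _)).
  rewrite !Rplus_0_r in S.
  assert (S2 : (1 + d) * RInt (fun x => W ((1 + d) * x)) a b = RInt W ((1 + d) * a) ((1 + d) * b)).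
  { rewrite <- S. symmetry.
    rewrite (RInt_ext_R _ (fun y => (1 + d) * W ((1 + d) * y))).
    - apply (RInt_scal (V := R_CompleteNormedModule) (fun x => W ((1 + d) * x))). now apply lpc_int.
    - intros t _. unfold scal; simpl. unfold mult; simpl. now rewrite Rplus_0_r. }
  assert (P : forall p q, 0 <= p <= q -> 0 <= RInt W p q).
  { intros p q Hpq. apply RInt_ge_0; auto; [lra|]. intros x Hx. apply W0. lra. }
  assert (C1 := RInt_Chasles (V := R_CompleteNormedModule) W a ((1 + d) * a) ((1 + d) * b) (I _ _) (I _ _)).
  assert (C2 := RInt_Chasles (V := R_CompleteNormedModule) W a b ((1 + d) * b) (I _ _) (I _ _)).
  change (RInt W a ((1 + d) * a) + RInt W ((1 + d) * a) ((1 + d) * b) = RInt W a ((1 + d) * b)) in C1.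
  change (RInt W a b + RInt W b ((1 + d) * b) = RInt W a ((1 + d) * b)) in C2.
  assert (U : RInt W b ((1 + d) * b) <= RInt (fun _ => W ((1 + d) * b)) b ((1 + d) * b)).
  { apply RInt_le; auto; [nra|apply ex_RInt_const|]. intros x Hx. apply HW. lra. }
  rewrite RInt_const in U. change (RInt W b ((1 + d) * b) <= ((1 + d) * b - b) * W ((1 + d) * b)) in U.
  assert (P1 := P a ((1 + d) * a) ltac:(nra)). assert (P2 := P ((1 + d) * a) ((1 + d) * b) ltac:(nra)).
  assert (RInt (fun x => W ((1 + d) * x)) a b <= RInt W ((1 + d) * a) ((1 + d) * b)).
  { rewrite <- S2 in P2 |- *. assert (0 <= RInt (fun x => W ((1 + d) * x)) a b); nra. }
  nra.
Qed.

(** The jump of psi at n, with primitive max(0, x - n). *)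
Definition stp (n : nat) (u : R) : R := if Rle_dec (INR n) u then 1 else 0.

Lemma RInt_stp (n : nat) (a b : R) : a <= b ->
  is_RInt (stp n) a b (Rmax 0 (b - INR n) - Rmax 0 (a - INR n)).
Proof.
  intros Hab.
  assert (one : forall p q, INR n <= p <= q -> is_RInt (stp n) p q (q - p)).
  { intros p q H. replace (q - p) with (scal (q - p) 1 : R) by (unfold scal; simpl; unfold mult; simpl; ring).
    apply (is_RInt_ext (fun _ => 1)); [|apply (is_RInt_const (V := R_NormedModule))].
    intros t. rewrite Rmin_left, Rmax_right by lra. intros Ht. unfold stp. destruct (Rle_dec (INR n) t); lra. }
  assert (zer : forall p q, p <= q <= INR n -> is_RInt (stp n) p q 0).
  { intros p q H. replace 0 with (scal (q - p) 0 : R) at 1 by (unfold scal; simpl; unfold mult; simpl; ring).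
    apply (is_RInt_ext (fun _ => 0)); [|apply (is_RInt_const (V := R_NormedModule))].
    intros t. rewrite Rmin_left, Rmax_right by lra. intros Ht. unfold stp. destruct (Rle_dec (INR n) t); lra. }
  destruct (Rle_lt_dec (INR n) a) as [L|L].
  - rewrite !Rmax_right by lra. replace (b - INR n - (a - INR n)) with (b - a) by ring. apply one. lra.
  - rewrite (Rmax_left 0 (a - INR n)) by lra. destruct (Rle_lt_dec b (INR n)) as [L2|L2].
    + rewrite Rmax_left by lra. rewrite Rminus_0_r. apply zer. lra.
    + rewrite Rmax_right by lra. replace (b - INR n - 0) with (plus 0 (b - INR n) : R) by (unfold plus; simpl; ring).
      apply (is_RInt_Chasles (V := R_NormedModule) _ a (INR n)); [apply zer|apply one]; lra.
Qed.

Section Error.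
Variables (l : nat -> C) (m : nat).

(** psi(x) - m x. Entry [k] of [l] is the coefficient of k + 1, so the first floor(x) entries are
    those up to x. *)
Definition Ef (x : R) : C := (csum l (Z.to_nat (Int_part x)) - RtoC (INR m * x))%C.

Lemma lpcC_Ef : lpcC Ef.
Proof.
  apply (lpcC_minus (fun x => csum l (Z.to_nat (Int_part x))) (fun x => RtoC (INR m * x))).
  - split; [apply (lpc_Int_part (fun k => fst (csum l (Z.to_nat k))))|apply (lpc_Int_part (fun k => snd (csum l (Z.to_nat k))))].
  - split; simpl; [|apply lpc_const]. apply lpc_scal, lpc_cont. intros; apply continuous_id.
Qed.

Lemma csum_stp (u : R) (N : nat) : 0 <= u -> u <= INR N ->
  csum l (Z.to_nat (Int_part u)) = csum (fun k => l k * stp (S k) u)%C N.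
Proof.
  intros Hu HN. destruct (base_Int_part u) as [B1 B2].
  assert (K0 : (0 <= Int_part u)%Z).
  { assert (-1 < Int_part u)%Z; [|lia]. apply lt_IZR. lra. }
  set (k := Z.to_nat (Int_part u)).
  assert (Hk : INR k = IZR (Int_part u)) by (unfold k; rewrite INR_IZR_INZ, Z2Nat.id; auto).
  assert (HkN : (k <= N)%nat) by (apply INR_le; lra).
  replace N with (k + (N - k))%nat by lia. rewrite csum_stable.
  - apply csum_ext. intros j Hj. unfold stp. destruct (Rle_dec (INR (S j)) u) as [L|L]; [ring|].
    elim L. assert (INR (S j) <= INR k) by (apply le_INR; lia). lra.
  - intros j Hj. unfold stp. destruct (Rle_dec (INR (S j)) u) as [L|L]; [|ring].
    assert (INR k <= INR j) by (apply le_INR; lia). rewrite S_INR in L. lra.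
Qed.

Lemma CI_Ef (a b : R) : 0 <= a <= b -> CI Ef a b = (E1 l m b - E1 l m a)%C.
Proof.
  intros Hab. destruct (INR_unbounded b) as [N HN].
  rewrite (E1_N l m b N), (E1_N l m a N) by lra.
  rewrite (CI_ext Ef (fun u => csum (fun k => l k * RtoC (stp (S k) u)) N - RtoC (INR m * u))%C).
  2:{ intros u Hu. rewrite Rmin_left, Rmax_right in Hu by lra. unfold Ef. now rewrite (csum_stp u N) by lra. }
  assert (Es : forall k, exCI (fun u => RtoC (stp (S k) u)) a b /\ CI (fun u => RtoC (stp (S k) u)) a b = RtoC (Rmax 0 (b - INR (S k)) - Rmax 0 (a - INR (S k)))).
  { intros k. assert (T := RInt_stp (S k) a b ltac:(lra)). split.
    - split; [eexists; apply T|exact (ex_RInt_const (V := R_NormedModule) a b 0)].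
    - unfold CI, RtoC. cbn [fst snd]. f_equal; [now apply is_RInt_unique|]. rewrite RInt_const. unfold scal; simpl; unfold mult; simpl. eqR; ring. }
  destruct (CI_csum l (fun k u => RtoC (stp (S k) u)) N a b ltac:(intros; apply Es)) as [EE CC].
  assert (Cl : forall t : R, contP (fun u => RtoC (INR m * u)) t).
  { intros t. split; simpl; [|apply continuous_const].
    apply (continuous_mult (K := R_AbsRing) (fun _ => INR m) (fun t => t)); [apply continuous_const|apply continuous_id]. }
  assert (EL : exCI (fun u => RtoC (INR m * u)) a b) by (apply exCI_cont; auto).
  rewrite CI_minus, CC by auto.
  assert (CL : CI (fun u => RtoC (INR m * u)) a b = RtoC (INR m * (b ^ 2 - a ^ 2) / 2)).
  { unfold CI, RtoC. cbn [fst snd]. f_equal.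
    - apply is_RInt_unique. replace (INR m * (b ^ 2 - a ^ 2) / 2) with (minus (INR m * b ^ 2 / 2) (INR m * a ^ 2 / 2)) by (unfold minus, plus, opp; simpl; field).
      apply (is_RInt_derive (V := R_CompleteNormedModule) (fun u => INR m * u ^ 2 / 2)).
      + intros x _. auto_derive; auto. field.
      + intros x _. exact (proj1 (Cl x)).
    - rewrite RInt_const. unfold scal; simpl; unfold mult; simpl. eqR; ring. }
  rewrite CL.
  assert (X : csum (fun k => l k * CI (fun u => RtoC (stp (S k) u)) a b)%C N =
    (csum (fun k => l k * Rmax 0 (b - INR (S k))) N + RtoC (-1) * csum (fun k => l k * Rmax 0 (a - INR (S k))) N)%C).
  { rewrite <- csum_mult_l, <- csum_plus. apply csum_ext. intros k _. rewrite (proj2 (Es k)), RtoC_minus. ring. }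
  rewrite X.
  replace (INR m * (b ^ 2 - a ^ 2) / 2) with (INR m * (b ^ 2 - 1) / 2 - INR m * (a ^ 2 - 1) / 2) by field.
  rewrite RtoC_minus. ring.
Qed.

Lemma contP_E1 (x : R) : 0 < x -> contP (E1 l m) x.
Proof.
  intros Hx. destruct (INR_unbounded (x + 1)) as [N HN].
  set (g := fun x => (csum (fun k => l k * RtoC (Rmax 0 (x - INR (S k)))) N - RtoC (INR m * (x ^ 2 - 1) / 2))%C).
  assert (Cg : contP g x).
  { assert (C1' : contP (fun x => csum (fun k => l k * RtoC (Rmax 0 (x - INR (S k)))) N)%C x).
    { apply (contP_csum (fun k x => l k * RtoC (Rmax 0 (x - INR (S k))))%C). intros k.
      apply contP_mult; [apply contP_const|]. split; simpl; [|apply continuous_const].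
      apply continuous_eps. intros e He. exists e. split; auto. intros y Hy.
      eapply Rle_lt_trans; [|apply Hy]. unfold Rmax. destruct (Rle_dec 0 (y - _)), (Rle_dec 0 (x - _)); unfold Rabs; repeat destruct (Rcase_abs _); lra. }
    assert (C2' : continuous (fun x => INR m * (x ^ 2 - 1) / 2) x).
    { apply (ex_derive_continuous (V := R_NormedModule)). auto_derive. auto. }
    destruct C1' as [A1 A2]. split; simpl.
    - apply (continuous_minus (V := R_NormedModule) (fun x => fst (csum (fun k => l k * RtoC (Rmax 0 (x - INR (S k))))%C N)) (fun x => INR m * (x ^ 2 - 1) / 2)); auto.
    - apply (continuous_minus (V := R_NormedModule) (fun x => snd (csum (fun k => l k * RtoC (Rmax 0 (x - INR (S k))))%C N)) (fun x => 0)); auto. apply continuous_const. }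
  assert (Loc : locally x (fun y => g y = E1 l m y)).
  { exists (mkposreal (Rmin x 1) ltac:(apply Rmin_glb_lt; lra)). intros y Hy. simpl in Hy.
    change (Rabs (y - x) < Rmin x 1) in Hy. assert (M1 := Rmin_l x 1). assert (M2 := Rmin_r x 1).
    apply Rabs_lt_between in Hy. symmetry. apply E1_N; lra. }
  destruct Cg as [A1 A2]. split.
  - apply (continuous_ext_loc _ (fun y => fst (g y))); auto.
    apply (filter_imp (fun y => g y = E1 l m y)); auto. intros y Ey. now rewrite Ey.
  - apply (continuous_ext_loc _ (fun y => snd (g y))); auto.
    apply (filter_imp (fun y => g y = E1 l m y)); auto. intros y Ey. now rewrite Ey.
Qed.

(** The mean of [Ef] over [x, (1+d)x], written through the primitive [E1], which is continuous and
    has an absolutely convergent inversion. *)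
Definition Ad (d x : R) : C := ((E1 l m ((1 + d) * x) - E1 l m x) / RtoC (d * x))%C.

Lemma Ad_avg (d x : R) : 0 < d -> 0 < x ->
  Ad d x = (RtoC (/ (d * x)) * CI Ef x ((1 + d) * x))%C.
Proof.
  intros Hd Hx. unfold Ad. rewrite CI_Ef by nra. assert (d * x <> 0) by nra.
  rewrite RtoC_inv by auto. field. intro E. apply RtoC_inj in E. auto.
Qed.

(** A nondecreasing function whose increments dominate those of [Ef]; it measures how far averaging
    can move [Ef]. *)
Definition Wf (x : R) : R := rsum (fun k => Cmod (l k)) (Z.to_nat (Int_part x)) + INR m * x.

Lemma rsum_mono (f : nat -> R) (i j : nat) : (forall k, 0 <= f k) -> (i <= j)%nat -> rsum f i <= rsum f j.
Proof. intros H Hij. induction Hij as [|j Hij IH]; [lra|]. simpl. specialize (H j). lra. Qed.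

Lemma Int_part_mono (x y : R) : x <= y -> (Int_part x <= Int_part y)%Z.
Proof.
  intros H. destruct (base_Int_part x), (base_Int_part y).
  assert (Int_part x < Int_part y + 1)%Z; [|lia]. apply lt_IZR. rewrite plus_IZR. lra.
Qed.

Lemma csum_diff (f : nat -> C) (i j : nat) : (i <= j)%nat ->
  Cmod (csum f j - csum f i)%C <= rsum (fun k => Cmod (f k)) j - rsum (fun k => Cmod (f k)) i.
Proof.
  intros Hij. induction Hij as [|j Hij IH].
  - replace (csum f i - csum f i)%C with (RtoC 0) by ring. rewrite Cmod_0. lra.
  - simpl. replace (csum f j + f j - csum f i)%C with ((csum f j - csum f i) + f j)%C by ring.
    eapply Rle_trans; [apply Cmod_triangle|]. lra.
Qed.

Lemma Wf_props : (forall x y, 0 <= x <= y -> Wf x <= Wf y) /\ (forall x, 0 <= x -> 0 <= Wf x) /\ lpc Wf /\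
  (forall x y, 0 <= x <= y -> Cmod (Ef y - Ef x)%C <= Wf y - Wf x).
Proof.
  assert (Pm := pos_INR m).
  assert (IM : forall x y, x <= y -> (Z.to_nat (Int_part x) <= Z.to_nat (Int_part y))%nat).
  { intros x y H. assert (T := Int_part_mono x y H). lia. }
  split; [|split; [|split]].
  - intros x y H. unfold Wf. apply Rplus_le_compat; [|nra]. apply rsum_mono; [intros; apply Cmod_ge_0|]. apply IM. lra.
  - intros x H. unfold Wf. assert (0 <= rsum (fun k => Cmod (l k)) (Z.to_nat (Int_part x))).
    { change 0 with (rsum (fun k => Cmod (l k)) 0). apply rsum_mono; [intros; apply Cmod_ge_0|lia]. }
    nra.
  - apply lpc_plus; [apply (lpc_Int_part (fun k => rsum (fun k => Cmod (l k)) (Z.to_nat k)))|].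
    apply lpc_scal, lpc_cont. intros; apply continuous_id.
  - intros x y H. unfold Ef, Wf.
    replace (csum l (Z.to_nat (Int_part y)) - RtoC (INR m * y) - (csum l (Z.to_nat (Int_part x)) - RtoC (INR m * x)))%C
      with ((csum l (Z.to_nat (Int_part y)) - csum l (Z.to_nat (Int_part x))) - RtoC (INR m * (y - x)))%C
      by (replace (INR m * (y - x)) with (INR m * y - INR m * x) by ring; rewrite (RtoC_minus (INR m * y)); ring).
    eapply Rle_trans; [apply Cmod_le_sub|]. rewrite Cmod_R, (Rabs_pos_eq (INR m * (y - x))) by nra.
    assert (T := csum_diff l _ _ (IM x y ltac:(lra))). lra.
Qed.

Lemma Ad_close (d x : R) : 0 < d -> 0 < x -> Cmod (Ad d x - Ef x)%C <= Wf ((1 + d) * x) - Wf x.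
Proof.
  intros Hd Hx. destruct Wf_props as [W1 [W2 [W3 W4]]].
  assert (dx : 0 < d * x) by nra. rewrite Ad_avg by auto.
  assert (L : exCI Ef x ((1 + d) * x)) by (apply exCI_lpc, lpcC_Ef).
  replace (RtoC (/ (d * x)) * CI Ef x ((1 + d) * x) - Ef x)%C
    with (RtoC (/ (d * x)) * CI (fun u => Ef u - Ef x)%C x ((1 + d) * x)%R)%C.
  2:{ rewrite CI_minus by (auto; apply exCI_const). rewrite CI_const.
      replace ((1 + d) * x - x) with (d * x) by ring. rewrite RtoC_inv by lra. field. intro E. apply RtoC_inj in E. lra. }
  rewrite Cmod_mult, Cmod_R, Rabs_pos_eq by (left; now apply Rinv_0_lt_compat).
  apply Rmult_le_reg_l with (d * x); auto. rewrite <- Rmult_assoc, Rinv_r, Rmult_1_l by lra.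
  eapply Rle_trans; [apply CI_norm_const with (M := Wf ((1 + d) * x) - Wf x)|].
  - nra.
  - apply exCI_minus; auto. apply exCI_const.
  - intros t Ht. eapply Rle_trans; [apply W4; lra|]. assert (T := W1 t ((1 + d) * x) ltac:(lra)). lra.
  - right. ring.
Qed.

Lemma contP_Ad (d x : R) : 0 < d -> 0 < x -> contP (Ad d) x.
Proof.
  intros Hd Hx.
  assert (A1 : contP (fun x => E1 l m ((1 + d) * x)) x).
  { assert (C0' : continuous (fun x => (1 + d) * x) x)
      by (apply (continuous_mult (K := R_AbsRing) (fun _ => 1 + d) (fun t => t)); [apply continuous_const|apply continuous_id]).
    destruct (contP_E1 ((1 + d) * x) ltac:(nra)) as [B1 B2]. split.
    - now apply (continuous_comp (fun x => (1 + d) * x) (fun s => fst (E1 l m s))).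
    - now apply (continuous_comp (fun x => (1 + d) * x) (fun s => snd (E1 l m s))). }
  assert (A2 : contP (fun x => E1 l m ((1 + d) * x) + RtoC (-1) * E1 l m x)%C x).
  { apply contP_plus; auto. apply contP_mult; [apply contP_const|now apply contP_E1]. }
  assert (A3 : contP (fun x => RtoC (/ (d * x))) x).
  { split; simpl; [|apply continuous_const]. apply (ex_derive_continuous (V := R_NormedModule)). auto_derive. nra. }
  assert (A4 := contP_mult _ _ _ A2 A3).
  assert (Loc : locally x (fun y => ((E1 l m ((1 + d) * y) + RtoC (-1) * E1 l m y) * RtoC (/ (d * y)))%C = Ad d y)).
  { exists (mkposreal x Hx). intros y Hy. change (Rabs (y - x) < x) in Hy. apply Rabs_lt_between in Hy.
    unfold Ad. assert (d * y <> 0) by nra. rewrite RtoC_inv by auto. field. intro E. apply RtoC_inj in E. auto. }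
  destruct A4 as [B1 B2]. split.
  - apply (continuous_ext_loc _ _ x (filter_imp _ _ (fun y (E : _ = _) => f_equal fst E) Loc) B1).
  - apply (continuous_ext_loc _ _ x (filter_imp _ _ (fun y (E : _ = _) => f_equal snd E) Loc) B2).
Qed.

End Error.

(** * Mean squares from Mellin transforms *)

Lemma N2_plus_le (x y : C) : N2 (x + y)%C <= 2 * N2 x + 2 * N2 y.
Proof.
  unfold N2; destruct x as [a b], y as [c d]; simpl.
  assert (T1 := pow2_ge_0 (a - c)). assert (T2 := pow2_ge_0 (b - d)). nra.
Qed.

Lemma N2_scal (k : R) (x : C) : N2 (RtoC k * x)%C = k ^ 2 * N2 x.
Proof. rewrite N2_mult. unfold N2 at 1; simpl. ring. Qed.

(** With u = ln x the interval [Z, eZ] becomes a window of length 1, the shape that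
    [plancherel_window] requires. The weights exp(2 s u) and exp u, from the line of integration and
    from dx, are bounded by exp((2s+1)(U+1)). *)
Lemma window_bound (Bf b : R -> C) (s c C0 V : R) : 0 <= s <= c -> 0 <= C0 -> 0 <= V ->
  (forall t, contP b t) -> (forall T, 0 < T -> RInt (fun t => N2 (b t)) (- T) T <= V) ->
  (forall x T, 1 <= x -> 1 <= T ->
     Cmod (RtoC (2 * PI) * Bf x - RtoC (exp (s * ln x)) * CI (fun t => b t * cexp (0, (t * ln x)%R)) (- T)%R T)%C
     <= C0 * exp (c * ln x) / T) ->
  (forall x, 0 < x -> contP Bf x) ->
  forall Z, 1 <= Z -> RInt (fun x => N2 (Bf x)) Z (exp 1 * Z) <= exp (2 * s + 1) * Rpower Z (2 * s + 1) * V.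
Proof.
  intros Hs HC0 HV Hb HbV Happ HB Z HZ. set (U := ln Z).
  assert (HU : exp U = Z) by (unfold U; apply exp_ln; lra).
  assert (U0 : 0 <= U) by (unfold U; rewrite <- ln_1; apply ln_le; lra).
  assert (EZ : exp (U + 1) = exp 1 * Z) by (rewrite exp_plus, HU; ring).
  assert (HPI := PI_RGT_0). assert (PI1 : 1 <= PI) by (assert (T := PI2_1); unfold PI2 in T; lra).
  set (g := fun x => N2 (Bf x)).
  assert (Cg : forall x, 0 < x -> continuous g x) by (intros x Hx; apply contP_N2; auto).
  assert (Sub : RInt (fun u => exp u * g (exp u)) U (U + 1) = RInt g Z (exp 1 * Z)).
  { rewrite <- HU at 1. rewrite <- EZ. apply (RInt_comp (V := R_CompleteNormedModule) g exp exp U (U + 1)).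
    - intros u _. apply Cg, exp_pos.
    - intros u _. split; [apply is_derive_Reals, derivable_pt_lim_exp|].
      apply continuity_pt_filterlim. apply derivable_continuous_pt, derivable_pt_exp. }
  fold g. rewrite <- Sub. clear Sub.
  assert (Ce : forall u, continuous exp u).
  { intros u. apply continuity_pt_filterlim. apply derivable_continuous_pt, derivable_pt_exp. }
  assert (Eg : ex_RInt (fun u => exp u * g (exp u)) U (U + 1)).
  { apply ex_RInt_cont. intros u. apply (continuous_mult (K := R_AbsRing) exp (fun u => g (exp u))); auto.
    apply (continuous_comp exp g); auto. apply Cg, exp_pos. }
  set (M := exp ((2 * s + 1) * (U + 1))). assert (HM : 0 < M) by apply exp_pos.
  replace (exp (2 * s + 1) * Rpower Z (2 * s + 1)) with M
    by (unfold M, Rpower; fold U; rewrite <- exp_plus; f_equal; ring).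
  set (C1 := exp (U + 1) * (C0 * exp (c * (U + 1))) ^ 2).
  assert (HC1 : 0 <= C1) by (apply Rmult_le_pos; [left; apply exp_pos|apply pow2_ge_0]).
  apply le_epsilon. intros e He.
  (* [T = PI * INR n] is a whole number of periods and can be taken so large that the truncation
     error, of order T^(-2) after squaring, is below [e]. *)
  destruct (INR_unbounded (C1 / e + 1)) as [n Hn].
  set (T := PI * INR n).
  assert (Hn1 : 1 <= INR n).
  { assert (0 <= C1 / e) by (apply Rmult_le_pos; [auto|left; now apply Rinv_0_lt_compat]). lra. }
  assert (HT : 1 <= T) by (unfold T; nra). assert (HTn : INR n <= T) by (unfold T; nra).
  destruct (plancherel_window b T U Hb n eq_refl) as [Jf [IJ BJ]].
  assert (pt : forall u, U <= u <= U + 1 -> exp u * g (exp u) <= M * Jf u + (C1 / T ^ 2) * 1).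
  { intros u Hu. assert (A := Happ (exp u) T). rewrite ln_exp in A.
    assert (1 <= exp u) by (rewrite <- exp_0; apply exp_le_compat; lra). specialize (A H HT).
    set (P := CI (fun t => b t * cexp (0, (t * u)%R))%C (- T) T) in *.
    specialize (BJ u). fold P in BJ.
    set (er := (RtoC (2 * PI) * Bf (exp u) - RtoC (exp (s * u)) * P)%C) in *.
    assert (Q1 : (2 * PI) ^ 2 * g (exp u) <= 2 * (exp (s * u) ^ 2 * N2 P) + 2 * N2 er).
    { unfold g. rewrite <- !N2_scal. eapply Rle_trans; [|apply N2_plus_le]. right. f_equal. unfold er. ring. }
    assert (Q2 : N2 er <= (C0 * exp (c * (U + 1))) ^ 2 / T ^ 2).
    { rewrite N2_Cmod. replace ((C0 * exp (c * (U + 1))) ^ 2 / T ^ 2) with ((C0 * exp (c * (U + 1)) / T) ^ 2) by (field; lra).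
      apply pow_incr. split; [apply Cmod_ge_0|]. eapply Rle_trans; [apply A|].
      apply Rmult_le_compat_r; [left; apply Rinv_0_lt_compat; lra|]. apply Rmult_le_compat_l; auto.
      apply exp_le_compat. nra. }
    assert (Jp : 0 <= Jf u) by (assert (T0 := N2_pos P); nra).
    assert (E2 : exp u * exp (s * u) ^ 2 <= M).
    { unfold M. simpl. rewrite Rmult_1_r, <- !exp_plus. apply exp_le_compat. nra. }
    assert (E3 : exp u <= exp (U + 1)) by (apply exp_le_compat; lra).
    assert (gp : 0 <= g (exp u)) by apply N2_pos. assert (ep := exp_pos u).
    assert (Tp : 0 < / T ^ 2) by (apply Rinv_0_lt_compat, pow_lt; lra).
    set (w := (C0 * exp (c * (U + 1))) ^ 2) in *. assert (wp : 0 <= w) by apply pow2_ge_0.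
    assert (S1 : (2 * PI) ^ 2 * (exp u * g (exp u)) <= 2 * (2 * PI) * (M * Jf u) + 2 * (C1 / T ^ 2)).
    { apply Rle_trans with (exp u * (2 * (exp (s * u) ^ 2 * N2 P) + 2 * N2 er)); [nra|].
      assert (exp u * (exp (s * u) ^ 2 * N2 P) <= 2 * PI * (M * Jf u)).
      { rewrite <- Rmult_assoc. apply Rle_trans with (M * (2 * PI * Jf u)); [|right; ring].
        apply Rmult_le_compat; auto; [apply Rmult_le_pos; [lra|apply pow2_ge_0]|apply N2_pos]. }
      assert (exp u * N2 er <= C1 / T ^ 2).
      { unfold C1. fold w. unfold Rdiv in *. rewrite Rmult_assoc. apply Rmult_le_compat; auto; [lra|apply N2_pos]. }
      lra. }
    set (X := exp u * g (exp u)) in *. assert (X0 : 0 <= X) by (apply Rmult_le_pos; lra).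
    set (Y := M * Jf u) in *. assert (Y0 : 0 <= Y) by (apply Rmult_le_pos; lra).
    set (q := C1 / T ^ 2) in *. assert (q0 : 0 <= q) by (apply Rmult_le_pos; lra).
    assert ((2 * PI) ^ 2 * X <= (2 * PI) ^ 2 * (Y + q)).
    { eapply Rle_trans; [apply S1|]. assert (2 * (2 * PI) <= (2 * PI) ^ 2) by nra. assert (2 <= (2 * PI) ^ 2) by nra. nra. }
    rewrite Rmult_1_r. apply Rmult_le_reg_l with ((2 * PI) ^ 2); [nra|auto]. }
  assert (EJ : ex_RInt Jf U (U + 1)) by (eexists; apply IJ).
  apply Rle_trans with (RInt (fun u => M * Jf u + (C1 / T ^ 2) * 1) U (U + 1)).
  - apply RInt_le; auto; [lra| |].
    + apply (exRInt_lin Jf (fun _ => 1)); auto. apply ex_RInt_const.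
    + intros u Hu. apply pt. lra.
  - rewrite (RInt_lin Jf (fun _ => 1)) by (auto; apply ex_RInt_const).
    rewrite RInt_const, (is_RInt_unique _ _ _ _ IJ). unfold scal; simpl. unfold mult; simpl.
    assert (M * RInt (fun t => N2 (b t)) (- T) T <= M * V) by (apply Rmult_le_compat_l; [lra|apply HbV; lra]).
    assert (C1 / (T * (T * 1)) * ((U + 1 - U) * 1) <= e).
    { replace ((U + 1 - U) * 1) with 1 by ring. rewrite Rmult_1_r.
      apply Rmult_le_reg_r with (T * (T * 1)); [nra|]. unfold Rdiv. rewrite Rmult_assoc, Rinv_l, Rmult_1_r by nra.
      assert (C1 / e < T) by lra. apply Rmult_lt_compat_r with (r := e) in H0; [|lra].
      replace (C1 / e * e) with C1 in H0 by (field; lra). nra. }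
    lra.
Qed.

Lemma cexp_sub1 (z : C) (w : R) : 0 <= w -> 0 <= fst z ->
  Cmod (cexp (z * w) - 1)%C <= Cmod z * w * exp (fst z * w).
Proof.
  intros Hw Hz.
  assert (D : forall x, isD (fun x => cexp (z * x))%C x (z * cexp (z * x))%C).
  { intros x. eapply isD_eq; cycle 1.
    { apply (isD_comp cexp (fun x => z * x)%C); [apply isD_scal, isD_id|apply isD_cexp]. } cbv beta. ring. }
  assert (Cn : forall x, contC (fun x => z * cexp (z * x))%C x).
  { intros x. apply contC_mult; [apply contC_const|]. eapply isD_contC, D. }
  assert (F := CI_FTC_horiz (fun x => cexp (z * x))%C (fun x => z * cexp (z * x))%C 0 0 w ltac:(auto)).
  cbv beta in F.
  replace (cexp (z * (w, 0)))%C with (cexp (z * w))%C in F by reflexivity.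
  replace (cexp (z * (0, 0)))%C with (RtoC 1) in F.
  2:{ change ((0, 0) : C) with (RtoC 0). now rewrite Cmult_0_r, cexp_0. }
  rewrite <- F. replace (Cmod z * w * exp (fst z * w)) with (Cmod z * exp (fst z * w) * (w - 0)) by ring.
  apply CI_norm_const; auto.
  - apply contP_ab; auto. intros t _. apply (contC_horiz (fun x => z * cexp (z * x))%C t 0). apply Cn.
  - intros t Ht. rewrite Cmod_mult, Cmod_cexp. apply Rmult_le_compat_l; [apply Cmod_ge_0|]. apply exp_le_compat.
    simpl. nra.
Qed.

(* Averaging over [[x, (1 + d) x]] multiplies Mellin transforms by [kap d]. *)
Definition kap (d : R) (z : C) : C := ((cexp ((z + 1) * ln (1 + d)) - 1) / (d * (z + 1)))%C.

(** Every 4 is at least (1+d)^(s+1), an upper bound for the exponentials involved. The trivial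
    bounds and the linear ones in d|z| are both kept, since interpolation between them yields the
    power of d. *)
Lemma kap_bounds (d s t : R) : 0 < d <= 1 -> 0 <= s <= 1 ->
  Cmod (kap d (s, t)) <= 4 /\ Cmod (kap d (s, t) - 1)%C <= 4 * (d * Cmod (s, t)) /\
  Cmod (cexp ((s, t) * ln (1 + d)) - 1)%C <= 4 * (d * Cmod (s, t)) /\
  Cmod (cexp ((s, t) * ln (1 + d)) - 1)%C <= 4.
Proof.
  intros Hd Hs. set (w := ln (1 + d)). set (z := (s, t)).
  assert (Ew : exp w = 1 + d) by (unfold w; apply exp_ln; lra).
  assert (w0 : 0 <= w) by (unfold w; rewrite <- ln_1; apply ln_le; lra).
  assert (wd : w <= d) by (assert (T := exp_ineq1_le w); lra).
  assert (ws : exp (s * w) <= 2).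
  { apply Rle_trans with (exp w); [apply exp_le_compat; nra|lra]. }
  assert (ws1 : exp ((s + 1) * w) <= 4).
  { replace ((s + 1) * w) with (s * w + w) by ring. rewrite exp_plus. assert (T := exp_pos (s * w)). nra. }
  assert (nz : (z + 1)%C <> 0) by (intro E; apply (f_equal fst) in E; simpl in E; lra).
  assert (Pz := Cmod_ge_0 z). assert (Pz1 := proj1 (Cmod_gt_0 _) nz).
  assert (nd : RtoC d <> 0) by (intro E; apply RtoC_inj in E; lra).
  assert (Md : Cmod (d * (z + 1))%C = d * Cmod (z + 1)%C) by (rewrite Cmod_mult, Cmod_R, Rabs_pos_eq by lra; reflexivity).
  assert (dp : 0 < d * Cmod (z + 1)%C) by (apply Rmult_lt_0_compat; lra).
  split; [|split; [|split]].
  - unfold kap. fold w z. rewrite Cmod_div by (now apply Cmult_neq_0). rewrite Md.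
    apply Rmult_le_reg_r with (d * Cmod (z + 1)%C); auto. unfold Rdiv. rewrite Rmult_assoc, Rinv_l, Rmult_1_r by lra.
    eapply Rle_trans; [apply cexp_sub1; auto; simpl; lra|].
    replace (fst (z + 1)%C * w) with ((s + 1) * w) by (simpl; ring). 
    apply Rle_trans with (Cmod (z + 1)%C * d * 4); [|right; ring].
    apply Rmult_le_compat; auto; [nra|left; apply exp_pos|]. nra.
  (* The function exp((z+1)x) - (z+1) exp x has derivative (z+1) exp x (exp(zx) - 1), and between 0
     and ln(1+d) it changes by d (z+1)(kap d z - 1). *)
  - assert (F := CI_FTC_horiz (fun x => cexp ((z + 1) * x) - (z + 1) * cexp x)%C
      (fun x => (z + 1) * (cexp x * (cexp (z * x) - 1)))%C 0 0 w).
    assert (D0 : forall x : C, isD (fun x => cexp ((z + 1) * x) - (z + 1) * cexp x)%C x ((z + 1) * (cexp x * (cexp (z * x) - 1)))%C).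
    { intros x. eapply isD_eq; cycle 1.
      { apply isD_minus; [|apply isD_scal, isD_cexp].
        apply (isD_comp cexp (fun x => (z + 1) * x)%C); [apply isD_scal, isD_id|apply isD_cexp]. }
      cbv beta. replace ((z + 1) * x)%C with (z * x + x)%C by ring. rewrite cexp_plus. ring. }
    assert (Cn : forall x, contC (fun x => (z + 1) * (cexp x * (cexp (z * x) - 1)))%C x).
    { intros x. apply contC_mult; [apply contC_const|]. apply contC_mult; [eapply isD_contC, isD_cexp|].
      apply contC_minus; [|apply contC_const]. apply (contC_comp cexp (fun x => z * x)%C); [apply contC_mult; [apply contC_const|apply contC_id]|eapply isD_contC, isD_cexp]. }
    specialize (F ltac:(auto)). cbv beta in F.
    change ((w, 0) : C) with (RtoC w) in F. change ((0, 0) : C) with (RtoC 0) in F.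
    rewrite Cmult_0_r, cexp_0 in F.
    assert (Ecw : cexp (RtoC w) = RtoC (1 + d)).
    { unfold cexp, RtoC; simpl. rewrite Ew, cos_0, sin_0. f_equal; ring. }
    rewrite Ecw, RtoC_plus in F.
    assert (E : (kap d z - 1)%C = (CI (fun x => (z + 1) * (cexp (x, 0) * (cexp (z * (x, 0)) - 1)))%C 0 w / (d * (z + 1)))%C).
    { rewrite F. unfold kap. fold w. field. auto. }
    rewrite E, Cmod_div, Md by (now apply Cmult_neq_0).
    apply Rmult_le_reg_r with (d * Cmod (z + 1)%C); auto. unfold Rdiv. rewrite Rmult_assoc, Rinv_l, Rmult_1_r by lra.
    apply Rle_trans with (Cmod (z + 1)%C * (Cmod z * d * 4) * (w - 0)).
    + apply CI_norm_const; auto.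
      * apply contP_ab; auto. intros x _. apply (contC_horiz (fun x => (z + 1) * (cexp x * (cexp (z * x) - 1)))%C x 0). apply Cn.
      * intros x Hx. rewrite Cmod_mult. apply Rmult_le_compat_l; [lra|]. rewrite Cmod_mult, Cmod_cexp. simpl fst at 1.
        assert (B := cexp_sub1 z x ltac:(lra) ltac:(simpl; lra)). change (RtoC x) with ((x, 0) : C) in B. simpl fst in B.
        assert (X1 : exp x * exp (s * x) <= 4).
        { rewrite <- exp_plus. eapply Rle_trans; [|apply ws1]. apply exp_le_compat. nra. }
        assert (X2 := exp_pos x). assert (X3 := exp_pos (s * x)).
        apply Rle_trans with (exp x * (Cmod z * x * exp (s * x))); [apply Rmult_le_compat_l; lra|].
        replace (exp x * (Cmod z * x * exp (s * x))) with (Cmod z * x * (exp x * exp (s * x))) by ring.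
        apply Rmult_le_compat; auto; [apply Rmult_le_pos; lra|nra|]. apply Rmult_le_compat_l; lra.
    + rewrite Rminus_0_r. replace (4 * (d * Cmod z) * (d * Cmod (z + 1)%C)) with (Cmod (z + 1)%C * (Cmod z * d * 4) * d) by ring.
      apply Rmult_le_compat_l; [|lra]. apply Rmult_le_pos; [lra|]. apply Rmult_le_pos; [apply Rmult_le_pos; lra|lra].
  - eapply Rle_trans; [apply cexp_sub1; auto; simpl; lra|]. simpl fst.
    apply Rle_trans with (Cmod z * d * 4); [|right; ring]. apply Rmult_le_compat; auto; [nra|left; apply exp_pos|nra|lra].
  - eapply Rle_trans; [apply Cmod_le_sub|]. rewrite Cmod_cexp, Cmod_1.
    replace (fst (z * w)%C) with (s * w) by (simpl; ring). lra.
Qed.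

Lemma tail_integral (e T : R) : 0 < e -> 0 < T ->
  ex_RInt (fun t => Rpower (1 + Rabs t) (- (1 + 2 * e))) (- T) T /\
  RInt (fun t => Rpower (1 + Rabs t) (- (1 + 2 * e))) (- T) T <= / e.
Proof.
  intros He HT.
  assert (pos : is_RInt (fun t => Rpower (1 + Rabs t) (- (1 + 2 * e))) 0 T (/ (2 * e) - / (2 * e) * Rpower (1 + T) (- (2 * e)))).
  { apply (is_RInt_ext (fun t => Rpower (1 + t) (- (1 + 2 * e)))).
    { intros t. rewrite Rmin_left, Rmax_right by lra. intros Ht. now rewrite Rabs_pos_eq by lra. }
    evar_last.
    - apply (is_RInt_derive (V := R_CompleteNormedModule) (fun t => - / (2 * e) * Rpower (1 + t) (- (2 * e)))).
      + intros t. rewrite Rmin_left, Rmax_right by lra. intros Ht. unfold Rpower. auto_derive; [lra|].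
        replace (- (1 + 2 * e) * ln (1 + t)) with (- (2 * e) * ln (1 + t) + - ln (1 + t)) by ring.
        rewrite exp_plus, exp_Ropp, exp_ln by lra. field. lra.
      + intros t. rewrite Rmin_left, Rmax_right by lra. intros Ht.
        apply (ex_derive_continuous (V := R_NormedModule)). unfold Rpower. auto_derive. lra.
    - unfold minus, plus, opp; simpl. rewrite Rplus_0_r. unfold Rpower at 2. rewrite ln_1, Rmult_0_r, exp_0. ring. }
  assert (neg : is_RInt (fun t => Rpower (1 + Rabs t) (- (1 + 2 * e))) (- T) 0 (/ (2 * e) - / (2 * e) * Rpower (1 + T) (- (2 * e)))).
  { assert (C := is_RInt_comp_opp (V := R_NormedModule) (fun t => Rpower (1 + Rabs t) (- (1 + 2 * e))) (- T) 0 (- (/ (2 * e) - / (2 * e) * Rpower (1 + T) (- (2 * e))))).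
    rewrite Ropp_involutive, Ropp_0 in C. specialize (C (is_RInt_swap (V := R_NormedModule) _ _ _ _ pos)).
    apply (is_RInt_opp (V := R_NormedModule)) in C.
    evar_last.
    - apply (is_RInt_ext _ _ _ _ _ ) with (2 := C). intros t _. unfold opp; simpl. rewrite Rabs_Ropp. ring.
    - unfold opp; simpl. ring. }
  assert (tot := is_RInt_Chasles (V := R_NormedModule) _ _ _ _ _ _ neg pos).
  split; [eexists; apply tot|]. rewrite (is_RInt_unique _ _ _ _ tot). unfold plus; simpl.
  assert (P : 0 < Rpower (1 + T) (- (2 * e))) by apply exp_pos.
  assert (P2 : 0 < / (2 * e)) by (apply Rinv_0_lt_compat; lra).
  replace (/ e) with (/ (2 * e) + / (2 * e)) by (field; lra). nra.
Qed.

Lemma RInt_aff (g : R -> R) (al be a b : R) : 0 < al -> lpc g ->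
  RInt (fun x => g (al * x + be)) a b = / al * RInt g (al * a + be) (al * b + be).
Proof.
  intros Ha Lg.
  assert (S := RInt_comp_lin (V := R_CompleteNormedModule) g al be a b (lpc_int g _ _ Lg)).
  rewrite <- S. rewrite (RInt_ext_R (fun y => scal al (g (al * y + be))) (fun y => al * g (al * y + be))) by reflexivity.
  assert (E : RInt (fun y => al * g (al * y + be)) a b = al * RInt (fun y => g (al * y + be)) a b).
  { apply (RInt_scal (V := R_CompleteNormedModule) (fun x => g (al * x + be))). apply lpc_int. now apply lpc_aff. }
  rewrite E, <- Rmult_assoc, Rinv_l, Rmult_1_l by lra. reflexivity.
Qed.

Lemma RInt_dil (g : R -> R) (al a b : R) : 0 < al -> lpc g ->
  RInt (fun x => g (al * x)) a b = / al * RInt g (al * a) (al * b).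
Proof.
  intros Ha Lg. assert (E := RInt_aff g al 0 a b Ha Lg). rewrite !Rplus_0_r in E. rewrite <- E.
  apply RInt_ext_R. intros. now rewrite Rplus_0_r.
Qed.

Lemma lpc_dil (g : R -> R) (al : R) : 0 < al -> lpc g -> lpc (fun x => g (al * x)).
Proof. intros Ha Lg. apply (lpc_ext (fun x => g (al * x + 0))); [intros; f_equal; ring|now apply lpc_aff]. Qed.

Lemma lpcC_dil (g : R -> C) (al : R) : 0 < al -> lpcC g -> lpcC (fun x => g (al * x)).
Proof.
  intros Ha [H1 H2]. split; [apply (lpc_dil (fun x => fst (g x)))|apply (lpc_dil (fun x => snd (g x)))]; auto.
Qed.

(** The exponent 1 - 4e is the saving in d that the integral over t can afford: |H|^2 is of order
    y^(-2+2e), and y^(1-4e) brings it to y^(-1-2e), still integrable. *)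
Lemma min_sq_le (X y e : R) : 0 <= X -> X <= 1 -> X <= y -> 0 < y -> 0 < e <= 1/4 -> X ^ 2 <= Rpower y (1 - 4 * e).
Proof.
  intros H0 H1 H2 Hy He. destruct (Rle_lt_dec y 1) as [L|L].
  - apply Rle_trans with (y ^ 2); [apply pow_incr; lra|]. rewrite <- (Rpower_pow 2) by auto.
    unfold Rpower. apply exp_le_compat. simpl. assert (ln y <= 0) by (rewrite <- ln_1; apply ln_le; lra). nra.
  - apply Rle_trans with 1; [simpl; nra|]. unfold Rpower. apply Rle_trans with (exp 0); [rewrite exp_0; lra|].
    apply exp_le_compat. assert (0 <= ln y) by (rewrite <- ln_1; apply ln_le; lra). nra.
Qed.

Section MeanSquare.
Variables (l : nat -> C) (m : nat) (G G' : C -> C) (c B : R).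
Hypotheses (Hc : 5 <= c) (DG : forall z, isD G z (G' z)) (NZ : forall z, 1/2 < fst z -> G z <> 0)
  (LD : forall e, 0 < e <= 1 -> exists B, 0 < B /\ forall x t, 1/2 + e <= x <= c ->
    Cmod (G' (x, t) / G (x, t))%C <= B * ln (3 + Rabs t))
  (HD : forall t, limC (fun n => csum (fun k => l k * cexp (- (c, t) * ln (INR (S k))))%C (S n))
    (- (G' (c, t) / G (c, t) - INR m / ((c, t) - 1)))%C)
  (HB : 0 < B) (Hl : forall n, Cmod (l n) <= B * INR (S n) ^ 2).
Variable e : R.
Hypothesis He : 0 < e <= 1/4.
Let s := 1/2 + e.
Let H := Hm m G G'.

(** The logarithm of the bound for G'/G is absorbed in the e-th power, with constant 2 + 1/e, and |s
    + it| >= (1 + |t|)/3. *)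
Lemma Hm_bound : exists K, 0 < K /\ forall t, Cmod (H (s, t)) <= K * Rpower (1 + Rabs t) (-1 + e).
Proof.
  destruct (LD e ltac:(lra)) as [B0 [HB0 L0]]. assert (Pm := pos_INR m).
  exists (3 * (B0 * (2 + / e) + INR m)).
  assert (Pe : 0 < / e) by (apply Rinv_0_lt_compat; lra).
  split; [nra|]. intros t. set (y := 1 + Rabs t). assert (Hy : 1 <= y) by (unfold y; assert (T := Rabs_pos t); lra).
  assert (Ye : 1 <= Rpower y e).
  { unfold Rpower. rewrite <- exp_0 at 1. apply exp_le_compat. assert (0 <= ln y) by (rewrite <- ln_1; apply ln_le; lra). nra. }
  assert (Ln : ln (3 + Rabs t) <= (2 + / e) * Rpower y e).
  { apply Rle_trans with (2 + ln y).
    - assert (ln (3 + Rabs t) <= ln (3 * y)) by (apply ln_le; unfold y; assert (T := Rabs_pos t); lra).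
      rewrite ln_mult in H0 by lra.
      assert (T3 := exp_ineq1_le (ln 3)). rewrite exp_ln in T3 by lra. lra.
    - assert (T := exp_ineq1_le (e * ln y)). fold (Rpower y e) in T.
      assert (ln y <= / e * Rpower y e).
      { apply Rmult_le_reg_l with e; [lra|]. rewrite <- Rmult_assoc, Rinv_r, Rmult_1_l by lra. lra. }
      nra. }
  assert (B1 := L0 s t ltac:(unfold s; lra)).
  unfold H, Hm.
  assert (F1 := fst_le_Cmod (s, t)). assert (F2 := snd_le_Cmod (s, t)). simpl in F1, F2.
  rewrite Rabs_pos_eq in F1 by (unfold s; lra).
  assert (Hs : 1/2 <= s) by (unfold s; lra). assert (Zl : y / 3 <= Cmod (s, t)) by (unfold y; lra).
  assert (nz : ((s, t) : C) <> 0) by (apply Cmod_gt_0; lra).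
  rewrite Cmod_div, Cmod_opp by auto.
  assert (NB : Cmod (G' (s, t) / G (s, t) + INR m)%C <= (B0 * (2 + / e) + INR m) * Rpower y e).
  { eapply Rle_trans; [apply Cmod_triangle|]. rewrite Cmod_R, (Rabs_pos_eq (INR m)) by lra.
    assert (B0 * ln (3 + Rabs t) <= B0 * ((2 + / e) * Rpower y e)) by (apply Rmult_le_compat_l; lra). nra. }
  rewrite Rpower_plus. replace (Rpower y (-1)) with (/ y).
  2:{ change (-1) with (- (1)). rewrite Rpower_Ropp, Rpower_1; lra. }
  apply Rle_trans with ((B0 * (2 + / e) + INR m) * Rpower y e * / (y / 3)).
  - apply Rmult_le_compat; auto; [apply Cmod_ge_0|left; apply Rinv_0_lt_compat; lra|]. apply Rinv_le_contravar; lra.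
  - right. field. lra.
Qed.

(* [Bf] has Mellin transform [H mu], inverted on the line [Re z = s] with a truncation error. *)
Definition Inv (Bf : R -> C) (mu : C -> C) : Prop :=
  (forall t, contC mu (s, t)) /\ exists C0, 0 <= C0 /\ forall x T, 1 <= x -> 1 <= T ->
  Cmod (RtoC (2 * PI) * Bf x - RtoC (exp (s * ln x)) * CI (fun t => (H (s, t) * mu (s, t)) * cexp (0, (t * ln x)%R)) (- T)%R T)%C
   <= C0 * exp (c * ln x) / T.

Lemma contP_Hmu (mu : C -> C) (t : R) : contC mu (s, t) -> contP (fun t => H (s, t) * mu (s, t))%C t.
Proof.
  intros Hmu. apply contP_mult; apply contC_vert; auto.
  destruct (isD_Hm m G G' DG NZ (s, t)) as [d Hd]; [simpl; unfold s; lra|]. now apply isD_contC with d.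
Qed.

Lemma exCI_Hmu (mu : C -> C) (u T : R) : (forall t, contC mu (s, t)) ->
  exCI (fun t => (H (s, t) * mu (s, t)) * cexp (0, (t * u)%R))%C (- T) T.
Proof.
  intros Hmu. apply exCI_cont. intros t _. apply contP_mult; [now apply contP_Hmu|apply contP_exp].
Qed.

Lemma contC_mu0 (v t : R) : contC (fun z => cexp ((z + 1) * v) / (z + 1))%C (s, t).
Proof.
  apply contC_div; [intro E; apply (f_equal fst) in E; simpl in E; unfold s in E; lra| |].
  - eapply isD_contC, isD_cexp_lin.
  - eapply isD_contC, isD_shift.
Qed.

(** Averages of E and their dilations are linear combinations of such functions. Division by x
    lowers the power x^(s+1) in the inversion of [E1] to x^s. *)
Lemma Inv_base (al : R) : 1 <= al ->
  Inv (fun x => E1 l m (al * x) * RtoC (/ x))%C (fun z => cexp ((z + 1) * ln al) / (z + 1))%C.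
Proof.
  intros Hal. split; [intros; apply contC_mu0|].
  destruct (inversion l m G G' c B Hc DG NZ LD HD HB Hl e ltac:(lra)) as [K [HK I]].
  exists (K * exp ((c + 1) * ln al)). split; [left; apply Rmult_lt_0_compat; [auto|apply exp_pos]|].
  intros x T X1 HT. specialize (I (al * x) T ltac:(nra) HT).
  set (u := ln x) in *. assert (Ex : exp u = x) by (unfold u; apply exp_ln; lra).
  assert (El : ln (al * x) = ln al + u) by (unfold u; apply ln_mult; lra). rewrite El in I.
  fold s in I.
  assert (nz : forall t, ((s, t) + 1)%C <> 0) by (intros t E; apply (f_equal fst) in E; simpl in E; unfold s in E; lra).
  assert (EC : CI (fun t => Hx m G G' (ln al + u) (s, t)) (- T) T =
    (RtoC (exp ((s + 1) * u)) * CI (fun t => (H (s, t) * (cexp (((s, t) + 1) * ln al) / ((s, t) + 1))) * cexp (0, (t * u)%R)) (- T)%R T)%C).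
  { rewrite <- CI_scal by (apply (exCI_Hmu (fun z => cexp ((z + 1) * ln al) / (z + 1))%C); intros; apply contC_mu0).
    apply CI_ext. intros t _. unfold Hx. fold H.
    replace (((s, t) + 1) * (ln al + u)%R)%C with (((s, t) + 1) * ln al + (RtoC ((s + 1) * u) + (0, (t * u)%R)))%C.
    2:{ apply injective_projections; simpl; ring. }
    rewrite !cexp_plus.
    replace (cexp (RtoC ((s + 1) * u))) with (RtoC (exp ((s + 1) * u))).
    2:{ unfold cexp, RtoC; simpl. rewrite cos_0, sin_0. f_equal; ring. }
    field. apply nz. }
  rewrite EC in I.
  set (P := CI (fun t => (H (s, t) * (cexp (((s, t) + 1) * ln al) / ((s, t) + 1))) * cexp (0, (t * u)%R))%C (- T) T) in *.
  assert (nx : RtoC x <> 0) by (intro E; apply RtoC_inj in E; lra).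
  replace (RtoC (2 * PI) * (E1 l m (al * x)%R * RtoC (/ x)) - RtoC (exp (s * u)) * P)%C
    with (RtoC (/ x) * (RtoC (2 * PI) * E1 l m (al * x)%R - RtoC (exp ((s + 1) * u)) * P))%C.
  2:{ replace ((s + 1) * u) with (s * u + u) by ring. rewrite exp_plus, Ex, (RtoC_mult (exp (s * u)) x), RtoC_inv by lra. field. auto. }
  rewrite Cmod_mult, Cmod_R, Rabs_pos_eq by (left; apply Rinv_0_lt_compat; lra).
  apply Rmult_le_reg_l with x; [lra|]. rewrite <- Rmult_assoc, Rinv_r, Rmult_1_l by lra.
  eapply Rle_trans; [apply I|]. right.
  replace ((c + 1) * (ln al + u)) with ((c + 1) * ln al + (c * u + u)) by ring.
  rewrite !exp_plus, Ex. field. lra.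
Qed.

Lemma Inv_lin (B1 B2 : R -> C) (m1 m2 : C -> C) (k1 k2 : R) : Inv B1 m1 -> Inv B2 m2 ->
  Inv (fun x => RtoC k1 * B1 x + RtoC k2 * B2 x)%C (fun z => RtoC k1 * m1 z + RtoC k2 * m2 z)%C.
Proof.
  intros [M1 [C1 [HC1 I1]]] [M2 [C2 [HC2 I2]]]. split.
  { intros t. apply contC_plus; apply contC_mult; auto; apply contC_const. }
  exists (Rabs k1 * C1 + Rabs k2 * C2). assert (P1 := Rabs_pos k1). assert (P2 := Rabs_pos k2).
  split; [nra|]. intros x T Hx HT. specialize (I1 x T Hx HT). specialize (I2 x T Hx HT).
  set (u := ln x) in *.
  assert (E : CI (fun t => H (s, t) * (RtoC k1 * m1 (s, t) + RtoC k2 * m2 (s, t)) * cexp (0, (t * u)%R))%C (- T) T =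
    (RtoC k1 * CI (fun t => H (s, t) * m1 (s, t) * cexp (0, (t * u)%R)) (- T)%R T + RtoC k2 * CI (fun t => H (s, t) * m2 (s, t) * cexp (0, (t * u)%R)) (- T)%R T)%C).
  { rewrite <- !CI_scal by (now apply exCI_Hmu). rewrite <- CI_plus by (apply exCI_scal; now apply exCI_Hmu).
    apply CI_ext. intros t _. ring. }
  rewrite E.
  set (X1 := CI (fun t => H (s, t) * m1 (s, t) * cexp (0, (t * u)%R))%C (- T) T) in *.
  set (X2 := CI (fun t => H (s, t) * m2 (s, t) * cexp (0, (t * u)%R))%C (- T) T) in *.
  replace (RtoC (2 * PI) * (RtoC k1 * B1 x + RtoC k2 * B2 x) - RtoC (exp (s * u)) * (RtoC k1 * X1 + RtoC k2 * X2))%C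
    with (RtoC k1 * (RtoC (2 * PI) * B1 x - RtoC (exp (s * u)) * X1) + RtoC k2 * (RtoC (2 * PI) * B2 x - RtoC (exp (s * u)) * X2))%C by ring.
  eapply Rle_trans; [apply Cmod_triangle|]. rewrite !Cmod_mult, !Cmod_R.
  replace ((Rabs k1 * C1 + Rabs k2 * C2) * exp (c * u) / T) with (Rabs k1 * (C1 * exp (c * u) / T) + Rabs k2 * (C2 * exp (c * u) / T)) by (field; lra).
  apply Rplus_le_compat; apply Rmult_le_compat_l; auto.
Qed.

Lemma Inv_ext (B1 B2 : R -> C) (m1 m2 : C -> C) : (forall x, 1 <= x -> B1 x = B2 x) ->
  (forall z, 0 < fst z -> m1 z = m2 z) -> Inv B1 m1 -> Inv B2 m2.
Proof.
  intros EB Em [M1 [C1 [HC1 I1]]]. split.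
  - intros t. apply (contC_ext_loc m1 m2 (s, t) s); [unfold s; lra| |auto]. intros w Hw. apply Em.
    assert (T := fst_le_Cmod (w - (s, t))%C). simpl in T. apply Rabs_le_between in T. lra.
  - exists C1. split; auto. intros x T Hx HT. rewrite <- EB by auto.
    rewrite (CI_ext _ (fun t => H (s, t) * m1 (s, t) * cexp (0, (t * ln x)%R))%C).
    + now apply I1.
    + intros t _. rewrite Em; auto. simpl. unfold s. lra.
Qed.

Lemma Inv_Ad (d : R) : 0 < d -> Inv (Ad l m d) (kap d).
Proof.
  intros Hd. eapply Inv_ext; [| |apply (Inv_lin _ _ _ _ (/ d) (- / d) (Inv_base (1 + d) ltac:(lra)) (Inv_base 1 ltac:(lra)))].
  - intros x Hx. cbv beta. unfold Ad. rewrite Rmult_1_l, !RtoC_opp, !RtoC_inv, RtoC_mult by lra. field.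
    split; intro E; apply RtoC_inj in E; lra.
  - intros z Hz. cbv beta. unfold kap. rewrite ln_1, Cmult_0_r, cexp_0, !RtoC_opp, !RtoC_inv by lra.
    field. split; [|intro E; apply RtoC_inj in E; lra]. intro E; apply (f_equal fst) in E; simpl in E; lra.
Qed.

Lemma Inv_Ad_dil (d h : R) : 0 < d -> 0 < h ->
  Inv (fun x => Ad l m d ((1 + h) * x)) (fun z => kap d z * cexp (z * ln (1 + h)))%C.
Proof.
  intros Hd Hh. eapply Inv_ext; [| |apply (Inv_lin _ _ _ _ (/ (d * (1 + h))) (- / (d * (1 + h)))
    (Inv_base ((1 + d) * (1 + h)) ltac:(nra)) (Inv_base (1 + h) ltac:(lra)))].
  - intros x Hx. cbv beta. unfold Ad. rewrite <- (Rmult_assoc (1 + d)).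
    assert (d * (1 + h) <> 0) by nra.
    rewrite !RtoC_opp, !RtoC_inv, !(RtoC_mult d), RtoC_mult by lra. field.
    repeat split; intro E; apply RtoC_inj in E; lra.
  - intros z Hz. cbv beta. unfold kap. rewrite ln_mult, RtoC_plus by lra. assert (d * (1 + h) <> 0) by nra.
    assert (n1 : (z + 1)%C <> 0) by (intro E; apply (f_equal fst) in E; simpl in E; lra).
    assert (nd : RtoC d <> 0) by (intro E; apply RtoC_inj in E; lra).
    assert (nh : RtoC (1 + h) <> 0) by (intro E; apply RtoC_inj in E; lra).
    rewrite !RtoC_opp, !RtoC_inv, RtoC_mult by auto.
    replace ((z + 1) * (ln (1 + d) + ln (1 + h)))%C with ((z + 1) * ln (1 + d) + (z * ln (1 + h) + RtoC (ln (1 + h))))%C by ring.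
    replace ((z + 1) * ln (1 + h))%C with (z * ln (1 + h) + RtoC (ln (1 + h)))%C by ring.
    rewrite !cexp_plus, (cexp_ln (1 + h)) by lra. field. auto.
Qed.

Lemma Inv_window (Bf : R -> C) (mu : C -> C) (M : R) : Inv Bf mu -> 0 <= M ->
  (forall x, 0 < x -> contP Bf x) ->
  (forall t, N2 (H (s, t) * mu (s, t))%C <= M * Rpower (1 + Rabs t) (- (1 + 2 * e))) ->
  forall Z, 1 <= Z -> RInt (fun x => N2 (Bf x)) Z (exp 1 * Z) <= exp (2 * s + 1) * Rpower Z (2 * s + 1) * (M * / e).
Proof.
  intros [Hmu [C0 [HC0 I]]] HM CB Hb Z HZ.
  assert (Pe : 0 < / e) by (apply Rinv_0_lt_compat; lra).
  apply (window_bound Bf (fun t => H (s, t) * mu (s, t))%C s c C0); auto.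
  - unfold s; lra.
  - apply Rmult_le_pos; lra.
  - intros t. now apply contP_Hmu.
  - intros T HT. destruct (tail_integral e T ltac:(lra) HT) as [E1' B1'].
    apply Rle_trans with (RInt (fun t => M * Rpower (1 + Rabs t) (- (1 + 2 * e))) (- T) T).
    + apply RInt_le; [lra| | |intros; apply Hb].
      * apply ex_RInt_cont. intros t. apply contP_N2. now apply contP_Hmu.
      * apply (ex_RInt_scal (V := R_NormedModule) _ _ _ M E1').
    + assert (ES : RInt (fun t => M * Rpower (1 + Rabs t) (- (1 + 2 * e))) (- T) T = M * RInt (fun t => Rpower (1 + Rabs t) (- (1 + 2 * e))) (- T) T)
        by exact (RInt_scal (V := R_CompleteNormedModule) _ _ _ M E1').
      rewrite ES.
      apply Rmult_le_compat_l; auto.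
Qed.

(** Bounded multipliers need only -2 + 2e <= -1 - 2e, that is e <= 1/4. The bound 16 is that of
    [kap] times that of the dilation minus 1, at most 4 each; multipliers also bounded by 16 d|z|
    gain d^(1-4e). *)
Lemma mult_bound : exists K, 0 < K /\
  (forall (mu : C -> C), (forall t, Cmod (mu (s, t)) <= 4) ->
     forall t, N2 (H (s, t) * mu (s, t))%C <= K * Rpower (1 + Rabs t) (- (1 + 2 * e))) /\
  (forall (mu : C -> C) d, 0 < d -> (forall t, Cmod (mu (s, t)) <= 16) -> (forall t, Cmod (mu (s, t)) <= 16 * (d * Cmod (s, t))) ->
     forall t, N2 (H (s, t) * mu (s, t))%C <= K * Rpower d (1 - 4 * e) * Rpower (1 + Rabs t) (- (1 + 2 * e))).
Proof.
  destruct Hm_bound as [K [HK HH]]. exists (K ^ 2 * 256). split; [assert (0 < K ^ 2) by (apply pow_lt; lra); lra|].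
  assert (sq : forall t, Cmod (H (s, t)) ^ 2 <= K ^ 2 * Rpower (1 + Rabs t) (-2 + 2 * e)).
  { intros t. replace (K ^ 2 * Rpower (1 + Rabs t) (-2 + 2 * e)) with ((K * Rpower (1 + Rabs t) (-1 + e)) ^ 2).
    - apply pow_incr. split; [apply Cmod_ge_0|auto].
    - simpl. replace (-2 + 2 * e) with ((-1 + e) + (-1 + e)) by ring. rewrite (Rpower_plus (-1 + e) (-1 + e)). ring. }
  split.
  - intros mu Hmu t. rewrite N2_mult, !N2_Cmod. specialize (sq t). specialize (Hmu t).
    set (y := 1 + Rabs t) in *. assert (Hy : 1 <= y) by (unfold y; assert (T := Rabs_pos t); lra).
    assert (Cmod (mu (s, t)) ^ 2 <= 256) by (assert (T := Cmod_ge_0 (mu (s, t))); nra).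
    assert (Rpower y (-2 + 2 * e) <= Rpower y (- (1 + 2 * e))) by (apply Rle_Rpower; lra).
    assert (0 < K ^ 2) by (apply pow_lt; lra). assert (P := pow2_ge_0 (Cmod (H (s, t)))). assert (P' := pow2_ge_0 (Cmod (mu (s, t)))).
    apply Rle_trans with (K ^ 2 * Rpower y (- (1 + 2 * e)) * 256); [|right; ring].
    apply Rmult_le_compat; auto. eapply Rle_trans; [apply sq|]. apply Rmult_le_compat_l; lra.
  - intros mu d Hd Hm1 Hm2 t. rewrite N2_mult, !N2_Cmod. specialize (sq t). specialize (Hm1 t). specialize (Hm2 t).
    set (y := 1 + Rabs t) in *. assert (Hy : 1 <= y) by (unfold y; assert (T := Rabs_pos t); lra).
    assert (Zy : Cmod (s, t) <= y).
    { eapply Rle_trans; [apply Cmod_le_abs|]. simpl. rewrite (Rabs_pos_eq s) by (unfold s; lra). unfold y, s. lra. }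
    set (X := Cmod (mu (s, t)) / 16). assert (Q := Cmod_ge_0 (mu (s, t))).
    assert (Sx := min_sq_le X (d * y) e ltac:(unfold X; lra) ltac:(unfold X; lra)
      ltac:(unfold X; apply Rle_trans with (d * Cmod (s, t)); [lra|apply Rmult_le_compat_l; lra]) ltac:(nra) He).
    assert (E2 : Cmod (mu (s, t)) ^ 2 <= 256 * (Rpower d (1 - 4 * e) * Rpower y (1 - 4 * e))).
    { rewrite Rpower_mult_distr by lra. unfold X in Sx. simpl in Sx |- *. lra. }
    assert (P := pow2_ge_0 (Cmod (H (s, t)))). assert (P' := pow2_ge_0 (Cmod (mu (s, t)))).
    apply Rle_trans with (K ^ 2 * Rpower y (-2 + 2 * e) * (256 * (Rpower d (1 - 4 * e) * Rpower y (1 - 4 * e)))).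
    + apply Rmult_le_compat; auto.
    + right. replace (- (1 + 2 * e)) with ((-2 + 2 * e) + (1 - 4 * e)) by ring. rewrite (Rpower_plus (-2 + 2 * e) (1 - 4 * e)). ring.
Qed.

(* Frozen below [1/2] to be continuous on the whole line. *)
Definition Ar (d x : R) : C := Ad l m d (Rmax (1/2) x).

Lemma Ar_eq (d x : R) : 1/2 <= x -> Ar d x = Ad l m d x.
Proof. intros Hx. unfold Ar. now rewrite Rmax_right. Qed.

Lemma lpcC_Ar (d : R) : 0 < d -> lpcC (Ar d).
Proof.
  intros Hd.
  assert (Cm : forall x, continuous (fun x => Rmax (1/2) x) x).
  { intros x. apply continuous_eps. intros ep Hep. exists ep. split; auto. intros y Hy.
    eapply Rle_lt_trans; [|apply Hy]. unfold Rmax. destruct (Rle_dec (1/2) y), (Rle_dec (1/2) x); unfold Rabs; repeat destruct (Rcase_abs _); lra. }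
  assert (P : forall x, 0 < Rmax (1/2) x) by (intros x; assert (T := Rmax_l (1/2) x); lra).
  split; apply lpc_cont; intros x; destruct (contP_Ad l m d (Rmax (1/2) x) Hd (P x)) as [A1 A2].
  - now apply (continuous_comp (fun x => Rmax (1/2) x) (fun y => fst (Ad l m d y))).
  - now apply (continuous_comp (fun x => Rmax (1/2) x) (fun y => snd (Ad l m d y))).
Qed.

(** Convergence of the averages in mean square, since uniform convergence fails at the jumps: the
    square of the difference is at most a constant times the increment of [Wf], whose integral
    [RInt_monotone_shift] makes small. *)
Lemma Ar_to_Ef (a b ep : R) : 1/2 <= a <= b -> 0 < ep -> exists d0, 0 < d0 <= 1 /\ forall d, 0 < d <= d0 ->
  RInt (fun x => N2 (Ar d x - Ef l m x)%C) a b <= ep.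
Proof.
  intros Hab Hep. destruct (Wf_props l m) as [W1 [W2 [W3 W4]]].
  set (W := Wf l m (2 * b)). assert (HW : 0 <= W) by (apply W2; lra).
  exists (Rmin 1 (ep / (b * W ^ 2 + 1))).
  assert (HbW : 0 <= b * W ^ 2) by (apply Rmult_le_pos; [lra|apply pow2_ge_0]).
  split; [split; [apply Rmin_glb_lt; [lra|apply Rdiv_lt_0_compat; lra]|apply Rmin_l]|].
  intros d Hd. assert (M1 := Rmin_l 1 (ep / (b * W ^ 2 + 1))). assert (M2 := Rmin_r 1 (ep / (b * W ^ 2 + 1))).
  assert (L1 : lpc (fun x => Wf l m ((1 + d) * x) - Wf l m x)) by (apply lpc_minus; auto; apply lpc_dil; auto; lra).
  apply Rle_trans with (RInt (fun x => W * (Wf l m ((1 + d) * x) - Wf l m x)) a b).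
  - apply RInt_le; [lra| | |].
    + apply lpc_int, lpc_N2, lpcC_minus; [apply lpcC_Ar; lra|apply lpcC_Ef].
    + apply lpc_int. now apply lpc_scal.
    + intros x Hx. rewrite N2_Cmod, Ar_eq by lra.
      assert (A := Ad_close l m d x ltac:(lra) ltac:(lra)). assert (Q := Cmod_ge_0 (Ad l m d x - Ef l m x)%C).
      assert (Wf l m ((1 + d) * x) - Wf l m x <= W).
      { assert (T1 := W2 x ltac:(lra)). assert (T2 := W1 ((1 + d) * x) (2 * b) ltac:(nra)). fold W in T2. lra. }
      simpl. nra.
  - assert (E : RInt (fun x => W * (Wf l m ((1 + d) * x) - Wf l m x)) a b = W * RInt (fun x => Wf l m ((1 + d) * x) - Wf l m x) a b)
      by (apply (RInt_scal (V := R_CompleteNormedModule) (fun x => Wf l m ((1 + d) * x) - Wf l m x)); now apply lpc_int).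
    rewrite E. assert (S := RInt_monotone_shift (Wf l m) d a b ltac:(lra) ltac:(lra) W1 W2 W3).
    assert (T2 := W1 ((1 + d) * b) (2 * b) ltac:(nra)). fold W in T2.
    assert (d * b * Wf l m ((1 + d) * b) <= d * b * W) by (apply Rmult_le_compat_l; nra).
    apply Rle_trans with (W * (d * b * W)); [apply Rmult_le_compat_l; lra|].
    replace (W * (d * b * W)) with (d * (b * W ^ 2)) by ring.
    apply Rle_trans with (ep / (b * W ^ 2 + 1) * (b * W ^ 2)); [apply Rmult_le_compat_r; lra|].
    apply Rmult_le_reg_r with (b * W ^ 2 + 1); [lra|].
    replace (ep / (b * W ^ 2 + 1) * (b * W ^ 2) * (b * W ^ 2 + 1)) with (ep * (b * W ^ 2)) by (field; lra). nra.
Qed.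

(** Each bound is first proved with E replaced by its average of length d0. The multipliers are
    [kap d0], [kap d0] times the dilation minus 1, and [kap d0 - kap d]; their bounds do not depend
    on d0, which then tends to 0. *)
Lemma mean_squares : exists K, 0 < K /\ forall Z, 1 <= Z ->
  RInt (fun x => N2 (Ef l m x)) Z (exp 1 * Z) <= K * Rpower Z (2 + 2 * e) /\
  forall d, 0 < d <= 1 ->
   RInt (fun x => N2 (Ef l m ((1 + d) * x) - Ef l m x)%C) Z (exp 1 * Z) <= K * Rpower d (1 - 4 * e) * Rpower Z (2 + 2 * e) /\
   RInt (fun x => N2 (Ef l m x - Ar d x)%C) Z (exp 1 * Z) <= K * Rpower d (1 - 4 * e) * Rpower Z (2 + 2 * e).
Proof.
  destruct mult_bound as [K [HK [MB1 MB2]]].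
  set (K1 := exp (2 * s + 1) * (K * / e)).
  assert (Pe : 0 < / e) by (apply Rinv_0_lt_compat; lra).
  assert (HK1 : 0 < K1) by (apply Rmult_lt_0_compat; [apply exp_pos|nra]).
  exists (2 * K1). split; [lra|]. intros Z HZ.
  assert (e1 : 1 < exp 1) by (assert (T := exp_ineq1_le 1); lra).
  set (Z' := exp 1 * Z). assert (HZ' : Z <= Z') by (unfold Z'; nra).
  replace (2 + 2 * e) with (2 * s + 1) by (unfold s; field).
  set (RZ := Rpower Z (2 * s + 1)). assert (HRZ : 0 < RZ) by apply exp_pos.
  assert (LE := lpcC_Ef l m).
  (* Transfers a bound from the smoothed function [Y] to the true one [X] at the price of a factor
     2. *)
  assert (gen : forall (X Y : R -> C) (bd ep : R), lpcC X -> lpcC Y -> 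
     RInt (fun x => N2 (Y x)) Z Z' <= bd -> RInt (fun x => N2 (X x - Y x)%C) Z Z' <= ep ->
     RInt (fun x => N2 (X x)) Z Z' <= 2 * bd + 2 * ep).
  { intros X Y bd ep LX LY HY HXY.
    assert (I1 : ex_RInt (fun x => N2 (Y x)) Z Z') by (apply lpc_int; now apply lpc_N2).
    assert (I2 : ex_RInt (fun x => N2 (X x - Y x)%C) Z Z') by (apply lpc_int, lpc_N2; now apply lpcC_minus).
    apply Rle_trans with (RInt (fun x => 2 * N2 (Y x) + 2 * N2 (X x - Y x)%C) Z Z').
    - apply RInt_le; auto; [apply lpc_int; now apply lpc_N2|now apply exRInt_lin|].
      intros x _. eapply Rle_trans; [|apply N2_plus_le]. right. f_equal. ring.
    - rewrite RInt_lin by auto. lra. }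
  split; [|intros d Hd].
  - apply le_epsilon. intros ep Hep.
    destruct (Ar_to_Ef Z Z' (ep / 2) ltac:(lra) ltac:(lra)) as [d0 [Hd0 AE]].
    specialize (AE d0 ltac:(lra)).
    assert (W := Inv_window (Ad l m d0) (kap d0) K (Inv_Ad d0 ltac:(lra)) ltac:(lra) ltac:(intros; apply contP_Ad; lra)
      (MB1 (kap d0) ltac:(intros t; apply (kap_bounds d0 s t); [lra|unfold s; lra])) Z HZ). fold Z' RZ in W.
    assert (W' : RInt (fun x => N2 (Ar d0 x)) Z Z' <= K1 * RZ).
    { eapply Rle_trans; [|eapply Rle_trans; [apply W|right; unfold K1; ring]]. right. apply RInt_ext_R.
      rewrite Rmin_left, Rmax_right by lra. intros x Hx. now rewrite Ar_eq by lra. }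
    assert (AE' : RInt (fun x => N2 (Ef l m x - Ar d0 x)%C) Z Z' <= ep / 2).
    { eapply Rle_trans; [|apply AE]. right. apply RInt_ext_R. intros x _. rewrite !N2_Cmod. now rewrite Cmod_sub_sym. }
    assert (GG := gen (Ef l m) (Ar d0) _ _ LE (lpcC_Ar d0 ltac:(lra)) W' AE'). lra.
  - assert (PD : 0 < Rpower d (1 - 4 * e)) by apply exp_pos.
    assert (KD : 0 <= K * Rpower d (1 - 4 * e)) by nra.
    split; apply le_epsilon; intros ep Hep.
    + destruct (Ar_to_Ef Z Z' (ep / 8) ltac:(lra) ltac:(lra)) as [d1 [Hd1 AE1]].
      destruct (Ar_to_Ef ((1 + d) * Z) ((1 + d) * Z') (ep / 8) ltac:(nra) ltac:(lra)) as [d2 [Hd2 AE2]].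
      (* The approximation is needed on the window and on its dilate, since E is also evaluated at
         (1+d)x. *)
      set (d0 := Rmin d1 d2). assert (M1 := Rmin_l d1 d2). assert (M2 := Rmin_r d1 d2). fold d0 in M1, M2.
      assert (Hd0 : 0 < d0) by (apply Rmin_glb_lt; lra).
      specialize (AE1 d0 ltac:(lra)). specialize (AE2 d0 ltac:(lra)).
      set (Y := fun x => (Ar d0 ((1 + d) * x) - Ar d0 x)%C).
      assert (LA := lpcC_Ar d0 Hd0).
      assert (LY : lpcC Y) by (apply lpcC_minus; auto; apply lpcC_dil; auto; lra).
      set (X := fun x => (Ef l m ((1 + d) * x) - Ef l m x)%C).
      assert (LX : lpcC X) by (apply lpcC_minus; auto; apply lpcC_dil; auto; lra).
      assert (IV : Inv (fun x => RtoC 1 * Ad l m d0 ((1 + d) * x) + RtoC (-1) * Ad l m d0 x)%C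
         (fun z => RtoC 1 * (kap d0 z * cexp (z * ln (1 + d))) + RtoC (-1) * kap d0 z)%C)
        by (apply Inv_lin; [apply Inv_Ad_dil; lra|apply Inv_Ad; lra]).
      assert (kb : forall t, Cmod (1 * (kap d0 (s, t) * cexp ((s, t) * ln (1 + d))) + -1 * kap d0 (s, t))%C <= 16 /\
         Cmod (1 * (kap d0 (s, t) * cexp ((s, t) * ln (1 + d))) + -1 * kap d0 (s, t))%C <= 16 * (d * Cmod (s, t))).
      { intros t. replace (1 * (kap d0 (s, t) * cexp ((s, t) * ln (1 + d))) + -1 * kap d0 (s, t))%C
          with (kap d0 (s, t) * (cexp ((s, t) * ln (1 + d)) - 1))%C by ring. rewrite Cmod_mult.
        destruct (kap_bounds d0 s t ltac:(lra) ltac:(unfold s; lra)) as [k1 _].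
        destruct (kap_bounds d s t ltac:(lra) ltac:(unfold s; lra)) as [_ [_ [k2 k3]]].
        assert (q1 := Cmod_ge_0 (kap d0 (s, t))). assert (q2 := Cmod_ge_0 (cexp ((s, t) * ln (1 + d)) - 1)%C).
        split; [nra|]. apply Rle_trans with (4 * (4 * (d * Cmod (s, t)))); [|lra]. apply Rmult_le_compat; auto. }
      assert (W := Inv_window _ _ (K * Rpower d (1 - 4 * e)) IV KD).
      specialize (W ltac:(intros x Hx; apply contP_plus; apply contP_mult; try apply contP_const; [|apply contP_Ad; lra];
        assert (P0 : 0 < (1 + d) * x) by nra; destruct (contP_Ad l m d0 ((1 + d) * x) Hd0 P0) as [c1 c2];
        assert (cc : continuous (fun x => (1 + d) * x) x) by (apply (continuous_mult (K := R_AbsRing) (fun _ => 1 + d) (fun t => t)); [apply continuous_const|apply continuous_id]);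
        split; [now apply (continuous_comp (fun x => (1 + d) * x) (fun y => fst (Ad l m d0 y)))|now apply (continuous_comp (fun x => (1 + d) * x) (fun y => snd (Ad l m d0 y)))])).
      specialize (W (MB2 _ d ltac:(lra) (fun t => proj1 (kb t)) (fun t => proj2 (kb t))) Z HZ). fold Z' RZ in W.
      assert (W' : RInt (fun x => N2 (Y x)) Z Z' <= K1 * Rpower d (1 - 4 * e) * RZ).
      { eapply Rle_trans; [|eapply Rle_trans; [apply W|right; unfold K1; ring]]. right. apply RInt_ext_R.
        rewrite Rmin_left, Rmax_right by lra. intros x Hx. unfold Y. rewrite !Ar_eq by nra. f_equal. ring. }
      assert (XY : RInt (fun x => N2 (X x - Y x)%C) Z Z' <= ep / 2).
      { set (D := fun x => (Ar d0 x - Ef l m x)%C). assert (LD' : lpcC D) by (now apply lpcC_minus).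
        assert (I1 : ex_RInt (fun x => N2 (D ((1 + d) * x))) Z Z') by (apply lpc_int, lpc_N2, (lpcC_dil D); auto; lra).
        assert (I2 : ex_RInt (fun x => N2 (D x)) Z Z') by (apply lpc_int, lpc_N2; auto).
        apply Rle_trans with (RInt (fun x => 2 * N2 (D ((1 + d) * x)) + 2 * N2 (D x)) Z Z').
        - apply RInt_le; auto; [apply lpc_int, lpc_N2; now apply lpcC_minus|now apply exRInt_lin|].
          intros x _. replace (N2 (D ((1 + d) * x))) with (N2 (- D ((1 + d) * x)%R)%C) by (rewrite !N2_Cmod, Cmod_opp; reflexivity).
          eapply Rle_trans; [|apply N2_plus_le]. right. f_equal. unfold D, X, Y. ring.
        - rewrite RInt_lin by auto. rewrite (RInt_dil (fun x => N2 (D x))) by (try lra; now apply lpc_N2).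
          assert (J2 : 0 <= RInt (fun x => N2 (D x)) ((1 + d) * Z) ((1 + d) * Z')).
          { apply RInt_ge_0; [nra|apply lpc_int; now apply lpc_N2|intros; apply N2_pos]. }
          assert (Hi : / (1 + d) <= 1) by (rewrite <- Rinv_1; apply Rinv_le_contravar; lra).
          assert (Hi0 : 0 < / (1 + d)) by (apply Rinv_0_lt_compat; lra).
          fold D in AE1, AE2. change (RInt (fun x => N2 (D x)) Z Z' <= ep / 8) in AE1.
          change (RInt (fun x => N2 (D x)) ((1 + d) * Z) ((1 + d) * Z') <= ep / 8) in AE2. nra. }
      assert (GG := gen X Y _ _ LX LY W' XY). unfold X in GG. lra.
    + destruct (Ar_to_Ef Z Z' (ep / 2) ltac:(lra) ltac:(lra)) as [d1 [Hd1 AE]].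
      set (d0 := Rmin d1 d). assert (M1 := Rmin_l d1 d). assert (M2 := Rmin_r d1 d). fold d0 in M1, M2.
      assert (Hd0 : 0 < d0) by (apply Rmin_glb_lt; lra). specialize (AE d0 ltac:(lra)).
      assert (LA := lpcC_Ar d0 Hd0). assert (LAd := lpcC_Ar d ltac:(lra)).
      assert (IV : Inv (fun x => RtoC 1 * Ad l m d0 x + RtoC (-1) * Ad l m d x)%C (fun z => RtoC 1 * kap d0 z + RtoC (-1) * kap d z)%C)
        by (apply Inv_lin; apply Inv_Ad; lra).
      assert (kb : forall t, Cmod (1 * kap d0 (s, t) + -1 * kap d (s, t))%C <= 16 /\
         Cmod (1 * kap d0 (s, t) + -1 * kap d (s, t))%C <= 16 * (d * Cmod (s, t))).
      { intros t. destruct (kap_bounds d0 s t ltac:(lra) ltac:(unfold s; lra)) as [k1 [k2 _]].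
        destruct (kap_bounds d s t ltac:(lra) ltac:(unfold s; lra)) as [k3 [k4 _]].
        assert (q := Cmod_ge_0 (s, t)).
        split.
        - replace (1 * kap d0 (s, t) + -1 * kap d (s, t))%C with (kap d0 (s, t) - kap d (s, t))%C by ring.
          eapply Rle_trans; [apply Cmod_le_sub|lra].
        - replace (1 * kap d0 (s, t) + -1 * kap d (s, t))%C with ((kap d0 (s, t) - 1) - (kap d (s, t) - 1))%C by ring.
          eapply Rle_trans; [apply Cmod_le_sub|]. assert (d0 * Cmod (s, t) <= d * Cmod (s, t)) by (apply Rmult_le_compat_r; lra). nra. }
      assert (W := Inv_window _ _ (K * Rpower d (1 - 4 * e)) IV KD).
      specialize (W ltac:(intros x Hx; apply contP_plus; apply contP_mult; try apply contP_const; apply contP_Ad; lra)).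
      specialize (W (MB2 _ d ltac:(lra) (fun t => proj1 (kb t)) (fun t => proj2 (kb t))) Z HZ). fold Z' RZ in W.
      assert (W' : RInt (fun x => N2 (Ar d0 x - Ar d x)%C) Z Z' <= K1 * Rpower d (1 - 4 * e) * RZ).
      { eapply Rle_trans; [|eapply Rle_trans; [apply W|right; unfold K1; ring]]. right. apply RInt_ext_R.
        rewrite Rmin_left, Rmax_right by lra. intros x Hx. rewrite !Ar_eq by lra. f_equal. ring. }
      assert (XY : RInt (fun x => N2 ((Ef l m x - Ar d x) - (Ar d0 x - Ar d x))%C) Z Z' <= ep / 2).
      { eapply Rle_trans; [|apply AE]. right. apply RInt_ext_R. intros x _. rewrite !N2_Cmod. rewrite Cmod_sub_sym.
        f_equal. f_equal. ring. }
      assert (GG := gen (fun x => Ef l m x - Ar d x)%C (fun x => Ar d0 x - Ar d x)%C _ _ ltac:(now apply lpcC_minus) ltac:(now apply lpcC_minus) W' XY).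
      cbv beta in GG. lra.
Qed.
End MeanSquare.

(** * Mean squares for the Selberg class *)

(** The integral in the definitions is chosen by [epsilon]; integrability makes the choice satisfy
    its specification, and the Riemann integral does not depend on the proof of integrability. *)
Lemma Defs_RInt (f : R -> R) (a b : R) : ex_RInt f a b -> Defs.RInt f a b = RInt f a b.
Proof.
  intros H. unfold Defs.RInt.
  assert (pr := ex_RInt_Reals_0 f a b H).
  assert (S := epsilon_spec (inhabits 0) (fun v => exists pr : Riemann_integrable f a b, RiemannInt pr = v)
    (ex_intro _ _ (ex_intro _ pr eq_refl))).
  cbv beta in S. destruct S as [pr' E]. rewrite <- E. symmetry. apply RInt_Reals.
Qed.

Section Bridge.
Variables (Lam : nat -> Cx) (m : nat).
Let l := fun k => toC (Lam (S k)).

Lemma toC_psiF (x : R) : toC (psiF Lam x) = csum l (Z.to_nat (Int_part x)).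
Proof. apply toC_Csum. Qed.

Lemma Cnorm_N2 (z : Cx) : Cnorm z ^ 2 = N2 (toC z).
Proof. rewrite N2_Cmod. reflexivity. Qed.

Lemma V_F_eq (X d : R) : 0 < d ->
  V_F Lam m X d = RInt (fun x => N2 (Ef l m ((1 + d) * x) - Ef l m x)%C) 1 X.
Proof.
  intros Hd. unfold V_F.
  assert (E : forall x, N2 (Ef l m ((1 + d) * x) - Ef l m x)%C =
    Cnorm (Csub (Csub (psiF Lam (x + d * x)) (psiF Lam x)) (Defs.RtoC (INR m * d * x))) ^ 2).
  { intros x. rewrite Cnorm_N2. f_equal. unfold Ef. rewrite <- !toC_psiF.
    replace (x + d * x) with ((1 + d) * x) by ring. apply injective_projections; simpl; ring. }
  rewrite Defs_RInt.
  - apply RInt_ext_R. intros. now rewrite E.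
  - apply lpc_int. apply (lpc_ext _ _ E). apply lpc_N2, lpcC_minus; [|apply lpcC_Ef].
    apply lpcC_dil; [lra|apply lpcC_Ef].
Qed.

Lemma lpcC_shift (f : R -> C) (h : R) : lpcC f -> lpcC (fun x => f (x + h)).
Proof.
  intros H. assert (T := lpcC_aff f 1 h ltac:(lra) H). destruct T as [T1 T2].
  split; [eapply lpc_ext; [|apply T1]|eapply lpc_ext; [|apply T2]]; intros; simpl; now rewrite Rmult_1_l.
Qed.

Lemma Vt_F_eq (X h : R) :
  Vt_F Lam m X h = RInt (fun x => N2 (Ef l m (x + h) - Ef l m x)%C) 1 X.
Proof.
  unfold Vt_F.
  assert (E : forall x, N2 (Ef l m (x + h) - Ef l m x)%C =
    Cnorm (Csub (Csub (psiF Lam (x + h)) (psiF Lam x)) (Defs.RtoC (INR m * h))) ^ 2).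
  { intros x. rewrite Cnorm_N2. f_equal. unfold Ef. rewrite <- !toC_psiF.
    apply injective_projections; simpl; ring. }
  rewrite Defs_RInt.
  - apply RInt_ext_R. intros. now rewrite E.
  - apply lpc_int. apply (lpc_ext _ _ E). apply lpc_N2, lpcC_minus; [|apply lpcC_Ef].
    apply lpcC_shift, lpcC_Ef.
Qed.

(** Applied to the series of [Lam] at s = 2, it yields the bound B n^2 for its coefficients directly
    from convergence. *)
Lemma limC_bounded_terms (u : nat -> C) (L : C) : limC (fun n => csum u (S n)) L ->
  exists B, 0 < B /\ forall n, Cmod (u n) <= B.
Proof.
  intros H. destruct (H 1 ltac:(lra)) as [N HN].
  assert (P : forall n, (n >= N)%nat -> Cmod (u (S n)) <= 2).
  { intros n Hn. assert (A := HN n Hn). assert (A' := HN (S n) ltac:(lia)).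
    change (csum u (S (S n))) with (csum u (S n) + u (S n))%C in A'.
    replace (u (S n)) with ((csum u (S n) + u (S n) - L) - (csum u (S n) - L))%C by ring.
    assert (T := Cmod_triangle (csum u (S n) + u (S n) - L)%C (- (csum u (S n) - L))%C). rewrite Cmod_opp in T.
    unfold Cminus at 1. lra. }
  assert (Fi : forall n, exists B, 0 < B /\ forall k, (k <= n)%nat -> Cmod (u k) <= B).
  { induction n as [|n [B [HB IH]]].
    - exists (1 + Cmod (u 0%nat)). assert (T := Cmod_ge_0 (u 0%nat)). split; [lra|]. intros k Hk.
      replace k with 0%nat by lia. lra.
    - exists (B + Cmod (u (S n))). assert (T := Cmod_ge_0 (u (S n))). split; [lra|]. intros k Hk.
      destruct (Nat.eq_dec k (S n)) as [->|Hne]; [lra|]. specialize (IH k ltac:(lia)). lra. }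
  destruct (Fi (S N)) as [B [HB FB]]. exists (B + 2). split; [lra|]. intros n.
  destruct (Nat.le_gt_cases n (S N)) as [Hn|Hn]; [specialize (FB n Hn); lra|].
  destruct n as [|n]; [lia|]. specialize (P n ltac:(lia)). lra.
Qed.

Lemma selberg_mean_squares (F : Cx -> Cx) (a : nat -> Cx) (r : nat) (Q : R) (lam : nat -> R) (mu : nat -> Cx) (epsF : Cx) :
  selberg_data F a m r Q lam mu epsF -> is_vonMangoldt F Lam -> GRH F m r lam mu ->
  forall e, 0 < e <= 1/4 -> exists K, 0 < K /\ forall Z, 1 <= Z ->
  RInt (fun x => N2 (Ef l m x)) Z (exp 1 * Z) <= K * Rpower Z (2 + 2 * e) /\
  forall d, 0 < d <= 1 ->
   RInt (fun x => N2 (Ef l m ((1 + d) * x) - Ef l m x)%C) Z (exp 1 * Z) <= K * Rpower d (1 - 4 * e) * Rpower Z (2 + 2 * e) /\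
   RInt (fun x => N2 (Ef l m x - Ar l m d x)%C) Z (exp 1 * Z) <= K * Rpower d (1 - 4 * e) * Rpower Z (2 + 2 * e).
Proof.
  intros HS HL HG e He.
  destruct (selberg_logderiv F a m r Q lam mu epsF HS HG) as [G [G' [c [Hc [DG [NZ [GF LD]]]]]]].
  destruct (HL (ofC (2, 0)) ltac:(simpl; lra)) as [d2 [_ S2]].
  apply dirichlet_lim in S2. destruct (limC_bounded_terms _ _ S2) as [B [HB BB]].
  apply (mean_squares l m G G' c B Hc DG NZ LD); auto.
  - intros t. destruct (HL (ofC (c, t)) ltac:(simpl; lra)) as [d [Dd Sd]].
    apply dirichlet_lim in Sd.
    (* For G = (z-1)^m F the logarithmic derivative is F'/F + m/(z-1), so both sides equal - F'/F.
       The case m = 0 is separate because of [pred m]. *)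
    replace (- (G' (c, t) / G (c, t) - INR m / ((c, t) - 1)))%C with (toC (Defs.Copp (Defs.Cdiv d (F (ofC (c, t)))))).
    { exact Sd. }
    assert (DF : isD (Fc F) (c, t) (toC d)).
    { assert (T := toC_isD F _ _ Dd). rewrite toC_ofC in T. exact T. }
    assert (Fn : Fc F (c, t) <> 0).
    { apply (Fc_nz F a m r Q lam mu epsF HS HG); [simpl; lra|]. right. intro E. apply (f_equal fst) in E. simpl in E. lra. }
    assert (zn : ((c, t) - 1)%C <> 0) by (intro E; apply (f_equal fst) in E; simpl in E; lra).
    assert (D1 : isD (fun z => (z - 1) ^ m * Fc F z)%C (c, t)
      (INR m * ((c, t) - 1) ^ pred m * (1 - 0) * Fc F (c, t) + ((c, t) - 1) ^ m * toC d)%C).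
    { apply (isD_mult (fun z => (z - 1) ^ m)%C); auto. apply (isD_pow (fun z => z - 1)%C).
      apply isD_minus; [apply isD_id|apply isD_const]. }
    assert (D2 : isD (fun z => (z - 1) ^ m * Fc F z)%C (c, t) (G' (c, t))).
    { apply (isD_ext_loc G _ _ _ 1); [lra| |apply DG]. intros w Hw. apply GF.
      assert (T := fst_le_Cmod (w - (c, t))%C). simpl in T. apply Rabs_le_between in T. lra. }
    rewrite (isD_unique _ _ _ _ D2 D1), GF by (simpl; lra).
    change (toC (Defs.Copp (Defs.Cdiv d (F (ofC (c, t)))))) with (- (toC d / Fc F (c, t)))%C.
    assert (pn : forall k, (((c, t) - 1) ^ k)%C <> 0) by (intros k; now apply Cpow_nz).
    destruct m as [|k].
    + simpl. field. auto.
    + simpl pred. rewrite Cpow_S. field. auto.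
  - intros n. specialize (BB n). rewrite Cmod_dterm in BB. simpl fst in BB.
    change (Cnorm (Lam (S n)) * Rpower (INR (S n)) (- (2)) <= B) in BB.
    assert (Pn : 0 < INR (S n)) by (apply lt_0_INR; lia).
    rewrite Rpower_Ropp in BB. replace 2 with (INR 2) in BB by (simpl; ring). rewrite Rpower_pow in BB by auto.
    change (Cmod (l n)) with (Cnorm (Lam (S n))).
    assert (P2 : 0 < INR (S n) ^ 2) by (now apply pow_lt).
    apply Rmult_le_reg_r with (/ INR (S n) ^ 2); [now apply Rinv_0_lt_compat|].
    rewrite (Rmult_assoc B), Rinv_r by lra. lra.
Qed.
End Bridge.

(** * Increments over short lags *)

Lemma RInt_Chasles_lpc (f : R -> R) (a b c : R) : lpc f -> RInt f a c = RInt f a b + RInt f b c.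
Proof. intros H. symmetry. apply (RInt_Chasles (V := R_CompleteNormedModule)); now apply lpc_int. Qed.

Lemma RInt_lpc_ge0 (f : R -> R) (a b : R) : lpc f -> a <= b -> (forall x, a <= x -> 0 <= f x) -> 0 <= RInt f a b.
Proof. intros H Hab Hf. apply RInt_ge_0; [auto|now apply lpc_int|]. intros. apply Hf. lra. Qed.

Lemma RInt_lpc_le (f g : R -> R) (a b : R) : lpc f -> lpc g -> a <= b ->
  (forall x, a < x < b -> f x <= g x) -> RInt f a b <= RInt g a b.
Proof. intros. apply RInt_le; auto; now apply lpc_int. Qed.

Lemma RInt_lpc_sub (f : R -> R) (a b a' b' : R) : lpc f -> (forall x, a' <= x -> 0 <= f x) ->
  a' <= a -> a <= b -> b <= b' ->
  RInt f a b <= RInt f a' b'.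
Proof.
  intros L P H1 H2 H3. rewrite (RInt_Chasles_lpc f a' a b' L), (RInt_Chasles_lpc f a b b' L).
  assert (T1 := RInt_lpc_ge0 f a' a L H1 P). assert (T2 : 0 <= RInt f b b'); [|lra].
  apply RInt_lpc_ge0; auto. intros. apply P. lra.
Qed.

Lemma RInt_lpc_lin (f g : R -> R) (k k' a b : R) : lpc f -> lpc g ->
  RInt (fun t => k * f t + k' * g t) a b = k * RInt f a b + k' * RInt g a b.
Proof. intros. apply RInt_lin; now apply lpc_int. Qed.

Lemma lpc_lin (f g : R -> R) (k k' : R) : lpc f -> lpc g -> lpc (fun t => k * f t + k' * g t).
Proof. intros. apply lpc_plus; now apply lpc_scal. Qed.

Lemma lpc_shift (f : R -> R) (h : R) : lpc f -> lpc (fun x => f (x + h)).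
Proof.
  intros H. apply (lpc_ext (fun x => f (1 * x + h))); [intros; now rewrite Rmult_1_l|]. apply lpc_aff; auto. lra.
Qed.

Lemma RInt_lpc_shift (f : R -> R) (h a b : R) : lpc f -> RInt (fun x => f (x + h)) a b = RInt f (a + h) (b + h).
Proof.
  intros H. assert (E := RInt_aff f 1 h a b ltac:(lra) H). rewrite !Rmult_1_l, Rinv_1, Rmult_1_l in E.
  rewrite <- E. apply RInt_ext_R. intros. now rewrite Rmult_1_l.
Qed.

Lemma continuous_primitive (f : R -> R) (a x : R) : lpc f -> continuous (fun y => RInt f a y) x.
Proof.
  intros H. apply (continuous_RInt_1 (V := R_NormedModule) f a x). exists (mkposreal 1 Rlt_0_1). intros y _.
  apply (RInt_correct (V := R_CompleteNormedModule)). now apply lpc_int.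
Qed.

Lemma RInt_increment_le (W : R -> R) (a b y : R) : lpc W -> a <= b -> 0 <= y ->
  (forall u v, a <= u <= v -> W u <= W v) -> (forall u, a <= u -> 0 <= W u) ->
  RInt (fun v => W (v + y) - W v) a b <= y * W (b + y).
Proof.
  intros L Hab Hy Mo Po.
  rewrite (RInt_ext_R _ (fun v => 1 * W (v + y) + (-1) * W v)) by (intros; ring).
  rewrite RInt_lpc_lin by (auto; now apply lpc_shift). rewrite RInt_lpc_shift by auto.
  assert (C1 := RInt_Chasles_lpc W a (a + y) (b + y) L). assert (C2 := RInt_Chasles_lpc W a b (b + y) L).
  assert (0 <= RInt W a (a + y)).
  { apply RInt_ge_0; [lra|now apply lpc_int|]. intros x Hx. apply Po. lra. }
  assert (RInt W b (b + y) <= y * W (b + y)).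
  { apply Rle_trans with (RInt (fun _ => W (b + y)) b (b + y)).
    - apply RInt_lpc_le; auto; [apply lpc_const|lra|]. intros x Hx. apply Mo. lra.
    - rewrite RInt_const. right. unfold scal; simpl; unfold mult; simpl. ring. }
  lra.
Qed.

(** Induction on the number of halvings that bring Y below 2 Z1; each step only has to treat one
    dyadic interval [Z, 2Z]. *)
Lemma dyadic_ind (P : R -> Prop) (Z0 Z1 : R) : 0 < Z1 -> (forall Y, Z0 <= Y <= 2 * Z1 -> P Y) ->
  (forall Z, Z1 <= Z -> Z0 <= Z -> P Z -> P (2 * Z)) -> (Z0 <= Z1) -> forall Y, Z0 <= Y -> P Y.
Proof.
  intros HZ Hb Hs H01.
  assert (K : forall n Y, Z0 <= Y -> Y <= 2 ^ n * (2 * Z1) -> P Y).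
  { induction n as [|n IH]; intros Y H0 HY.
    - apply Hb. simpl in HY. lra.
    - destruct (Rle_lt_dec Y (2 * Z1)) as [L|L]; [apply Hb; lra|].
      replace Y with (2 * (Y / 2)) by field. apply Hs; [lra|lra|]. apply IH; [lra|]. simpl in HY. lra. }
  intros Y HY. destruct (Pow_x_infinity 2 ltac:(rewrite Rabs_pos_eq; lra) (Y / (2 * Z1))) as [n Hn].
  specialize (Hn n (Nat.le_refl n)). rewrite Rabs_pos_eq in Hn by (left; apply pow_lt; lra).
  apply (K n); auto. apply Rmult_le_reg_r with (/ (2 * Z1)); [apply Rinv_0_lt_compat; lra|].
  rewrite Rmult_assoc, Rinv_r by lra. unfold Rdiv in Hn. lra.
Qed.

Lemma ln_le_Rpower (y e : R) : 0 < e -> 0 < y -> ln y <= / e * Rpower y e.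
Proof.
  intros He Hy. assert (T := exp_ineq1_le (e * ln y)). fold (Rpower y e) in T.
  apply Rmult_le_reg_l with e; [auto|]. rewrite <- Rmult_assoc, Rinv_r, Rmult_1_l by lra. lra.
Qed.

Lemma Rpower_ge1 (y q : R) : 1 <= y -> 0 <= q -> 1 <= Rpower y q.
Proof.
  intros Hy Hq. apply Rle_trans with (exp 0); [rewrite exp_0; lra|]. apply exp_le_compat.
  assert (0 <= ln y) by (rewrite <- ln_1; apply ln_le; lra). nra.
Qed.

Lemma Rpower_le1 (y q : R) : 0 < y <= 1 -> 0 <= q -> Rpower y q <= 1.
Proof.
  intros Hy Hq. apply Rle_trans with (exp 0); [|rewrite exp_0; lra]. apply exp_le_compat.
  assert (ln y <= 0) by (rewrite <- ln_1; apply ln_le; lra). nra.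
Qed.

Lemma Rpower_le_exp (y p q : R) : 0 < y <= 1 -> q <= p -> Rpower y p <= Rpower y q.
Proof.
  intros Hy Hq. apply exp_le_compat. assert (ln y <= 0) by (rewrite <- ln_1; apply ln_le; lra). nra.
Qed.

Section Lag.
Variables (E : R -> C) (A : R -> R -> C) (e : R).
Hypotheses (He : 0 < e <= 1/4) (LE : lpcC E) (LA : forall d, 0 < d -> lpcC (A d))
  (HA : forall d x, 0 < d -> 1/2 <= x -> A d x = (RtoC (/ (d * x)) * CI E x ((1 + d) * x))%C)
  (HM : exists K, 0 < K /\ forall Z, 1 <= Z ->
  RInt (fun x => N2 (E x)) Z (exp 1 * Z) <= K * Rpower Z (2 + 2 * e) /\
  forall d, 0 < d <= 1 ->
   RInt (fun x => N2 (E ((1 + d) * x) - E x)%C) Z (exp 1 * Z) <= K * Rpower d (1 - 4 * e) * Rpower Z (2 + 2 * e) /\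
   RInt (fun x => N2 (E x - A d x)%C) Z (exp 1 * Z) <= K * Rpower d (1 - 4 * e) * Rpower Z (2 + 2 * e)).

(** Since e >= 2, three windows cover [Z, 8Z]; this contains all points reached from [Z, 4Z] by a
    lag or a dilation. *)
Lemma window8 (f : R -> R) (K : R) : lpc f -> (forall x, 0 <= f x) -> 0 <= K ->
  (forall Z, 1 <= Z -> RInt f Z (exp 1 * Z) <= K * Rpower Z (2 + 2 * e)) ->
  forall Z, 1 <= Z -> RInt f Z (8 * Z) <= 500 * K * Rpower Z (2 + 2 * e).
Proof.
  intros L P HK H Z HZ. assert (e2 : 2 <= exp 1) by (assert (T := exp_ineq1_le 1); lra).
  assert (st : forall Y, 1 <= Y -> RInt f Y (2 * Y) <= K * Rpower Y (2 + 2 * e)).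
  { intros Y HY. eapply Rle_trans; [|apply H; auto]. apply RInt_lpc_sub; auto; nra. }
  rewrite (RInt_Chasles_lpc f Z (2 * Z) (8 * Z) L), (RInt_Chasles_lpc f (2 * Z) (4 * Z) (8 * Z) L).
  assert (S1 := st Z HZ). assert (S2 := st (2 * Z) ltac:(lra)). assert (S3 := st (4 * Z) ltac:(lra)).
  replace (2 * (2 * Z)) with (4 * Z) in S2 by ring. replace (2 * (4 * Z)) with (8 * Z) in S3 by ring.
  rewrite <- Rpower_mult_distr in S2, S3 by lra.
  set (RZ := Rpower Z (2 + 2 * e)) in *. assert (0 < RZ) by apply exp_pos.
  assert (P4 : Rpower 4 (2 + 2 * e) <= 64).
  { apply Rle_trans with (4 ^ 3); [|lra]. rewrite <- (Rpower_pow 3) by lra. apply Rle_Rpower; simpl; lra. }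
  assert (P2 : Rpower 2 (2 + 2 * e) <= 64).
  { apply Rle_trans with (Rpower 4 (2 + 2 * e)); auto. apply Rle_Rpower_l; lra. }
  assert (KR : 0 <= K * RZ) by nra.
  assert (K * (Rpower 2 (2 + 2 * e) * RZ) <= 64 * (K * RZ)) by nra.
  assert (K * (Rpower 4 (2 + 2 * e) * RZ) <= 64 * (K * RZ)) by nra.
  lra.
Qed.

(* The average [A D] moves slowly, so that increments of [E] over lags at most [D Z] are controlled by
   [E - A D] at both ends together with a local mean square. *)
Lemma lag : exists K, 0 < K /\ forall Z D, 1 <= Z -> 0 < D <= 1 -> exists Q : R -> R, lpc Q /\ (forall x, Z <= x -> 0 <= Q x) /\
  RInt Q Z (4 * Z) <= K * Rpower D (1 - 4 * e) * Rpower Z (2 + 2 * e) /\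
  forall v v', Z <= v -> v <= v' <= v + D * Z -> N2 (E v' - E v)%C <= Q v + Q v'.
Proof.
  destruct HM as [K [HK M]]. exists (100000 * K). split; [lra|]. intros Z D HZ HD.
  set (Dl := fun z => N2 (E ((1 + D) * z) - E z)%C). set (Rs := fun z => N2 (E z - A D z)%C).
  assert (LDl : lpc Dl) by (apply lpc_N2, lpcC_minus; auto; apply lpcC_dil; auto; lra).
  assert (LRs : lpc Rs) by (apply lpc_N2, lpcC_minus; auto; apply LA; lra).
  assert (LN : lpc (fun z => N2 (E z))) by (now apply lpc_N2).
  assert (LAd : lpc (fun z => N2 (A D z))) by (apply lpc_N2, LA; lra).
  set (RZ := Rpower Z (2 + 2 * e)). assert (HRZ : 0 < RZ) by apply exp_pos.
  set (q := Rpower D (1 - 4 * e)). assert (Hq : 0 < q) by apply exp_pos.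
  assert (Dq : D ^ 2 <= q).
  { rewrite <- (Rpower_pow 2) by lra. apply Rpower_le_exp; simpl; lra. }
  assert (BDl : RInt Dl Z (8 * Z) <= 500 * (K * q) * RZ).
  { apply window8; auto; [intros; apply N2_pos|nra|]. intros Y HY. exact (proj1 (proj2 (M Y HY) D HD)). }
  assert (BRs : RInt Rs Z (8 * Z) <= 500 * (K * q) * RZ).
  { apply window8; auto; [intros; apply N2_pos|nra|]. intros Y HY. exact (proj2 (proj2 (M Y HY) D HD)). }
  assert (BN : RInt (fun z => N2 (E z)) Z (8 * Z) <= 500 * K * RZ).
  { apply window8; auto; [intros; apply N2_pos|lra|]. intros Y HY. exact (proj1 (M Y HY)). }
  (* Majorant of |(1+D) E((1+D)z) - E(z)|^2, written as (1+D)(E((1+D)z) - E(z)) + D E(z), with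
     2(1+D)^2 <= 8. *)
  set (g := fun z => 8 * Dl z + (2 * D ^ 2) * N2 (E z)).
  assert (Lg : lpc g) by (now apply lpc_lin).
  assert (Pg : forall z, 0 <= g z).
  { intros z. unfold g, Dl. assert (T1 := N2_pos (E ((1 + D) * z) - E z)%C). assert (T2 := N2_pos (E z)).
    assert (T3 := pow2_ge_0 D). nra. }
  set (W := (fun x => RInt g Z x) : R -> R).
  assert (LW : lpc W) by (apply lpc_cont; intros; now apply continuous_primitive).
  assert (MW : forall u v, Z <= u <= v -> W u <= W v) by (intros u v Huv; apply RInt_lpc_sub; auto; lra).
  assert (PW : forall u, Z <= u -> 0 <= W u) by (intros u Hu; apply RInt_lpc_ge0; auto).
  assert (DZ : 0 < D * Z) by nra.
  (* Bounds |A D v' - A D v|^2 for v <= v' <= v + D Z. The first term is Cauchy-Schwarz for the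
     change of the integral in the average, the second the relative change, at most D, of its
     denominator. Enlarging the interval to [v, v + D Z] removes the dependence on v'. *)
  set (S := fun v => (2 / (D * Z)) * (W (v + D * Z) - W v) + (2 * D ^ 2) * N2 (A D v)).
  assert (LWs : lpc (fun v => W (v + D * Z) - W v)) by (apply lpc_minus; auto; now apply lpc_shift).
  assert (LS : lpc S) by (now apply lpc_lin).
  assert (P2 : 0 < 2 / (D * Z)) by (apply Rdiv_lt_0_compat; lra).
  assert (PS : forall v, Z <= v -> 0 <= S v).
  { intros v Hv. unfold S. assert (T1 := N2_pos (A D v)). assert (T3 := pow2_ge_0 D).
    assert (W v <= W (v + D * Z)) by (apply MW; lra). nra. }
  exists (fun v => 3 * Rs v + 3 * S v). split; [now apply lpc_lin|]. split.
  { intros x Hx. specialize (PS x Hx). assert (T := N2_pos (E x - A D x)%C). fold (Rs x) in T. lra. }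
  split.
  - rewrite RInt_lpc_lin by auto.
    assert (B1 : RInt Rs Z (4 * Z) <= 500 * (K * q) * RZ).
    { eapply Rle_trans; [|apply BRs]. apply RInt_lpc_sub; auto; [intros; apply N2_pos|lra..]. }
    assert (BA : RInt (fun z => N2 (A D z)) Z (4 * Z) <= 4 * (500 * K * RZ)).
    { apply Rle_trans with (RInt (fun z => 2 * N2 (E z) + 2 * Rs z) Z (4 * Z)).
      - apply RInt_lpc_le; auto; [now apply lpc_lin|lra|]. intros z _.
        replace (A D z) with (E z + - (E z - A D z))%C by ring. eapply Rle_trans; [apply N2_plus_le|].
        replace (N2 (- (E z - A D z))%C) with (Rs z); [lra|]. unfold Rs, N2; simpl. ring.
      - rewrite RInt_lpc_lin by auto.
        assert (RInt (fun z => N2 (E z)) Z (4 * Z) <= 500 * K * RZ).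
        { eapply Rle_trans; [|apply BN]. apply RInt_lpc_sub; auto; [intros; apply N2_pos|lra..]. }
        assert (q <= 1) by (apply Rpower_le1; lra). assert (0 <= K * RZ) by nra.
        assert (500 * (K * q) * RZ <= 500 * K * RZ) by nra. lra. }
    assert (BW : RInt (fun v => W (v + D * Z) - W v) Z (4 * Z) <= D * Z * (8 * (500 * (K * q) * RZ) + 2 * D ^ 2 * (500 * K * RZ))).
    { eapply Rle_trans; [apply RInt_increment_le; auto; lra|]. apply Rmult_le_compat_l; [lra|].
      apply Rle_trans with (W (8 * Z)); [apply MW; nra|]. unfold W, g. rewrite RInt_lpc_lin by auto.
      apply Rplus_le_compat; [lra|]. apply Rmult_le_compat_l; auto. assert (T := pow2_ge_0 D). lra. }
    unfold S. rewrite RInt_lpc_lin by auto.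
    assert (B2 : 2 / (D * Z) * RInt (fun v => W (v + D * Z) - W v) Z (4 * Z) <= 2 * (8 * (500 * (K * q) * RZ) + 2 * D ^ 2 * (500 * K * RZ))).
    { eapply Rle_trans; [apply Rmult_le_compat_l; [lra|apply BW]|]. right. field. lra. }
    assert (KR : 0 <= K * RZ) by nra.
    assert (D ^ 2 * (K * RZ) <= q * (K * RZ)) by (apply Rmult_le_compat_r; auto).
    assert (2 * D ^ 2 * RInt (fun z => N2 (A D z)) Z (4 * Z) <= 2 * D ^ 2 * (4 * (500 * K * RZ)))
      by (apply Rmult_le_compat_l; auto; assert (T := pow2_ge_0 D); lra).
    replace (100000 * K * q * RZ) with (100000 * (q * (K * RZ))) by ring.
    replace (500 * (K * q) * RZ) with (500 * (q * (K * RZ))) in * by ring.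
    replace (2 * D ^ 2 * (500 * K * RZ)) with (1000 * (D ^ 2 * (K * RZ))) in * by ring.
    replace (2 * D ^ 2 * (4 * (500 * K * RZ))) with (4000 * (D ^ 2 * (K * RZ))) in * by ring.
    assert (0 <= q * (K * RZ)) by (apply Rmult_le_pos; lra). lra.
  - intros v v' Hv Hvv.
    assert (Sv : N2 (A D v' - A D v)%C <= S v).
    { rewrite !HA by lra.
      (* The derivative in z of the integral of E over [z, (1+D)z]. *)
      set (k := fun z => (RtoC (1 + D) * E ((1 + D) * z)%R - E z)%C).
      assert (Lk : lpcC k).
      { apply lpcC_minus; auto. assert (T := lpcC_dil E (1 + D) ltac:(lra) LE). destruct T as [T1 T2]. split; simpl.
        - apply (lpc_ext (fun t => (1 + D) * fst (E ((1 + D) * t)))); [intros; ring|]. now apply lpc_scal.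
        - apply (lpc_ext (fun t => (1 + D) * snd (E ((1 + D) * t)))); [intros; ring|]. now apply lpc_scal. }
      assert (EP : (CI E v' ((1 + D) * v') - CI E v ((1 + D) * v))%C = CI k v v').
      { assert (X1 : exCI (fun z => E ((1 + D) * z)%R) v v') by (apply exCI_lpc, lpcC_dil; [lra|exact LE]).
        assert (X2 : exCI E v v') by (apply exCI_lpc; exact LE).
        unfold k. rewrite (CI_minus _ _ _ _ (exCI_scal _ _ _ _ X1) X2), (CI_scal _ _ _ _ X1).
        assert (Ed : (RtoC (1 + D) * CI (fun z => E ((1 + D) * z)%R) v v')%C = CI E ((1 + D) * v) ((1 + D) * v')).
        { destruct LE as [LE1 LE2]. apply injective_projections; simpl.
          - rewrite (RInt_dil (fun t => fst (E t))) by (auto; lra). rewrite Rmult_0_l, Rminus_0_r, <- Rmult_assoc, Rinv_r, Rmult_1_l by lra. reflexivity.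
          - rewrite (RInt_dil (fun t => snd (E t))) by (auto; lra). rewrite Rmult_0_l, Rplus_0_r, <- Rmult_assoc, Rinv_r, Rmult_1_l by lra. reflexivity. }
        rewrite Ed.
        assert (X : forall a b, exCI E a b) by (intros; now apply exCI_lpc).
        assert (C1 := CI_Chasles E v ((1 + D) * v) ((1 + D) * v') (X _ _) (X _ _)).
        assert (C2 := CI_Chasles E v v' ((1 + D) * v') (X _ _) (X _ _)). rewrite <- C1 in C2.
        set (p := CI E v' ((1 + D) * v')) in *. set (p1 := CI E v ((1 + D) * v)) in *. set (p2 := CI E ((1 + D) * v) ((1 + D) * v')) in *.
        set (p3 := CI E v v') in *.
        replace p with ((p3 + p) - p3)%C by ring. rewrite C2. ring. }
      set (P' := CI E v' ((1 + D) * v')) in *. set (P := CI E v ((1 + D) * v)) in *.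
      replace (RtoC (/ (D * v')) * P' - RtoC (/ (D * v)) * P)%C
        with (RtoC (/ (D * v')) * CI k v v' + RtoC (- ((v' - v) / v')) * (RtoC (/ (D * v)) * P))%C.
      2:{ rewrite <- EP. rewrite RtoC_opp, RtoC_div, RtoC_minus, !RtoC_inv, !RtoC_mult by nra. field.
          repeat split; intro E0; apply RtoC_inj in E0; lra. }
      eapply Rle_trans; [apply N2_plus_le|]. rewrite !N2_scal. unfold S. rewrite HA by lra. fold P. rewrite N2_scal.
      apply Rplus_le_compat.
      - assert (CS : N2 (CI k v v') <= (D * Z) * (W (v + D * Z) - W v)).
        { replace (W (v + D * Z) - W v) with (RInt g v (v + D * Z)) by (unfold W; rewrite (RInt_Chasles_lpc g Z v (v + D * Z) Lg); lra).
          destruct (Req_dec v v') as [Ev|Nv].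
          - rewrite <- Ev. replace (CI k v v) with (RtoC 0) by (unfold CI; rewrite !RInt_point; reflexivity).
            replace (N2 (RtoC 0)) with 0 by (unfold N2; simpl; ring).
            apply Rmult_le_pos; [lra|apply RInt_lpc_ge0; auto; lra].
          - eapply Rle_trans; [apply CI_Cauchy_Schwarz; [lra|now apply exCI_lpc|apply lpc_int; now apply lpc_N2]|].
            apply Rmult_le_compat; [lra|apply RInt_lpc_ge0; [now apply lpc_N2|lra|intros; apply N2_pos]|lra|].
            apply Rle_trans with (RInt g v v'); [|apply RInt_lpc_sub; auto; lra].
            apply RInt_lpc_le; auto; [now apply lpc_N2|lra|]. intros z _. unfold k, g, Dl.
            replace (RtoC (1 + D) * E ((1 + D) * z)%R - E z)%C with (RtoC (1 + D) * (E ((1 + D) * z)%R - E z) + RtoC D * E z)%C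
              by (rewrite RtoC_plus; ring).
            eapply Rle_trans; [apply N2_plus_le|]. rewrite !N2_scal.
            assert (T1 := N2_pos (E ((1 + D) * z) - E z)%C). assert ((1 + D) ^ 2 <= 4) by nra. nra. }
        assert (I1 : (/ (D * v')) ^ 2 <= (/ (D * Z)) ^ 2).
        { apply pow_incr. split; [left; apply Rinv_0_lt_compat; nra|]. apply Rinv_le_contravar; nra. }
        assert (T := N2_pos (CI k v v')).
        apply Rle_trans with (2 * ((/ (D * Z)) ^ 2 * ((D * Z) * (W (v + D * Z) - W v)))).
        + apply Rmult_le_compat_l; [lra|]. apply Rmult_le_compat; auto. apply pow2_ge_0.
        + right. field. nra.
      - assert (T := N2_pos P). assert (T' := pow2_ge_0 (/ (D * v))).
        assert (I2 : (- ((v' - v) / v')) ^ 2 <= D ^ 2).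
        { replace ((- ((v' - v) / v')) ^ 2) with (((v' - v) / v') ^ 2) by ring. apply pow_incr. split.
          - apply Rmult_le_pos; [lra|left; apply Rinv_0_lt_compat; lra].
          - apply Rmult_le_reg_r with v'; [lra|]. unfold Rdiv. rewrite Rmult_assoc, Rinv_l by lra. nra. }
        assert (0 <= (/ (D * v)) ^ 2 * N2 P) by (apply Rmult_le_pos; auto). nra. }
    assert (PS' := PS v' ltac:(lra)).
    replace (E v' - E v)%C with ((E v' - A D v') + (- (E v - A D v) + (A D v' - A D v)))%C by ring.
    fold (Rs v) (Rs v') in *. unfold Rs.
    assert (N3 : forall x y z, N2 (x + (- y + z))%C <= 3 * N2 x + 3 * N2 y + 3 * N2 z).
    { intros [x1 x2] [y1 y2] [z1 z2]. unfold N2; simpl.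
      assert (sq : forall a b c, (a + (- b + c)) * (a + (- b + c)) <= 3 * (a * a) + 3 * (b * b) + 3 * (c * c)).
      { intros a b c. assert (T1 := pow2_ge_0 (a + b)). assert (T2 := pow2_ge_0 (a - c)). assert (T3 := pow2_ge_0 (b + c)). nra. }
      assert (Q1 := sq x1 y1 z1). assert (Q2 := sq x2 y2 z2). lra. }
    eapply Rle_trans; [apply N3|]. lra.
Qed.
End Lag.

(** * From dilations to translations *)

(* A primitive of [fun x => h * (d * ln (x / h) + ka)]. *)
Definition Tm (d ka h x : R) : R := h * x * (d * ln (x / h) + ka - d).

(** On a block the main term for the dilation and the increment of the primitive [Tm] agree to first
    order in w; the rest is controlled by 0 <= (x+w) ln((x+w)/x) - w <= w^2/x. *)
Lemma main_term (d ka h x w : R) : 0 <= d -> 0 < h -> 0 < x -> 0 <= w ->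
  Rabs (1/2 * (h / x) * ((x + w) ^ 2 - x ^ 2) * (d * ln (x / h) + ka) - (Tm d ka h (x + w) - Tm d ka h x))
  <= h * w ^ 2 / x * (d + Rabs (d * ln (x / h) + ka)).
Proof.
  intros Hd Hh Hx Hw. unfold Tm. set (lm := ln ((x + w) / x)).
  assert (El : ln ((x + w) / h) = ln (x / h) + lm).
  { unfold lm. rewrite !ln_div by lra. lra. }
  rewrite El. set (M := ln (x / h)).
  assert (U : lm <= w / x).
  { assert (T := exp_ineq1_le lm). unfold lm in T at 2. rewrite exp_ln in T by (apply Rdiv_lt_0_compat; lra).
    replace ((x + w) / x) with (1 + w / x) in T by (field; lra). lra. }
  assert (L : w / (x + w) <= lm).
  { assert (T := exp_ineq1_le (- lm)). rewrite exp_Ropp in T. unfold lm in T at 2. rewrite exp_ln in T by (apply Rdiv_lt_0_compat; lra).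
    replace (/ ((x + w) / x)) with (1 - w / (x + w)) in T by (field; lra). lra. }
  assert (ph : 0 <= (x + w) * lm - w <= w ^ 2 / x).
  { split.
    - apply Rmult_le_compat_l with (r := x + w) in L; [|lra]. replace ((x + w) * (w / (x + w))) with w in L by (field; lra). lra.
    - apply Rmult_le_compat_l with (r := x + w) in U; [|lra]. replace ((x + w) * (w / x)) with (w + w ^ 2 / x) in U by (field; lra). lra. }
  set (phi := (x + w) * lm - w) in ph.
  replace (1/2 * (h / x) * ((x + w) ^ 2 - x ^ 2) * (d * M + ka) - (h * (x + w) * (d * (M + lm) + ka - d) - h * x * (d * M + ka - d)))
    with (h * w ^ 2 / x * (1/2) * (d * M + ka) + - (h * d * phi)).
  2:{ unfold phi. field. lra. }
  set (t := h * w ^ 2 / x). assert (Ht : 0 <= t).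
  { unfold t. apply Rmult_le_pos; [apply Rmult_le_pos; [lra|apply pow2_ge_0]|left; apply Rinv_0_lt_compat; lra]. }
  eapply Rle_trans; [apply Rabs_triang|]. rewrite Rabs_Ropp, Rabs_mult, (Rabs_pos_eq (t * (1/2))), (Rabs_pos_eq (h * d * phi)).
  - assert (P := Rabs_pos (d * M + ka)).
    assert (h * d * phi <= d * t).
    { apply Rle_trans with (h * d * (w ^ 2 / x)); [apply Rmult_le_compat_l; [nra|lra]|]. right. unfold t. field. lra. }
    nra.
  - apply Rmult_le_pos; [nra|lra].
  - lra.
Qed.

(** The weight [th] divides the cost between the size of [a], of the order of the variance, and the
    much smaller difference; it is tuned in [doubling]. *)
Lemma N2_diff (a b : C) (th : R) : 0 < th <= 1 ->
  Rabs (N2 a - N2 b) <= th * N2 a + 2 / th * N2 (a - b)%C.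
Proof.
  intros Ht. set (i := / th). assert (Hi : th * i = 1) by (apply Rinv_r; lra). assert (1 <= i).
  { unfold i. rewrite <- Rinv_1. apply Rinv_le_contravar; lra. }
  assert (sq : forall p q : R, Rabs (p * p - q * q) <= th * (p * p) + 2 * i * ((p - q) * (p - q))).
  { intros p q. set (t := p - q). replace q with (p - t) by (unfold t; ring).
    assert (A1 : 0 <= th * p * p - 2 * p * t + i * (t * t)).
    { replace (th * p * p - 2 * p * t + i * (t * t)) with (th * ((p - i * t) * (p - i * t)) + (1 - th * i) * (i * (t * t) - 2 * p * t)) by ring.
      rewrite Hi, Rminus_diag, Rmult_0_l, Rplus_0_r. apply Rmult_le_pos; [lra|apply Rle_0_sqr]. }
    assert (A2 : 0 <= th * p * p + 2 * p * t + i * (t * t)).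
    { replace (th * p * p + 2 * p * t + i * (t * t)) with (th * ((p + i * t) * (p + i * t)) + (1 - th * i) * (i * (t * t) + 2 * p * t)) by ring.
      rewrite Hi, Rminus_diag, Rmult_0_l, Rplus_0_r. apply Rmult_le_pos; [lra|apply Rle_0_sqr]. }
    assert (0 <= t * t) by apply Rle_0_sqr. assert (t * t <= i * (t * t)) by nra. apply Rabs_le. split; lra. }
  assert (S1 := sq (fst a) (fst b)). assert (S2 := sq (snd a) (snd b)). apply Rabs_le_between in S1, S2.
  unfold N2, Rdiv. fold i. simpl. apply Rabs_le. split; lra.
Qed.

Lemma nat_between (y : R) : 1 <= y -> exists n, y <= INR n <= 2 * y.
Proof.
  intros Hy. destruct (archimed y) as [A1 A2]. exists (Z.to_nat (up y)).
  assert (0 < up y)%Z by (apply lt_IZR; lra). rewrite INR_IZR_INZ, Z2Nat.id by lia. lra.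
Qed.

Section Real.
Variables (E : R -> C) (e : R).
Hypotheses (He : 0 < e <= 1/4) (LE : lpcC E)
  (HE : exists K, 0 < K /\ forall Z, 1 <= Z -> RInt (fun x => N2 (E x)) Z (exp 1 * Z) <= K * Rpower Z (2 + 2 * e))
  (HQ : exists K, 0 < K /\ forall Z D, 1 <= Z -> 0 < D <= 1 -> exists Q : R -> R, lpc Q /\ (forall x, Z <= x -> 0 <= Q x) /\
  RInt Q Z (4 * Z) <= K * Rpower D (1 - 4 * e) * Rpower Z (2 + 2 * e) /\
  forall v v', Z <= v -> v <= v' <= v + D * Z -> N2 (E v' - E v)%C <= Q v + Q v').

Lemma mean_square_E : exists K, 0 < K /\ forall Y, 1 <= Y -> RInt (fun x => N2 (E x)) 1 Y <= K * Rpower Y (2 + 2 * e).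
Proof.
  destruct HE as [K [HK H]]. exists K. split; auto. assert (e2 : 2 <= exp 1) by (assert (T := exp_ineq1_le 1); lra).
  assert (LN : lpc (fun x => N2 (E x))) by (now apply lpc_N2).
  assert (st : forall Z Y, 1 <= Z -> Z <= Y <= 2 * Z -> RInt (fun x => N2 (E x)) Z Y <= K * Rpower Z (2 + 2 * e)).
  { intros Z Y HZ HY. eapply Rle_trans; [|apply H; auto]. apply RInt_lpc_sub; auto; [intros; apply N2_pos|lra|lra|nra]. }
  apply (dyadic_ind _ 1 1); [lra| | |lra].
  - intros Y HY. eapply Rle_trans; [apply st; lra|]. apply Rmult_le_compat_l; [lra|]. apply Rle_Rpower_l; lra.
  - intros Z HZ _ IH. rewrite (RInt_Chasles_lpc _ 1 Z (2 * Z) LN). assert (S1 := st Z (2 * Z) HZ ltac:(lra)).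
    rewrite <- Rpower_mult_distr by lra. assert (2 <= Rpower 2 (2 + 2 * e)).
    { rewrite <- (Rpower_1 2) at 1 by lra. apply Rle_Rpower; lra. }
    assert (0 < K * Rpower Z (2 + 2 * e)) by (apply Rmult_lt_0_compat; [auto|apply exp_pos]). nra.
Qed.

Let f2 (h u : R) : R := N2 (E (u + h) - E u)%C.

Lemma lpc_f2 (h : R) : lpc (f2 h).
Proof. apply lpc_N2, lpcC_minus; auto. now apply lpcC_shift. Qed.

Lemma f2_pos (h u : R) : 0 <= f2 h u.
Proof. apply N2_pos. Qed.

(** The lag estimate with D = h/Z gives h^(1-4e) Z^(1+6e). The lower bound h >= k is what bounds
    h^(-4e), because h need not be large when B3 = 1. *)
Lemma window_f2 (k : R) : 0 < k <= 1 -> exists K, 0 < K /\ forall Z h, 1 <= Z -> k <= h <= Z ->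
  RInt (f2 h) Z (2 * Z) <= K * (h * Rpower Z (1 + 6 * e)).
Proof.
  intros Hk. destruct HQ as [K [HK HL]].
  exists (2 * K * / k). assert (Ik : 0 < / k) by (apply Rinv_0_lt_compat; lra).
  split; [apply Rmult_lt_0_compat; lra|]. intros Z h HZ Hh.
  assert (HD : 0 < h / Z <= 1).
  { split; [apply Rdiv_lt_0_compat; lra|]. apply Rmult_le_reg_r with Z; [lra|]. unfold Rdiv. rewrite Rmult_assoc, Rinv_l by lra. lra. }
  destruct (HL Z (h / Z) HZ HD) as [Q [LQ [PQ [IQ BQ]]]].
  assert (EDZ : h / Z * Z = h) by (field; lra). rewrite EDZ in BQ.
  assert (B1 : RInt (f2 h) Z (2 * Z) <= 2 * RInt Q Z (4 * Z)).
  { apply Rle_trans with (RInt (fun u => 1 * Q u + 1 * Q (u + h)) Z (2 * Z)).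
    - apply RInt_lpc_le; [apply lpc_f2|apply lpc_lin; auto; now apply lpc_shift|lra|].
      intros u Hu. rewrite !Rmult_1_l. apply BQ; lra.
    - rewrite RInt_lpc_lin by (auto; now apply lpc_shift). rewrite RInt_lpc_shift by auto.
      assert (RInt Q Z (2 * Z) <= RInt Q Z (4 * Z)) by (apply RInt_lpc_sub; auto; lra).
      assert (RInt Q (Z + h) (2 * Z + h) <= RInt Q Z (4 * Z)) by (apply RInt_lpc_sub; auto; lra). lra. }
  eapply Rle_trans; [apply B1|].
  replace (2 * K * / k * (h * Rpower Z (1 + 6 * e))) with (2 * (K * (h * / k * Rpower Z (1 + 6 * e)))) by ring.
  apply Rmult_le_compat_l; [lra|]. eapply Rle_trans; [apply IQ|]. rewrite Rmult_assoc. apply Rmult_le_compat_l; [lra|].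
  unfold Rdiv. rewrite <- Rpower_mult_distr by (try apply Rinv_0_lt_compat; lra).
  assert (E1 : Rpower (/ Z) (1 - 4 * e) * Rpower Z (2 + 2 * e) = Rpower Z (1 + 6 * e)).
  { rewrite <- (Rpower_1 Z) at 1 by lra. rewrite <- Rpower_Ropp, Rpower_mult, <- Rpower_plus. f_equal. ring. }
  rewrite Rmult_assoc, E1. apply Rmult_le_compat_r; [left; apply exp_pos|].
  unfold Rminus. rewrite Rpower_plus, Rpower_1 by lra. apply Rmult_le_compat_l; [lra|].
  rewrite Rpower_Ropp. rewrite <- Rpower_Ropp. 
  apply Rle_trans with (Rpower k (- (4 * e))).
  - rewrite !Rpower_Ropp. apply Rinv_le_contravar; [apply exp_pos|]. apply Rle_Rpower_l; lra.
  - rewrite <- (Rpower_1 k) at 2 by lra. rewrite <- Rpower_Ropp. apply Rpower_le_exp; lra.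
Qed.

(** The trivial bound for the range where the hypothesis says nothing. Below h the two values of E
    are estimated separately, above h dyadically by [window_f2]. *)
Lemma small_range (k : R) : 0 < k <= 1 -> exists K, 0 < K /\ forall h Y, k <= h -> 1 <= Y -> h <= Y ->
  RInt (f2 h) 1 Y <= K * (h * Rpower Y (1 + 6 * e)).
Proof.
  intros Hk. destruct (window_f2 k Hk) as [K1 [HK1 W]]. destruct mean_square_E as [K2 [HK2 M]].
  set (K := K1 + 32 * K2). exists K. assert (HK : 0 < K) by (unfold K; lra). split; auto. intros h Y Hh.
  set (Z0 := Rmax 1 h). assert (Z1 : 1 <= Z0) by apply Rmax_l. assert (Z2 : h <= Z0) by apply Rmax_r.
  intros Y1 Yh. assert (HY : Z0 <= Y) by (now apply Rmax_lub). clear Y1 Yh. revert Y HY.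
  assert (Lf := lpc_f2 h).
  apply (dyadic_ind _ Z0 Z0); [lra| | |lra].
  - intros Y HY. rewrite (RInt_Chasles_lpc _ 1 Z0 Y Lf).
    assert (RY : Rpower Z0 (1 + 6 * e) <= Rpower Y (1 + 6 * e)) by (apply Rle_Rpower_l; lra).
    assert (S1 : RInt (f2 h) Z0 Y <= K1 * (h * Rpower Y (1 + 6 * e))).
    { eapply Rle_trans; [apply (RInt_lpc_sub _ _ _ Z0 (2 * Z0)); auto; [intros; apply f2_pos|lra..]|].
      eapply Rle_trans; [apply W; lra|]. apply Rmult_le_compat_l; [lra|]. apply Rmult_le_compat_l; lra. }
    assert (S0 : RInt (f2 h) 1 Z0 <= 32 * K2 * (h * Rpower Y (1 + 6 * e))).
    { assert (PR : 0 < Rpower Y (1 + 6 * e)) by apply exp_pos.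
      destruct (Rle_lt_dec h 1) as [L|L].
      - unfold Z0. rewrite Rmax_left by lra. rewrite RInt_point.
        assert (0 <= h * Rpower Y (1 + 6 * e)) by nra. change (0 <= 32 * K2 * (h * Rpower Y (1 + 6 * e))). nra.
      - assert (EZ : Z0 = h) by (unfold Z0; rewrite Rmax_right; lra). rewrite EZ in *.
        assert (LN : lpc (fun x => N2 (E x))) by (now apply lpc_N2).
        assert (LN' : lpc (fun x => N2 (E (x + h)))) by (now apply (lpc_shift (fun x => N2 (E x)))).
        apply Rle_trans with (4 * RInt (fun x => N2 (E x)) 1 (2 * h)).
        + apply Rle_trans with (RInt (fun u => 2 * N2 (E (u + h)) + 2 * N2 (E u)) 1 h).
          * apply RInt_lpc_le; [auto|now apply lpc_lin|lra|]. intros u _. unfold f2.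
            replace (E (u + h) - E u)%C with (E (u + h)%R + - E u)%C by ring. eapply Rle_trans; [apply N2_plus_le|].
            replace (N2 (- E u)%C) with (N2 (E u)) by (unfold N2; simpl; ring). lra.
          * rewrite (RInt_lpc_lin (fun u => N2 (E (u + h)))) by auto. rewrite (RInt_lpc_shift (fun u => N2 (E u))) by auto.
            assert (RInt (fun u => N2 (E u)) (1 + h) (h + h) <= RInt (fun u => N2 (E u)) 1 (2 * h))
              by (apply RInt_lpc_sub; auto; [intros; apply N2_pos|lra..]).
            assert (RInt (fun u => N2 (E u)) 1 h <= RInt (fun u => N2 (E u)) 1 (2 * h))
              by (apply RInt_lpc_sub; auto; [intros; apply N2_pos|lra..]). lra.
        + assert (S2 := M (2 * h) ltac:(lra)). rewrite <- Rpower_mult_distr in S2 by lra.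
          assert (P8 : Rpower 2 (2 + 2 * e) <= 8).
          { apply Rle_trans with (2 ^ 3); [|lra]. rewrite <- (Rpower_pow 3) by lra. apply Rle_Rpower; simpl; lra. }
          assert (Ph : Rpower h (2 + 2 * e) <= h * Rpower Y (1 + 6 * e)).
          { replace (2 + 2 * e) with (1 + (1 + 2 * e)) by ring. rewrite Rpower_plus, Rpower_1 by lra.
            apply Rmult_le_compat_l; [lra|]. apply Rle_trans with (Rpower h (1 + 6 * e)); [apply Rle_Rpower; lra|auto]. }
          assert (0 < Rpower h (2 + 2 * e)) by apply exp_pos.
          assert (Rpower 2 (2 + 2 * e) * Rpower h (2 + 2 * e) <= 8 * (h * Rpower Y (1 + 6 * e))) by nra.
          assert (K2 * (Rpower 2 (2 + 2 * e) * Rpower h (2 + 2 * e)) <= K2 * (8 * (h * Rpower Y (1 + 6 * e)))) by (apply Rmult_le_compat_l; lra).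
          lra. }
    unfold K. lra.
  - intros Z HZ _ IH. rewrite (RInt_Chasles_lpc _ 1 Z (2 * Z) Lf).
    assert (S1 := W Z h ltac:(lra) ltac:(lra)). rewrite <- Rpower_mult_distr by lra.
    assert (P2 : 2 <= Rpower 2 (1 + 6 * e)) by (rewrite <- (Rpower_1 2) at 1 by lra; apply Rle_Rpower; lra).
    set (t := h * Rpower Z (1 + 6 * e)) in *. assert (Ht : 0 < t) by (apply Rmult_lt_0_compat; [lra|apply exp_pos]).
    replace (h * (Rpower 2 (1 + 6 * e) * Rpower Z (1 + 6 * e))) with (Rpower 2 (1 + 6 * e) * t) by (unfold t; ring).
    assert (K1 * t <= K * t) by (apply Rmult_le_compat_r; [lra|unfold K; lra]).
    assert (2 * (K * t) <= Rpower 2 (1 + 6 * e) * (K * t)) by (apply Rmult_le_compat_r; [nra|lra]).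
    lra.
Qed.

Let f1 (dl u : R) : R := N2 (E ((1 + dl) * u) - E u)%C.

Lemma lpc_f1 (dl : R) : 0 < dl -> lpc (f1 dl).
Proof. intros H. apply lpc_N2, lpcC_minus; auto. apply lpcC_dil; auto. lra. Qed.

(* On [[x, x + w]] the dilation by [1 + h / x] and the translation by [h] differ by at most [h w / x]. *)
Lemma block_compare (Q : R -> R) (Z h x w th eta : R) : 0 < h <= Z -> Z <= x -> 0 <= w -> h * w / x <= eta -> 0 < th <= 1 -> lpc Q ->
  (forall x, Z <= x -> 0 <= Q x) ->
  (forall v v', Z <= v -> v <= v' <= v + eta -> N2 (E v' - E v)%C <= Q v + Q v') ->
  Rabs (RInt (f2 h) x (x + w) - RInt (f1 (h / x)) x (x + w)) <=
    th * RInt (f1 (h / x)) x (x + w) + 4 / th * RInt Q (x + h) (x + 2 * w + h).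
Proof.
  intros Hh Hx Hw He' Hth LQ PQ BQ. assert (Hdl : 0 < h / x) by (apply Rdiv_lt_0_compat; lra).
  set (dl := h / x) in *. assert (Edl : dl * x = h) by (unfold dl; field; lra).
  assert (dl1 : dl <= 1) by nra.
  assert (L1 := lpc_f1 dl Hdl). assert (L2 := lpc_f2 h).
  set (g := fun u => N2 (E ((1 + dl) * u) - E (u + h))%C).
  assert (Lg : lpc g) by (apply lpc_N2, lpcC_minus; [apply lpcC_dil; auto; lra|now apply lpcC_shift]).
  assert (Lq : lpc (fun u => Q ((1 + dl) * u))) by (apply lpc_dil; auto; lra).
  assert (Bg : RInt g x (x + w) <= 2 * RInt Q (x + h) (x + 2 * w + h)).
  { apply Rle_trans with (RInt (fun u => 1 * Q (u + h) + 1 * Q ((1 + dl) * u)) x (x + w)).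
    - apply RInt_lpc_le; auto; [apply lpc_lin; auto; now apply lpc_shift|lra|]. intros u Hu. rewrite !Rmult_1_l.
      apply BQ; [lra|]. assert (dl * (u - x) <= h * w / x).
      { replace (h * w / x) with (dl * w) by (unfold dl; field; lra). apply Rmult_le_compat_l; lra. }
      split; nra.
    - rewrite RInt_lpc_lin by (auto; now apply lpc_shift). rewrite RInt_lpc_shift, RInt_dil by (auto; lra).
      assert (A1 : RInt Q (x + h) (x + w + h) <= RInt Q (x + h) (x + 2 * w + h)).
      { apply RInt_lpc_sub; auto; try lra. intros; apply PQ; lra. }
      assert (A2 : RInt Q ((1 + dl) * x) ((1 + dl) * (x + w)) <= RInt Q (x + h) (x + 2 * w + h)).
      { apply RInt_lpc_sub; auto; try nra. intros; apply PQ; lra. }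
      assert (A3 : 0 <= RInt Q ((1 + dl) * x) ((1 + dl) * (x + w))).
      { apply RInt_lpc_ge0; auto; [nra|]. intros; apply PQ; nra. }
      assert (A4 : / (1 + dl) <= 1) by (rewrite <- Rinv_1; apply Rinv_le_contravar; lra).
      assert (/ (1 + dl) * RInt Q ((1 + dl) * x) ((1 + dl) * (x + w)) <= 1 * RInt Q ((1 + dl) * x) ((1 + dl) * (x + w)))
        by (apply Rmult_le_compat_r; auto).
      lra. }
  assert (pt : forall u, Rabs (f1 dl u - f2 h u) <= th * f1 dl u + 2 / th * g u).
  { intros u. unfold f1, f2, g. replace (E ((1 + dl) * u) - E (u + h))%C with ((E ((1 + dl) * u)%R - E u) - (E (u + h)%R - E u))%C by ring.
    now apply N2_diff. }
  assert (P2 : 0 < 2 / th) by (apply Rdiv_lt_0_compat; lra).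
  assert (Bg' : 2 / th * RInt g x (x + w) <= 4 / th * RInt Q (x + h) (x + 2 * w + h)).
  { replace (4 / th * RInt Q (x + h) (x + 2 * w + h)) with (2 / th * (2 * RInt Q (x + h) (x + 2 * w + h))) by (field; lra).
    apply Rmult_le_compat_l; lra. }
  assert (L3 : lpc (fun u => th * f1 dl u + 2 / th * g u)) by (now apply lpc_lin).
  assert (I3 : RInt (fun u => th * f1 dl u + 2 / th * g u) x (x + w) = th * RInt (f1 dl) x (x + w) + 2 / th * RInt g x (x + w)) by (now apply RInt_lpc_lin).
  assert (U1 : RInt (f2 h) x (x + w) <= RInt (fun u => 1 * f1 dl u + 1 * (th * f1 dl u + 2 / th * g u)) x (x + w)).
  { apply RInt_lpc_le; auto; [now apply lpc_lin|lra|]. intros u _. assert (T := pt u). apply Rabs_le_between in T. lra. }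
  assert (U2 : RInt (f1 dl) x (x + w) <= RInt (fun u => 1 * f2 h u + 1 * (th * f1 dl u + 2 / th * g u)) x (x + w)).
  { apply RInt_lpc_le; auto; [now apply lpc_lin|lra|]. intros u _. assert (T := pt u). apply Rabs_le_between in T. lra. }
  rewrite (RInt_lpc_lin (f1 dl) (fun u => th * f1 dl u + 2 / th * g u)) in U1 by auto.
  rewrite (RInt_lpc_lin (f2 h) (fun u => th * f1 dl u + 2 / th * g u)) in U2 by auto.
  rewrite I3 in U1, U2. apply Rabs_le. lra.
Qed.

(** The logarithm is paid for with Z^(10e), the same power of Z that the lag term needs in
    [doubling]. *)
Lemma log_bound (d ka k Z h x : R) : 0 <= d -> 0 < k <= 1 -> 1 <= Z -> k <= h <= x -> x <= 2 * Z ->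
  Rabs (d * ln (x / h) + ka) <= (d * (ln (2 / k) + / (10 * e)) + Rabs ka) * Rpower Z (10 * e).
Proof.
  intros Hd Hk HZ Hh Hx. assert (S1 := Rpower_ge1 Z (10 * e) HZ ltac:(lra)).
  assert (L0 : 0 <= ln (x / h)).
  { rewrite <- ln_1. apply ln_le; [lra|]. apply Rmult_le_reg_r with h; [lra|]. unfold Rdiv. rewrite Rmult_assoc, Rinv_l by lra. lra. }
  assert (L1 : ln (x / h) <= ln (2 / k) + ln Z).
  { rewrite <- ln_mult by (try apply Rdiv_lt_0_compat; lra). apply ln_le; [apply Rdiv_lt_0_compat; lra|].
    replace (2 / k * Z) with (2 * Z * / k) by (unfold Rdiv; ring).
    apply Rmult_le_compat; [lra|left; apply Rinv_0_lt_compat; lra|lra|]. apply Rinv_le_contravar; lra. }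
  assert (L2 := ln_le_Rpower Z (10 * e) ltac:(lra) ltac:(lra)).
  assert (L3 : 0 <= ln (2 / k)).
  { rewrite <- ln_1. apply ln_le; [lra|]. apply Rmult_le_reg_r with k; [lra|]. unfold Rdiv. rewrite Rmult_assoc, Rinv_l by lra. lra. }
  eapply Rle_trans; [apply Rabs_triang|]. rewrite Rabs_mult, (Rabs_pos_eq d), (Rabs_pos_eq (ln (x / h))) by auto.
  assert (Pk := Rabs_pos ka).
  assert (ln (x / h) <= (ln (2 / k) + / (10 * e)) * Rpower Z (10 * e)) by nra.
  assert (d * ln (x / h) <= d * ((ln (2 / k) + / (10 * e)) * Rpower Z (10 * e))) by (apply Rmult_le_compat_l; auto).
  nra.
Qed.

(** The contribution of one dyadic interval, with its main term as an increment of [Tm] so that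
    consecutive intervals telescope. *)
Lemma doubling (d ka c K0 k : R) : 0 <= d -> 0 < c <= 1 -> 0 <= K0 -> 0 < k <= 1 -> exists K, 0 < K /\
  forall Z h, 1 <= Z -> k <= h <= Z ->
  (forall x x', Z <= x <= 2 * Z -> Z <= x' <= 2 * Z ->
     Rabs (RInt (f1 (h / x)) 1 x' - 1/2 * (h / x) * x' ^ 2 * (d * ln (x / h) + ka)) <= K0 * Rpower (h / x) (1 + c) * x' ^ 2) ->
  Rabs (RInt (f2 h) Z (2 * Z) - (Tm d ka h (2 * Z) - Tm d ka h Z)) <= K * (h * Z * Rpower (h / Z) (c / 3) * Rpower Z (10 * e)).
Proof.
  intros Hd Hc HK0 Hk. destruct HQ as [K [HK HL]].
  set (CL := d * (ln (2 / k) + / (10 * e)) + Rabs ka).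
  assert (HCL : 0 <= CL).
  { assert (0 <= ln (2 / k)).
    { rewrite <- ln_1. apply ln_le; [lra|]. apply Rmult_le_reg_r with k; [lra|]. unfold Rdiv. rewrite Rmult_assoc, Rinv_l by lra. lra. }
    assert (0 < / (10 * e)) by (apply Rinv_0_lt_compat; lra). assert (T := Rabs_pos ka). unfold CL. nra. }
  assert (Pk2 : 0 < / k ^ 2) by (apply Rinv_0_lt_compat, pow_lt; lra).
  exists (2 * CL + 32 * K0 + (d + CL) + 16 * K * / k ^ 2). split; [nra|].
  intros Z h HZ Hh HVl.
  set (r := h / Z). assert (Hr : 0 < r <= 1).
  { split; [apply Rdiv_lt_0_compat; lra|]. unfold r. apply Rmult_le_reg_r with Z; [lra|]. unfold Rdiv. rewrite Rmult_assoc, Rinv_l by lra. lra. }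
  assert (ErZ : r * Z = h) by (unfold r; field; lra).
  set (th := Rpower r (c / 3)). assert (Hth : 0 < th <= 1) by (split; [apply exp_pos|apply Rpower_le1; lra]).
  assert (Eth2 : Rpower r (2 * c / 3) = th ^ 2).
  { unfold th. replace (2 * c / 3) with (c / 3 + c / 3) by field. rewrite Rpower_plus. ring. }
  (* The number of blocks, between th^(-2) and 2 th^(-2); both bounds are used, the upper one for
     the hypothesis errors and the lower one for the length of the lags. *)
  destruct (nat_between (/ th ^ 2)) as [n [Hn1 Hn2]].
  { rewrite <- Rinv_1 at 1. apply Rinv_le_contravar; [apply pow_lt; lra|]. simpl. nra. }
  assert (Pt2 : 0 < th ^ 2) by (apply pow_lt; lra).
  assert (N1 : 1 <= INR n).
  { eapply Rle_trans; [|apply Hn1]. rewrite <- Rinv_1 at 1. apply Rinv_le_contravar; auto. simpl; nra. }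
  assert (IN : / INR n <= th ^ 2).
  { rewrite <- (Rinv_inv (th ^ 2)). apply Rinv_le_contravar; auto. now apply Rinv_0_lt_compat. }
  assert (PIN : 0 < / INR n) by (apply Rinv_0_lt_compat; lra).
  assert (IN1 : / INR n <= 1) by (rewrite <- Rinv_1; apply Rinv_le_contravar; lra).
  (* On a block of length w = Z/n the dilation and the translation differ by at most h w/Z = h/n,
     and this is D Z. *)
  set (D := r * / INR n). assert (HD : 0 < D <= 1) by (unfold D; split; [nra|nra]).
  destruct (HL Z D HZ HD) as [Q [LQ [PQ [IQ BQ]]]].
  set (w := Z * / INR n). assert (Hw : 0 < w <= Z) by (unfold w; split; nra).
  assert (Enw : INR n * w = Z) by (unfold w; field; lra).
  assert (EDZ : D * Z = h * / INR n) by (unfold D; rewrite <- ErZ; ring).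
  set (S := Rpower Z (10 * e)). assert (HS : 1 <= S) by (apply Rpower_ge1; lra).
  set (L := CL * S). assert (HLp : 0 <= L) by (unfold L; nra).
  set (E1 := 2 * (K0 * Rpower r (1 + c) * (2 * Z) ^ 2)). set (E2 := h * w ^ 2 / Z * (d + L)).
  assert (Pr : 0 < Rpower r (1 + c)) by apply exp_pos.
  assert (HE1 : 0 <= E1).
  { unfold E1. apply Rmult_le_pos; [lra|]. apply Rmult_le_pos; [nra|apply pow2_ge_0]. }
  (* Per block: th times the main part of the variance; [E1] twice, once for the hypothesis at the
     two ends of the block and once because th also multiplies that error; [E2] for the main
     term. *)
  set (Aj := 2 * th * h * w * L + 2 * E1 + E2).
  assert (blk : forall x, Z <= x -> x + w <= 2 * Z ->
    Rabs (RInt (f2 h) x (x + w) - (Tm d ka h (x + w) - Tm d ka h x)) <= Aj + 4 / th * RInt Q (x + h) (x + 2 * w + h)).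
  { intros x Hx Hxw.
    assert (Hdl : 0 < h / x) by (apply Rdiv_lt_0_compat; lra).
    assert (dlr : h / x <= r) by (unfold r, Rdiv; apply Rmult_le_compat_l; [lra|]; apply Rinv_le_contravar; lra).
    assert (BL : Rabs (d * ln (x / h) + ka) <= L) by (apply (log_bound d ka k); lra).
    set (M := d * ln (x / h) + ka) in *.
    assert (V1 := HVl x x ltac:(lra) ltac:(lra)). assert (V2 := HVl x (x + w) ltac:(lra) ltac:(lra)). fold M in V1, V2.
    assert (Hb : forall x', Z <= x' <= 2 * Z -> K0 * Rpower (h / x) (1 + c) * x' ^ 2 <= K0 * Rpower r (1 + c) * (2 * Z) ^ 2).
    { intros x' Hx'. apply Rmult_le_compat; [|apply pow2_ge_0| |apply pow_incr; lra].
      - apply Rmult_le_pos; [auto|left; apply exp_pos].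
      - apply Rmult_le_compat_l; auto. apply Rle_Rpower_l; lra. }
    assert (B1 := Hb x ltac:(lra)). assert (B2 := Hb (x + w) ltac:(lra)).
    set (v := RInt (f1 (h / x)) x (x + w)).
    assert (Ev : v = RInt (f1 (h / x)) 1 (x + w) - RInt (f1 (h / x)) 1 x).
    { unfold v. rewrite (RInt_Chasles_lpc (f1 (h / x)) 1 x (x + w)) by (now apply lpc_f1). lra. }
    set (mn := 1/2 * (h / x) * ((x + w) ^ 2 - x ^ 2) * M).
    assert (Vm : Rabs (v - mn) <= E1).
    { apply Rabs_le_between in V1, V2. apply Rabs_le. rewrite Ev.
      replace mn with (1/2 * (h / x) * (x + w) ^ 2 * M - 1/2 * (h / x) * x ^ 2 * M) by (unfold mn; ring).
      unfold E1. lra. }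
    assert (Hm : mn <= 2 * h * w * L).
    { unfold mn. replace (1/2 * (h / x) * ((x + w) ^ 2 - x ^ 2)) with (h * w * (1 + 1/2 * (w / x))) by (field; lra).
      assert (w / x <= 1).
      { apply Rmult_le_reg_r with x; [lra|]. unfold Rdiv. rewrite Rmult_assoc, Rinv_l by lra. lra. }
      assert (0 <= w / x) by (apply Rmult_le_pos; [lra|left; apply Rinv_0_lt_compat; lra]).
      assert (0 <= h * w) by nra. assert (M <= L) by (eapply Rle_trans; [apply Rle_abs|auto]).
      apply Rle_trans with (h * w * (1 + 1/2 * (w / x)) * L); [apply Rmult_le_compat_l; nra|].
      assert (0 <= h * w * L) by nra. nra. }
    assert (MT := main_term d ka h x w Hd ltac:(lra) ltac:(lra) ltac:(lra)). fold M in MT. fold mn in MT.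
    assert (B3 : h * w ^ 2 / x * (d + Rabs M) <= E2).
    { unfold E2. assert (PM := Rabs_pos M). assert (P2 := pow2_ge_0 w). apply Rmult_le_compat; [|lra| |lra].
      - apply Rmult_le_pos; [nra|left; apply Rinv_0_lt_compat; lra].
      - apply Rmult_le_compat_l; [nra|]. apply Rinv_le_contravar; lra. }
    assert (BC := block_compare Q Z h x w th (D * Z) ltac:(lra) Hx ltac:(lra)).
    assert (Hew : h * w / x <= D * Z).
    { rewrite EDZ. apply Rle_trans with (h * w / Z).
      - apply Rmult_le_compat_l; [nra|]. apply Rinv_le_contravar; lra.
      - right. unfold w. field. lra. }
    specialize (BC Hew Hth LQ PQ BQ). fold v in BC.
    apply Rabs_le_between in BC, MT, Vm. 
    assert (th * v <= th * (2 * h * w * L) + E1).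
    { apply Rle_trans with (th * (2 * h * w * L + E1)); [apply Rmult_le_compat_l; lra|]. nra. }
    replace (2 * th * h * w * L) with (th * (2 * h * w * L)) in * by ring.
    unfold Aj. apply Rabs_le. lra. }
  (* The window of Q used for a block has length 2w, so neighbouring windows overlap; they chain
     into two integrals whose ends are one block apart. *)
  assert (sum : forall j, (j <= n)%nat -> let x := Z + INR j * w in
    Rabs (RInt (f2 h) Z x - (Tm d ka h x - Tm d ka h Z)) <=
      INR j * Aj + 4 / th * (RInt Q (Z + h) (x + w + h) + RInt Q (Z + h) (x + h))).
  { induction j as [|j IH]; intros Hj x.
    - assert (Ex : x = Z) by (unfold x; simpl; ring). rewrite Ex.
      rewrite !RInt_point. change (INR 0) with 0.
      assert (0 <= RInt Q (Z + h) (Z + w + h)) by (apply RInt_lpc_ge0; auto; [lra|]; intros; apply PQ; lra).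
      assert (0 < 4 / th) by (apply Rdiv_lt_0_compat; lra).
      change (@zero (CompleteNormedModule.AbelianMonoid _ R_CompleteNormedModule)) with 0.
      rewrite Rabs_pos_eq by lra. nra.
    - specialize (IH ltac:(lia)). cbv zeta in IH. set (x0 := Z + INR j * w) in *.
      assert (Ex : x = x0 + w) by (unfold x, x0; rewrite S_INR; ring).
      assert (Jn : INR (Datatypes.S j) <= INR n) by (now apply le_INR).
      assert (P0 := pos_INR j).
      assert (Xw : x0 + w <= 2 * Z).
      { rewrite <- Ex. unfold x. assert (INR (Datatypes.S j) * w <= INR n * w) by (apply Rmult_le_compat_r; lra). lra. }
      assert (X0 : Z <= x0) by (unfold x0; nra).
      assert (B := blk x0 X0 Xw). rewrite Ex, S_INR.
      rewrite (RInt_Chasles_lpc (f2 h) Z x0 (x0 + w)) by apply lpc_f2.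
      assert (C1 := RInt_Chasles_lpc Q (Z + h) (x0 + h) (x0 + 2 * w + h) LQ).
      replace (x0 + w + w + h) with (x0 + 2 * w + h) by ring. rewrite C1.
      apply Rabs_le_between in B, IH. apply Rabs_le. lra. }
  specialize (sum n (Nat.le_refl n)). cbv zeta in sum. rewrite Enw in sum. replace (Z + Z) with (2 * Z) in sum by ring.
  eapply Rle_trans; [apply sum|].
  assert (Q1 : RInt Q (Z + h) (2 * Z + w + h) <= RInt Q Z (4 * Z)) by (apply RInt_lpc_sub; auto; lra).
  assert (Q2 : RInt Q (Z + h) (2 * Z + h) <= RInt Q Z (4 * Z)) by (apply RInt_lpc_sub; auto; lra).
  set (U := h * Z * th * S). assert (hZt : 0 < h * Z * th) by (apply Rmult_lt_0_compat; nra).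
  assert (HU : h * Z * th <= U) by (unfold U; nra).
  fold S. fold r. fold th. fold U.
  assert (F1 : INR n * (2 * th * h * w * L) = 2 * CL * U).
  { replace (INR n * (2 * th * h * w * L)) with (2 * th * h * (INR n * w) * L) by ring. rewrite Enw. unfold U, L. ring. }
  (* n r^(1+c) <= 2 r th, from n <= 2 th^(-2) and th^3 = r^c. *)
  assert (F2 : INR n * (2 * E1) <= 32 * K0 * U).
  { assert (G : INR n * Rpower r (1 + c) <= 2 * (r * th)).
    { replace (1 + c) with (1 + (c / 3 + 2 * c / 3)) by field. rewrite !Rpower_plus, Rpower_1, Eth2 by lra. fold th.
      apply Rmult_le_compat_r with (r := th ^ 2) in Hn2; [|lra]. rewrite Rmult_assoc, Rinv_l in Hn2 by lra.
      assert (0 < r * th) by nra. nra. }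
    unfold E1. replace (INR n * (2 * (2 * (K0 * Rpower r (1 + c) * (2 * Z) ^ 2)))) with (16 * K0 * Z ^ 2 * (INR n * Rpower r (1 + c))) by ring.
    apply Rle_trans with (16 * K0 * Z ^ 2 * (2 * (r * th))).
    - apply Rmult_le_compat_l; auto. assert (T := pow2_ge_0 Z). nra.
    - replace (16 * K0 * Z ^ 2 * (2 * (r * th))) with (32 * K0 * (r * Z * Z * th)) by ring. rewrite ErZ. nra. }
  assert (F3 : INR n * E2 <= (d + CL) * U).
  { unfold E2. replace (INR n * (h * w ^ 2 / Z * (d + L))) with (h * Z * / INR n * (d + L)) by (unfold w; field; lra).
    assert (/ INR n <= th) by (eapply Rle_trans; [apply IN|]; simpl; nra).
    assert (d + L <= (d + CL) * S) by (unfold L; nra).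
    apply Rle_trans with (h * Z * th * ((d + CL) * S)); [|right; unfold U; ring].
    apply Rmult_le_compat; [|lra| |auto]; [apply Rmult_le_pos; nra|apply Rmult_le_compat_l; nra]. }
  (* D is of order r th^2, so D Z^2/th is of order h Z th. The loss D^(-4e) is at most 2 r^(-8e),
     because D >= r^2/2; this and the power 2e of the mean squares make up Z^(10e). *)
  assert (F4 : 4 / th * (2 * (K * Rpower D (1 - 4 * e) * Rpower Z (2 + 2 * e))) <= 16 * K * / k ^ 2 * U).
  { assert (G1 : Rpower D (1 - 4 * e) <= r * th ^ 2 * (2 * Rpower r (- (8 * e)))).
    { unfold Rminus. rewrite Rpower_plus, Rpower_1 by lra. apply Rmult_le_compat; [lra|left; apply exp_pos|unfold D; nra|].
      rewrite !Rpower_Ropp.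
      assert (D2 : r ^ 2 / 2 <= D).
      { unfold D. assert (th ^ 2 / 2 <= / INR n).
        { replace (th ^ 2 / 2) with (/ (2 * / th ^ 2)) by (field; lra). apply Rinv_le_contravar; lra. }
        assert (r <= th ^ 2).
        { rewrite <- Eth2. rewrite <- (Rpower_1 r) at 1 by lra. apply Rpower_le_exp; lra. }
        simpl. simpl in *. nra. }
      assert (Pr2 : 0 < r ^ 2) by (apply pow_lt; lra).
      assert (D3 : Rpower r (8 * e) / 2 <= Rpower D (4 * e)).
      { apply Rle_trans with (Rpower (r ^ 2 / 2) (4 * e)); [|apply Rle_Rpower_l; lra].
        unfold Rdiv. rewrite <- Rpower_mult_distr by lra.
        replace (Rpower (r ^ 2) (4 * e)) with (Rpower r (8 * e)).
        2:{ rewrite <- (Rpower_pow 2) by lra. rewrite Rpower_mult. f_equal. simpl. ring. }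
        apply Rmult_le_compat_l; [left; apply exp_pos|]. rewrite <- (Rpower_1 (/ 2)) at 1 by lra. apply Rpower_le_exp; lra. }
      assert (0 < Rpower r (8 * e)) by apply exp_pos.
      apply Rle_trans with (/ (Rpower r (8 * e) / 2)); [apply Rinv_le_contravar; lra|]. right. field. lra. }
    assert (G2 : Rpower r (- (8 * e)) <= / k ^ 2 * Rpower Z (8 * e)).
    { unfold r, Rdiv. rewrite <- Rpower_mult_distr by (try apply Rinv_0_lt_compat; lra).
      replace (Rpower (/ Z) (- (8 * e))) with (Rpower Z (8 * e)).
      2:{ rewrite <- (Rpower_1 Z) at 2 by lra. rewrite <- Rpower_Ropp, Rpower_mult. f_equal. ring. }
      apply Rmult_le_compat_r; [left; apply exp_pos|]. rewrite Rpower_Ropp. apply Rinv_le_contravar; [apply pow_lt; lra|].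
      apply Rle_trans with (Rpower k (8 * e)); [|apply Rle_Rpower_l; lra].
      rewrite <- (Rpower_pow 2) by lra. apply Rpower_le_exp; simpl; lra. }
    assert (G3 : Rpower Z (2 + 2 * e) = Z ^ 2 * Rpower Z (2 * e)).
    { rewrite Rpower_plus. replace (Rpower Z 2) with (Z ^ 2); auto. rewrite <- Rpower_pow by lra. f_equal. }
    assert (G4 : Rpower Z (8 * e) * Rpower Z (2 * e) = S) by (unfold S; rewrite <- Rpower_plus; f_equal; ring).
    assert (PZ : 0 < Rpower Z (2 * e)) by apply exp_pos. assert (PZ2 : 0 < Z ^ 2) by (apply pow_lt; lra).
    rewrite G3.
    apply Rle_trans with (4 / th * (2 * (K * (r * th ^ 2 * (2 * (/ k ^ 2 * Rpower Z (8 * e)))) * (Z ^ 2 * Rpower Z (2 * e))))).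
    - apply Rmult_le_compat_l; [left; apply Rdiv_lt_0_compat; lra|]. apply Rmult_le_compat_l; [lra|].
      apply Rmult_le_compat_r; [nra|]. apply Rmult_le_compat_l; [lra|]. eapply Rle_trans; [apply G1|].
      apply Rmult_le_compat_l; [nra|]. lra.
    - right. unfold U. rewrite <- G4, <- ErZ. field. lra. }
  assert (F5 : 4 / th * (RInt Q (Z + h) (2 * Z + w + h) + RInt Q (Z + h) (2 * Z + h)) <=
    4 / th * (2 * (K * Rpower D (1 - 4 * e) * Rpower Z (2 + 2 * e)))).
  { apply Rmult_le_compat_l; [left; apply Rdiv_lt_0_compat; lra|]. lra. }
  unfold Aj. lra.
Qed.
End Real.

(** * Summation over dyadic ranges *)

(** Applied to y = 2 Xo/X with Xo of order h^(1/(1-B1)), it produces the second error term of the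
    theorem. *)
Lemma Rmin1_le_cuberoot (y : R) : 0 < y -> Rmin 1 y <= Rpower y (1/3).
Proof.
  intros Hy. destruct (Rle_lt_dec y 1) as [L|L].
  - rewrite Rmin_right by lra. rewrite <- (Rpower_1 y) at 1 by lra. apply Rpower_le_exp; lra.
  - rewrite Rmin_left by lra. apply Rpower_ge1; lra.
Qed.

Lemma Rpower_half_le (b p x x' : R) : 0 <= b <= 1 -> p = - b -> 0 < x -> 0 < x' -> x <= 2 * x' -> 1/2 * Rpower x' p <= Rpower x p.
Proof.
  intros Hb -> Hx Hx' H. apply Rle_trans with (Rpower (2 * x') (- b)).
  - rewrite <- Rpower_mult_distr by lra. apply Rmult_le_compat_r; [left; apply exp_pos|].
    rewrite Rpower_Ropp. replace (1/2) with (/ 2) by field. apply Rinv_le_contravar; [apply exp_pos|].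
    rewrite <- (Rpower_1 2) at 2 by lra. apply Rle_Rpower; lra.
  - rewrite !Rpower_Ropp. apply Rinv_le_contravar; [apply exp_pos|]. apply Rle_Rpower_l; lra.
Qed.

Lemma Rpower_dbl (p : R) : 2/3 <= p -> 4/3 <= Rpower 2 p.
Proof.
  intros Hp. assert (T := exp_ineq1_le (p * ln 2)). fold (Rpower 2 p) in T. assert (L := ln_lt_2). nra.
Qed.

Section Assembly.
Variables (E : R -> C) (d ka B1 B2 B3 c : R).
Let f1 (dl u : R) : R := N2 (E ((1 + dl) * u) - E u)%C.
Let f2 (h u : R) : R := N2 (E (u + h) - E u)%C.
Hypotheses (LE : lpcC E) (Hd : 0 < d) (HB : 0 < B1 /\ B1 < B2 /\ B2 <= B3 /\ B3 <= 1) (Hc : 0 < c)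
  (HM : forall e, 0 < e <= 1/4 ->
    (exists K, 0 < K /\ forall Z, 1 <= Z -> RInt (fun x => N2 (E x)) Z (exp 1 * Z) <= K * Rpower Z (2 + 2 * e)) /\
    (exists K, 0 < K /\ forall Z D, 1 <= Z -> 0 < D <= 1 -> exists Q : R -> R, lpc Q /\ (forall x, Z <= x -> 0 <= Q x) /\
      RInt Q Z (4 * Z) <= K * Rpower D (1 - 4 * e) * Rpower Z (2 + 2 * e) /\
      forall v v', Z <= v -> v <= v' <= v + D * Z -> N2 (E v' - E v)%C <= Q v + Q v'))
  (HV : forall k1 k2, k1 > 0 -> k2 > 0 -> exists K X0, forall X dl, X >= X0 ->
     k1 * Rpower X (- B3) <= dl -> dl <= k2 * Rpower X (- B1) ->
     Rabs (RInt (f1 dl) 1 X - 1/2 * dl * X ^ 2 * (d * ln (1 / dl) + ka)) <= K * Rpower dl (1 + c) * X ^ 2).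

(** Dyadic induction upwards from Xo, the point beyond which the dilations h/x lie in the range of
    the hypothesis. The error carried along has a fixed part [A], from below Xo, and a part
    proportional to the last dyadic interval. *)
Lemma variance_translation : forall ep k1 k2, 0 < ep -> 0 < k1 -> 0 < k2 -> exists K X0, forall X h, X >= X0 ->
  k1 * Rpower X (1 - B3) <= h -> h <= k2 * Rpower X (1 - B2) ->
  Rabs (RInt (f2 h) 1 X - Tm d ka h X) <=
    K * (h * Rpower X (1 + ep) * Rpower (h / X) (c / 3)) +
    K * (h * Rpower X (1 + ep) * Rpower (h * Rpower X (- (1 - B1))) (1 / (3 * (1 - B1)))).
Proof.
  intros ep k1 k2 Hep Hk1 Hk2. destruct HB as [HB1 [HB12 [HB23 HB3]]].
  (* All losses are at most X^(10e). *)
  set (e := Rmin (1/4) (ep / 10)). assert (e1 : e <= 1/4) by apply Rmin_l. assert (e2 : e <= ep / 10) by apply Rmin_r.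
  assert (e0 : 0 < e) by (apply Rmin_glb_lt; lra).
  destruct (HM e ltac:(lra)) as [HE HQ].
  set (c0 := Rmin c 1). assert (c1 : c0 <= c) by apply Rmin_l. assert (c2 : c0 <= 1) by apply Rmin_r.
  assert (c3 : 0 < c0) by (apply Rmin_glb_lt; lra).
  (* Since B3 <= 1, the lower end of the range of h gives h >= k. *)
  set (k := Rmin k1 1). assert (kk1 : k <= k1) by apply Rmin_l. assert (k1' : k <= 1) by apply Rmin_r.
  assert (k0 : 0 < k) by (apply Rmin_glb_lt; lra).
  set (be := / (1 - B1)). assert (Ebe : be * (1 - B1) = 1) by (unfold be; field; lra).
  assert (Hbe : 1 <= be) by (unfold be; rewrite <- Rinv_1; apply Rinv_le_contravar; lra).
  (* The constants are relaxed by a factor 2, because the dilation h/x is used with the integral up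
     to a different point x' of the same dyadic interval. *)
  destruct (HV (k1 / 2) 2 ltac:(lra) ltac:(lra)) as [KV [XV HVk]].
  (* Makes Xo = Cc h^be at least 1, h and the threshold [XV], even when h < 1. *)
  set (Cc := (1 + Rabs XV) * Rpower k (- be)).
  assert (PX := Rabs_pos XV).
  assert (Pkb : 1 <= Rpower k (- be)).
  { rewrite Rpower_Ropp. rewrite <- Rinv_1 at 1. apply Rinv_le_contravar; [apply exp_pos|]. apply Rpower_le1; lra. }
  assert (C1 : 1 <= Cc) by (unfold Cc; nra).
  destruct (small_range E e ltac:(lra) LE HE HQ k ltac:(lra)) as [K1 [HK1 SR]].
  destruct (doubling E e ltac:(lra) LE HQ d ka c0 (Rabs KV) k ltac:(lra) ltac:(lra) (Rabs_pos KV) ltac:(lra)) as [K3 [HK3 DB]].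
  set (CL := d * (ln (2 / k) + / (10 * e)) + Rabs ka).
  set (K5 := K1 + Rabs CL + d). assert (HK5 : 0 < K5) by (unfold K5; assert (T := Rabs_pos CL); lra).
  set (C3 := Rpower (2 * Cc) (1/3)). assert (HC3 : 0 < C3) by apply exp_pos.
  (* For X beyond this threshold k2 X^(1-B2) <= X, hence h <= X. *)
  exists (3 * K3 * C3 + K5 * C3 + 3 * K3), (Rmax 1 (Rpower k2 (/ B2))).
  intros X h HX Hh1 Hh2.
  assert (X1 : 1 <= X) by (assert (T := Rmax_l 1 (Rpower k2 (/ B2))); lra).
  assert (X2 : Rpower k2 (/ B2) <= X) by (assert (T := Rmax_r 1 (Rpower k2 (/ B2))); lra).
  assert (hk : k <= h).
  { assert (T := Rpower_ge1 X (1 - B3) X1 ltac:(lra)). nra. }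
  assert (hX : h <= X).
  { eapply Rle_trans; [apply Hh2|]. unfold Rminus. rewrite Rpower_plus, Rpower_1, Rpower_Ropp by lra.
    assert (k2 <= Rpower X B2).
    { apply Rle_trans with (Rpower (Rpower k2 (/ B2)) B2).
      - rewrite Rpower_mult, Rinv_l, Rpower_1 by lra. lra.
      - apply Rle_Rpower_l; [lra|]. split; [apply exp_pos|auto]. }
    assert (P : 0 < Rpower X B2) by apply exp_pos.
    apply Rmult_le_reg_r with (Rpower X B2); auto. replace (k2 * (X * / Rpower X B2) * Rpower X B2) with (k2 * X) by (field; lra). nra. }
  set (Xo := Cc * Rpower h be).
  assert (hb : 0 < Rpower h be) by apply exp_pos.
  assert (hkb : Rpower (h / k) be = Rpower h be * Rpower k (- be)).
  { unfold Rdiv. rewrite <- Rpower_mult_distr by (try apply Rinv_0_lt_compat; lra). f_equal.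
    rewrite <- (Rpower_1 k) at 1 by lra. rewrite <- Rpower_Ropp, Rpower_mult. f_equal. ring. }
  assert (hk1 : 1 <= h / k).
  { apply Rmult_le_reg_r with k; [lra|]. unfold Rdiv. rewrite Rmult_assoc, Rinv_l by lra. lra. }
  assert (XoE : Xo = (1 + Rabs XV) * Rpower (h / k) be) by (unfold Xo, Cc; rewrite hkb; ring).
  assert (hkb1 : 1 <= Rpower (h / k) be) by (apply Rpower_ge1; lra).
  assert (hkb2 : h <= Rpower (h / k) be).
  { apply Rle_trans with (h / k).
    - apply Rmult_le_reg_r with k; [lra|]. unfold Rdiv. rewrite Rmult_assoc, Rinv_l by lra. nra.
    - rewrite <- (Rpower_1 (h / k)) at 1 by lra. apply Rle_Rpower; lra. }
  assert (Xo1 : 1 <= Xo) by (rewrite XoE; nra).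
  assert (XoV : XV <= Xo) by (rewrite XoE; assert (T := Rle_abs XV); nra).
  assert (Xoh : h <= Xo) by (rewrite XoE; nra).
  set (t := Rpower (h * Rpower X (- (1 - B1))) (1 / (3 * (1 - B1)))).
  assert (Et : Rpower (2 * Xo / X) (1/3) = C3 * t).
  { unfold C3, t, Xo. replace (2 * (Cc * Rpower h be) / X) with ((2 * Cc) * (Rpower h be * / X)) by (unfold Rdiv; ring).
    rewrite <- Rpower_mult_distr by (try (apply Rmult_lt_0_compat; [auto|apply Rinv_0_lt_compat]); lra). f_equal.
    rewrite <- !Rpower_mult_distr by (try apply exp_pos; try apply Rinv_0_lt_compat; lra).
    f_equal; [|rewrite <- (Rpower_1 X) at 1 by lra; rewrite <- Rpower_Ropp]; rewrite !Rpower_mult; f_equal; unfold be; field; lra. }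
  assert (Ht : 0 < t) by apply exp_pos.
  set (S := Rpower X (10 * e)). assert (HS : 1 <= S) by (apply Rpower_ge1; lra).
  set (g := fun Y => h * Y * Rpower (h / Y) (c0 / 3) * Rpower Y (10 * e)).
  set (A := K5 * (h * X * S * (C3 * t))).
  assert (claim : forall Y, Rmax 1 h <= Y -> Y <= X -> Rabs (RInt (f2 h) 1 Y - Tm d ka h Y) <= A + 3 * K3 * g Y).
  { assert (M1 := Rmax_l 1 h). assert (M2 := Rmax_r 1 h).
    assert (gpos : forall Y, 0 < Y -> 0 < g Y).
    { intros Y HY. unfold g. apply Rmult_lt_0_compat; [apply Rmult_lt_0_compat; [nra|apply exp_pos]|apply exp_pos]. }
    apply (dyadic_ind (fun Y => Y <= X -> Rabs (RInt (f2 h) 1 Y - Tm d ka h Y) <= A + 3 * K3 * g Y) (Rmax 1 h) Xo); [lra| | |now apply Rmax_lub].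
    (* Base range Y <= 2 Xo: the variance and the main term are bounded separately by h Y X^(10e),
       and Y is at most X times the cube root of 2 Xo/X. *)
    - intros Y HY HYX. assert (HYp : 0 < g Y) by (apply gpos; lra).
      assert (B1' := SR h Y hk ltac:(lra) ltac:(lra)).
      assert (B0 : 0 <= RInt (f2 h) 1 Y) by (apply RInt_lpc_ge0; [now apply lpc_f2|lra|intros; apply N2_pos]).
      assert (BL := log_bound e ltac:(lra) d ka k Y h Y ltac:(lra) ltac:(lra) ltac:(lra) ltac:(lra) ltac:(lra)). fold CL in BL.
      assert (SY : Rpower Y (10 * e) <= S) by (apply Rle_Rpower_l; lra).
      assert (SY1 : 1 <= Rpower Y (10 * e)) by (apply Rpower_ge1; lra).
      assert (R6 : Rpower Y (1 + 6 * e) <= Y * S).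
      { rewrite Rpower_plus, Rpower_1 by lra. apply Rmult_le_compat_l; [lra|]. apply Rle_trans with (Rpower Y (10 * e)); auto. apply Rle_Rpower; lra. }
      assert (hY : 0 < h * Y) by nra.
      assert (BT : Rabs (Tm d ka h Y) <= (Rabs CL + d) * (h * Y * S)).
      { unfold Tm. rewrite Rabs_mult, (Rabs_pos_eq (h * Y)) by lra.
        replace ((Rabs CL + d) * (h * Y * S)) with (h * Y * ((Rabs CL + d) * S)) by ring. apply Rmult_le_compat_l; [lra|].
        unfold Rminus. eapply Rle_trans; [apply Rabs_triang|]. rewrite Rabs_Ropp, (Rabs_pos_eq d) by lra.
        assert (CL * Rpower Y (10 * e) <= Rabs CL * S).
        { apply Rle_trans with (Rabs CL * Rpower Y (10 * e)); [apply Rmult_le_compat_r; [lra|apply Rle_abs]|].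
          apply Rmult_le_compat_l; [apply Rabs_pos|auto]. }
        nra. }
      assert (hYX : h * Y * S <= h * X * S * (C3 * t)).
      { rewrite <- Et. assert (YX : Y <= X * Rpower (2 * Xo / X) (1/3)).
        { apply Rle_trans with (X * Rmin 1 (2 * Xo / X)).
          - unfold Rmin. destruct (Rle_dec 1 (2 * Xo / X)); [lra|]. replace (X * (2 * Xo / X)) with (2 * Xo) by (field; lra). lra.
          - apply Rmult_le_compat_l; [lra|]. apply Rmin1_le_cuberoot. apply Rdiv_lt_0_compat; lra. }
        replace (h * X * S * Rpower (2 * Xo / X) (1 / 3)) with (h * S * (X * Rpower (2 * Xo / X) (1 / 3))) by ring.
        replace (h * Y * S) with (h * S * Y) by ring. apply Rmult_le_compat_l; [nra|auto]. }
      unfold Rminus. eapply Rle_trans; [apply Rabs_triang|]. rewrite Rabs_Ropp, (Rabs_pos_eq _ B0).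
      assert (RInt (f2 h) 1 Y <= K1 * (h * Y * S)).
      { eapply Rle_trans; [apply B1'|]. apply Rmult_le_compat_l; [lra|]. rewrite Rmult_assoc. apply Rmult_le_compat_l; lra. }
      assert (K5 * (h * Y * S) <= A) by (apply Rmult_le_compat_l; lra).
      assert (0 < 3 * K3 * g Y) by nra. unfold K5 in *. lra.
    - intros Z HZ HZ0 IH HZX. specialize (IH ltac:(lra)). assert (Gp := gpos Z ltac:(lra)).
      assert (D := DB Z h ltac:(lra) ltac:(lra)).
      assert (D' : Rabs (RInt (f2 h) Z (2 * Z) - (Tm d ka h (2 * Z) - Tm d ka h Z)) <= K3 * g Z).
      { apply D. intros x x' Hx Hx'.
        assert (dl0 : 0 < h / x) by (apply Rdiv_lt_0_compat; lra).
        assert (dl1 : h / x <= 1).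
        { apply Rmult_le_reg_r with x; [lra|]. unfold Rdiv. rewrite Rmult_assoc, Rinv_l by lra. lra. }
        assert (V := HVk x' (h / x) ltac:(lra)).
        assert (x1B : forall b, Rpower x (1 - b) / x = Rpower x (- b)).
        { intros b. unfold Rminus. rewrite Rpower_plus, Rpower_1 by lra. field. lra. }
        assert (Lo : k1 / 2 * Rpower x' (- B3) <= h / x).
        { apply Rle_trans with (k1 * Rpower x (- B3)).
          - assert (T := Rpower_half_le B3 (- B3) x x' ltac:(lra) eq_refl ltac:(lra) ltac:(lra) ltac:(lra)). nra.
          - rewrite <- x1B. unfold Rdiv. rewrite <- Rmult_assoc. apply Rmult_le_compat_r; [left; apply Rinv_0_lt_compat; lra|].
            eapply Rle_trans; [|apply Hh1]. apply Rmult_le_compat_l; [lra|]. apply Rle_Rpower_l; lra. }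
        assert (Hi : h / x <= 2 * Rpower x' (- B1)).
        { apply Rle_trans with (Rpower x (- B1)).
          - rewrite <- x1B. apply Rmult_le_compat_r; [left; apply Rinv_0_lt_compat; lra|].
            apply Rle_trans with (Rpower (Rpower h be) (1 - B1)).
            + rewrite Rpower_mult, Ebe, Rpower_1 by lra. lra.
            + apply Rle_Rpower_l; [lra|]. split; [auto|]. unfold Xo in HZ. nra.
          - assert (T := Rpower_half_le B1 (- B1) x' x ltac:(lra) eq_refl ltac:(lra) ltac:(lra) ltac:(lra)). lra. }
        specialize (V Lo Hi). replace (1 / (h / x)) with (x / h) in V by (field; lra).
        eapply Rle_trans; [apply V|]. apply Rmult_le_compat_r; [apply pow2_ge_0|].
        apply Rle_trans with (Rabs KV * Rpower (h / x) (1 + c)); [apply Rmult_le_compat_r; [left; apply exp_pos|apply Rle_abs]|].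
        apply Rmult_le_compat_l; [apply Rabs_pos|]. apply Rpower_le_exp; lra. }
      (* The ratio is 2^(1 - c0/3 + 10e) >= 2^(2/3), where c0 <= 1 is used. As K3 + 3 K3 = 3 K3
         (4/3), the coefficient 3 K3 of [g] reproduces itself. *)
      assert (G2 : 4/3 * g Z <= g (2 * Z)).
      { unfold g. replace (h / (2 * Z)) with (/ 2 * (h / Z)) by (field; lra).
        rewrite <- !Rpower_mult_distr by (try apply Rdiv_lt_0_compat; lra).
        assert (P := Rpower_dbl (1 - c0 / 3 + 10 * e) ltac:(lra)).
        assert (EP : Rpower 2 (1 - c0 / 3 + 10 * e) = 2 * Rpower (/ 2) (c0 / 3) * Rpower 2 (10 * e)).
        { rewrite <- (Rpower_1 2) at 3 by lra. rewrite <- Rpower_Ropp, Rpower_mult.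
          rewrite <- (Rpower_1 2) at 2 by lra. rewrite <- !Rpower_plus. f_equal. field. }
        replace (h * (2 * Z) * (Rpower (/ 2) (c0 / 3) * Rpower (h / Z) (c0 / 3)) * (Rpower 2 (10 * e) * Rpower Z (10 * e)))
          with ((2 * Rpower (/ 2) (c0 / 3) * Rpower 2 (10 * e)) * g Z) by (unfold g; ring).
        rewrite <- EP. fold (g Z). apply Rmult_le_compat_r; lra. }
      rewrite (RInt_Chasles_lpc (f2 h) 1 Z (2 * Z)) by (now apply lpc_f2).
      assert (3 * K3 * (4/3 * g Z) <= 3 * K3 * g (2 * Z)) by (apply Rmult_le_compat_l; lra).
      apply Rabs_le_between in IH, D'. apply Rabs_le. lra. }
  specialize (claim X (Rmax_lub _ _ _ X1 hX) ltac:(lra)).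
  eapply Rle_trans; [apply claim|].
  set (U := h * Rpower X (1 + ep)). assert (HU : 0 < U) by (apply Rmult_lt_0_compat; [lra|apply exp_pos]).
  assert (SU : h * X * S <= U).
  { unfold U, S. rewrite Rpower_plus, Rpower_1 by lra. rewrite Rmult_assoc. apply Rmult_le_compat_l; [lra|].
    apply Rmult_le_compat_l; [lra|]. apply Rle_Rpower; lra. }
  set (u := Rpower (h / X) (c / 3)). assert (Hu : 0 < u) by apply exp_pos.
  assert (hXp : 0 < h / X) by (apply Rdiv_lt_0_compat; lra).
  (* When c > 1 the exponent was lowered to 1/3; since h <= Xo, the excess is part of the second
     error term. *)
  assert (cu : Rpower (h / X) (c0 / 3) <= u + C3 * t).
  { assert (0 < C3 * t) by nra. destruct (Rle_lt_dec c 1) as [L|L].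
    - unfold c0. rewrite Rmin_left by lra. fold u. lra.
    - unfold c0. rewrite Rmin_right by lra. assert (Rpower (h / X) (1/3) <= Rpower (2 * Xo / X) (1/3)).
      { apply Rle_Rpower_l; [lra|]. split; auto. apply Rmult_le_compat_r; [left; apply Rinv_0_lt_compat; lra|lra]. }
      rewrite Et in *. lra. }
  assert (gX : g X <= U * (u + C3 * t)).
  { unfold g. fold S. replace (h * X * Rpower (h / X) (c0 / 3) * S) with (h * X * S * Rpower (h / X) (c0 / 3)) by ring.
    apply Rmult_le_compat; auto; [apply Rmult_le_pos; nra|left; apply exp_pos]. }
  assert (AU : A <= K5 * (U * (C3 * t))).
  { apply Rmult_le_compat_l; [lra|]. apply Rmult_le_compat_r; nra. }
  assert (3 * K3 * g X <= 3 * K3 * (U * (u + C3 * t))) by (apply Rmult_le_compat_l; lra).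
  assert (0 < U * u) by nra. assert (0 < U * t) by nra.
  assert (0 <= 3 * K3 * C3 * (U * u) + K5 * C3 * (U * u) + 3 * K3 * (U * t)).
  { assert (0 < K3 * C3) by nra. assert (0 < K5 * C3) by nra. nra. }
  lra.
Qed.
End Assembly.

(** * Very short intervals *)

Lemma power_small (a C ep : R) : 0 < a -> 0 < ep -> exists X0, forall X, X0 <= X -> 0 < X -> C * Rpower X (- a) <= ep.
Proof.
  intros Ha He. set (y := (Rabs C + 1) / ep). assert (P := Rabs_pos C).
  assert (Hy : 0 < y) by (apply Rdiv_lt_0_compat; lra).
  exists (Rpower y (/ a)). intros X HX PX.
  assert (y <= Rpower X a).
  { apply Rle_trans with (Rpower (Rpower y (/ a)) a).
    - rewrite Rpower_mult, Rinv_l, Rpower_1 by lra. lra.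
    - apply Rle_Rpower_l; [lra|]. split; [apply exp_pos|auto]. }
  rewrite Rpower_Ropp. apply Rle_trans with (Rabs C * / y).
  - apply Rle_trans with (Rabs C * / Rpower X a).
    + apply Rmult_le_compat_r; [left; apply Rinv_0_lt_compat, exp_pos|apply Rle_abs].
    + apply Rmult_le_compat_l; auto. apply Rinv_le_contravar; auto.
  - unfold y. replace (Rabs C * / ((Rabs C + 1) / ep)) with (ep * (Rabs C / (Rabs C + 1))) by (field; lra).
    assert (Rabs C / (Rabs C + 1) <= 1); [|nra].
    apply Rmult_le_reg_r with (Rabs C + 1); [lra|]. unfold Rdiv. rewrite Rmult_assoc, Rinv_l by lra. lra.
Qed.

Section SmallScale.
Variables (l : nat -> C) (m : nat).
Let E := Ef l m.
Let f1 (dl u : R) : R := N2 (E ((1 + dl) * u) - E u)%C.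

(* Two consecutive increments over a total length below 1 cannot both meet an integer. *)
Lemma disjoint_increments (dl x X sg : R) : 0 < dl <= 1 -> 1 <= x <= X -> (2 * dl + dl ^ 2) * X < 1 -> 0 < sg <= 1 ->
  (1 - sg) * (f1 dl x + f1 dl ((1 + dl) * x)) - 3 / sg * (2 * INR m * dl * X) ^ 2 <= f1 (2 * dl + dl ^ 2) x.
Proof.
  intros Hdl Hx HX Hsg. set (y := 2 * INR m * dl * X).
  assert (Pm := pos_INR m).
  set (N := fun t => Z.to_nat (Int_part t)).
  assert (Xx : (2 * dl + dl ^ 2) * x < 1) by (assert (0 < 2 * dl + dl ^ 2) by nra; nra).
  assert (P1 := Int_part_mono x ((1 + dl) * x) ltac:(nra)).
  assert (P2 := Int_part_mono ((1 + dl) * x) ((1 + dl) * ((1 + dl) * x)) ltac:(nra)).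
  assert (P3 : (Int_part ((1 + dl) * ((1 + dl) * x)) <= Int_part x + 1)%Z).
  { assert (Int_part ((1 + dl) * ((1 + dl) * x)) < Int_part x + 2)%Z; [|lia]. apply lt_IZR. rewrite plus_IZR.
    destruct (base_Int_part x) as [A1 A2]. destruct (base_Int_part ((1 + dl) * ((1 + dl) * x))) as [A3 A4]. nra. }
  set (a := (E ((1 + dl) * x) - E x)%C). set (b := (E ((1 + dl) * ((1 + dl) * x))%R - E ((1 + dl) * x)%R)%C).
  assert (Ef1 : f1 (2 * dl + dl ^ 2) x = N2 (a + b)%C).
  { unfold f1. replace ((1 + (2 * dl + dl ^ 2)) * x) with ((1 + dl) * ((1 + dl) * x)) by ring.
    f_equal. unfold a, b. ring. }
  rewrite Ef1. change (f1 dl x) with (N2 a). change (f1 dl ((1 + dl) * x)) with (N2 b).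
  assert (y0 : 0 <= y) by (unfold y; apply Rmult_le_pos; [apply Rmult_le_pos; nra|lra]).
  assert (I : 1 <= / sg) by (rewrite <- Rinv_1; apply Rinv_le_contravar; lra).
  assert (sm : forall z, Rabs z <= y -> N2 (RtoC z) <= y ^ 2).
  { intros z Hz. apply Rabs_le_between in Hz. unfold N2; simpl. nra. }
  assert (core : forall p q, N2 p <= y ^ 2 -> (1 - sg) * (N2 p + N2 q) - 3 / sg * y ^ 2 <= N2 (q + p)%C).
  { intros p q Hp. assert (T := N2_diff q (q + p)%C sg Hsg).
    replace (N2 (q - (q + p))%C) with (N2 p) in T by (unfold N2; simpl; ring).
    apply Rabs_le_between in T. assert (T1 := N2_pos p). assert (T2 := N2_pos q).
    assert (2 / sg * N2 p <= 2 / sg * y ^ 2) by (apply Rmult_le_compat_l; [left; apply Rdiv_lt_0_compat; lra|auto]).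
    assert (y ^ 2 <= 1 / sg * y ^ 2) by (unfold Rdiv; rewrite Rmult_1_l; assert (0 <= y ^ 2) by apply pow2_ge_0; nra).
    replace (3 / sg * y ^ 2) with (2 / sg * y ^ 2 + 1 / sg * y ^ 2) by (field; lra). nra. }
  (* If the first increment meets no integer, it is pure drift of size m dl x; otherwise the second
     one is. The drift is the summand [p] of [core]. *)
  destruct (Z.eq_dec (Int_part x) (Int_part ((1 + dl) * x))) as [Eq|Ne].
  - assert (Ea : a = RtoC (- (INR m * dl * x))).
    { unfold a, E, Ef. rewrite <- Eq. apply injective_projections; simpl; ring. }
    rewrite Cplus_comm. apply core. rewrite Ea. apply sm. rewrite Rabs_Ropp, Rabs_pos_eq by (apply Rmult_le_pos; nra).
    unfold y. assert (0 <= INR m * dl) by nra. nra.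
  - assert (Eq : Int_part ((1 + dl) * x) = Int_part ((1 + dl) * ((1 + dl) * x))) by lia.
    assert (Eb : b = RtoC (- (INR m * dl * ((1 + dl) * x)))).
    { unfold b, E, Ef. rewrite <- Eq. apply injective_projections; simpl; ring. }
    rewrite (Rplus_comm (N2 a)). apply core. rewrite Eb. apply sm.
    assert (0 <= INR m * dl) by nra. assert ((1 + dl) * x <= 2 * X) by nra. assert (0 <= (1 + dl) * x) by nra.
    rewrite Rabs_Ropp, Rabs_pos_eq by (apply Rmult_le_pos; nra). unfold y. nra.
Qed.

Lemma lpc_f1' (dl : R) : 0 < dl -> lpc (f1 dl).
Proof. intros H. apply (lpc_f1 E); auto. apply lpcC_Ef. Qed.

(** Dilating the variable moves the lower limit 1 to 1 + dl; this is the piece lost there. *)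
Lemma near_one : exists C0, 0 < C0 /\ forall dl, 0 < dl <= 1 -> RInt (f1 dl) 1 (1 + dl) <= C0 * dl.
Proof.
  destruct (Wf_props l m) as [W1 [W2 [W3 W4]]].
  exists (Wf l m 4 ^ 2 + 1). assert (P := pow2_ge_0 (Wf l m 4)). split; [lra|]. intros dl Hdl.
  apply Rle_trans with (RInt (fun _ => Wf l m 4 ^ 2 + 1) 1 (1 + dl)).
  - apply RInt_lpc_le; [apply lpc_f1'; lra|apply lpc_const|lra|]. intros x Hx. unfold f1. rewrite N2_Cmod.
    assert (T := W4 x ((1 + dl) * x) ltac:(nra)). assert (T1 := W2 x ltac:(lra)). assert (T2 := W1 ((1 + dl) * x) 4 ltac:(nra)).
    fold E in T. assert (Q := Cmod_ge_0 (E ((1 + dl) * x) - E x)%C).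
    assert (Cmod (E ((1 + dl) * x) - E x)%C ^ 2 <= Wf l m 4 ^ 2) by (apply pow_incr; lra). lra.
  - rewrite RInt_const. right. unfold scal; simpl; unfold mult; simpl. ring.
Qed.

(** Two dilations by 1 + dl compose to one by 1 + 2 dl + dl^2, and the squares of their increments
    add up to the small losses of [disjoint_increments]. *)
Lemma variance_split (dl X sg : R) : 0 < dl <= 1 -> 1 <= X -> (2 * dl + dl ^ 2) * X < 1 -> 0 < sg <= 1 ->
  (1 - sg) * (RInt (f1 dl) 1 X + / (1 + dl) * (RInt (f1 dl) 1 ((1 + dl) * X) - RInt (f1 dl) 1 (1 + dl)))
   - 3 / sg * (2 * INR m * dl * X) ^ 2 * X <= RInt (f1 (2 * dl + dl ^ 2)) 1 X.
Proof.
  intros Hdl HX1 HX Hsg. assert (L := lpc_f1' dl ltac:(lra)).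
  assert (L' : lpc (fun x => f1 dl ((1 + dl) * x))) by (apply lpc_dil; [lra|auto]).
  assert (L2 := lpc_f1' (2 * dl + dl ^ 2) ltac:(nra)).
  set (y2 := 3 / sg * (2 * INR m * dl * X) ^ 2).
  assert (Hy2 : 0 <= y2) by (apply Rmult_le_pos; [left; apply Rdiv_lt_0_compat; lra|apply pow2_ge_0]).
  assert (Es : RInt (f1 dl) 1 ((1 + dl) * X) - RInt (f1 dl) 1 (1 + dl) = RInt (f1 dl) (1 + dl) ((1 + dl) * X)).
  { rewrite (RInt_Chasles_lpc (f1 dl) 1 (1 + dl) ((1 + dl) * X) L). lra. }
  rewrite Es. replace (1 + dl) with ((1 + dl) * 1) at 2 by ring. rewrite <- (RInt_dil (f1 dl)) by (auto; lra).
  apply Rle_trans with (RInt (fun x => 1 * ((1 - sg) * f1 dl x + (1 - sg) * f1 dl ((1 + dl) * x)) + (- y2) * 1) 1 X).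
  - rewrite (RInt_lpc_lin (fun x => (1 - sg) * f1 dl x + (1 - sg) * f1 dl ((1 + dl) * x)) (fun _ => 1))
      by (try apply lpc_const; now apply lpc_lin).
    rewrite (RInt_lpc_lin (f1 dl)) by auto.
    assert (Ec : RInt (fun _ => 1) 1 X = X - 1) by (rewrite RInt_const; unfold scal; simpl; unfold mult; simpl; ring).
    rewrite Ec. nra.
  - apply RInt_lpc_le; auto; [|intros x Hx].
    + apply (lpc_lin _ (fun _ => 1)); [now apply lpc_lin|apply lpc_const].
    + assert (T := disjoint_increments dl x X sg Hdl ltac:(lra) HX Hsg). fold y2 in T. lra.
Qed.

(** Take dl = X^(-B3). By splitting, the variance at 2 dl + dl^2 is nearly at least twice that at
    dl. The asymptotic formula makes it smaller than that by about dl X^2 d ln 2, since doubling dl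
    lowers log(1/dl) by ln 2. *)
Lemma small_scale_contradiction (d ka B1 B3 c : R) : 0 < d -> 0 < B1 <= B3 -> 1 < B3 -> 0 < c ->
  (forall k1 k2, k1 > 0 -> k2 > 0 -> exists K X0, forall X dl, X >= X0 ->
     k1 * Rpower X (- B3) <= dl -> dl <= k2 * Rpower X (- B1) ->
     Rabs (RInt (f1 dl) 1 X - 1/2 * dl * X ^ 2 * (d * ln (1 / dl) + ka)) <= K * Rpower dl (1 + c) * X ^ 2) -> False.
Proof.
  intros Hd HB HB3 Hc HV.
  (* The 3 admits 2 dl + dl^2 <= 3 dl, and 2^B1 admits dl when the upper limit is (1 + dl) X instead
     of X. *)
  destruct (HV 1 (3 + Rpower 2 B1) ltac:(lra)) as [KV [XV HVk]].
  { assert (0 < Rpower 2 B1) by apply exp_pos. lra. }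
  destruct near_one as [C0 [HC0 N1]].
  set (K := Rabs KV). assert (HK : 0 <= K) by apply Rabs_pos.
  (* Then dl X = X^(-4 et), and the weight sg = X^(-2 et) is its square root; this makes the drift
     loss, relative to dl X^2, equal to 12 m^2 sg. *)
  set (et := (B3 - 1) / 4). assert (Het : 0 < et) by (unfold et; lra).
  set (CM := d * B3 * / et + Rabs ka). 
  assert (Iet : 0 < / et) by (apply Rinv_0_lt_compat; auto).
  assert (HCM : 0 < CM) by (unfold CM; assert (T := Rabs_pos ka); assert (0 < d * B3 * / et) by (apply Rmult_lt_0_compat; nra); lra).
  set (T3 := Rpower 3 (1 + c)). assert (HT3 : 0 < T3) by apply exp_pos.
  destruct (power_small et (2 * CM) (d / 20) Het ltac:(lra)) as [Xa Pa].
  destruct (power_small (c * B3) ((5 + T3) * K) (d / 20) ltac:(nra) ltac:(lra)) as [Xb Pb].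
  destruct (power_small 2 C0 (d / 20) ltac:(lra) ltac:(lra)) as [Xc Pc].
  destruct (power_small (2 * et) (12 * INR m ^ 2) (d / 20) ltac:(lra) ltac:(lra)) as [Xd Pd].
  destruct (power_small (4 * et) 3 (1/2) ltac:(lra) ltac:(lra)) as [Xe Pe].
  destruct (power_small B3 (exp ((- ka + d * ln 2) / d)) 1) as [Xf Pf]; [lra|lra|].
  set (X := Rmax 1 (Rmax XV (Rmax Xa (Rmax Xb (Rmax Xc (Rmax Xd (Rmax Xe Xf))))))).
  assert (X1 : 1 <= X) by apply Rmax_l.
  assert (R2 := Rmax_r 1 (Rmax XV (Rmax Xa (Rmax Xb (Rmax Xc (Rmax Xd (Rmax Xe Xf))))))).
  assert (XVX : XV <= X) by (eapply Rle_trans; [apply Rmax_l|apply R2]).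
  assert (R3 := Rle_trans _ _ _ (Rmax_r XV _) R2). assert (XaX := Rle_trans _ _ _ (Rmax_l Xa _) R3).
  assert (R4 := Rle_trans _ _ _ (Rmax_r Xa _) R3). assert (XbX := Rle_trans _ _ _ (Rmax_l Xb _) R4).
  assert (R5 := Rle_trans _ _ _ (Rmax_r Xb _) R4). assert (XcX := Rle_trans _ _ _ (Rmax_l Xc _) R5).
  assert (R6 := Rle_trans _ _ _ (Rmax_r Xc _) R5). assert (XdX := Rle_trans _ _ _ (Rmax_l Xd _) R6).
  assert (R7 := Rle_trans _ _ _ (Rmax_r Xd _) R6). assert (XeX := Rle_trans _ _ _ (Rmax_l Xe _) R7).
  assert (XfX := Rle_trans _ _ _ (Rmax_r Xe _) R7).
  fold X in XaX, XbX, XcX, XdX, XeX, XfX.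
  specialize (Pa X XaX ltac:(lra)). specialize (Pb X XbX ltac:(lra)). specialize (Pc X XcX ltac:(lra)).
  specialize (Pd X XdX ltac:(lra)). specialize (Pe X XeX ltac:(lra)). specialize (Pf X XfX ltac:(lra)).
  clear R2 R3 R4 R5 R6 R7. clearbody X.
  set (dl := Rpower X (- B3)). assert (Hdl0 : 0 < dl) by apply exp_pos.
  set (sg := Rpower X (- (2 * et))). assert (Hsg0 : 0 < sg) by apply exp_pos.
  assert (EdX : dl * X = sg ^ 2).
  { unfold dl, sg. rewrite <- (Rpower_1 X) at 2 by lra. simpl. rewrite Rmult_1_r, <- !Rpower_plus. f_equal. unfold et. field. }
  assert (E4 : Rpower X (- (4 * et)) = sg ^ 2).
  { unfold sg. simpl. rewrite Rmult_1_r, <- Rpower_plus. f_equal. ring. }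
  rewrite E4 in Pe.
  assert (sg1 : sg <= 1) by nra.
  assert (dls : dl <= sg ^ 2) by nra.
  assert (dl1 : dl <= 1/6) by lra.
  assert (HX3 : (2 * dl + dl ^ 2) * X < 1) by nra.
  assert (VS := variance_split dl X sg ltac:(lra) X1 HX3 ltac:(lra)).
  set (d2 := 2 * dl + dl ^ 2) in *. assert (Hd2 : 2 * dl <= d2 <= 3 * dl) by (unfold d2; nra).
  set (lg := ln (1 / dl)). assert (Elg : lg = B3 * ln X).
  { unfold lg, dl, Rdiv. rewrite Rmult_1_l, <- Rpower_Ropp, Ropp_involutive. unfold Rpower. apply ln_exp. }
  set (M := d * lg + ka).
  assert (lX : 0 <= ln X) by (rewrite <- ln_1; apply ln_le; lra).
  assert (MU : M <= CM * Rpower X et).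
  { assert (T := ln_le_Rpower X et Het ltac:(lra)). assert (T1 := Rpower_ge1 X et X1 ltac:(lra)). assert (T2 := Rle_abs ka).
    assert (T4 := Rabs_pos ka). unfold M, CM. rewrite Elg.
    assert (d * B3 * ln X <= d * B3 * (/ et * Rpower X et)) by (apply Rmult_le_compat_l; nra). nra. }
  assert (ML : d * ln 2 <= M).
  { assert (T : (- ka + d * ln 2) / d <= lg).
    { fold dl in Pf. assert (P2 : exp ((- ka + d * ln 2) / d) <= exp lg).
      { unfold lg. rewrite exp_ln by (apply Rdiv_lt_0_compat; lra).
        apply Rmult_le_reg_r with dl; [auto|]. unfold Rdiv at 2. rewrite Rmult_1_l, Rinv_l by lra. auto. }
      destruct (Rle_lt_dec ((- ka + d * ln 2) / d) lg) as [|L]; auto. apply exp_increasing in L. lra. }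
    apply Rmult_le_compat_l with (r := d) in T; [|lra]. replace (d * ((- ka + d * ln 2) / d)) with (- ka + d * ln 2) in T by (field; lra).
    unfold M. lra. }
  assert (L2 := ln_lt_2). assert (HM0 : 0 < M) by nra.
  assert (B13 : dl <= Rpower X (- B1)) by (apply Rle_Rpower; lra).
  assert (PB1 : 1 <= Rpower 2 B1) by (apply Rpower_ge1; lra).
  assert (V1 := HVk X dl ltac:(lra) ltac:(fold dl; lra) ltac:(nra)).
  assert (V2 := HVk X d2 ltac:(lra) ltac:(fold dl; lra) ltac:(nra)).
  assert (dX : 0 < dl * X <= X) by (split; [apply Rmult_lt_0_compat; lra|rewrite <- (Rmult_1_l X) at 2; apply Rmult_le_compat_r; lra]).
  assert (V3 := HVk ((1 + dl) * X) dl ltac:(lra)).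
  assert (A1 : 1 * Rpower ((1 + dl) * X) (- B3) <= dl).
  { rewrite Rmult_1_l. unfold dl at 2. rewrite !Rpower_Ropp. apply Rinv_le_contravar; [apply exp_pos|]. apply Rle_Rpower_l; lra. }
  assert (A2 : dl <= (3 + Rpower 2 B1) * Rpower ((1 + dl) * X) (- B1)).
  { apply Rle_trans with (Rpower 2 B1 * Rpower (2 * X) (- B1)).
    - rewrite <- Rpower_mult_distr by lra. rewrite <- Rmult_assoc, <- Rpower_plus, Rplus_opp_r, Rpower_O by lra. lra.
    - apply Rmult_le_compat; [lra|left; apply exp_pos|lra|]. rewrite !Rpower_Ropp. apply Rinv_le_contravar; [apply exp_pos|]. apply Rle_Rpower_l; lra. }
  specialize (V3 A1 A2). clear A1 A2. fold lg in V1, V3. fold M in V1, V3.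
  set (dc := Rpower dl c). assert (Hdc : 0 < dc) by apply exp_pos.
  assert (Edc : Rpower dl (1 + c) = dl * dc) by (unfold dc; rewrite Rpower_plus, Rpower_1; lra).
  assert (Edc' : dc = Rpower X (- (c * B3))) by (unfold dc, dl; rewrite Rpower_mult; f_equal; ring).
  rewrite <- Edc' in Pb.
  assert (KVK : KV <= K) by apply Rle_abs.
  assert (F2 : Rpower d2 (1 + c) <= T3 * (dl * dc)).
  { rewrite <- Edc. unfold T3. rewrite Rpower_mult_distr by lra. apply Rle_Rpower_l; lra. }
  assert (PX2 : 0 < X ^ 2) by (apply pow_lt; lra).
  set (q := dl * X ^ 2) in *. assert (Hq : 0 < q) by (unfold q; nra).
  assert (W1 : q * (1/2 * M - K * dc) <= RInt (f1 dl) 1 X).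
  { rewrite Edc in V1. apply Rabs_le_between in V1.
    assert (KV * (dl * dc) * X ^ 2 <= K * dc * q).
    { replace (KV * (dl * dc) * X ^ 2) with (KV * (dc * q)) by (unfold q; ring). replace (K * dc * q) with (K * (dc * q)) by ring. apply Rmult_le_compat_r; nra. }
    replace (1/2 * dl * X ^ 2 * M) with (1/2 * q * M) in V1 by (unfold q; ring). lra. }
  assert (W3 : q * (1/2 * M - 2 * K * dc) - C0 * dl <= / (1 + dl) * (RInt (f1 dl) 1 ((1 + dl) * X) - RInt (f1 dl) 1 (1 + dl))).
  { specialize (N1 dl ltac:(lra)). rewrite Edc in V3. apply Rabs_le_between in V3.
    assert (KV * (dl * dc) * ((1 + dl) * X) ^ 2 <= K * dc * q * (1 + dl) ^ 2).
    { replace (KV * (dl * dc) * ((1 + dl) * X) ^ 2) with (KV * (dc * q * (1 + dl) ^ 2)) by (unfold q; ring).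
      replace (K * dc * q * (1 + dl) ^ 2) with (K * (dc * q * (1 + dl) ^ 2)) by ring. apply Rmult_le_compat_r; [|auto].
      apply Rmult_le_pos; [nra|apply pow2_ge_0]. }
    replace (1/2 * dl * ((1 + dl) * X) ^ 2 * M) with (1/2 * q * M * (1 + dl) ^ 2) in V3 by (unfold q; ring).
    apply Rmult_le_reg_l with (1 + dl); [lra|]. rewrite <- Rmult_assoc, Rinv_r, Rmult_1_l by lra.
    assert (Kq : 0 <= K * dc * q) by (apply Rmult_le_pos; [apply Rmult_le_pos; lra|lra]).
    assert (Mq : 0 <= q * M) by nra.
    assert ((1 + dl) * (K * dc * q) <= 2 * (K * dc * q)) by (apply Rmult_le_compat_r; lra).
    apply Rle_trans with (1/2 * q * M * (1 + dl) ^ 2 - K * dc * q * (1 + dl) ^ 2 - C0 * dl); [|lra].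
    replace ((1 + dl) * (q * (1/2 * M - 2 * K * dc) - C0 * dl)) with ((1 + dl) * (1/2 * (q * M)) - (1 + dl) * (2 * (K * dc * q)) - (1 + dl) * (C0 * dl)) by ring.
    replace (1/2 * q * M * (1 + dl) ^ 2) with ((1 + dl) * ((1 + dl) * (1/2 * (q * M)))) by ring.
    replace (K * dc * q * (1 + dl) ^ 2) with ((1 + dl) * ((1 + dl) * (K * dc * q))) by ring.
    assert ((1 + dl) * ((1 + dl) * (K * dc * q)) <= (1 + dl) * (2 * (K * dc * q))) by (apply Rmult_le_compat_l; lra).
    assert ((1 + dl) * (1 / 2 * (q * M)) <= (1 + dl) * ((1 + dl) * (1 / 2 * (q * M)))).
    { apply Rmult_le_compat_l; [lra|]. rewrite <- (Rmult_1_l (1 / 2 * (q * M))) at 1. apply Rmult_le_compat_r; lra. }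
    assert (0 <= C0 * dl) by (apply Rmult_le_pos; lra). assert (0 <= dl * (C0 * dl)) by (apply Rmult_le_pos; lra). lra. }
  assert (W2 : RInt (f1 d2) 1 X <= q * ((1 + dl) * (M - d * ln 2) + T3 * K * dc)).
  { apply Rabs_le_between in V2.
    assert (KV * Rpower d2 (1 + c) * X ^ 2 <= q * (T3 * K * dc)).
    { apply Rle_trans with (K * (T3 * (dl * dc)) * X ^ 2); [|right; unfold q; ring]. apply Rmult_le_compat_r; [lra|].
      apply Rle_trans with (K * Rpower d2 (1 + c)); [apply Rmult_le_compat_r; [left; apply exp_pos|auto]|]. apply Rmult_le_compat_l; auto. }
    assert (ln (1 / d2) <= lg - ln 2).
    { unfold lg. rewrite <- ln_div by (try apply Rdiv_lt_0_compat; lra). apply ln_le; [apply Rdiv_lt_0_compat; lra|].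
      replace (1 / dl / 2) with (/ (2 * dl)) by (field; lra). unfold Rdiv. rewrite Rmult_1_l. apply Rinv_le_contravar; lra. }
    assert (d * ln (1 / d2) <= d * (lg - ln 2)) by (apply Rmult_le_compat_l; lra).
    assert (d * ln (1 / d2) + ka <= M - d * ln 2) by (unfold M; lra).
    assert (1/2 * d2 * X ^ 2 * (d * ln (1 / d2) + ka) <= q * (1 + dl) * (M - d * ln 2)).
    { apply Rle_trans with (1/2 * d2 * X ^ 2 * (M - d * ln 2)).
      - apply Rmult_le_compat_l; auto. apply Rmult_le_pos; lra.
      - apply Rmult_le_compat_r; [lra|]. unfold q, d2. assert (0 <= dl ^ 2 * X ^ 2) by (apply Rmult_le_pos; [apply pow2_ge_0|lra]). lra. }
    lra. }
  assert (Y : 3 / sg * (2 * INR m * dl * X) ^ 2 * X = q * (12 * INR m ^ 2 * sg)).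
  { replace (3 / sg * (2 * INR m * dl * X) ^ 2 * X) with (3 / sg * (4 * INR m ^ 2) * (dl * X) * (dl * X ^ 2)) by ring.
    rewrite EdX. fold q. field. lra. }
  rewrite Y in VS.
  assert (Cq : C0 * dl = q * (C0 * Rpower X (- 2))).
  { unfold q. replace (Rpower X (- 2)) with (/ X ^ 2); [field; lra|]. change (-2) with (- (2)). rewrite Rpower_Ropp. f_equal.
    rewrite <- Rpower_pow by lra. f_equal. }
  change (- (2)) with (-2) in Pc. set (cx := C0 * Rpower X (-2)) in *.
  assert (Hcx : 0 < cx) by (apply Rmult_lt_0_compat; [auto|apply exp_pos]).
  rewrite Cq in W3.
  assert (Z1 : (1 - sg) * (q * (M - 3 * (K * dc) - cx)) - q * (12 * INR m ^ 2 * sg) <= q * ((1 + dl) * (M - d * ln 2) + T3 * K * dc)).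
  { eapply Rle_trans; [|apply W2]. eapply Rle_trans; [|apply VS]. apply Rplus_le_compat_r. apply Rmult_le_compat_l; lra. }
  (* After division by dl X^2, four groups of errors of at most d/20 each stand against d ln 2 >=
     d/2. *)
  assert (Z2 : (1 - sg) * (M - 3 * (K * dc) - cx) - 12 * INR m ^ 2 * sg <= (1 + dl) * (M - d * ln 2) + T3 * K * dc).
  { apply Rmult_le_reg_l with q; [auto|]. lra. }
  assert (SM : 2 * (sg * M) <= d / 20).
  { apply Rle_trans with (2 * (sg * (CM * Rpower X et))).
    - apply Rmult_le_compat_l; [lra|]. apply Rmult_le_compat_l; lra.
    - eapply Rle_trans; [|apply Pa]. right. unfold sg. replace (- (2 * et)) with (- et + - et) by ring. rewrite Rpower_plus.
      replace (2 * (Rpower X (- et) * Rpower X (- et) * (CM * Rpower X et))) with (2 * CM * Rpower X (- et) * (Rpower X (- et) * Rpower X et)) by ring.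
      rewrite <- Rpower_plus, Rplus_opp_l, Rpower_O by lra. ring. }
  assert (dls' : dl <= sg) by (apply Rle_trans with (1 := dls); simpl; rewrite Rmult_1_r; rewrite <- (Rmult_1_r sg) at 3; apply Rmult_le_compat_l; lra).
  assert (dl * M <= sg * M) by (apply Rmult_le_compat_r; lra).
  fold sg in Pd.
  assert (Kd : 0 <= K * dc) by (apply Rmult_le_pos; lra).
  assert (0 <= sg * (K * dc)) by (apply Rmult_le_pos; lra). assert (0 <= sg * cx) by (apply Rmult_le_pos; lra).
  assert (dlt : d * (1/2) <= d * ln 2) by (apply Rmult_le_compat_l; lra).
  assert (0 <= dl * (d * ln 2)) by (apply Rmult_le_pos; lra).
  lra.
Qed.
End SmallScale.

(** * Application to the Selberg class *)

Lemma degree_nonneg (r : nat) (lam : nat -> R) : (forall j, (j < r)%nat -> lam j > 0) -> 0 <= degree r lam.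
Proof.
  intros H. unfold degree. assert (P : 0 <= Rsum r lam); [|lra].
  induction r as [|r IH]; simpl; [lra|]. assert (T := H r ltac:(lia)). specialize (IH ltac:(intros; apply H; lia)). lra.
Qed.

Theorem theoremC1
  (F : Cx -> Cx) (a : nat -> Cx) (m r : nat) (Q : R) (lam : nat -> R) (mu : nat -> Cx)
  (epsF : Cx) (Lam : nat -> Cx)
  (HS : selberg_data F a m r Q lam mu epsF) (Hprim : selberg_primitive F)
  (HLam : is_vonMangoldt F Lam)
  (HGRH : GRH F m r lam mu)
  (B1 B2 B3 c : R)
  (HB : 0 < B1 /\ B1 < B2 /\ B2 <= B3 /\ B3 < 1 / degree r lam)
  (Hc : c > 0)
  (HV : forall k1 k2, k1 > 0 -> k2 > 0 -> exists K X0, forall X delta,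
     X >= X0 -> k1 * Rpower X (- B3) <= delta -> delta <= k2 * Rpower X (- B1) ->
     Rabs (V_F Lam m X delta
           - 1/2 * delta * X ^ 2 * (degree r lam * ln (1 / delta) + ln (conductor r Q lam)
                + (1 - euler_gamma - ln (2 * PI)) * degree r lam))
       <= K * Rpower delta (1 + c) * X ^ 2) :
  forall e, e > 0 -> forall k1 k2, k1 > 0 -> k2 > 0 -> exists K X0, forall X h,
    X >= X0 -> k1 * Rpower X (1 - B3) <= h -> h <= k2 * Rpower X (1 - B2) ->
    Rabs (Vt_F Lam m X h
          - h * X * (degree r lam * ln (X / h) + ln (conductor r Q lam)
               - (euler_gamma + ln (2 * PI)) * degree r lam))
      <= K * (h * Rpower X (1 + e) * Rpower (h / X) (c / 3))
         + K * (h * Rpower X (1 + e) * Rpower (h * Rpower X (- (1 - B1))) (1 / (3 * (1 - B1)))).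
Proof.
  intros e He k1 k2 Hk1 Hk2.
  set (d := degree r lam) in *.
  set (ka := ln (conductor r Q lam) + (1 - euler_gamma - ln (2 * PI)) * d).
  set (l := fun k => toC (Lam (S k))).
  (* For d = 0 the value [1 / d] would be 0 by convention, leaving no room for B3. *)
  assert (Hd : 0 < d).
  { assert (D0 : 0 <= d) by (apply degree_nonneg; intros j Hj; now apply HS).
    destruct (Req_dec d 0) as [E|]; [|lra]. rewrite E in HB. unfold Rdiv in HB. rewrite Rinv_0 in HB. lra. }
  assert (HV' : forall k1 k2, k1 > 0 -> k2 > 0 -> exists K X0, forall X dl, X >= X0 ->
     k1 * Rpower X (- B3) <= dl -> dl <= k2 * Rpower X (- B1) ->
     Rabs (RInt (fun u => N2 (Ef l m ((1 + dl) * u) - Ef l m u)%C) 1 X - 1/2 * dl * X ^ 2 * (d * ln (1 / dl) + ka))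
       <= K * Rpower dl (1 + c) * X ^ 2).
  { intros q1 q2 Hq1 Hq2. destruct (HV q1 q2 Hq1 Hq2) as [K [X0 H]]. exists K, X0. intros X dl HX H1 H2.
    assert (P : 0 < dl) by (assert (0 < Rpower X (- B3)) by apply exp_pos; nra).
    specialize (H X dl HX H1 H2). rewrite (V_F_eq Lam m X dl P) in H. fold l in H. unfold ka.
    rewrite <- Rplus_assoc. exact H. }
  assert (B3' : B3 <= 1).
  { destruct (Rle_lt_dec B3 1) as [|L]; auto. exfalso.
    apply (small_scale_contradiction l m d ka B1 B3 c); auto; lra. }
  destruct (variance_translation (Ef l m) d ka B1 B2 B3 c (lpcC_Ef l m) Hd ltac:(lra) ltac:(lra)) with (ep := e) (k1 := k1) (k2 := k2)
    as [K [X0 H]]; auto; try lra.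
  { intros ep Hep. assert (MS := selberg_mean_squares Lam m F a r Q lam mu epsF HS HLam HGRH ep Hep). fold l in MS. split.
    - destruct MS as [K [HK M]]. exists K. split; auto. intros Z HZ. exact (proj1 (M Z HZ)).
    - apply (lag (Ef l m) (Ar l m) ep); auto; [apply lpcC_Ef|intros; now apply lpcC_Ar|].
      intros d0 x Hd0 Hx. rewrite Ar_eq by auto. apply Ad_avg; lra. }
  exists K, X0. intros X h HX H1 H2. specialize (H X h HX H1 H2). rewrite Vt_F_eq. fold l.
  (* Integrating the logarithm in [Tm] subtracts d, which turns the constant 1 - gamma_0 - log(2 pi)
     of the hypothesis into - (gamma_0 + log(2 pi)). *)
  replace (h * X * (d * ln (X / h) + ln (conductor r Q lam) - (euler_gamma + ln (2 * PI)) * d)) with (Tm d ka h X); [exact H|].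
  unfold Tm, ka. ring.
Qed.
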